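(* Let $F$ be a $p$-adic field, $\mathbf G$ a connected reductive group over $F$, and let $\theta$ be either an automorphism or a Frobenius morphism of $\breve G$ with $\theta(\breve I)=\breve I$. Suppose that the induced actions of $\theta$ and $\sigma$ on $\breve W$ commute, and let $\Gamma\subseteq\Omega$ be a $\theta$-stable subgroup. Then the natural embedding $W=\breve W^\sigma \hookrightarrow \breve W$ induces an injection $$i: W /\!\!/_\theta W(\Gamma) \hookrightarrow \breve W /\!\!/_\theta \breve W(\Gamma),$$ i.e. each straight $W(\Gamma)$-orbit on $W$ is contained in a single straight $\breve W(\Gamma)$-orbit on $\breve W$ (for $\theta$-twisted conjugation), and the resulting map is injective.
   Context: Groups. $F$ is a $p$-adic field, $\breve F$ the completion of its maximal unramified extension, $\sigma$ the Frobenius automorphism of $\breve F/F$; $\mathbf G$ is a connected reductive group over $F$, $G=\mathbf G(F)$, $\breve G=\mathbf G(\breve F)$; $\sigma$ also denotes the induced automorphism of $\breve G$, so $G=\breve G^\sigma$. ''Automorphism'' of $\breve G$ means one coming from an automorphism of the algebraic group over $\breve F$; a ''Frobenius morphism'' is one of the same type as $\sigma$, i.e. coming from an $F$-structure. Iwahori-Weyl group over $F$. Fix a maximal $F$-split torus $\mathbf A$ of $\mathbf G$ with centralizer $\mathbf M$ and normalizer $\mathbf N$. Put $W=\mathbf N(F)/\mathbf M(F)_1$, where $\mathbf M(F)_1$ is the unique parahoric subgroup of $\mathbf M(F)$. Fix an alcove $\mathfrak a_C$ in the apartment $\mathscr A$ of $\mathbf A$ over $F$. Let $G_1\subseteq G$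 be the subgroup generated by all parahoric subgroups and $W_a\subseteq W$ the image of $\mathbf N(F)\cap G_1$. Then $W=W_a\rtimes\Omega$ with $\Omega$ the stabilizer of $\mathfrak a_C$. The length function $\ell$ on $W$ is the Coxeter length on $W_a$ with respect to the reflections in the walls of $\mathfrak a_C$, extended by $\ell(w\tau)=\ell(w)$ for $w\in W_a$, $\tau\in\Omega$. Iwahori-Weyl group over $\breve F$. Let $\mathbf S\supseteq\mathbf A$ be a maximal $\breve F$-split torus defined over $F$, $\mathbf T$ its centralizer, $\mathbf N_{\mathbf S}$ its normalizer, and $\breve{\mathscr A}$ its apartment over $\breve F$, so that $\mathscr A=\breve{\mathscr A}^\sigma$. Put $\breve W=\mathbf N_{\mathbf S}(\breve F)/\mathbf T(\breve F)_1$, where $\mathbf T(\breve F)_1$ is the unique parahoric subgroup of $\mathbf T(\breve F)$. Fix a $\sigma$-stable alcove $\breve{\mathfrak a}_C\subseteq\breve{\mathscr A}$ containing $\mathfrak a_C$, with associated Iwahori subgroup $\breve I\subseteq\breve G$; then $\breve I\backslash\breve G/\breve I=\breve W$. Let $\breve G_1\subseteq\breve G$ be the subgroup generated by all parahoric subgroups, $\breve W_a\subseteq\breve W$ the image of $\mathbf N_{\mathbf S}(\breve F)\cap\breve G_1$, and $\breve\Omega$ the stabilizer of $\breve{\mathfrak a}_C$; then $\breve W=\breve W_a\rtimes\breve\Omega$, with length function $\breve\ell$ defined as for $W$. One has $W=\breve W^\sigma$, $W_a=\breve W_a^\sigma$, $\Omega=\breve\Omega^\sigma$. The action of $\theta$.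 Since $\theta(\breve I)=\breve I$, $\theta$ induces a length-preserving automorphism of $\breve W$, still denoted $\theta$ and assumed to be of finite order; as it commutes with $\sigma$ on $\breve W$, it restricts to $W=\breve W^\sigma$. For a $\theta$-stable subgroup $\Gamma\subseteq\Omega\subseteq\breve\Omega$ put $W(\Gamma)=W_a\rtimes\Gamma\subseteq W$ and $\breve W(\Gamma)=\breve W_a\rtimes\Gamma\subseteq\breve W$. These groups act on $W$, respectively $\breve W$, by $\theta$-twisted conjugation $w\cdot_\theta w'=ww'\theta(w)^{-1}$. Straightness. $x\in W$ (resp. $x\in\breve W$) is $\theta$-straight if $\ell(x\theta(x)\cdots\theta^{n-1}(x))=n\ell(x)$ (resp. the same with $\breve\ell$) for all $n\ge0$. An orbit is straight if it contains a $\theta$-straight element. $W/\!\!/_\theta W(\Gamma)$ is the set of straight $W(\Gamma)$-orbits on $W$ and $\breve W/\!\!/_\theta\breve W(\Gamma)$ the set of straight $\breve W(\Gamma)$-orbits on $\breve W$. *)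

(* Defs.v *)
From HB Require Import structures.
From mathcomp Require Import all_boot all_order all_algebra all_fingroup all_field.
From mathcomp Require Import boolp classical_sets reals.
From mathcomp Require mpoly.

Set Implicit Arguments.
Unset Strict Implicit.
Unset Printing Implicit Defensive.

Import Order.TTheory GRing.Theory Num.Theory.

Local Open Scope classical_set_scope.
Local Open Scope ring_scope.

(* A p-adic field F, the completion L of its maximal unramified extension, and
   the Frobenius sigma of L/F.  v is the normalized valuation of L; its value
   at 0 is irrelevant, and [val_ge] treats 0 as having infinite valuation. *)
Section Padic.
Variables (F L : fieldType) (iF : {rmorphism F -> L}) (v : L -> int).
Variable sigma : {rmorphism L -> L}.

Definition val_ge (k : int) (x : L) : Prop := x = 0 \/ (k <= v x)%R.

Definition complete_for (k : fieldType) (i : k -> L) : Prop :=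
  forall u : nat -> k,
    (forall e : int, exists N : nat, forall a b : nat,
        (N <= a)%N -> (N <= b)%N -> val_ge e (i (u a) - i (u b))) ->
    exists l : k, forall e : int, exists N : nat, forall a : nat,
        (N <= a)%N -> val_ge e (i (u a) - i l).

Record padic_frobenius : Prop := PadicFrobenius {
  val_mul : forall x y, x != 0 -> y != 0 -> v (x * y) = v x + v y;
  val_add : forall k x y, val_ge k x -> val_ge k y -> val_ge k (x + y);
  padic_char0 : forall k : nat, (k.+1)%:R != 0 :> F;
  (* The value groups of F and of L are both equal to Z. *)
  val_base_onto : exists x : F, x != 0 /\ v (iF x) = 1;
  base_complete : complete_for iF;
  complete : complete_for id;
  (* L is the completion of an unramified algebraic extension of F, which is
     the maximal one because the residue field of L is algebraically closed. *)
  algebraic_dense : forall (x : L) (e : int), exists y : L,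
    (exists p : {poly F}, p != 0 /\ root (map_poly iF p) y) /\ val_ge e (x - y);
  residue_closed : forall p : {poly L}, p \is monic -> (1 < size p)%N ->
    (forall k, val_ge 0 p`_k) -> exists x : L, val_ge 0 x /\ val_ge 1 p.[x];
  sigma_bij : bijective sigma;
  sigma_base : forall x : F, sigma (iF x) = iF x;
  sigma_val : forall x : L, x != 0 -> v (sigma x) = v x;
  (* reps is a system of representatives of the residue field of F. *)
  sigma_frobenius : exists reps : seq F,
    [/\ forall x, x \in reps -> val_ge 0 (iF x),
        forall x : F, val_ge 0 (iF x) ->
          exists2 y, y \in reps & val_ge 1 (iF (x - y)),
        forall j k : nat, (j < k < size reps)%N ->
          ~ val_ge 1 (iF (reps`_j - reps`_k)) &
        forall x : L, val_ge 0 x -> val_ge 1 (sigma x - x ^+ size reps)]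
}.

End Padic.

Definition algebraic_closure (L : fieldType) (K : closedFieldType)
    (iL : L -> K) : Prop :=
  forall x : K, exists p : {poly L}, p != 0 /\ root (map_poly iL p) x.

(* Linear algebraic groups in the language of varieties: a group is the set of
   its points in GL_n over the algebraically closed field K.  All fields below
   have characteristic 0, so that being defined over a subfield k is the same
   as being cut out by polynomials with coefficients in k. *)
Section AlgebraicGroups.
Variable K : closedFieldType.

Definition eval_mx (k k' : fieldType) (i : k -> k') n
    (p : mpoly.mpoly (n * n) k) (g : 'M[k']_n) : k' :=
  mpoly.mmap i (fun j => mxvec g 0 j) p.

Definition closed_over (k : fieldType) (i : k -> K) n (X : set 'M[K]_n) : Prop :=
  exists P : set (mpoly.mpoly (n * n) k),
    X = [set g | g \in unitmx /\ forall p, P p -> eval_mx i p g = 0].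

Definition mx_subgroup (k : fieldType) n (X : set 'M[k]_n) : Prop :=
  [/\ forall g, X g -> g \in unitmx, X 1%:M,
      forall g h, X g -> X h -> X (g *m h) &
      forall g, X g -> X (invmx g)].

Definition generated (k : fieldType) n (X : set 'M[k]_n) : set 'M[k]_n :=
  [set g | forall H, mx_subgroup H -> X `<=` H -> H g].

Definition alg_group (k : fieldType) (i : k -> K) n (G : set 'M[K]_n) : Prop :=
  closed_over i G /\ mx_subgroup G.

Definition zariski_connected n (X : set 'M[K]_n) : Prop :=
  forall Y Z : set 'M[K]_n, closed_over id Y -> closed_over id Z ->
    X = Y `|` Z -> Y `&` Z = set0 -> Y = set0 \/ Z = set0.

Definition unipotent n (g : 'M[K]_n) : Prop := exists k, (g - 1%:M) ^+ k = 0.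

Definition reductive n (G : set 'M[K]_n) : Prop :=
  forall U : set 'M[K]_n, alg_group id U -> U `<=` G ->
    (forall g u, G g -> U u -> U (g *m u *m invmx g)) ->
    zariski_connected U -> (forall u, U u -> unipotent u) -> U = [set 1%:M].

Definition connected_reductive (k : fieldType) (i : k -> K) n
    (G : set 'M[K]_n) : Prop :=
  [/\ alg_group i G, zariski_connected G & reductive G].

Definition monomials (k : fieldType) q r (B : 'M[int]_(q, r)) (t : 'cV[k]_r)
  : 'cV[k]_q := \col_i \prod_j t j 0 ^ B i j.

Definition invertible_coords (k : fieldType) r (t : 'cV[k]_r) : Prop :=
  forall j, t j 0 != 0.

(* The homomorphism from the r-dimensional split torus to GL_n with weights
   the rows of m with respect to the basis of eigenvectors given by g. *)
Definition torus_param (k : fieldType) n r (g : 'M[k]_n) (m : 'M[int]_(n, r))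
    (t : 'cV[k]_r) : 'M[k]_n :=
  g *m diag_mx (monomials m t)^T *m invmx g.

Definition torus_coordinates (k : fieldType) (i : k -> K) n r
    (g : 'M[k]_n) (m : 'M[int]_(n, r)) (S : set 'M[K]_n) : Prop :=
  [/\ g \in unitmx,
      forall t t' : 'cV[K]_r, invertible_coords t -> invertible_coords t' ->
        torus_param (map_mx i g) m t = torus_param (map_mx i g) m t' -> t = t' &
      S = [set torus_param (map_mx i g) m t | t in
             [set t : 'cV[K]_r | invertible_coords t]]].

Definition split_torus (k : fieldType) (i : k -> K) n (S : set 'M[K]_n) : Prop :=
  exists r (g : 'M[k]_n) (m : 'M[int]_(n, r)), torus_coordinates i g m S.

Definition maximal_split_torus (k : fieldType) (i : k -> K) n
    (G S : set 'M[K]_n) : Prop :=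
  [/\ split_torus i S, S `<=` G &
      forall S', split_torus i S' -> S' `<=` G -> S `<=` S' -> S' = S].

Definition points (k : fieldType) (i : k -> K) n (G : set 'M[K]_n)
  : set 'M[k]_n := [set g | G (map_mx i g)].

Definition centralizer n (G S : set 'M[K]_n) : set 'M[K]_n :=
  [set g | G g /\ forall s, S s -> g *m s = s *m g].

Definition normalizer n (G S : set 'M[K]_n) : set 'M[K]_n :=
  [set g | G g /\ forall s, S s <-> S (g *m s *m invmx g)].

(* f restricts to a morphism of varieties from G to GL_q, defined over k. *)
Definition regular_over (k : fieldType) (i : k -> K) n q (G : set 'M[K]_n)
    (f : 'M[K]_n -> 'M[K]_q) : Prop :=
  forall a b, exists (p : mpoly.mpoly (n * n) k) (d : nat),
    forall g, G g -> f g a b = eval_mx i p g / \det g ^+ d.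

Definition group_iso_over (k : fieldType) (i : k -> K) n q
    (G : set 'M[K]_n) (G' : set 'M[K]_q) (f : 'M[K]_n -> 'M[K]_q) : Prop :=
  [/\ regular_over i G f, forall g, G g -> G' (f g),
      forall g h, G g -> G h -> f (g *m h) = f g *m f h &
      exists f' : 'M[K]_q -> 'M[K]_n,
        [/\ regular_over i G' f', forall g, G' g -> G (f' g),
            forall g, G g -> f' (f g) = g & forall g, G' g -> f (f' g) = g]].

End AlgebraicGroups.

Section GroupsOverL.
Variables (F L : fieldType) (K : closedFieldType).
Variables (iF : {rmorphism F -> L}) (iL : {rmorphism L -> K}).
Variables (v : L -> int) (sigma : {rmorphism L -> L}).

Definition is_automorphism n (G : set 'M[K]_n) (theta : 'M[L]_n -> 'M[L]_n)
  : Prop :=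
  exists f : 'M[K]_n -> 'M[K]_n, group_iso_over iL G G f /\
    forall g, points iL G g -> map_mx iL (theta g) = f (map_mx iL g).

(* theta is transported from the Frobenius of a group G' over F by an
   isomorphism, defined over L, of G with G'. *)
Definition is_frobenius_morphism n (G : set 'M[K]_n)
    (theta : 'M[L]_n -> 'M[L]_n) : Prop :=
  exists q (G' : set 'M[K]_q) (f : 'M[K]_n -> 'M[K]_q),
    [/\ alg_group (iL \o iF) G', group_iso_over iL G G' f &
        forall g (h : 'M[L]_q), points iL G g -> map_mx iL h = f (map_mx iL g) ->
          points iL G (theta g) /\
          f (map_mx iL (theta g)) = map_mx iL (map_mx sigma h)].

Definition integral_mx (E : splittingFieldType L) n (t : 'M[E]_n) : Prop :=
  exists (d : nat) (c : nat -> L), (forall i, val_ge v 0 (c i)) /\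
    t ^+ d = \sum_(i < d) (c i)%:A *: t ^+ i.

(* The parahoric subgroup of a torus T over L, i.e. the kernel of the Kottwitz
   homomorphism from T(L) to the inertia coinvariants of the cocharacters.  If
   the Galois extension E splits T, then the norm from T(E) to T(L) is onto and
   the Kottwitz homomorphism sends the norm of t to the class of the cocharacter
   attached to t, so this kernel consists of the norms of the elements of the
   maximal bounded subgroup of T(E). *)
Definition torus_parahoric n (T : set 'M[K]_n) : set 'M[L]_n :=
  [set t | exists (E : splittingFieldType L) (j : {rmorphism E -> K})
             (t' : 'M[E]_n),
    [/\ forall x : L, j x%:A = iL x, split_torus j T, points j T t',
        integral_mx t' /\ integral_mx (invmx t') &
        map_mx (in_alg E) t =
          \big[mulmx/1%:M]_(tau in 'Gal({:E} / 1)%g) map_mx tau t']].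

(* From now on T is the centralizer of a maximal L-split torus S of G with
   coordinates (g0, m); NS below is the group of L-points of its normalizer.
   Characters of S are rows, cocharacters are columns of integers. *)
Variables (n r : nat) (G S : set 'M[K]_n) (g0 : 'M[L]_n) (m : 'M[int]_(n, r)).

Definition TS : set 'M[L]_n := points iL (centralizer G S).
Definition NS : set 'M[L]_n := points iL (normalizer G S).
Definition T1 : set 'M[L]_n := torus_parahoric (centralizer G S).

(* The L-points of the root group attached to the ray of a: S acts by
   conjugation on the (i, j) entry in the basis g0 by the character
   row i m - row j m, and only positive rational multiples of a may occur.
   It is trivial when no positive multiple of a is a root; when both b and 2 b
   are roots, it is the full root group of b. *)
Definition root_group (a : 'rV[int]_r) : set 'M[L]_n :=
  [set u | points iL G u /\ forall i j,
     (invmx g0 *m u *m g0) i j = (i == j)%:R \/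
     exists p q : nat, [/\ (0 < p)%N, (0 < q)%N &
                           (row i m - row j m) *+ q = a *+ p]].

(* w is the element m(u) of Bruhat and Tits: it is determined by u and acts on
   the apartment as a reflection. *)
Definition root_reflection (a : 'rV[int]_r) (u w : 'M[L]_n) : Prop :=
  [/\ a != 0, root_group a u, u != 1%:M, NS w &
      exists u' u'', [/\ root_group (- a) u', root_group (- a) u'' &
                         w = u' *m u *m u'']].

Definition is_quotient (W : groupType) (pi : 'M[L]_n -> W)
    (N N1 : set 'M[L]_n) : Prop :=
  [/\ forall x y, N x -> N y -> pi (x *m y) = (pi x * pi y)%g,
      forall w : W, exists2 x, N x & pi x = w &
      forall x, N x -> (pi x = 1%g <-> N1 x)].

Section Apartment.
Variables (R : realType) (W : groupType) (pi : 'M[L]_n -> W).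
Variable act : W -> 'cV[R]_r -> 'cV[R]_r.

Definition pairing (b : 'rV[int]_r) (x : 'cV[R]_r) : R :=
  (map_mx intr b *m x) 0 0.

(* The function p / det^d is an L-rational character of the centralizer of S,
   whose restriction to S is b. *)
Definition rational_character (p : mpoly.mpoly (n * n) L) (d : nat)
    (b : 'rV[int]_r) : Prop :=
  let chi (g : 'M[K]_n) := eval_mx iL p g / \det g ^+ d in
  [/\ chi 1%:M = 1,
      forall g h, centralizer G S g -> centralizer G S h ->
        chi (g *m h) = chi g * chi h &
      forall t : 'cV[K]_r, invertible_coords t ->
        chi (torus_param (map_mx iL g0) m t) = monomials b t 0 0].

(* The apartment of S, an affine space under the real cocharacters of S, on
   which NS acts by affine transformations extending the translation action of
   the centralizer of S; this determines the action up to translation. *)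
Record is_apartment : Prop := IsApartment {
  act_one : forall x, act 1%g x = x;
  act_mul : forall w w' x, act (w * w')%g x = act w (act w' x);
  act_linear : forall w : 'M[L]_n, NS w -> exists B : 'M[int]_r,
    (forall t : 'cV[K]_r, invertible_coords t ->
       map_mx iL w *m torus_param (map_mx iL g0) m t *m invmx (map_mx iL w)
         = torus_param (map_mx iL g0) m (monomials B t)) /\
    (forall x y, act (pi w) x - act (pi w) y = map_mx intr B *m (x - y));
  act_translation : forall (t : 'M[L]_n) p d b, TS t ->
    rational_character p d b -> forall x,
    pairing b (act (pi t) x - x) = - (v (eval_mx id p t / \det t ^+ d))%:~R
}.

(* sA is the action of sigma on the apartment and sW the one on W.  The linear
   part is the Galois action on cocharacters; once sA is required to have a
   fixed point, sA is determined up to a translation of the apartment. *)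
Record is_sigma_action (sW : W -> W) (sA : 'cV[R]_r -> 'cV[R]_r) : Prop :=
  IsSigmaAction {
  sigma_W : forall w : 'M[L]_n, NS w -> sW (pi w) = pi (map_mx sigma w);
  sigma_linear : exists C : 'M[int]_r,
    (forall t : 'cV[L]_r, invertible_coords t ->
       map_mx sigma (torus_param g0 m t)
         = torus_param g0 m (monomials C (map_mx sigma t))) /\
    (forall x y, sA x - sA y = map_mx intr C *m (x - y));
  sigma_equivariant : forall w x, sA (act w x) = act (sW w) (sA x)
}.

Definition hyperplanes : set (set 'cV[R]_r) :=
  [set H | exists a u w, root_reflection a u w /\ H = [set x | act (pi w) x = x]].

(* The affine root attached to (a, u) is a(x - h), for h on its hyperplane. *)
Definition parahoric_at (x : 'cV[R]_r) : set 'M[L]_n :=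
  generated (T1 `|` [set u | exists a w, root_reflection a u w /\
                       forall h, act (pi w) h = h -> 0 <= pairing a (x - h)]).

(* All maximal L-split tori of G are conjugate under G(L). *)
Definition is_parahoric (P : set 'M[L]_n) : Prop :=
  exists g x, points iL G g /\
    P = [set g *m h *m invmx g | h in parahoric_at x].

Definition G1 : set 'M[L]_n :=
  generated [set g | exists2 P, is_parahoric P & P g].

Definition Wa : set W := [set pi w | w in NS `&` G1].

(* For a family Hs of hyperplanes of an affine subspace through x0, none of
   which contains x0: the open alcove containing x0, its walls, and the
   reflections in these walls lying in the group D. *)
Definition segment_avoids (Hs : set (set 'cV[R]_r)) (x0 y : 'cV[R]_r)
    (I : set R) : Prop :=
  forall H, Hs H -> forall t, I t -> ~ H (x0 + t *: (y - x0)).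

Definition alcove Hs x0 : set 'cV[R]_r :=
  [set y | segment_avoids Hs x0 y [set t | 0 <= t <= 1]].

(* H has a point y in the closure of the alcove which lies on no other
   hyperplane. *)
Definition alcove_wall Hs x0 (H : set 'cV[R]_r) : Prop :=
  Hs H /\ exists y, [/\ H y, forall H', Hs H' -> H' y -> H' = H &
                        segment_avoids Hs x0 y [set t | 0 <= t < 1]].

Definition wall_reflections Hs x0 (D : set W) : set W :=
  [set s | [/\ D s, s <> 1%g &
               exists2 H, alcove_wall Hs x0 H & forall x, H x -> act s x = x]].

Definition Omega (x0 : 'cV[R]_r) : set W :=
  [set w | act w @` alcove hyperplanes x0 = alcove hyperplanes x0].

(* Theorems of Bruhat and Tits, which hold for every reductive group and are
   needed for the length function of W to make sense: W is the semidirect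
   product of Wa and Omega, and Wa is generated by the reflections in the
   affine root hyperplanes. *)
Record affine_weyl_structure (x0 : 'cV[R]_r) : Prop := AffineWeylStructure {
  Wa_normal : forall w u, Wa u -> Wa (w * u * w^-1)%g;
  Wa_Omega_cover : forall w, exists u tau,
    [/\ Wa u, Omega x0 tau & w = (u * tau)%g];
  Wa_Omega_disjoint : forall w, Wa w -> Omega x0 w -> w = 1%g;
  hyperplane_reflection : forall a u w, root_reflection a u w ->
    exists c : R, [set x | act (pi w) x = x] = [set x | pairing a x = c];
  Wa_generated : Wa = [set w | exists l : seq W,
    (forall i, (i < size l)%N ->
       exists a u x, root_reflection a u x /\ nth 1%g l i = pi x) /\
    w = (\prod_(s <- l) s)%g]
}.

End Apartment.
End GroupsOverL.

Section Straight.
Variable W : groupType.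

(* has_length D Om Sr w k: in the semidirect product of D and Om, the length of
   w is k, i.e. k is the word length of the D-part of w for the generators Sr. *)
Definition has_length (D Om Sr : set W) (w : W) (k : nat) : Prop :=
  let word (u : W) (j : nat) := exists l : seq W,
    [/\ size l = j, forall i, (i < j)%N -> Sr (nth 1%g l i) &
        u = (\prod_(s <- l) s)%g] in
  exists u tau, [/\ D u, Om tau, w = (u * tau)%g, word u k &
                    forall j, word u j -> (k <= j)%N].

Variable theta : W -> W.

Definition straight (len : W -> nat -> Prop) (x : W) : Prop :=
  exists2 k, len x k &
    forall j : nat, len (\prod_(i < j) iter i theta x)%g (j * k)%N.

Definition twisted_orbit (D : set W) (x : W) : set W :=
  [set (w * x * (theta w)^-1)%g | w in D].

Definition straight_orbits (X D : set W) (len : W -> nat -> Prop)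
  : set (set W) :=
  [set O | (exists2 y, X y & O = twisted_orbit D y) /\
           (exists2 x, O x & straight len x)].

Definition is_subgroup (D : set W) : Prop :=
  [/\ D 1%g, forall x y, D x -> D y -> D (x * y)%g &
      forall x, D x -> D (x^-1)%g].

Definition set_prod (D E : set W) : set W :=
  [set w | exists x y, [/\ D x, E y & w = (x * y)%g]].

(* Inclusion of orbits induces an injective map from the set A of orbits to the
   set B of orbits. *)
Definition induces_injection (A B : set (set W)) : Prop :=
  exists i : set W -> set W,
    (forall O, A O -> [/\ B (i O), O `<=` i O &
                          forall O', B O' -> O `<=` O' -> O' = i O]) /\
    (forall O1 O2, A O1 -> A O2 -> i O1 = i O2 -> O1 = O2).

(* theta is the length-preserving automorphism of W, stabilizing D, induced by
   the automorphism thG of the group through the identification of W with the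
   double cosets of I.  As thG need not stabilize N, double cosets cannot be
   avoided; by the Bruhat decomposition they determine theta. *)
Record is_induced_automorphism (L : fieldType) n (N I : set 'M[L]_n)
    (pi : 'M[L]_n -> W) (thG : 'M[L]_n -> 'M[L]_n) (D : set W)
    (len : W -> nat -> Prop) : Prop := IsInducedAutomorphism {
  induced_mul : forall x y, theta (x * y)%g = (theta x * theta y)%g;
  induced_bij : bijective theta;
  induced_dcoset : let dcoset w := [set g | exists a b,
      [/\ I a, I b & g = a *m w *m b]] in
    forall w w', N w -> N w' -> pi w' = theta (pi w) ->
      thG @` dcoset w = dcoset w';
  induced_length : forall w k, len w k -> len (theta w) k;
  induced_Wa : theta @` D = D
}.

End Straight.

(* Main.v *)
(* The affine Weyl group acts on the apartment as a group generated by orthogonal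
   reflections, freely on alcoves, and sigma acts compatibly, fixing x0.  The
   relative length of a sigma-fixed element is its length with respect to the
   relative simple reflections, and the absolute length is additive along relative
   reduced words, so straight elements of W are straight in the larger group.

   For injectivity, decomposing x = u tau reduces to two straight sigma-fixed
   elements u, u' of the affine Weyl group with u alpha(w) = w u', where
   alpha = Ad(tau) theta; one must find a sigma-fixed such w.  Some power
   u alpha(u) ... alpha^(N-1)(u) is a translation by a vector nu.  Correcting w by
   the group generated by the reflections whose walls are parallel to nu, the
   discrepancy sigma(w) w^-1 falls in a free abelian group, lattice-ordered by
   coordinates along the walls crossed by nu, and on which sigma and alpha act by
   order automorphisms.  The join of a finite orbit in this lattice is a correction
   of w that makes it sigma-fixed.

   The concrete data enter as follows.  Elements of the normalizer permute the
   weights of S, which gives an invariant Euclidean form.  Determinants of weight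
   blocks are rational characters of the centralizer of S, so translations lie in
   a discrete group, and the elements varpi^c of S supply translations in all
   directions. *)
Require Import Defs.
From HB Require Import structures.
From mathcomp Require Import all_boot all_order all_algebra all_fingroup all_field.
From mathcomp Require Import boolp classical_sets reals.
From mathcomp Require Import zify ring lra.
Set Implicit Arguments.
Unset Strict Implicit.
Unset Printing Implicit Defensive.
Import Order.TTheory GRing.Theory Num.Theory.
Local Open Scope classical_set_scope.
Local Open Scope ring_scope.

(** * Affine reflection groups *)

(** Two obstacles shape the proof. First, the automorphism is known on W only, through lengths, and
    has no action on the apartment. Whatever it must transport (being a reflection, separating two
    chambers, being parallel to a translation, pointing in its direction) is therefore expressed
    through lengths, separation of chambers indexed by the group, and commutation with the
    translation. Secondly, the elements conjugating u to u' form a torsor under a twisted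
    centralizer on which sigma acts, and a nonabelian cohomology class could obstruct a fixed point.
    Straightness removes the contribution of the parallel walls: the twisted powers of a straight
    element never cross them, so a conjugator can be chosen that keeps the base chamber on the same
    side of all of them. On the remaining lattice the actions preserve the order, and a join does
    the work of the vanishing cohomology of a permutation module. *)

Inductive gen (W : groupType) (T : set W) : W -> Prop :=
| gen1 : gen T 1%g
| genM t w : T t -> gen T w -> gen T (t * w)%g.

Lemma gen_incl (W : groupType) (T : set W) t : T t -> gen T t.
Proof. by move=> h; rewrite -[t]mulg1; apply: genM => //; apply: gen1. Qed.

Lemma gen_mul (W : groupType) (T : set W) a b :
  gen T a -> gen T b -> gen T (a * b)%g.
Proof.
by move=> ha hb; elim: ha => [|t w ht _ ih]; rewrite ?mul1g // -mulgA; apply: genM.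
Qed.

Lemma gen_sub (W : groupType) (T T' : set W) a :
  T `<=` T' -> gen T a -> gen T' a.
Proof. by move=> h; elim=> [|t w /h ht _ ih]; [apply: gen1|apply: genM]. Qed.

Section Datum.
Variables (R : realType) (V : lmodType R) (W : groupType).
Variables (ip : V -> V -> R) (act lin : W -> V -> V) (T D : set W).
Variables (nrm : W -> V) (off : W -> R) (x0 : V).

Definition wall_form (t : W) (x : V) : R := ip (nrm t) x - off t.

Definition separates (t : W) (x y : V) : Prop := wall_form t x * wall_form t y < 0.

(** An axiomatic affine reflection group: [T] holds all reflections, not only simple ones, and [W]
    may exceed [D], leaving room for the stabilizer of the alcove. Normals are oriented
    consistently, so parallel walls have equal, never opposite, normals and comparable offsets.
    Finitely many normals and separated offsets give local finiteness; [lin_finite] turns powers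
    into translations. *)
Record reflection_group : Prop := ReflectionGroup {
  ipC : forall x y, ip x y = ip y x;
  ipDl : forall x y z, ip (x + y) z = ip x z + ip y z;
  ipZl : forall a x y, ip (a *: x) y = a * ip x y;
  ip_gt0 : forall x, x != 0 -> 0 < ip x x;
  rg_act1 : forall x, act 1%g x = x;
  rg_actM : forall w w' x, act (w * w')%g x = act w (act w' x);
  act_lin : forall w x y, act w x - act w y = lin w (x - y);
  linZ : forall w a x, lin w (a *: x) = a *: lin w x;
  lin_ip : forall w x y, ip (lin w x) (lin w y) = ip x y;
  lin_finite : forall w, exists2 k, (0 < k)%N & forall x, iter k (lin w) x = x;
  nrm_unit : forall t, T t -> ip (nrm t) (nrm t) = 1;
  act_refl : forall t x, T t -> act t x = x - (2 * wall_form t x) *: nrm t;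
  T_conj : forall w t, T t -> T (w * t * w^-1)%g;
  nrm_finite : exists l : seq V, forall t, T t -> nrm t \in l;
  nrm_opp : forall t t', T t -> T t' -> nrm t <> - nrm t';
  off_discrete : exists2 e : R, 0 < e & forall t t', T t -> T t' ->
    nrm t = nrm t' -> off t < off t' -> e <= off t' - off t;
  off_infinite : forall t, T t ->
    exists t', [/\ T t', nrm t' = nrm t & off t' != off t];
  D_gen : forall w, D w <-> gen T w;
  x0_regular : forall t, T t -> wall_form t x0 != 0;
  D_free : forall w, D w -> (forall t, T t -> ~ separates t x0 (act w x0)) ->
    w = 1%g
}.
End Datum.

Section Basics.
Variables (R : realType) (V : lmodType R) (W : groupType).
Variables (ip : V -> V -> R) (act lin : W -> V -> V) (T D : set W).
Variables (nrm : W -> V) (off : W -> R) (x0 : V).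
Hypothesis rg : reflection_group ip act lin T D nrm off x0.
Notation f := (wall_form ip nrm off).
Notation sep := (separates ip nrm off).

Lemma ipDr x y z : ip x (y + z) = ip x y + ip x z.
Proof. by rewrite (ipC rg) (ipDl rg) !(ipC rg x). Qed.
Lemma ipZr a x y : ip x (a *: y) = a * ip x y.
Proof. by rewrite (ipC rg) (ipZl rg) (ipC rg x). Qed.
Lemma ipNl x y : ip (- x) y = - ip x y.
Proof. by rewrite -scaleN1r (ipZl rg) mulN1r. Qed.
Lemma ipNr x y : ip x (- y) = - ip x y.
Proof. by rewrite -scaleN1r ipZr mulN1r. Qed.
Lemma ip0l x : ip 0 x = 0.
Proof. by rewrite -(scale0r 0) (ipZl rg) mul0r. Qed.
Lemma ip0r x : ip x 0 = 0.
Proof. by rewrite (ipC rg) ip0l. Qed.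
Lemma ip_ge0 x : 0 <= ip x x.
Proof. by have [->|/(ip_gt0 rg)/ltW //] := eqVneq x 0; rewrite ip0l. Qed.
Lemma ip_eq0 x : ip x x = 0 -> x = 0.
Proof.
by move=> e; apply/eqP; apply: contraT => /(ip_gt0 rg); rewrite e ltxx.
Qed.
Definition ipE := (ipDr, ipDl rg, ipNl, ipNr, ipZr, ipZl rg, ip0l, ip0r).

(** Reduces a vector identity to a scalar one, which [ring] or [field] settles after expansion by
    [ipE]. *)
Lemma ip_ext x y : (forall z, ip x z = ip y z) -> x = y.
Proof.
move=> h; apply/eqP; rewrite -subr_eq0; apply/eqP/ip_eq0.
by rewrite [ip (x - y) _](ipDl rg) ipNl h subrr.
Qed.

Lemma cauchy_schwarz x y : ip x y ^+ 2 <= ip x x * ip y y.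
Proof.
have [->|/(ip_gt0 rg) hy] := eqVneq y 0; first by rewrite !ipE mulr0 expr0n.
have := ip_ge0 (ip y y *: x - ip x y *: y); rewrite !ipE (ipC rg y x) => h.
have : 0 <= ip y y * (ip x x * ip y y - ip x y ^+ 2) by apply: le_trans h _; lra.
by rewrite pmulr_rge0 // subr_ge0.
Qed.

Lemma unit_ip_lt x y : ip x x = 1 -> ip y y = 1 -> x <> y -> ip x y < 1.
Proof.
move=> hx hy hxy; have : x - y != 0 by rewrite subr_eq0; apply/eqP.
by move=> /(ip_gt0 rg); rewrite !ipE hx hy (ipC rg y x); lra.
Qed.

(** A crude form of Cauchy-Schwarz that avoids square roots. *)
Lemma unit_ip_bound n x : ip n n = 1 -> - (1 + ip x x) <= ip n x <= 1 + ip x x.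
Proof.
move=> hn; have := cauchy_schwarz n x; rewrite hn mul1r => h.
have := ip_ge0 x; nra.
Qed.

Lemma lin0 w : lin w 0 = 0.
Proof. by have := act_lin rg w 0 0; rewrite !subrr. Qed.
Lemma linD w x y : lin w (x + y) = lin w x + lin w y.
Proof.
have := act_lin rg w (x + y) 0; have := act_lin rg w (x + y) y.
have := act_lin rg w y 0; rewrite !subr0 addrK => <- <- <-.
by rewrite addrA subrK.
Qed.
Lemma linN w x : lin w (- x) = - lin w x.
Proof. by rewrite -scaleN1r (linZ rg) scaleN1r. Qed.
Lemma linM w w' x : lin (w * w')%g x = lin w (lin w' x).
Proof.
have := act_lin rg (w * w')%g x 0; have := act_lin rg w (act w' x) (act w' 0).
by have := act_lin rg w' x 0; rewrite !(rg_actM rg) !subr0 => -> -> ->.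
Qed.
Lemma lin1 x : lin 1%g x = x.
Proof. by have := act_lin rg 1%g x 0; rewrite !(rg_act1 rg) !subr0. Qed.
Lemma linVK w x : lin w^-1%g (lin w x) = x.
Proof. by rewrite -linM mulVg lin1. Qed.
Lemma linKV w x : lin w (lin w^-1%g x) = x.
Proof. by rewrite -linM mulgV lin1. Qed.
Lemma act_invK w x : act w^-1%g (act w x) = x.
Proof. by rewrite -(rg_actM rg) mulVg (rg_act1 rg). Qed.
Lemma act_Kinv w x : act w (act w^-1%g x) = x.
Proof. by rewrite -(rg_actM rg) mulgV (rg_act1 rg). Qed.
Lemma actD w x v : act w (x + v) = act w x + lin w v.
Proof.
by have := act_lin rg w (x + v) x; rewrite [x + v - x]addrAC subrr add0r => <-; rewrite addrCA subrr addr0.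
Qed.
Lemma ip_linl w x y : ip (lin w x) y = ip x (lin w^-1%g y).
Proof. by rewrite -{1}[y](linKV w) (lin_ip rg). Qed.

Lemma wall_formD t x v : f t (x + v) = f t x + ip (nrm t) v.
Proof. by rewrite /wall_form !ipE; lra. Qed.

Lemma lin_refl t v : T t -> lin t v = v - (2 * ip (nrm t) v) *: nrm t.
Proof.
move=> ht; have := act_lin rg t v 0; rewrite subr0 => <-.
rewrite !(act_refl rg _ ht) -{2}[v]add0r wall_formD.
by apply: ip_ext => z; rewrite !ipE; ring.
Qed.
End Basics.

Section Walls.
Variables (R : realType) (V : lmodType R) (W : groupType).
Variables (ip : V -> V -> R) (act lin : W -> V -> V) (T D : set W).
Variables (nrm : W -> V) (off : W -> R) (x0 : V).
Hypothesis rg : reflection_group ip act lin T D nrm off x0.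
Notation f := (wall_form ip nrm off).
Notation sep := (separates ip nrm off).
Local Notation ipE := (ipE rg).

Lemma T_sub_D : T `<=` D.
Proof. by move=> t /gen_incl; rewrite -(D_gen rg). Qed.
Lemma D_one : D 1%g.
Proof. by rewrite (D_gen rg); apply: gen1. Qed.
Lemma D_mul a b : D a -> D b -> D (a * b)%g.
Proof. by rewrite !(D_gen rg); apply: gen_mul. Qed.

Lemma wall_refl t x : T t -> f t (act t x) = - f t x.
Proof.
move=> ht; rewrite (act_refl rg _ ht) (wall_formD rg) !ipE (nrm_unit rg ht); ring.
Qed.

Lemma act_fix t x : T t -> f t x = 0 -> act t x = x.
Proof. by move=> ht h; rewrite (act_refl rg _ ht) h mulr0 scale0r subr0. Qed.

Lemma D_fix_x0 w : D w -> act w x0 = x0 -> w = 1%g.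
Proof.
move=> hw e; apply: (D_free rg hw) => t ht; rewrite /separates e -expr2.
by rewrite ltNge sqr_ge0.
Qed.

Lemma T_invol t : T t -> (t * t = 1)%g.
Proof.
move=> ht; apply: D_fix_x0; first by apply: D_mul; apply: T_sub_D.
rewrite (rg_actM rg) (act_refl rg x0 ht) (actD rg) (act_refl rg x0 ht).
rewrite (linN rg) (linZ rg) (lin_refl rg _ ht) (nrm_unit rg ht).
by apply: (ip_ext rg) => z; rewrite !ipE; ring.
Qed.

Lemma T_inv t : T t -> (t^-1 = t)%g.
Proof. by move=> /T_invol/(congr1 (fun x => t^-1 * x)%g); rewrite mulKg mulg1. Qed.

Lemma gen_inv (T' : set W) a : T' `<=` T -> gen T' a -> gen T' (a^-1)%g.
Proof.
move=> h; elim=> [|t w ht _ ih]; first by rewrite invg1; apply: gen1.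
by rewrite invgM; apply: gen_mul ih _; rewrite T_inv; [apply: gen_incl|apply: h].
Qed.

Lemma D_inv a : D a -> D (a^-1)%g.
Proof. by rewrite !(D_gen rg); apply: gen_inv. Qed.

Lemma D_faithful w w' : D w -> D w' -> act w x0 = act w' x0 -> w = w'.
Proof.
move=> hw hw' e; apply: (mulgI w^-1%g); rewrite mulVg; apply/esym.
apply: D_fix_x0; first by apply: D_mul => //; apply: D_inv.
by rewrite (rg_actM rg) -e (act_invK rg).
Qed.

(** Comparing the displacement of [act w x] under the conjugate reflection with the image of the
    displacement of [x] under [t] makes the normals proportional. A sign remains because normals are
    oriented by a global choice that [w] need not respect. *)
Lemma wall_conj w t : T t -> exists s : R, [/\ s ^+ 2 = 1,
  nrm (w * t * w^-1)%g = s *: lin w (nrm t) &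
  forall x, f (w * t * w^-1)%g (act w x) = s * f t x].
Proof.
move=> ht; have ht' := T_conj rg w ht; set t' := (w * t * w^-1)%g in ht' *.
have key x : f t' (act w x) *: nrm t' = f t x *: lin w (nrm t).
  have : act t' (act w x) = act w (act t x).
    by rewrite -!(rg_actM rg) mulgVK.
  rewrite (act_refl rg _ ht') (act_refl rg _ ht) (actD rg) (linN rg) (linZ rg).
  move=> /addrI/oppr_inj; rewrite -!scalerA => /(scalerI _); apply.
  by rewrite pnatr_eq0.
have fn x : f t ((off t + x) *: nrm t) = x.
  by rewrite /wall_form !ipE (nrm_unit rg ht); lra.
(* By [fn] the form [f t] takes the value 1 at this point, so [key] reads off the factor there. *)
set s := f t' (act w ((off t + 1) *: nrm t)).
have e : s *: nrm t' = lin w (nrm t) by have := key ((off t + 1) *: nrm t); rewrite fn scale1r.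
have s2 : s ^+ 2 = 1.
  have := lin_ip rg w (nrm t) (nrm t); rewrite -e !ipE (nrm_unit rg ht) (nrm_unit rg ht').
  by rewrite mulr1 expr2.
exists s; split=> [//||x]; first by rewrite -e scalerA -expr2 s2 scale1r.
have := congr1 (ip (nrm t')) (key x); rewrite -e scalerA !ipE (nrm_unit rg ht') !mulr1.
by rewrite mulrC.
Qed.

Lemma sep_conj w t x y : T t ->
  sep (w * t * w^-1)%g (act w x) (act w y) <-> sep t x y.
Proof.
move=> ht; have [s [s2 _ h]] := wall_conj w ht.
by rewrite /separates !h mulrACA -expr2 s2 mul1r.
Qed.

Lemma sep_conjV w t x y : T t ->
  sep t (act w x) (act w y) <-> sep (w^-1 * t * w)%g x y.
Proof.
move=> ht; have := sep_conj w^-1%g (act w x) (act w y) ht.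
by rewrite invgK !(act_invK rg) => ->.
Qed.

Lemma wall_inj t t' : T t -> T t' -> nrm t = nrm t' -> off t = off t' -> t = t'.
Proof.
move=> ht ht' en eo; apply: D_faithful; try exact: T_sub_D.
by rewrite (act_refl rg _ ht) (act_refl rg _ ht') /wall_form en eo.
Qed.

(** Vectors orthogonal to [nrm t] move along the wall of [t], hence along that of [t'], so the unit
    normals are proportional. Opposite normals are excluded by the orientation. *)
Lemma wall_zeros t t' : T t -> T t' -> (forall x, f t x = 0 -> f t' x = 0) -> t = t'.
Proof.
move=> ht ht' h.
pose n := nrm t; pose n' := nrm t'.
have hn : ip n n = 1 := nrm_unit rg ht; have hn' : ip n' n' = 1 := nrm_unit rg ht'.
have e v : ip n v = 0 -> ip n' v = 0.
  move=> hv; pose p := off t *: n.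
  have p0 : f t p = 0 by rewrite /wall_form !ipE -/n hn; lra.
  have : f t' (p + v) = 0 by apply: h; rewrite (wall_formD rg) p0 hv addr0.
  by rewrite (wall_formD rg) (h _ p0) add0r.
have en : n' = ip n n' *: n.
  apply/eqP; rewrite -subr_eq0; apply/eqP/(ip_eq0 rg).
  have := e (n' - ip n n' *: n); rewrite !ipE hn mulr1 subrr => /(_ erefl) h0.
  rewrite -[RHS]h0 (ipC rg n' n); ring.
have s2 : ip n n' ^+ 2 = 1 by have := hn'; rewrite -/n' en !ipE hn; lra.
have /orP[/eqP e1|/eqP e1] : (ip n n' == 1) || (ip n n' == -1) by rewrite -sqrf_eq1 s2.
  move: en; rewrite e1 scale1r => en.
  apply: wall_inj => //; rewrite -/n -?en //.
  have /h : f t (off t *: n) = 0 by rewrite /wall_form !ipE -/n hn; lra.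
  by rewrite /wall_form -/n' en !ipE hn; lra.
by move: en; rewrite e1 scaleN1r => /(nrm_opp rg ht' ht).
Qed.

(** Finitely many normals occur. For a fixed one, distinct offsets differ by at least [e], so
    cutting the range of [f t x] into intervals of width [e] leaves at most one wall in each, which
    [xget] selects. *)
Lemma local_finite (x : V) (rho : R) :
  exists l : seq W, forall t, T t -> - rho <= f t x <= rho -> t \in l.
Proof.
have [L hL] := nrm_finite rg.
have [e e0 he] := off_discrete rg.
have one n : exists l : seq W, forall t, T t -> nrm t = n -> - rho <= f t x <= rho -> t \in l.
  pose k t := Num.truncn ((f t x + rho) / e).
  pose P j := [set t | [/\ T t, nrm t = n, - rho <= f t x <= rho & k t = j]].
  exists [seq xget 1%g (P j) | j <- iota 0 (Num.truncn (2 * rho / e)).+1].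
  move=> t ht hn hx; apply/mapP; exists (k t).
    rewrite mem_iota add0n ltnS /=; apply: le_truncn.
    have h : f t x + rho <= 2 * rho by lra.
    by rewrite ler_pM2r ?invr_gt0.
  have : P (k t) (xget 1%g (P (k t))) by apply: xgetI (_ : P (k t) t).
  set t' := xget _ _; move=> [ht' hn' hx' hk].
  have pos u : - rho <= f u x <= rho -> 0 <= (f u x + rho) / e.
    move=> hu; have h : 0 <= f u x + rho by lra.
    by rewrite divr_ge0 // ltW.
  have /andP[a1 a2] := truncn_itv (pos t hx).
  have /andP[b1 b2] := truncn_itv (pos t' hx').
  have {}a1 : (k t)%:R <= (f t x + rho) / e := a1.
  have {}a2 : (f t x + rho) / e < (k t).+1%:R := a2.
  have {}b1 : (k t)%:R <= (f t' x + rho) / e by rewrite -hk.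
  have {}b2 : (f t' x + rho) / e < (k t).+1%:R by rewrite -hk.
  apply/esym; apply: wall_inj => //; first by rewrite hn'.
  move: a1 a2 b1 b2; rewrite !ler_pdivlMr // !ltr_pdivrMr // /wall_form hn hn' -!natr1.
  set K := (k t)%:R; move=> a1 a2 b1 b2.
  have := he t' t ht' ht; have := he t t' ht ht'; rewrite hn hn' => /(_ erefl) o1 /(_ erefl) o2.
  by case: (ltgtP (off t') (off t)) => // o; [have := o2 o|have := o1 o]; lra.
have [g hg] := boolp.choice one.
exists (flatten (map g L)) => t ht hx; apply/flatten_mapP.
by exists (nrm t); [apply: hL|apply: hg].
Qed.

Definition near0 (P : R -> Prop) := exists2 d : R, 0 < d & forall s : R, 0 < s -> s <= d -> P s.

Lemma near0_and P Q : near0 P -> near0 Q -> near0 (fun s => P s /\ Q s).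
Proof.
move=> [d d0 h] [d' d0' h']; case: (lerP d d') => dd.
  by exists d => // s s0 sd; split; [apply: h|apply: h' => //; apply: le_trans dd].
exists d' => // s s0 sd; split; [apply: h => //|exact: h'].
by apply: le_trans sd _; apply: ltW.
Qed.

Lemma near0_all (I : eqType) (l : seq I) (P : I -> R -> Prop) :
  (forall i, i \in l -> near0 (P i)) -> near0 (fun s => forall i, i \in l -> P i s).
Proof.
elim: l => [|i l ih] h; first by exists 1.
have h1 := h i (mem_head _ _).
have h2 : near0 (fun s => forall j, j \in l -> P j s).
  by apply: ih => j hj; apply: h; rewrite in_cons hj orbT.
have [d d0 hd] := near0_and h1 h2; exists d => // s s0 sd j.
by have [a b] := hd s s0 sd; rewrite in_cons => /orP[/eqP->|/b].
Qed.

Lemma near0_ex P : near0 P -> exists2 s, 0 < s & P s.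
Proof. by move=> [d d0 h]; exists d => //; apply: h. Qed.

Lemma near0_sub (P Q : R -> Prop) : (forall s, 0 < s -> P s -> Q s) -> near0 P -> near0 Q.
Proof. by move=> h [d d0 hd]; exists d => // s s0 sd; apply: h => //; apply: hd. Qed.

Lemma near0_le (c : R) : 0 < c -> near0 (fun s => s <= c).
Proof. by move=> c0; exists c. Qed.

Lemma near0_mul (a b : R) : 0 < a -> near0 (fun s => s * b < a).
Proof.
move=> a0; have p : 0 < 1 + b ^+ 2 by rewrite ltr_pwDl ?sqr_ge0.
(* Dividing by [1 + b ^+ 2] instead of [b] spares a case distinction on the sign or vanishing of
   [b]. *)
exists (a / 2 / (1 + b ^+ 2)); first by rewrite !divr_gt0.
move=> s s0; rewrite ler_pdivlMr // => h.
have {}h : s * (1 + b ^+ 2) <= a / 2 := h.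
have := mulr_ge0 (ltW s0) (sqr_ge0 (b - 1)); nra.
Qed.

Lemma near0_affine (a b : R) : a != 0 -> near0 (fun s => 0 < (a + s * b) * a).
Proof.
move=> a0; have a2 : 0 < a ^+ 2 by rewrite exprn_even_gt0.
apply: near0_sub (near0_mul (- a * b) a2) => s s0 h; nra.
Qed.

Lemma near0_ball (x y : V) (e : R) : ip x x < e -> near0 (fun s => ip (x + s *: y) (x + s *: y) < e).
Proof.
move=> h; have h' : 0 < (e - ip x x) by lra.
apply: near0_sub (near0_and (near0_mul (2 * ip x y + ip y y) h') (near0_le ltr01)) => s s0 [h1 h2].
rewrite !ipE (ipC rg y x); move: (ip_ge0 rg y) h1.
move: (ip x x) (ip x y) (ip y y) => A B C C0 h1.
have h3 : 0 <= 1 - s by lra.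
have := mulr_ge0 (mulr_ge0 (ltW s0) C0) h3; lra.
Qed.

(** Instances are the whole space, a wall, a line, and the points fixed by [sA]. *)
Definition affine_set (P : set V) := forall y z (s : R), P y -> P z -> P (y + s *: (z - y)).

(** Induction on the list: if [g i] vanishes at the point found so far, a small move towards a point
    of [P] where it does not vanish repairs this, without losing the finitely many earlier
    inequalities or leaving the ball. *)
Lemma generic_point (P : set V) (I : eqType) (l : seq I) (g : I -> V -> R) y0 (e : R) :
  affine_set P ->
  (forall i y z (s : R), g i (y + s *: (z - y)) = g i y + s * (g i z - g i y)) ->
  0 < e -> P y0 -> (forall i, i \in l -> exists2 z, P z & g i z != 0) ->
  exists y, [/\ P y, ip (y - y0) (y - y0) < e & forall i, i \in l -> g i y != 0].
Proof.
move=> hP hg e0 hy0; elim: l => [|i l ih] h.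
  by exists y0; split=> //; rewrite subrr (ip0l rg).
have [y [hy he hl]] : exists y, [/\ P y, ip (y - y0) (y - y0) < e & forall i, i \in l -> g i y != 0].
  by apply: ih => j hj; apply: h; rewrite in_cons hj orbT.
have [z hz gz] := h i (mem_head _ _).
have [giy|giy] := eqVneq (g i y) 0; last first.
  by exists y; split=> // j; rewrite in_cons => /orP[/eqP->//|/hl].
have n1 : near0 (fun s => forall j, j \in l -> 0 < (g j y + s * (g j z - g j y)) * g j y).
  by apply: near0_all => j hj; apply: near0_affine; apply: hl.
have [s s0 [h1 h2]] := near0_ex (near0_and n1 (near0_ball (z - y) he)).
exists (y + s *: (z - y)); split; first exact: hP.
  by rewrite addrAC.
move=> j; rewrite in_cons hg => /orP[/eqP->|/h1].
  by rewrite giy subr0 add0r mulf_neq0 // gt_eqF.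
by case: eqP => // ->; rewrite mul0r ltxx.
Qed.

(** A sign change bounds [f t x] by its difference with [f t y]; with [local_finite], only finitely
    many walls separate two points. *)
Lemma sep_bound t x y : T t -> sep t x y ->
  - (1 + ip (x - y) (x - y)) <= f t x <= 1 + ip (x - y) (x - y).
Proof.
move=> ht; rewrite /separates => h.
have := unit_ip_bound rg (x - y) (nrm_unit rg ht); set B := 1 + _ => /andP[h1 h2].
have e : f t x - f t y = ip (nrm t) (x - y) by rewrite /wall_form !ipE; ring.
rewrite -e in h1 h2.
case: (ltrgt0P (f t x)) => h0; [|by nra|by rewrite h0 mul0r ltxx in h].
have hy : f t y < 0 by rewrite -(pmulr_rlt0 _ h0).
by apply/andP; split; lra.
Qed.

Lemma separators_ex x y : exists l : seq W, uniq l /\ forall t, t \in l <-> T t /\ sep t x y.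
Proof.
have [l hl] := local_finite x (1 + ip (x - y) (x - y)).
exists (undup [seq t <- l | `[< T t /\ sep t x y >]]); split; first exact: undup_uniq.
move=> t; rewrite mem_undup mem_filter; split=> [/andP[/asboolP //]|[ht hs]].
by apply/andP; split; [apply/asboolP|apply: hl => //; apply: sep_bound].
Qed.

Definition separators x y : seq W := sval (cid (separators_ex x y)).

Lemma separators_uniq x y : uniq (separators x y).
Proof. by rewrite /separators; case: cid => l []. Qed.

Lemma mem_separators x y t : t \in separators x y <-> T t /\ sep t x y.
Proof. by rewrite /separators; case: cid => l []. Qed.

Lemma wall_act w t : T t ->
  exists2 s : R, s != 0 & forall x, f t (act w x) = s * f (w^-1 * t * w)%g x.
Proof.
move=> ht; have ht' : T (w^-1 * t * w)%g by rewrite -{2}[w]invgK; apply: (T_conj rg).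
have [s [s2 _ e]] := wall_conj w ht'; exists s.
  by apply: contra_eq_neq s2 => ->; rewrite expr0n eq_sym oner_eq0.
by move=> x; rewrite -e !mulgA mulgV mul1g mulgK.
Qed.

Definition regular x := forall t, T t -> f t x != 0.

Lemma regular_act w x : regular x -> regular (act w x).
Proof.
move=> h t ht; have [s s0 ->] := wall_act w ht.
by rewrite mulf_neq0 //; apply: h; rewrite -{2}[w]invgK; apply: T_conj rg _ _ _.
Qed.

Lemma x0_reg : regular x0.
Proof. exact: (x0_regular rg). Qed.

(* An arbitrary separating reflection brings [y] closer to [x]: H is paired with its mirror image in t, and no H can
   have x, y on one side and their mirror images on the other. *)
Lemma sep_refl_move (T' : set W) t x y (l l' : seq W) :
  T' `<=` T -> (forall a b, T' a -> T' b -> T' (a * b * a^-1)%g) ->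
  T' t -> sep t x y -> (forall h, T' h -> f h y != 0) -> (forall h, T' h -> f h x != 0) ->
  (forall h, h \in l <-> T' h /\ sep h x y) -> uniq l' ->
  (forall h, h \in l' <-> T' h /\ sep h x (act t y)) -> (size l' < size l)%N.
Proof.
move=> hT hc ht hs ry rx hl ul' hl'.
have Tt := hT _ ht.
(* [phi] injects the walls separating [x] from [act t y] into those separating [x] from [y], and
   misses [t], so the count drops. *)
pose phi h := if h \in l then h else (t * h * t^-1)%g.
have same h u v : T h -> f h u != 0 -> f h v != 0 -> ~ sep h u v -> 0 < f h u * f h v.
  by move=> _ hu hv /negP; rewrite -leNgt le_eqVlt eq_sym mulf_eq0 (negPf hu) (negPf hv).
have phiP h : h \in l' -> h \notin l -> (t * h * t^-1)%g \in l.
  move=> /hl' [hh hsep] hnl; have Th := hT _ hh.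
  have nsep : ~ sep h x y by move=> hxy; move/negP: hnl; apply; apply/hl.
  apply/hl; split; first exact: hc.
  apply: contrapT => ns.
  have ns' : ~ sep h (act t x) (act t y).
    move=> /(sep_conjV _ _ _ Th) hh'; apply: ns.
    by move: hh'; rewrite (T_inv Tt).
  have fhx := rx _ hh; have fhy := ry _ hh.
  have reg u : (forall h, T' h -> f h u != 0) -> f h (act t u) != 0.
    move=> ru; have [s s0 ->] := wall_act t Th.
    by rewrite mulf_neq0 //; apply: ru; rewrite -{2}[t]invgK (T_inv Tt); apply: hc.
  have p1 := same h x y Th fhx fhy nsep.
  have p2 := same h _ _ Th (reg _ rx) (reg _ ry) ns'.
  move: hsep; rewrite /separates => p3.
  have e u : f h (act t u) = f h u - 2 * f t u * ip (nrm h) (nrm t).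
    by rewrite (act_refl rg _ Tt) (wall_formD rg) !ipE.
  move: (hs) p1 p2 p3; rewrite /separates !e.
  set c := ip _ _; set a := f h x; set b := f h y; set p := f t x; set q := f t y.
  (* With [x], [y] on one side of [h] and both mirror images on the other, [p * c] and [q * c] have
     the same sign, against [p * q < 0]. *)
  move=> pq ab h2 h3.
  have [a0|a0] : 0 < a \/ a < 0 by move: ab; case: (ltrgt0P a) => //; auto; move=> ->; rewrite mul0r ltxx.
    have b0 : 0 < b by move: ab; rewrite pmulr_rgt0.
    have k1 : b - 2 * q * c < 0 by move: h3; rewrite pmulr_rlt0.
    have k2 : a - 2 * p * c < 0 by move: h2; rewrite nmulr_lgt0.
    have k3 : 0 < q * c by lra.
    have k4 : 0 < p * c by lra.
    have := mulr_gt0 k3 k4; have := sqr_ge0 c; nra.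
  have b0 : b < 0 by move: ab; rewrite nmulr_rgt0.
  have k1 : 0 < b - 2 * q * c by move: h3; rewrite nmulr_rlt0.
  have k2 : 0 < a - 2 * p * c by move: h2; rewrite pmulr_lgt0.
  have k3 : q * c < 0 by lra.
  have k4 : p * c < 0 by lra.
  have : 0 < (q * c) * (p * c) by rewrite nmulr_rgt0.
  by have := sqr_ge0 c; nra.
have tl : t \in l by apply/hl.
have tnl' : t \notin l'.
  apply/negP => /hl' [_]; rewrite /separates wall_refl // mulrN oppr_lt0 => h.
  by move: hs; rewrite /separates => /(lt_trans h); rewrite ltxx.
have conjK a : (t * (t * a * t^-1) * t^-1)%g = a.
  by rewrite (T_inv Tt) !mulgA (T_invol Tt) mul1g -mulgA (T_invol Tt) mulg1.
have nocol a b : a \in l' -> b \in l' -> a \in l -> b \notin l -> a <> (t * b * t^-1)%g.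
  move=> /hl' [Ta sa] hb al bl e; have := phiP b hb bl; move: hb => /hl' [Tb sb].
  have nsb : ~ sep b x y by move=> hxy; move/negP: bl; apply; apply/hl.
  have Tb' := hT _ Tb.
  have sep' u v : sep a u v <-> sep b (act t u) (act t v).
    by rewrite (sep_conjV _ _ _ Tb') e (T_inv Tt).
  have := same b x y Tb' (rx _ Tb) (ry _ Tb) nsb.
  move: al => /hl [_ /sep']; move: sa => /sep'; move: sb; rewrite -(rg_actM rg) (T_invol Tt) (rg_act1 rg).
  rewrite /separates; move: (f b x) (f b y) (f b (act t x)) (f b (act t y)) => p q p' q'.
  move=> h1 h2 h3 h4 _.
  have : 0 < (p * q') * (p' * q) by rewrite nmulr_rgt0.
  have : (p * q) * (p' * q') < 0 by rewrite pmulr_rlt0.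
  by nra.
have inj : {in l' &, injective phi}.
  move=> a b ha hb; rewrite /phi; case: ifP => la; case: ifP => lb //.
  - by move=> e; case: (nocol a b ha hb la (negbT lb) e).
  - by move=> e; case: (nocol b a hb ha lb (negbT la)).
  - by move=> /(congr1 (fun h => t * h * t^-1)%g); rewrite !conjK.
have sub : {subset t :: map phi l' <= l}.
  move=> h; rewrite in_cons => /orP[/eqP->//|/mapP[a ha ->]].
  by rewrite /phi; case: ifP => // /negbT; apply: phiP.
have un : uniq (t :: map phi l').
  rewrite /= map_inj_in_uniq // ul' andbT; apply/mapP => -[a ha].
  rewrite /phi; case: ifP => [_ e|/negbT la e]; first by rewrite e ha in tnl'.
  have : a = t by rewrite -[a]conjK -e mulgK.
  by move=> e'; rewrite e' tl in la.
by have := uniq_leq_size un sub; rewrite /= size_map.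
Qed.
End Walls.

(** * Cells and simple transitivity *)

Section Cells.
Variables (R : realType) (V : lmodType R) (W : groupType).
Variables (ip : V -> V -> R) (act lin : W -> V -> V) (T D : set W).
Variables (nrm : W -> V) (off : W -> R) (x0 : V).
Hypothesis rg : reflection_group ip act lin T D nrm off x0.
Notation f := (wall_form ip nrm off).
Notation sep := (separates ip nrm off).
Notation reg := (regular ip T nrm off).
Local Notation ipE := (ipE rg).

Definition conj_closed (T' : set W) := forall a b, T' a -> T' b -> T' (a * b * a^-1)%g.

(** Strict positivity packs two facts: neither point lies on a wall of [T'], and no such wall
    separates them. *)
Definition cell (T' : set W) (x y : V) := forall t, T' t -> 0 < f t x * f t y.

Lemma cell_sym T' x y : cell T' x y -> cell T' y x.
Proof. by move=> h t /h; rewrite mulrC. Qed.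

Lemma cell_trans T' x y z : cell T' x y -> cell T' y z -> cell T' x z.
Proof.
move=> h1 h2 t ht; have := h1 t ht; have := h2 t ht => a b.
have : 0 < (f t x * f t z) * (f t y * f t y) by have := mulr_gt0 a b; lra.
by rewrite pmulr_lgt0 // -expr2 exprn_even_gt0 //; apply: contraTneq a => ->; rewrite mul0r ltxx.
Qed.

Lemma cell_refl T' x : (forall t, T' t -> f t x != 0) -> cell T' x x.
Proof. by move=> h t /h h0; rewrite -expr2 exprn_even_gt0. Qed.

Lemma cell_nzl (T' : set W) x y : cell T' x y -> forall t, T' t -> f t x != 0.
Proof. by move=> h t /h; apply: contraTneq => ->; rewrite mul0r ltxx. Qed.

Lemma cell_nsep T' x y : cell T' x y -> forall t, T' t -> ~ sep t x y.
Proof. by move=> h t /h a; rewrite /separates => /(lt_trans a); rewrite ltxx. Qed.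

Lemma nsep_cell (T' : set W) x y : (forall t, T' t -> f t x != 0) -> (forall t, T' t -> f t y != 0) ->
  (forall t, T' t -> ~ sep t x y) -> cell T' x y.
Proof.
move=> rx ry h t ht; have := h t ht; rewrite /separates => /negP; rewrite -leNgt le_eqVlt.
by rewrite eq_sym mulf_eq0 (negPf (rx t ht)) (negPf (ry t ht)).
Qed.

Lemma cell_act (T' : set W) w x y : T' `<=` T -> (forall t, T' t -> T' (w^-1 * t * w)%g) ->
  cell T' x y -> cell T' (act w x) (act w y).
Proof.
move=> hT hw h t ht; have [s s0 e] := wall_act rg w (hT t ht).
by rewrite !e mulrACA -expr2 pmulr_rgt0 ?h ?exprn_even_gt0 //; apply: hw.
Qed.

Lemma cell_actT w x y : cell T x y -> cell T (act w x) (act w y).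
Proof. by apply: cell_act => // t ht; rewrite -{2}[w]invgK; apply: (T_conj rg). Qed.

Lemma nz_refl (T' : set W) t y : T' `<=` T -> conj_closed T' -> T' t ->
  (forall h, T' h -> f h y != 0) -> forall h, T' h -> f h (act t y) != 0.
Proof.
move=> hT hc ht ry h hh; have [s s0 ->] := wall_act rg t (hT h hh).
rewrite mulf_neq0 //; apply: ry; have /(T_inv rg) e := hT t ht.
by rewrite -{2}[t]invgK e; apply: hc.
Qed.

Lemma gen_conj_closed (T' : set W) r : T' `<=` T -> conj_closed T' -> gen T' r ->
  forall t, T' t -> T' (r^-1 * t * r)%g.
Proof.
move=> hT hc; elim=> [|a w ha _ ih] t ht; first by rewrite invg1 mul1g mulg1.
rewrite invgM; have -> : (w^-1 * a^-1 * t * (a * w) = w^-1 * (a^-1 * t * a) * w)%g.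
  by rewrite !mulgA.
by apply: ih; rewrite -{2}[a]invgK (T_inv rg (hT a ha)); apply: hc.
Qed.

(** Descent on the number of walls of [T'] separating the two points: reflecting in any one of them
    lowers it. Allowing a conjugation-closed part of [T] covers the walls through a point and the
    walls parallel to a vector. *)
Lemma cell_transitive (T' : set W) x y : T' `<=` T -> conj_closed T' ->
  (forall h, T' h -> f h x != 0) -> (forall h, T' h -> f h y != 0) ->
  exists2 r, gen T' r & cell T' x (act r y).
Proof.
move=> hT hc rx.
have ex z : exists l : seq W, uniq l /\ forall t, t \in l <-> T' t /\ sep t x z.
  exists [seq t <- separators rg x z | `[< T' t >]]; split.
    by rewrite filter_uniq // separators_uniq.
  move=> t; rewrite mem_filter; split=> [/andP[/asboolP h /mem_separators [_ ?]] //|[h ?]].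
  by apply/andP; split; [apply/asboolP|apply/mem_separators; split=> //; apply: hT].
move: y; suff: forall k y l, (size l < k)%N -> uniq l -> (forall t, t \in l <-> T' t /\ sep t x y) ->
    (forall h, T' h -> f h y != 0) -> exists2 r, gen T' r & cell T' x (act r y).
  by move=> h y ry; have [l [ul hl]] := ex y; apply: (h (size l).+1 y l).
elim=> // k ih y l; rewrite ltnS => sl ul hl ry.
case: l sl ul hl => [|t l] sl ul hl.
  exists 1%g; first exact: gen1.
  rewrite (rg_act1 rg); apply: nsep_cell => // t ht hs.
  by have /hl : T' t /\ sep t x y by [].
have [ht hs] : T' t /\ sep t x y by apply/hl; rewrite mem_head.
have [l' [ul' hl']] := ex (act t y).
have lt := sep_refl_move rg hT hc ht hs ry rx hl ul' hl'.
have [r hr hc'] := ih (act t y) l' (leq_trans lt sl) ul' hl' (nz_refl hT hc ht ry).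
exists (r * t)%g; first by apply: gen_mul => //; apply: gen_incl.
by rewrite (rg_actM rg).
Qed.

Lemma T_conj_closed : conj_closed T.
Proof. by move=> a b _ hb; apply: (T_conj rg). Qed.

Lemma D_transitive x y : reg x -> reg y -> exists2 r, D r & cell T x (act r y).
Proof.
move=> hx hy; have [r hr hc] := cell_transitive (@subset_refl _ T) T_conj_closed hx hy.
by exists r => //; apply/(D_gen rg).
Qed.

(** [D_free] speaks of [x0] only; conjugating by an element that moves the cell of [y] onto that of
    [x0] extends it to every cell. *)
Lemma D_free_cell w y : D w -> cell T y (act w y) -> w = 1%g.
Proof.
move=> hw hc; have ry := cell_nzl hc.
have [r hr hx] := D_transitive (x0_reg rg) ry.
have e : (r * w * r^-1)%g = 1%g.
  apply: (D_free rg); first by apply: (D_mul rg) (D_inv rg hr); apply: (D_mul rg).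
  apply: cell_nsep; apply: (cell_trans hx); apply: (cell_trans (y := act (r * w)%g y)).
    by rewrite (rg_actM rg); apply: cell_actT.
  have -> : act (r * w)%g y = act (r * w * r^-1)%g (act r y) by rewrite !(rg_actM rg) (act_invK rg).
  by apply: cell_actT; apply: cell_sym.
by have := congr1 (fun z => r^-1 * z * r)%g e; rewrite /= !mulgA mulVg mul1g mulgVK mulg1 mulVg.
Qed.

Lemma D_fix_regular w y : D w -> reg y -> act w y = y -> w = 1%g.
Proof. by move=> hw hy e; apply: (D_free_cell (y := y) hw); rewrite e; apply: cell_refl. Qed.

(** Only finitely many [t] have [f t p] between -1 and 1. With [e] at most 1 and below the square of
    each nonzero value among these, Cauchy-Schwarz leaves no room for a sign change. *)
Lemma ball_signs p : exists2 e : R, 0 < e &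
  forall y, ip (y - p) (y - p) < e -> forall t, T t -> f t p != 0 -> 0 < f t p * f t y.
Proof.
have [l hl] := local_finite rg p 1.
have [|e e0 [he e1]] := near0_ex (near0_and (near0_all (l := [seq t <- l | f t p != 0])
  (P := fun t e => e * 1 < f t p ^+ 2) _) (near0_le (@ltr01 R))).
  by move=> t; rewrite mem_filter => /andP[h _]; apply: near0_mul; rewrite exprn_even_gt0.
exists e => // y hy t ht h0.
have h : e <= f t p ^+ 2.
  case: (boolP (t \in l)) => [tl|/negP tl].
    by have := he t; rewrite mem_filter h0 tl mulr1 => /(_ erefl)/ltW.
  apply: le_trans e1 _; rewrite leNgt; apply/negP => h1; apply: tl; apply: hl => //.
  by apply/andP; split; nra.
have := cauchy_schwarz rg (nrm t) (y - p); rewrite (nrm_unit rg ht) mul1r => cs.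
have -> : f t y = f t p + ip (nrm t) (y - p) by rewrite -(wall_formD rg) addrC subrK.
move: cs h hy; move: (f t p) (ip (nrm t) _) (ip (y - p) _) => a b c cs h hy.
have : b ^+ 2 < a ^+ 2 by lra.
by move=> h2; nra.
Qed.

Lemma near_signs p v : near0 (fun s : R => forall t, T t -> f t p != 0 -> 0 < f t p * f t (p + s *: v)).
Proof.
have [e e0 he] := ball_signs p.
have h : ip 0 0 < e by rewrite (ip0l rg).
apply: near0_sub (near0_ball rg v h) => s s0; rewrite add0r => hs.
by apply: he; rewrite addrC addKr.
Qed.

Definition walls_at p : set W := [set t | T t /\ f t p = 0].

Lemma walls_at_conj_closed p : conj_closed (walls_at p).
Proof.
move=> a b [ha pa] [hb pb]; split; first exact: (T_conj rg).
have [s [_ _ e]] := wall_conj rg a hb.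
by rewrite -(act_fix rg ha pa) e pb mulr0.
Qed.

Lemma walls_at_fix p r : gen (walls_at p) r -> act r p = p.
Proof.
by elim=> [|a w [ha pa] _ ih]; rewrite ?(rg_act1 rg) // (rg_actM rg) ih (act_fix rg).
Qed.

Lemma gen_D (T' : set W) r : T' `<=` T -> gen T' r -> D r.
Proof. by move=> h /(gen_sub h)/(D_gen rg). Qed.

(** Very close to [p] only the walls through [p] matter, and [r] acts there through its linear part.
    Scaling [y - p] down to such a neighbourhood turns the hypothesis into one about all walls,
    where freeness is known. *)
Lemma walls_at_free p y r : gen (walls_at p) r -> cell (walls_at p) y (act r y) -> r = 1%g.
Proof.
move=> hr hc; have hp := walls_at_fix hr.
have hrD : D r by apply: gen_D hr => t [].
have [s s0 [h1 h2]] := near0_ex (near0_and (near_signs p (y - p)) (near_signs p (lin r (y - p)))).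
apply: (D_free_cell (y := p + s *: (y - p)) hrD).
rewrite (actD rg) hp (linZ rg) => t ht.
have [tp|tp] := eqVneq (f t p) 0; last first.
  have := h1 t ht tp; have := h2 t ht tp; rewrite ![f t p * _]mulrC.
  have c : cell [set t] (p + s *: (y - p)) p -> cell [set t] p (p + s *: lin r (y - p)) ->
    cell [set t] (p + s *: (y - p)) (p + s *: lin r (y - p)) by apply: cell_trans.
  move=> a b; apply: c => // t' -> //; by rewrite mulrC.
have e v : f t (p + s *: v) = s * ip (nrm t) v by rewrite (wall_formD rg) tp add0r (ipZr rg).
have e' v : f t v = ip (nrm t) (v - p) by rewrite -{1}[v](subrK p) addrC (wall_formD rg) tp add0r.
have := hc t (conj ht tp); rewrite !e !e' => h.
have -> : lin r (y - p) = act r y - p by rewrite -(act_lin rg) hp.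
by rewrite mulrACA pmulr_rgt0 // mulr_gt0.
Qed.

Lemma min_in_seq (I : eqType) (l : seq I) (g : I -> R) t0 : t0 \in l ->
  exists2 t, t \in l & forall t', t' \in l -> g t <= g t'.
Proof.
elim: l t0 => // a l ih t0 _; case: l ih => [|b l] ih.
  by exists a; rewrite ?mem_head // => t'; rewrite inE => /eqP->.
have [t ht hm] := ih b (mem_head _ _).
case: (lerP (g a) (g t)) => h.
  exists a; first exact: mem_head.
  by move=> t'; rewrite in_cons => /orP[/eqP-> //|/hm]; apply: le_trans.
exists t; first by rewrite in_cons ht orbT.
by move=> t'; rewrite in_cons => /orP[/eqP->|/hm //]; apply: ltW.
Qed.

(** The end point is perturbed within [P] and within its cell until walls crossed at the same
    parameter have the same trace on [P]; the first crossing is then a generic point of a wall of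
    [P]. *)
Lemma first_wall (P : set V) a y t1 : affine_set P -> P a -> P y -> reg a -> reg y ->
  T t1 -> sep t1 a y -> exists t z, [/\ T t, P z, f t z = 0,
    forall s : R, 0 <= s -> s < 1 -> reg (a + s *: (z - a)) &
    forall t', T t' -> f t' z = 0 -> sep t' a y /\ (forall p, P p -> (f t' p = 0 <-> f t p = 0))].
Proof.
move=> hP Pa Py ra ry ht1 hs1.
pose same (t t' : W) := forall p, P p -> (f t' p = 0 <-> f t p = 0).
pose L := [seq q <- [seq (t, t') | t <- separators rg a y, t' <- separators rg a y] | ~~ `[< same q.1 q.2 >] ].
(* Vanishing of [g (t, t')] at [x] expresses that the segment from [a] to [x] crosses both walls at
   the same parameter. *)
pose g (q : W * W) x := f q.1 a * f q.2 x - f q.2 a * f q.1 x.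
have faff t x z (s : R) : f t (x + s *: (z - x)) = f t x + s * (f t z - f t x).
  by rewrite /wall_form !ipE; ring.
have [e e0 he] := ball_signs y.
have [||y' [Py' hy' hg]] := generic_point rg (P := P) (l := L) (g := g) hP _ e0 Py _.
- by move=> q x z s; rewrite /g !faff; ring.
- move=> [t t']; rewrite mem_filter => /andP[/asboolP ns /allpairsP [[u u'] [/= hu hu' [? ?]]]].
  subst u u'; apply: contrapT => nz; apply: ns => p Pp.
  have : g (t, t') p = 0.
    by apply/eqP; apply: contrapT => /negP h; apply: nz; exists p.
  rewrite /g /=; move: hu hu' => /mem_separators[Tt _] /mem_separators[Tt' _].
  have := ra t Tt; have := ra t' Tt'; move=> n1 n2 h; split=> h0; move: h; rewrite h0 mulr0.
    by rewrite sub0r => /eqP; rewrite oppr_eq0 mulf_eq0 (negPf n1) => /eqP.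
  by rewrite subr0 => /eqP; rewrite mulf_eq0 (negPf n2) => /eqP.
have cy : cell T y y' by move=> t ht; apply: he => //; apply: ry.
pose lam t := f t a / (f t a - f t y').
have sepy' t : T t -> sep t a y' -> sep t a y.
  move=> ht; have := cy t ht; rewrite /separates => p1 p2.
  have p3 : (f t a * f t y) * (f t y' * f t y') < 0.
    have h : (f t a * f t y') * (f t y * f t y') < 0 by rewrite pmulr_llt0.
    by lra.
  move: p3; rewrite pmulr_llt0 // -expr2 exprn_even_gt0 //.
  by apply: contraTneq p1 => ->; rewrite mulr0 ltxx.
have lamP t s : T t -> 0 <= s -> s < 1 -> f t (a + s *: (y' - a)) = 0 -> sep t a y' /\ s = lam t.
  move=> ht s0 s1; rewrite faff => h.
  have a0 := ra t ht; have : f t a - f t y' != 0.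
    apply: contraNneq a0 => d; have -> : f t a = s * (f t a - f t y') by lra.
    by rewrite d mulr0.
  move=> d0; have es : s = lam t by apply: (mulIf d0); rewrite divfK //; lra.
  split=> //; rewrite /separates.
  have sp : 0 < s.
    rewrite lt_neqAle s0 andbT; apply: contraNneq a0 => s00; move: h; rewrite -s00 mul0r addr0.
    by move/eqP.
  have h' : (1 - s) * f t a = - (s * f t y') by lra.
  have : (1 - s) * (f t a * f t y') = - (s * f t y' ^+ 2) by rewrite mulrA h'; ring.
  move=> h2; have : (1 - s) * (f t a * f t y') < 0.
    rewrite h2 oppr_lt0 mulr_gt0 // exprn_even_gt0 //.
    by have := cell_nzl (cell_sym cy) ht.
  by rewrite pmulr_rlt0 // subr_gt0.
have lamS t : T t -> sep t a y' -> 0 < lam t < 1 /\ f t (a + lam t *: (y' - a)) = 0.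
  rewrite /separates /lam => ht hs.
  have d0 : f t a - f t y' != 0.
    apply: contraTneq hs => d; have -> : f t y' = f t a by lra.
    by rewrite -leNgt -expr2 sqr_ge0.
  split; last by rewrite faff -{1}[f t a](divfK d0); field.
  case: (ltrgt0P (f t a)) => h0.
  - have h1 : f t y' < 0 by rewrite -(pmulr_rlt0 _ h0).
    have h2 : 0 < f t a - f t y' by lra.
    by rewrite divr_gt0 //= ltr_pdivrMr // mul1r; lra.
  - have h1 : 0 < f t y' by rewrite -(nmulr_rlt0 _ h0).
    have h2 : f t a - f t y' < 0 by lra.
    by rewrite -mulrNN -invrN divr_gt0 ?ltr_pdivrMr ?mul1r /=; lra.
  - by move: hs; rewrite h0 mul0r ltxx.
have hs1' : sep t1 a y'.
  have := cy t1 ht1; move: hs1; rewrite /separates => p2 p1.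
  have p3 : (f t1 a * f t1 y') * (f t1 y * f t1 y) < 0.
    have h : (f t1 a * f t1 y) * (f t1 y * f t1 y') < 0 by rewrite pmulr_llt0.
    by lra.
  move: p3; rewrite pmulr_llt0 // -expr2 exprn_even_gt0 //.
  by apply: contraTneq p1 => ->; rewrite mul0r ltxx.
have [t ht hmin] := min_in_seq lam (proj2 (mem_separators rg a y' t1) (conj ht1 hs1')).
have [Tt St] := proj1 (mem_separators rg a y' t) ht.
have [/andP[l0 l1] lz] := lamS t Tt St.
have ez s : a + s *: (a + lam t *: (y' - a) - a) = a + (s * lam t) *: (y' - a).
  by rewrite [a + lam t *: _]addrC addrK scalerA.
exists t, (a + lam t *: (y' - a)); split=> //; first exact: hP.
  move=> s s0 s1 t' ht'; rewrite ez; apply/eqP => h.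
  have lt : s * lam t < lam t by rewrite gtr_pMl.
  have [| |hs e'] := lamP t' _ ht' _ _ h; first by rewrite mulr_ge0 // ltW.
    by apply: lt_trans lt l1.
  have := hmin t'; rewrite e' in lt; rewrite leNgt lt => /(_ (proj2 (mem_separators rg a y' t') (conj ht' hs))).
  by [].
move=> t' ht' hz; have [hs e'] := lamP t' _ ht' (ltW l0) l1 hz.
split; first exact: sepy'.
apply: contrapT => ns; have : (t, t') \in L.
  rewrite mem_filter; apply/andP; split; first by apply/asboolP => h; apply: ns.
  by apply/allpairsP; exists (t, t'); split=> //=; apply/mem_separators; split=> //; apply: sepy'.
move=> /hg /eqP; apply; rewrite /g /=.
have k1 := lz; have k2 := hz; rewrite !faff in k1 k2.
have q1 : lam t * f t y' = - (1 - lam t) * f t a by lra.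
have q2 : lam t * f t' y' = - (1 - lam t) * f t' a by lra.
apply: (mulfI (lt0r_neq0 l0)); rewrite mulr0.
have -> : lam t * (f t a * f t' y' - f t' a * f t y') =
  f t a * (lam t * f t' y') - f t' a * (lam t * f t y') by ring.
rewrite q1 q2; ring.
Qed.
End Cells.

(** * Relative lengths *)

Section Lengths.
Variables (R : realType) (V : lmodType R) (W : groupType).
Variables (ip : V -> V -> R) (act lin : W -> V -> V) (T D : set W).
Variables (nrm : W -> V) (off : W -> R) (x0 : V).
Hypothesis rg : reflection_group ip act lin T D nrm off x0.
Notation f := (wall_form ip nrm off).
Notation sep := (separates ip nrm off).
Notation reg := (regular ip T nrm off).
Notation cell := (cell ip nrm off).
Local Notation ipE := (ipE rg).

(** Counted as walls between chambers, the length makes sense on all of [W]; [simple_word] and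
    [word_ell_le] identify it on [D] with the word length. *)
Definition ell (w : W) : nat := size (separators rg x0 (act w x0)).

Lemma reg_act_x0 w : reg (act w x0).
Proof. by apply: (regular_act rg); apply: (x0_reg rg). Qed.

(** A wall has two sides, so among three points it separates either no pair or exactly two. *)
Lemma sep_trans t x y z : T t -> reg x -> reg y -> reg z ->
  sep t x z <-> (sep t x y /\ ~ sep t y z) \/ (~ sep t x y /\ sep t y z).
Proof.
move=> ht rx ry rz; have := rx t ht; have := ry t ht; have := rz t ht.
have sq : f t x * f t z * (f t y * f t y) = (f t x * f t y) * (f t y * f t z) by ring.
rewrite /separates => z0 y0 xx0.
have y2 : 0 < f t y * f t y by rewrite -expr2 exprn_even_gt0.
have pos (a b : R) : a != 0 -> b != 0 -> ~ (a * b < 0) <-> 0 < a * b.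
  move=> a0 b0; split=> [/negP|h h']; last by have := lt_trans h h'; rewrite ltxx.
  by rewrite -leNgt le_eqVlt eq_sym mulf_eq0 (negPf a0) (negPf b0).
rewrite -(pmulr_llt0 _ y2) sq; split.
  case: (ltrgt0P (f t x * f t y)) => [h|h|/eqP]; last by rewrite mulf_eq0 (negPf y0) (negPf xx0).
    by rewrite pmulr_rlt0 // => h'; right; split=> // h2.
  rewrite nmulr_rlt0 // => h'; left; split=> //; exact/pos.
by case=> -[]; [move=> h /(pos _ _ y0 z0) h'; rewrite nmulr_rlt0|
  move=> /(pos _ _ xx0 y0) h h'; rewrite pmulr_rlt0].
Qed.

Lemma sep_sym t x y : sep t x y <-> sep t y x.
Proof. by rewrite /separates mulrC. Qed.

Lemma ell_le x y z : reg x -> reg y -> reg z ->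
  (size (separators rg x z) <= size (separators rg x y) + size (separators rg y z))%N.
Proof.
move=> rx ry rz; rewrite -size_cat; apply: uniq_leq_size; first exact: separators_uniq.
move=> t /mem_separators[ht /(sep_trans ht rx ry rz) h]; rewrite mem_cat; apply/orP.
by case: h => -[a b]; [left|right]; apply/mem_separators.
Qed.

(** The walls between [x] and [z] form the symmetric difference of the other two sets, so the counts
    add exactly when no wall is crossed twice. *)
Lemma ell_add x y z : reg x -> reg y -> reg z ->
  (forall t, T t -> sep t x y -> ~ sep t y z) <->
  size (separators rg x z) = (size (separators rg x y) + size (separators rg y z))%N.
Proof.
move=> rx ry rz; split=> h.
  rewrite -size_cat; apply/eqP; rewrite eqn_leq; apply/andP; split.
    by rewrite size_cat; apply: ell_le.
  apply: uniq_leq_size.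
    rewrite cat_uniq !separators_uniq /= andbT; apply/hasPn => t /mem_separators[ht h2].
    by apply/negP => /mem_separators[_ h1]; apply: (h t).
  move=> t; rewrite mem_cat => /orP[] /mem_separators[ht hs]; apply/mem_separators; split=> //.
    by apply/(sep_trans ht rx ry rz); left; split=> //; apply: h.
  by apply/(sep_trans ht rx ry rz); right; split=> // h1; apply: (h t).
move=> t ht h1 h2.
have t1 : t \in separators rg x y by apply/mem_separators.
have t2 : t \in separators rg y z by apply/mem_separators.
(* A wall crossed twice can be deleted from both lists, a loss of two. *)
have : (size (separators rg x z) <= size (rem t (separators rg x y) ++ rem t (separators rg y z)))%N.
  apply: uniq_leq_size; first exact: separators_uniq.
  move=> t' /mem_separators[ht' /(sep_trans ht' rx ry rz) h'].
  have ne : t' != t by apply/eqP => e; subst t'; case: h' => -[].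
  rewrite mem_cat; apply/orP.
  by case: h' => -[a b]; [left|right]; rewrite mem_rem_uniq ?separators_uniq // inE ne;
    apply/mem_separators.
rewrite h size_cat !size_rem // => {}h.
have n1 : (0 < size (separators rg x y))%N by case: (separators rg x y) t1.
have n2 : (0 < size (separators rg y z))%N by case: (separators rg y z) t2.
move: h; rewrite -{1}(prednK n1) -{1}(prednK n2) addSn addnS => /ltnW.
by rewrite ltnn.
Qed.

Lemma size_separators_act w x y :
  size (separators rg (act w x) (act w y)) = size (separators rg x y).
Proof.
have le v p q : (size (separators rg p q) <= size (separators rg (act v p) (act v q)))%N.
  rewrite -(size_map (fun t => v * t * v^-1)%g); apply: uniq_leq_size.
    rewrite map_inj_uniq ?separators_uniq // => a b e.
    by apply: (mulgI v); apply: (mulIg v^-1%g).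
  move=> t /mapP[a /mem_separators[ha hs] ->]; apply/mem_separators.
  by split; [apply: (T_conj rg)|apply/(sep_conj rg)].
apply/eqP; rewrite eqn_leq le andbT; have := le w^-1%g (act w x) (act w y).
by rewrite !(act_invK rg).
Qed.

Lemma ellE w w' : size (separators rg (act w x0) (act w' x0)) = ell (w^-1 * w')%g.
Proof. by rewrite /ell (rg_actM rg) -[RHS](size_separators_act w) (act_Kinv rg). Qed.

Lemma ellM_le a b : (ell (a * b)%g <= ell a + ell b)%N.
Proof.
have := ell_le (x0_reg rg) (@reg_act_x0 a) (@reg_act_x0 (a * b)%g).
by rewrite ellE mulKg.
Qed.

Lemma ellM_add a b : ell (a * b)%g = (ell a + ell b)%N <->
  (forall t, T t -> sep t x0 (act a x0) -> ~ sep t (act a x0) (act (a * b)%g x0)).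
Proof.
by rewrite (ell_add (x0_reg rg) (@reg_act_x0 a) (@reg_act_x0 (a * b)%g)) ellE mulKg.
Qed.

Lemma ell0 w : D w -> ell w = 0%N -> w = 1%g.
Proof.
move=> hw /size0nil e; apply: (D_free rg hw) => t ht hs.
by have : t \in separators rg x0 (act w x0) by [apply/mem_separators]; rewrite e.
Qed.

Lemma ell1 : ell 1%g = 0%N.
Proof.
rewrite /ell (rg_act1 rg); case e: (separators _ _ _) => [//|t l].
have /mem_separators[_] : t \in separators rg x0 x0 by rewrite e mem_head.
by rewrite /separates -expr2 ltNge sqr_ge0.
Qed.

(** Reflecting in a separating wall shortens, and the converse is the same fact for [t * w].
    Separation thus becomes a statement about lengths, which length-preserving automorphisms
    respect. *)
Lemma sep_ell t w : T t -> sep t x0 (act w x0) <-> (ell (t * w)%g < ell w)%N.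
Proof.
have key t' w' : T t' -> sep t' x0 (act w' x0) -> (ell (t' * w')%g < ell w')%N.
  move=> ht' hs; rewrite /ell (rg_actM rg).
  apply: (sep_refl_move rg (T' := T) (t := t') (x := x0) (y := act w' x0)) => //.
  - exact: (T_conj_closed rg).
  - exact: reg_act_x0.
  - exact: (x0_reg rg).
  - by move=> h; apply: mem_separators.
  - exact: separators_uniq.
  - by move=> h; apply: mem_separators.
move=> ht; split; first exact: key.
move=> lt; apply: contrapT => ns.
have hs : sep t x0 (act (t * w)%g x0).
  rewrite (rg_actM rg) /separates (wall_refl rg) // mulrN oppr_lt0.
  have : ~ (f t x0 * f t (act w x0) < 0) := ns.
  move=> /negP; rewrite -leNgt le_eqVlt eq_sym mulf_eq0.
  by rewrite (negPf (x0_reg rg ht)) (negPf (@reg_act_x0 w t ht)).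
have := key t (t * w)%g ht hs; rewrite mulgA (T_invol rg ht) mul1g.
by move=> /(ltn_trans lt); rewrite ltnn.
Qed.

Lemma segment_sign (z : V) t :
  (forall s : R, 0 <= s -> s < 1 -> reg (x0 + s *: (z - x0))) ->
  T t -> f t z != 0 -> 0 < f t x0 * f t z.
Proof.
move=> hz ht h0; have a0 := x0_reg rg ht.
rewrite lt_neqAle eq_sym mulf_neq0 //= leNgt; apply/negP => neg.
have d0 : f t x0 - f t z != 0.
  apply: contraTneq neg => d; have -> : f t z = f t x0 by lra.
  by rewrite -leNgt -expr2 sqr_ge0.
pose s := f t x0 / (f t x0 - f t z).
have e : f t (x0 + s *: (z - x0)) = 0.
  rewrite (wall_formD rg) (ipZr rg).
  have -> : ip (nrm t) (z - x0) = f t z - f t x0 by rewrite /wall_form !ipE; ring.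
  by rewrite /s; field.
have [|] := boolP ((0 <= s) && (s < 1)); first by case/andP=> s0 s1; have := hz s s0 s1 t ht; rewrite e eqxx.
rewrite /s; case: (ltrgt0P (f t x0)) a0 => // p _.
  have q : f t z < 0 by rewrite -(pmulr_rlt0 _ p).
  have r : 0 < f t x0 - f t z by lra.
  by rewrite divr_ge0 ?ltW //= ltr_pdivrMr // mul1r; lra.
have q : 0 < f t z by rewrite -(nmulr_rlt0 _ p).
have r : 0 < - (f t x0 - f t z) by lra.
by rewrite -mulrNN -invrN divr_ge0 ?ltr_pdivrMr ?mul1r ?(ltW r) //=; lra.
Qed.

(** If [f t z] were nonzero, [z] would be on the same side of [t] as [x0] and, since [r] fixes [z]
    and carries walls to walls, also on the side of [act r x0]. *)
Lemma fix_segment_sep (z : V) r t :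
  (forall s : R, 0 <= s -> s < 1 -> reg (x0 + s *: (z - x0))) ->
  act r z = z -> T t -> sep t x0 (act r x0) -> f t z = 0.
Proof.
move=> hz hr ht hs; apply/eqP; apply: contraT => h0.
have p1 := segment_sign hz ht h0.
have [s s0 e] := wall_act rg r ht.
have ht' : T (r^-1 * t * r)%g by rewrite -{2}[r]invgK; apply: (T_conj rg).
have h0' : f (r^-1 * t * r)%g z != 0.
  by apply: contra_neq h0 => h; rewrite -hr e h mulr0.
have p2 := segment_sign hz ht' h0'.
move: hs; rewrite /separates e => hs.
have p3 : 0 < s ^+ 2 by rewrite exprn_even_gt0.
have := mulr_gt0 p3 (mulr_gt0 p1 p2).
have ez : f t z = s * f (r^-1 * t * r)%g z by rewrite -{1}hr e.
rewrite ez; move: (f (r^-1 * t * r)%g z) (f t x0) (f (r^-1 * t * r)%g x0) s hs {p1 p2 p3 ez h0' e s0} => a b c s hs.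
have -> : s ^+ 2 * (b * (s * a) * (c * a)) = (b * (s * c)) * (s * a) ^+ 2 by ring.
by rewrite nmulr_rgt0 // ltNge sqr_ge0.
Qed.

Variables (sW : W -> W) (sA sC : V -> V).

(** Multiplicativity and finite order of [sW] are asked on [D] only. Identity maps satisfy these
    axioms, which makes the absolute theory a special case of the relative one. *)
Record equivariant : Prop := Equivariant {
  sA_sC : forall x y, sA x - sA y = sC (x - y);
  sC_Z : forall (a : R) x, sC (a *: x) = a *: sC x;
  sC_ip : forall x y, ip (sC x) (sC y) = ip x y;
  sA_act : forall w x, sA (act w x) = act (sW w) (sA x);
  sA_x0 : sA x0 = x0;
  sW_mul : forall w w', D w -> D w' -> sW (w * w')%g = (sW w * sW w')%g;
  sW_T : forall t, T t -> T (sW t);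
  sW_finite : exists2 k, (0 < k)%N & forall w, D w -> iter k sW w = w
}.
Hypothesis sg : equivariant.

Lemma sW_D w : D w -> D (sW w).
Proof.
move=> hw; have := hw; rewrite !(D_gen rg); elim=> [|t v ht hv ih].
  have -> : sW 1%g = 1%g; last exact: gen1.
  have := sW_mul sg (D_one rg) (D_one rg); rewrite mulg1 => e.
  by apply: (mulgI (sW 1%g)); rewrite -e mulg1.
rewrite (sW_mul sg); [|exact: (T_sub_D rg)|exact/(D_gen rg)].
by apply: genM => //; apply: (sW_T sg).
Qed.

Lemma sW_1 : sW 1%g = 1%g.
Proof.
have := sW_mul sg (D_one rg) (D_one rg); rewrite mulg1 => e.
by apply: (mulgI (sW 1%g)); rewrite -e mulg1.
Qed.

Lemma sW_V w : D w -> sW (w^-1)%g = (sW w)^-1%g.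
Proof.
move=> hw; apply: (mulgI (sW w)); rewrite -(sW_mul sg) ?mulgV ?sW_1 //.
exact: (D_inv rg).
Qed.

Lemma sW_inj a b : D a -> D b -> sW a = sW b -> a = b.
Proof.
move=> ha hb e; have [k k0 hk] := sW_finite sg.
by rewrite -(hk a ha) -(hk b hb) -(prednK k0) !iterSr e.
Qed.

(** The comparison of displacements of [wall_conj], with [sC] in place of [lin w]. *)
Lemma wall_sigma t : T t -> exists2 s : R, s != 0 & forall x, f (sW t) (sA x) = s * f t x.
Proof.
move=> ht; have ht' := sW_T sg ht.
have key x : f (sW t) (sA x) *: nrm (sW t) = f t x *: sC (nrm t).
  have := sA_act sg t x; rewrite (act_refl rg _ ht') (act_refl rg _ ht) => e.
  have : sA (x - (2 * f t x) *: nrm t) - sA x = - (2 * f t x *: sC (nrm t)).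
    by rewrite (sA_sC sg) addrAC subrr add0r -scaleNr (sC_Z sg) scaleNr.
  rewrite e addrAC subrr add0r => /oppr_inj; rewrite -!scalerA => /(scalerI _); apply.
  by rewrite pnatr_eq0.
have k2 x : f (sW t) (sA x) ^+ 2 = f t x ^+ 2.
  have := congr1 (fun v => ip v v) (key x).
  by rewrite /= !ipE (sC_ip sg) (nrm_unit rg ht) (nrm_unit rg ht') !mulr1 -!expr2.
have n0 : f t x0 != 0 := x0_reg rg ht.
exists (f (sW t) (sA x0) / f t x0).
  by rewrite mulf_neq0 ?invr_eq0 //; have := expf_neq0 2 n0; rewrite -k2 expf_eq0.
move=> x; apply: (mulIf n0); rewrite mulrAC divfK //.
have := congr1 (ip (nrm (sW t))) (key x); have := congr1 (ip (nrm (sW t))) (key x0).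
rewrite !ipE (nrm_unit rg ht') !mulr1 => -> ->; ring.
Qed.

Definition fixA : set V := [set x | sA x = x].

Lemma fixA_affine : affine_set fixA.
Proof.
move=> y z s; rewrite /fixA /= => hy hz.
have := sA_sC sg (y + s *: (z - y)) y; rewrite addrAC subrr add0r (sC_Z sg) -(sA_sC sg) hy hz.
by move/(canRL (subrK _)) => ->; rewrite addrC.
Qed.

Lemma fixA_act w x : sW w = w -> fixA x -> fixA (act w x).
Proof. by rewrite /fixA /= (sA_act sg) => -> ->. Qed.

Lemma fixA_x0 : fixA x0.
Proof. exact: (sA_x0 sg). Qed.

Definition same_trace t t' := forall p, fixA p -> (f t' p = 0 <-> f t p = 0).

(** A relative reflection, labelled by an absolute wall: all [t] with the same trace on the fixed
    space label the same [s]. The trace must be nonempty, so that [t] cuts the relative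
    apartment. *)
Definition rel_refl t s := [/\ D s, sW s = s & [/\ s <> 1%g, T t, (exists2 z, fixA z & f t z = 0) &
  forall p, fixA p -> f t p = 0 -> act s p = p]].

Lemma faff t x z (s : R) : f t (x + s *: (z - x)) = f t x + s * (f t z - f t x).
Proof. by rewrite /wall_form !ipE; ring. Qed.

(** As [s] is an isometry fixing the trace of [t], the displacement of [x] is orthogonal to the
    vector from any trace point to the midpoint of [x] and [act s x]. A displacement parallel to [t]
    would then be orthogonal to itself; otherwise the line through both points meets the trace, and
    it can do so only in the midpoint. *)
Lemma rel_refl_sep t s x : rel_refl t s -> fixA x -> reg x -> sep t x (act s x).
Proof.
move=> [Ds sgs [ns ht [z Pz fz] hfix]] Px rx.
apply: contrapT => hns.
have Psx := fixA_act sgs Px.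
pose d := act s x - x.
have d0 : d = 0 -> False.
  by move=> e; apply: ns; apply: (D_fix_regular rg Ds rx); apply/eqP; rewrite -subr_eq0; apply/eqP.
have eq p : fixA p -> f t p = 0 -> ip d (2^-1 *: (x + act s x) - p) = 0.
  move=> Pp fp; have hp := hfix p Pp fp.
  have : ip (act s x - p) (act s x - p) = ip (x - p) (x - p).
    by rewrite -{1 2}hp (act_lin rg) (lin_ip rg).
  have -> : act s x - p = d + (x - p) by rewrite /d addrA subrK.
  have -> : 2^-1 *: (x + act s x) - p = 2^-1 *: d + (x - p).
    have -> : act s x = d + x by rewrite subrK.
    by apply: (ip_ext rg) => v; rewrite !ipE; field.
  rewrite !ipE (ipC rg (act s x) x) (ipC rg p (act s x)) (ipC rg p x); lra.
have [e|ne] := eqVneq (f t x) (f t (act s x)).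
  have nd : ip (nrm t) d = 0 by move: e; rewrite /d /wall_form !ipE; lra.
  have Pzd : fixA (z + d).
    have -> : z + d = x + 2 *: (z + 2^-1 *: (act s x - z) - x).
      by apply: (ip_ext rg) => v; rewrite /d !ipE; field.
    by apply: fixA_affine => //; apply: fixA_affine.
  have f1 : f t (z + d) = 0 by rewrite (wall_formD rg) fz nd addr0.
  have e1 := eq _ Pz fz; have := eq _ Pzd f1; rewrite opprD addrA (ipDr rg _ _ (- d)) e1 => /eqP.
  by rewrite add0r (ipNr rg) oppr_eq0 => /eqP/(ip_eq0 rg)/d0.
pose la := f t x / (f t x - f t (act s x)).
have d1 : f t x - f t (act s x) != 0 by rewrite subr_eq0.
have fp : f t (x + la *: (act s x - x)) = 0 by rewrite faff /la; field.
have := eq _ (fixA_affine la Px Psx) fp.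
have -> : 2^-1 *: (x + act s x) - (x + la *: (act s x - x)) = (2^-1 - la) *: d.
  by apply: (ip_ext rg) => v; rewrite /d !ipE; field.
rewrite (ipZr rg) => /eqP; rewrite mulf_eq0 => /orP[|/eqP/(ip_eq0 rg)/d0 //].
rewrite subr_eq0 => /eqP e; apply: hns; rewrite /separates.
have e' : f t (act s x) = - f t x.
  have : la * (f t x - f t (act s x)) = f t x by rewrite /la divfK.
  rewrite -e; lra.
by rewrite e' mulrN oppr_lt0 -expr2 exprn_even_gt0 //; apply: rx.
Qed.
End Lengths.

Section RelativeLengths.
Variables (R : realType) (V : lmodType R) (W : groupType).
Variables (ip : V -> V -> R) (act lin : W -> V -> V) (T D : set W).
Variables (nrm : W -> V) (off : W -> R) (x0 : V).
Hypothesis rg : reflection_group ip act lin T D nrm off x0.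
Variables (sW : W -> W) (sA sC : V -> V).
Hypothesis sg : equivariant ip act T D x0 sW sA sC.
Notation f := (wall_form ip nrm off).
Notation sep := (separates ip nrm off).
Notation reg := (regular ip T nrm off).
Notation cell := (cell ip nrm off).
Notation ell := (ell rg).
Notation fixA := (fixA sA).
Notation same_trace := (same_trace ip nrm off sA).
Notation rel_refl := (rel_refl ip act T D nrm off sW sA).
Notation walls_at := (walls_at ip T nrm off).
Local Notation ipE := (ipE rg).

(** The point [z] witnesses that the trace of [t] is a wall of the relative alcove: it is reached
    from [x0] without crossing, and every absolute wall through it has the same trace. This mirrors
    [alcove_wall] in the fixed space. *)
Definition rel_simple_at t z s := [/\ D s, sW s = s, s <> 1%g, T t &
  [/\ fixA z, f t z = 0, forall t', T t' -> f t' z = 0 -> same_trace t t',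
      forall r : R, 0 <= r -> r < 1 -> reg (x0 + r *: (z - x0)) &
      forall p, fixA p -> f t p = 0 -> act s p = p]].

Definition rel_simple s := exists t z, rel_simple_at t z s.

Lemma rel_simple_at_refl t z s t' : rel_simple_at t z s -> T t' -> f t' z = 0 -> rel_refl t' s.
Proof.
move=> [Ds ss s1 ht [Pz fz tr _ hfix]] ht' fz'; split=> //; split=> //; first by exists z.
by move=> p Pp fp; apply: hfix => //; apply/(tr t' ht' fz').
Qed.

Lemma rel_simple_sep t z s t' : rel_simple_at t z s -> T t' ->
  sep t' x0 (act s x0) <-> f t' z = 0.
Proof.
move=> h ht'; have [Ds ss s1 ht [Pz fz tr hseg hfix]] := h; split.
  by apply: (fix_segment_sep rg hseg) => //; apply: hfix.
move=> fz'; apply: (rel_refl_sep rg sg (rel_simple_at_refl h ht' fz')) (x0_reg rg).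
exact (fixA_x0 sg).
Qed.

(** Were they different, [s^-1 * s'] would also be a relative reflection for [t], and [t] would
    separate each pair among [x0], [act (s^-1 * s') x0] and [act s' x0], which a two-sided wall
    cannot do. *)
Lemma rel_refl_unique t s s' : rel_refl t s -> rel_refl t s' -> s = s'.
Proof.
move=> h h'; have [Ds ss [s1 ht hz hfix]] := h; have [Ds' ss' [s1' _ _ hfix']] := h'.
have [//|ne] := pselect (s = s').
have sV : sW (s^-1)%g = (s^-1)%g by rewrite (sW_V rg sg Ds) ss.
have DV := D_inv rg Ds.
have hy : rel_refl t (s^-1 * s')%g.
  split; first exact: (D_mul rg).
    by rewrite (sW_mul sg) // sV ss'.
  split=> // [e|p Pp fp]; first by apply: ne; rewrite -[s']mul1g -(mulgV s) -mulgA e mulg1.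
  by rewrite (rg_actM rg) hfix' // -{1}(hfix p Pp fp) (act_invK rg).
have Px := fixA_x0 sg; have [Dy sy _] := hy.
have a1 := rel_refl_sep rg sg hy Px (x0_reg rg).
have a2 := rel_refl_sep rg sg h' Px (x0_reg rg).
have a3 := rel_refl_sep rg sg h (fixA_act sg sy Px) (reg_act_x0 rg (s^-1 * s')%g).
rewrite (rg_actM rg) (act_Kinv rg) -(rg_actM rg) in a3.
have := a2 => /(sep_trans ht (x0_reg rg) (reg_act_x0 rg (s^-1 * s')%g) (reg_act_x0 rg s')).
by case=> -[].
Qed.

Lemma rel_refl_invol t s : rel_refl t s -> (s * s = 1)%g.
Proof.
move=> h; have [Ds ss [s1 ht hz hfix]] := h.
have /(rel_refl_unique h) e : rel_refl t s^-1%g.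
  split; [exact: (D_inv rg)|by rewrite (sW_V rg sg Ds) ss|split=> // [e|p Pp fp]].
    by apply: s1; rewrite -[s]invgK e invg1.
  by rewrite -{1}(hfix p Pp fp) (act_invK rg).
by rewrite {2}e mulgV.
Qed.

Lemma rel_refl_conj t s a : rel_refl t s -> D a -> sW a = a ->
  rel_refl (a^-1 * t * a)%g (a^-1 * s * a)%g.
Proof.
move=> [Ds ss [s1 ht [z Pz fz] hfix]] Da sa.
have DV := D_inv rg Da; have sV : sW (a^-1)%g = (a^-1)%g by rewrite (sW_V rg sg Da) sa.
have [c c0 e] := wall_act rg a ht.
have ez x : f (a^-1 * t * a)%g x = 0 <-> f t (act a x) = 0.
  rewrite e; split=> [->|/eqP]; first by rewrite mulr0.
  by rewrite mulf_eq0 (negPf c0) => /eqP.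
split; first by apply: (D_mul rg) => //; apply: (D_mul rg).
  by rewrite !(sW_mul sg) ?sV ?ss ?sa //; apply: (D_mul rg).
split.
- move=> h; apply: s1; have := congr1 (fun x => a * x * a^-1)%g h.
  by rewrite /= !mulgA mulgV mul1g mulg1 mulgK mulgV.
- by rewrite -{2}[a]invgK; apply: (T_conj rg).
- exists (act a^-1%g z); first exact (fixA_act sg sV Pz).
  by apply/ez; rewrite (act_Kinv rg).
- move=> p Pp /ez fp; rewrite !(rg_actM rg) hfix ?(act_invK rg) //.
  exact (fixA_act sg sa Pp).
Qed.

(** The line through [x] and [y] stays in the fixed space, so it meets both walls in the same point
    and the two forms are proportional along it. *)
Lemma same_trace_sep t t' x y : same_trace t t' -> T t -> T t' -> fixA x -> fixA y ->
  reg x -> reg y -> sep t x y -> sep t' x y.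
Proof.
move=> tr ht ht' Px Py rx ry; rewrite /separates => hs.
have d0 : f t x - f t y != 0.
  apply: contraTneq hs => d; have -> : f t y = f t x by lra.
  by rewrite -leNgt -expr2 sqr_ge0.
pose la := f t x / (f t x - f t y).
have fm : f t (x + la *: (y - x)) = 0 by rewrite (faff rg) /la; field.
have := proj2 (tr _ (fixA_affine sg la Px Py)) fm; rewrite (faff rg) => fm'.
have e : f t x * f t' y = f t y * f t' x.
  have e1 : la * (f t x - f t y) = f t x by rewrite /la divfK.
  have e2 : (f t x - f t y) * f t' x + (la * (f t x - f t y)) * (f t' y - f t' x) = 0.
    by rewrite -[RHS](mulr0 (f t x - f t y)) -fm'; ring.
  by rewrite e1 in e2; lra.
have x2 : 0 < f t x ^+ 2 by rewrite exprn_even_gt0 //; apply: rx.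
have x2' : 0 < f t' x ^+ 2 by rewrite exprn_even_gt0 //; apply: rx.
rewrite -(pmulr_rlt0 _ x2); have -> : f t x ^+ 2 * (f t' x * f t' y) = f t x * f t' x * (f t x * f t' y) by ring.
by rewrite e; have -> : f t x * f t' x * (f t y * f t' x) = f t' x ^+ 2 * (f t x * f t y) by [ring]; rewrite pmulr_rlt0.
Qed.

(** The walls crossed by a relative simple reflection all have the same trace, so a fixed element
    crosses all of them or none. *)
Lemma rel_simple_class s w t t' : rel_simple s -> D w -> sW w = w -> T t -> T t' ->
  sep t x0 (act s x0) -> sep t' x0 (act s x0) -> sep t x0 (act w x0) -> sep t' x0 (act w x0).
Proof.
move=> [t1 [z h]] Dw sw ht ht' /(rel_simple_sep h ht) z1 /(rel_simple_sep h ht') z2.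
have [_ _ _ ht1 [_ _ tr _ _]] := h.
apply: (same_trace_sep _ ht ht' (fixA_x0 sg) (fixA_act sg sw (fixA_x0 sg)) (x0_reg rg) (reg_act_x0 rg w)).
by move=> p Pp; rewrite (tr t' ht' z2 p Pp) (tr t ht z1 p Pp).
Qed.

Lemma sW_gen (T' : set W) r : T' `<=` T -> (forall t, T' t -> T' (sW t)) -> gen T' r -> gen T' (sW r).
Proof.
move=> hT hs; elim=> [|t v ht hv ih]; first by rewrite (sW_1 rg sg); apply: gen1.
rewrite (sW_mul sg); [by apply: genM => //; apply: hs|exact/(T_sub_D rg)/hT|].
exact: (gen_D rg hT).
Qed.

(** Let [z] be the first wall point on the way to [act w x0]. The reflections in the walls through
    [z] generate an element carrying [x0] to the opposite local chamber, the longest element of the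
    local group. Uniqueness makes it fixed by [sW], and it fixes the common trace pointwise. *)
Lemma rel_simple_ex w : D w -> sW w = w -> w <> 1%g -> exists s, rel_simple s /\
  forall t, T t -> sep t x0 (act s x0) -> sep t x0 (act w x0).
Proof.
move=> Dw sw w1.
have [t1 [ht1 hs1]] : exists t, T t /\ sep t x0 (act w x0).
  by apply: contrapT => h; apply: w1; apply: (D_free rg Dw) => t ht hs; apply: h; exists t.
have Px := fixA_x0 sg.
have [t [z [ht Pz fz hseg hz]]] := first_wall rg (fixA_affine sg) Px (fixA_act sg sw Px)
   (x0_reg rg) (reg_act_x0 rg w) ht1 hs1.
have wT : walls_at z `<=` T by move=> ? [].
(* The point reflection of [x0] in [z], so that every wall through [z] separates it from [x0]. *)
pose x1 := x0 + 2 *: (z - x0).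
have Px1 : fixA x1 by apply: (fixA_affine sg).
have f1 h : walls_at z h -> f h x1 = - f h x0.
  by move=> [hh h0]; rewrite /x1 (faff rg) h0; ring.
have nz0 h : walls_at z h -> f h x0 != 0 by move=> [hh _]; apply: (x0_regular rg).
have nz1 h : walls_at z h -> f h x1 != 0 by move=> hh; rewrite f1 // oppr_eq0 nz0.
have [r hr hc] := cell_transitive rg wT (walls_at_conj_closed rg (p := z)) nz1 nz0.
have Dr := gen_D rg wT hr.
have wS h : walls_at z h -> walls_at z (sW h).
  move=> [hh h0]; split; first exact: (sW_T sg).
  have [c c0 e] := wall_sigma rg sg hh.
  have -> : z = sA z by rewrite Pz.
  by rewrite e h0 mulr0.
have hsr := sW_gen wT wS hr.
have hcs : cell (walls_at z) x1 (act (sW r) x0).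
  move=> h hh; have [k k0 hk] := sW_finite sg.
  pose h0 := iter k.-1 sW h.
  have hh0 : walls_at z h0 by rewrite /h0; elim: (k.-1) => //= j; apply: wS.
  have eh : sW h0 = h by rewrite /h0 -iterS (prednK k0) hk //; apply: (T_sub_D rg); case: hh.
  have [c c0 e] := wall_sigma rg sg (wT _ hh0).
  have -> : act (sW r) x0 = sA (act r x0) by rewrite (sA_act sg) (sA_x0 sg).
  have -> : x1 = sA x1 by rewrite Px1.
  by rewrite -eh !e mulrACA -expr2 pmulr_rgt0 ?exprn_even_gt0 //; apply: hc.
(* Both [r] and [sW r] bring [x0] into the local cell of [x1]; freeness at [z] identifies them. *)
have sr : sW r = r.
  have : (r^-1 * sW r)%g = 1%g.
    apply: (walls_at_free rg (p := z) (y := x0)).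
      by apply: gen_mul hsr; apply: (gen_inv rg wT).
    rewrite (rg_actM rg) -[x in cell _ x](act_invK rg r).
    apply: (cell_act rg wT); last by apply: cell_trans hcs; apply: cell_sym.
    by apply: (gen_conj_closed rg wT (walls_at_conj_closed rg (p := z))); apply: (gen_inv rg wT).
  by move/(congr1 (fun x => r * x)%g); rewrite mulKVg mulg1.
have rs : rel_simple_at t z r.
  split=> //.
    move=> r1; have hzt : walls_at z t by split.
    have := hc t hzt; rewrite r1 (rg_act1 rg) f1 // mulNr oppr_gt0 -expr2.
    by rewrite ltNge sqr_ge0.
  split=> //; first by move=> t' ht' fz'; have [] := hz t' ht' fz'.
  move=> p Pp fp; apply: (walls_at_fix rg).
  apply: gen_sub hr => h [hh h0]; split=> //.
  by have [_ tr] := hz h hh h0; apply/(tr p Pp).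
exists r; split; first by exists t, z.
move=> t' ht' /(rel_simple_sep rs ht') h0.
by have [] := hz t' ht' h0.
Qed.

Lemma rel_simple_D s : rel_simple s -> D s.
Proof. by move=> [t [z []]]. Qed.
Lemma rel_simple_sW s : rel_simple s -> sW s = s.
Proof. by move=> [t [z []]]. Qed.
Lemma rel_simple_invol s : rel_simple s -> (s * s = 1)%g.
Proof.
move=> [t [z h]]; have [_ _ _ ht [_ fz _ _ _]] := h.
exact: rel_refl_invol (rel_simple_at_refl h ht fz).
Qed.
Lemma rel_simple_V s : rel_simple s -> (s^-1 = s)%g.
Proof. by move=> /rel_simple_invol/(congr1 (fun x => s^-1 * x)%g); rewrite mulKg mulg1. Qed.

(** One wall shared by [s] and [w] puts all walls of [s] among those of [w], so none is crossed
    twice when [w] is read as [s] followed by [s * w]. *)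
Lemma rel_simple_ell s w : rel_simple s -> D w -> sW w = w ->
  (exists t, [/\ T t, sep t x0 (act s x0) & sep t x0 (act w x0)]) ->
  ell w = (ell s + ell (s * w)%g)%N.
Proof.
move=> hs Dw sw [t [ht h1 h2]].
have e : (s * (s * w))%g = w by rewrite mulgA rel_simple_invol // mul1g.
rewrite -{1}e; apply/ellM_add => t' ht' h3; rewrite e.
have h4 := rel_simple_class hs Dw sw ht ht' h1 h3 h2.
by move: h4 => /(sep_trans ht' (x0_reg rg) (reg_act_x0 rg s) (reg_act_x0 rg w)) [] [].
Qed.

Definition words (l : seq W) := forall s, s \in l -> rel_simple s.

Lemma words_cons s l : words (s :: l) <-> rel_simple s /\ words l.
Proof.
split=> [h|[h1 h2] a]; last by rewrite in_cons => /orP[/eqP->|/h2].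
by split=> [|a ha]; apply: h; rewrite in_cons ?eqxx ?ha ?orbT.
Qed.

Lemma words_prod l : words l -> D (\prod_(s <- l) s)%g /\ sW (\prod_(s <- l) s)%g = (\prod_(s <- l) s)%g.
Proof.
elim: l => [_|a l ih /words_cons[ha /ih [hd hs]]].
  by rewrite big_nil; split; [exact: (D_one rg)|exact: (sW_1 rg sg)].
have Da := rel_simple_D ha; rewrite big_cons; split; first exact: (D_mul rg).
by rewrite (sW_mul sg) // hs (rel_simple_sW ha).
Qed.

(** Follow the word until [t] is crossed. If the first letter crosses it, that letter is [s] by
    uniqueness; otherwise conjugate [t] and [s] by the letter and continue with the tail. *)
Lemma rel_exchange l t s : words l -> rel_refl t s ->
  sep t x0 (act (\prod_(a <- l) a)%g x0) ->
  exists l', [/\ words l', (size l').+1 = size l & (\prod_(a <- l') a = s * \prod_(a <- l) a)%g].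
Proof.
elim: l t s => [|a l ih] t s hl hr.
  by rewrite big_nil (rg_act1 rg) /separates -expr2 ltNge sqr_ge0.
have /words_cons[ha hl'] := hl; have Da := rel_simple_D ha; have sa := rel_simple_sW ha.
have [Ds ss [s1 ht _ _]] := hr.
rewrite big_cons; set w := (\prod_(j <- l) j)%g => hs.
have [h|h] := pselect (sep t x0 (act a x0)).
  have [t1 [z hz]] := ha; have h0 := proj1 (rel_simple_sep hz ht) h.
  have e := rel_refl_unique hr (rel_simple_at_refl hz ht h0).
  exists l; split=> //; rewrite -/w e mulgA.
  by rewrite (rel_simple_invol ha) mul1g.
have hs' : sep (a^-1 * t * a)%g x0 (act w x0).
  apply/(sep_conjV rg _ _ _ ht); rewrite -(rg_actM rg).
  by case/(sep_trans ht (x0_reg rg) (reg_act_x0 rg a) (reg_act_x0 rg (a * w)%g)): hs => -[].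
have [l' [wl' sl' pl']] := ih _ _ hl' (rel_refl_conj hr Da sa) hs'.
exists (a :: l'); split; first by apply/words_cons.
  by rewrite /= sl'.
by rewrite big_cons pl' -/w !mulgA mulgV mul1g.
Qed.

(** If the first letter and the product of the tail cross a common wall in the relevant sense,
    exchange shortens the word; otherwise absolute lengths add. Words of minimal relative length
    therefore have additive absolute length. *)
Lemma rel_word_ell l : words l -> ell (\prod_(s <- l) s)%g = (\sum_(s <- l) ell s)%N \/
  exists l', [/\ words l', (size l' < size l)%N & (\prod_(a <- l') a = \prod_(a <- l) a)%g].
Proof.
elim: l => [_|s l ih hl]; first by left; rewrite !big_nil (ell1 rg).
have /words_cons[hs hl'] := hl; rewrite !big_cons; set w := (\prod_(j <- l) j)%g.
have [e|[l' [h1 h2 h3]]] := ih hl'; last first.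
  right; exists (s :: l'); split; [exact/words_cons|by rewrite /=|by rewrite big_cons h3].
have [Dw sw] := words_prod hl'.
have [h|h] := pselect (exists t, [/\ T t, sep t x0 (act s x0) & sep t x0 (act w x0)]).
  right; have [t [ht h1 h2]] := h; have [t1 [z hz]] := hs.
  have h0 := proj1 (rel_simple_sep hz ht) h1.
  have [l' [w' s' p']] := rel_exchange hl' (rel_simple_at_refl hz ht h0) h2.
  by exists l'; split=> //=; rewrite -s'; apply: ltnW.
left; rewrite -e; apply/ellM_add => t ht h1 h2; apply: h.
exists (s^-1 * t * s)%g; split.
- by rewrite -{2}[s]invgK; apply: (T_conj rg).
- apply/(sep_conjV rg _ _ _ ht); rewrite -(rg_actM rg) rel_simple_invol //.
  by rewrite (rg_act1 rg) sep_sym.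
- by apply/(sep_conjV rg _ _ _ ht); rewrite -(rg_actM rg).
Qed.
End RelativeLengths.

(** * Length-preserving automorphisms *)

Section DiagramAutomorphisms.
Variables (R : realType) (V : lmodType R) (W : groupType).
Variables (ip : V -> V -> R) (act lin : W -> V -> V) (T D : set W).
Variables (nrm : W -> V) (off : W -> R) (x0 : V).
Hypothesis rg : reflection_group ip act lin T D nrm off x0.
Notation f := (wall_form ip nrm off).
Notation sep := (separates ip nrm off).
Notation reg := (regular ip T nrm off).
Notation cell := (cell ip nrm off).
Notation ell := (ell rg).
Local Notation ipE := (ipE rg).

(** Nothing is asked about an action on [V]: compatibility with reflections and walls is deduced
    from lengths in [al_T] and [al_sep]. *)
Record diagram_aut (alpha : W -> W) : Prop := DiagramAut {
  al_D : forall w, D w -> D (alpha w);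
  al_mul : forall w w', D w -> D w' -> alpha (w * w')%g = (alpha w * alpha w')%g;
  al_ell : forall w, D w -> ell (alpha w) = ell w;
  al_finite : exists2 k, (0 < k)%N & forall w, D w -> iter k alpha w = w
}.

Section OneAutomorphism.
Variable alpha : W -> W.
Hypothesis al : diagram_aut alpha.

Lemma al_iterD i w : D w -> D (iter i alpha w).
Proof. by elim: i => //= i ih /ih; apply: (al_D al). Qed.

Lemma al_1 : alpha 1%g = 1%g.
Proof.
have := al_mul al (D_one rg) (D_one rg); rewrite mulg1 => e.
by apply: (mulgI (alpha 1%g)); rewrite -e mulg1.
Qed.

Lemma al_V w : D w -> alpha (w^-1)%g = (alpha w)^-1%g.
Proof.
move=> hw; apply: (mulgI (alpha w)); rewrite -(al_mul al) ?mulgV ?al_1 //.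
exact: (D_inv rg).
Qed.

Lemma al_inj a b : D a -> D b -> alpha a = alpha b -> a = b.
Proof.
move=> ha hb e; have [k k0 hk] := al_finite al.
by rewrite -(hk a ha) -(hk b hb) -(prednK k0) !iterSr e.
Qed.

Lemma al_surj a : D a -> exists2 b, D b & alpha b = a.
Proof.
move=> ha; have [k k0 hk] := al_finite al.
by exists (iter k.-1 alpha a); [apply: al_iterD|rewrite -iterS (prednK k0) hk].
Qed.

Lemma al_iter_mul i w w' : D w -> D w' -> iter i alpha (w * w')%g = (iter i alpha w * iter i alpha w')%g.
Proof. by move=> hw hw'; elim: i => //= i ->; rewrite (al_mul al) //; apply: al_iterD. Qed.

Lemma al_iter_ell i w : D w -> ell (iter i alpha w) = ell w.
Proof. by move=> hw; elim: i => //= i <-; rewrite (al_ell al) //; apply: al_iterD. Qed.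

Variables (sW : W -> W) (sA sC : V -> V).
Hypothesis sg : equivariant ip act T D x0 sW sA sC.
Notation rel_simple := (rel_simple ip act T D nrm off x0 sW sA).
Notation words := (words ip act T D nrm off x0 sW sA).
Hypothesis al_sW : forall w, D w -> alpha (sW w) = sW (alpha w).

(* Relative simple reflections are the elements of the fixed subgroup that are indecomposable for [ell]. *)
Lemma rel_simple_al s : rel_simple s -> rel_simple (alpha s).
Proof.
move=> hs; have Ds := rel_simple_D hs; have ss := rel_simple_sW hs.
have Das := al_D al Ds; have sas : sW (alpha s) = alpha s by rewrite -al_sW // ss.
have s1 : s <> 1%g by move: hs => [t [z []]].
have as1 : alpha s <> 1%g by rewrite -al_1 => /(al_inj Ds (D_one rg)).
have [s' [hs' sub]] := rel_simple_ex rg sg Das sas as1.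
have Ds' := rel_simple_D hs'; have ss' := rel_simple_sW hs'.
have [a Da ea] := al_surj Ds'.
have sa : sW a = a.
  by apply: al_inj => //; [exact: (sW_D rg sg)|rewrite al_sW // ea ss'].
suff e : a = s by rewrite -e ea.
have [t1 [z1 h1]] := hs'; have [_ _ _ ht1 [_ fz1 _ _ _]] := h1.
have hsep1 := proj2 (rel_simple_sep rg sg h1 ht1) fz1.
have add1 := rel_simple_ell rg sg hs' Das sas (ex_intro _ t1 (And3 ht1 hsep1 (sub t1 ht1 hsep1))).
have add : ell s = (ell a + ell (a^-1 * s))%N.
  have DaV := D_inv rg Da.
  rewrite -(al_ell al Ds) add1 -ea (al_ell al Da); congr (_ + _)%N.
  have -> : alpha a = alpha a^-1%g by rewrite al_V // ea (rel_simple_V rg sg hs').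
  rewrite -(al_mul al) // (al_ell al) //.
  exact: (D_mul rg).
have hN t : T t -> sep t x0 (act a x0) -> sep t x0 (act s x0).
  move=> ht h; have := proj1 (ellM_add rg a (a^-1 * s)%g); rewrite mulKVg => /(_ add t ht h) h'.
  by apply/(sep_trans ht (x0_reg rg) (reg_act_x0 rg a) (reg_act_x0 rg s)); left.
have a1 : a <> 1%g.
  by move=> a1; have [_ _ + _ _] := h1; rewrite -ea a1 al_1.
have [s2 [hs2 sub2]] := rel_simple_ex rg sg Da sa a1.
have [t2 [z2 h2]] := hs2; have [_ _ _ ht2 [_ fz2 _ _ _]] := h2.
have hsep2 := sub2 t2 ht2 (proj2 (rel_simple_sep rg sg h2 ht2) fz2).
(* The walls crossed by the relative simple [s] form one class, and [a] crosses one of them, hence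
   all. *)
have hN' t : T t -> sep t x0 (act s x0) -> sep t x0 (act a x0).
  by move=> ht h; apply: (rel_simple_class rg sg hs Da sa ht2 ht (hN _ ht2 hsep2) h hsep2).
apply: (mulgI a^-1%g); rewrite mulVg; apply/esym.
apply: (D_free_cell rg (y := x0)); first by apply: (D_mul rg) => //; apply: (D_inv rg).
rewrite -[x in cell _ x](act_invK rg a) (rg_actM rg).
apply: (cell_actT rg); apply: nsep_cell; try exact (reg_act_x0 rg _).
move=> t ht h.
have := sep_trans ht (x0_reg rg) (reg_act_x0 rg a) (reg_act_x0 rg s).
have := hN t ht; have := hN' t ht; tauto.
Qed.

Lemma rel_simple_iter i s : rel_simple s -> rel_simple (iter i alpha s).
Proof. by elim: i => //= i ih /ih; apply: rel_simple_al. Qed.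

Definition min_word w k := (exists l, [/\ words l, size l = k & (\prod_(a <- l) a = w)%g]) /\
  forall l, words l -> (\prod_(a <- l) a = w)%g -> (k <= size l)%N.

Lemma min_word_ell w k l : min_word w k -> words l -> size l = k -> (\prod_(a <- l) a = w)%g ->
  ell w = (\sum_(a <- l) ell a)%N.
Proof.
move=> [_ hm] wl sl pl; rewrite -pl; case: (rel_word_ell rg sg wl) => // -[l' [w' s' p']].
have := hm l' w'; rewrite p' pl => /(_ erefl); rewrite -sl.
by move=> /(leq_trans s'); rewrite ltnn.
Qed.

Definition twisted_power u n := (\prod_(i < n) iter i alpha u)%g.

Lemma twisted_powerS u n : twisted_power u n.+1 = (twisted_power u n * iter n alpha u)%g.
Proof. by rewrite /twisted_power big_ord_recr. Qed.

(** Concatenating the twisted copies of a minimal word for [u] gives a word of size [n * k], minimal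
    by hypothesis, and minimal words have additive [ell]. This transfers straightness from relative
    to absolute lengths. *)
Lemma min_word_power u k : min_word u k -> (forall n, min_word (twisted_power u n) (n * k)) ->
  forall n, ell (twisted_power u n) = (n * ell u)%N.
Proof.
move=> hu hn n; have [[l [wl sl pl]] _] := hu.
have el := min_word_ell hu wl sl pl.
have Dl a : a \in l -> D a by move=> /wl/rel_simple_D.
have w_i i : words (map (iter i alpha) l).
  by move=> a /mapP[b /wl hb ->]; apply: rel_simple_iter.
have p_i i : (\prod_(a <- map (iter i alpha) l) a = iter i alpha u)%g.
  rewrite -pl; elim: (l) Dl => [_|a l' ih Dl'].
    by rewrite !big_nil; elim: i {w_i} => //= i <-; rewrite al_1.
  have hl' b : b \in l' -> D b by move=> hb; apply: Dl'; rewrite in_cons hb orbT.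
  rewrite /= !big_cons ih // al_iter_mul //; first by apply: Dl'; rewrite mem_head.
  by elim: (l') hl' => [_|b m ihm hm]; rewrite ?big_nil ?big_cons; [exact: (D_one rg)|];
    apply: (D_mul rg); [apply: hm; rewrite mem_head|apply: ihm => c hc; apply: hm; rewrite in_cons hc orbT].
have [L [wL sL pL eL]] : exists L, [/\ words L, size L = (n * k)%N,
    (\prod_(a <- L) a = twisted_power u n)%g & (\sum_(a <- L) ell a = n * ell u)%N].
  elim: n => [|m [L [wL sL pL eL]]].
    by exists [::]; split=> //; rewrite ?big_nil // /twisted_power big_ord0.
  exists (L ++ map (iter m alpha) l); split.
  - by move=> s; rewrite mem_cat => /orP[/wL|/w_i].
  - by rewrite size_cat size_map sl sL mulSn addnC.
  - by rewrite big_cat /= pL p_i twisted_powerS.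
  rewrite big_cat /= eL big_map mulSn addnC; congr (_ + _)%N.
  by rewrite el big_seq [RHS]big_seq; apply: eq_bigr => a /Dl; apply: al_iter_ell.
by rewrite (min_word_ell (hn n) wL sL pL).
Qed.
End OneAutomorphism.

(** With trivial sigma, relative simple reflections are the ordinary ones, and exchange and word
    lengths specialize to them. *)
Lemma equivariant_id : equivariant ip act T D x0 id id id.
Proof. by split=> //; exists 1%N. Qed.

Notation simple := (rel_simple ip act T D nrm off x0 id id).

(** For trivial sigma the reflection [t] is itself a relative reflection for its own wall, so
    uniqueness identifies it with [s]. *)
Lemma simple_T s : simple s -> T s.
Proof.
move=> [t [z h]]; have [Ds ss s1 ht [Pz fz _ _ _]] := h.
have h1 := rel_simple_at_refl h ht fz.
suff h2 : rel_refl ip act T D nrm off id id t t by rewrite (rel_refl_unique rg equivariant_id h1 h2).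
split; [exact: (T_sub_D rg)|by []|split=> //].
- move=> t1; have := wall_refl rg x0 ht; rewrite t1 (rg_act1 rg) => e.
  have e0 : f 1%g x0 = 0 by lra.
  by have := x0_regular rg ht; rewrite t1 e0 eqxx.
- by exists z.
- by move=> p _ fp; apply: (act_fix rg).
Qed.

Lemma simple_sep s t : simple s -> T t -> sep t x0 (act s x0) -> t = s.
Proof.
move=> hs ht h; have Ts := simple_T hs; have [t' [z h']] := hs.
have [_ _ _ ht' [_ fz tr _ _]] := h'.
have h0 := proj1 (rel_simple_sep rg equivariant_id h' ht) h.
have e1 : t' = t by apply: (wall_zeros rg) => // x hx; apply/(tr t ht h0 x erefl).
have hs' : sep s x0 (act s x0).
  by rewrite /separates (wall_refl rg) // mulrN oppr_lt0 -expr2 exprn_even_gt0 // (x0_regular rg).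
have h1 := proj1 (rel_simple_sep rg equivariant_id h' Ts) hs'.
have e2 : t' = s by apply: (wall_zeros rg) => // x hx; apply/(tr s Ts h1 x erefl).
by rewrite -e1.
Qed.

Lemma simple_ell s : simple s -> ell s = 1%N.
Proof.
move=> hs; have Ts := simple_T hs; apply/eqP.
have hs' : sep s x0 (act s x0).
  by rewrite /separates (wall_refl rg) // mulrN oppr_lt0 -expr2 exprn_even_gt0 // (x0_regular rg).
rewrite eqn_leq; apply/andP; split.
  apply: (@uniq_leq_size _ _ [:: s]); first exact: separators_uniq.
  by move=> t /mem_separators[ht h]; rewrite inE (simple_sep hs ht h).
by rewrite lt0n; apply/eqP => /(ell0 (rel_simple_D hs)); move: hs => [t [z []]].
Qed.

Lemma exists_simple w : D w -> w <> 1%g -> exists s, [/\ simple s, sep s x0 (act w x0) & ell w = (ell (s * w)%g).+1].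
Proof.
move=> Dw w1; have [s [hs sub]] := rel_simple_ex rg equivariant_id Dw erefl w1.
have Ts := simple_T hs.
have hs' : sep s x0 (act s x0).
  by rewrite /separates (wall_refl rg) // mulrN oppr_lt0 -expr2 exprn_even_gt0 // (x0_regular rg).
exists s; split=> //; first exact: sub.
rewrite (rel_simple_ell rg equivariant_id hs Dw erefl) ?(simple_ell hs) ?add1n //.
by exists s; split; [exact: Ts|exact: hs'|exact: (sub s Ts hs')].
Qed.

Lemma simple_word w : D w -> exists l, [/\ (forall s, s \in l -> simple s), size l = ell w & (\prod_(a <- l) a = w)%g].
Proof.
move e : (ell w) => k; elim: k w e => [|k ih] w e Dw.
  by exists [::]; rewrite big_nil; split=> //; rewrite (ell0 Dw e).
have w1 : w <> 1%g by move=> w1; move: e; rewrite w1 ell1.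
have [s [hs _ e']] := exists_simple Dw w1.
have Dsw : D (s * w)%g by apply: (D_mul rg) => //; apply: rel_simple_D hs.
have [|l [hl sl pl]] := ih (s * w)%g _ Dsw; first by move: e; rewrite e' => -[].
exists (s :: l); split; last first.
- by rewrite big_cons pl mulgA (T_invol rg (simple_T hs)) mul1g.
- by rewrite /= sl.
by move=> a; rewrite in_cons => /orP[/eqP->|/hl].
Qed.

Lemma word_ell_le l : (forall s, s \in l -> simple s) -> (ell (\prod_(a <- l) a)%g <= size l)%N.
Proof.
elim: l => [|s l ih] h; first by rewrite big_nil ell1.
rewrite big_cons; apply: leq_trans (ellM_le rg _ _) _.
rewrite simple_ell ?add1n; last by apply: h; rewrite mem_head.
by rewrite /= ltnS; apply: ih => a ha; apply: h; rewrite in_cons ha orbT.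
Qed.

Lemma simple_of_sep t : T t -> (forall h, T h -> sep h x0 (act t x0) -> h = t) -> simple t.
Proof.
move=> ht h; have t1 : t <> 1%g.
  move=> t1; have := wall_refl rg x0 ht; rewrite {2}t1 (rg_act1 rg) => e.
  have e0 : f t x0 = 0 by lra.
  by have := x0_regular rg ht; rewrite e0 eqxx.
have [s [hs hsep _]] := exists_simple (T_sub_D rg ht) t1.
by rewrite -(h s (simple_T hs) hsep).
Qed.

(** From a point on the wall of [t] and on no other wall, step off along the normal: the chamber
    reached is adjacent to its mirror image. Moving it to the chamber of [x0] turns [t] into a
    reflection that crosses no wall but its own. *)
Lemma reflection_conj_simple t : T t -> exists r s, [/\ D r, simple s & t = (r * s * r^-1)%g].
Proof.
move=> ht.
pose P : set V := [set x | f t x = 0].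
have Paff : affine_set P by move=> y z s; rewrite /P /= (faff rg) => -> ->; ring.
pose y0 := x0 - f t x0 *: nrm t.
have Py0 : P y0 by rewrite /P /= /y0 (wall_formD rg) !ipE (nrm_unit rg ht); ring.
have [e e0 he] := ball_signs rg y0.
have [l hl] := local_finite rg y0 0.
pose l' := [seq h <- l | `[< T h >] && (h != t)].
have [| |y [Py hy hg]] := generic_point rg (P := P) (l := l') (g := fun h x => f h x) Paff _ e0 Py0 _.
- by move=> h x z s; rewrite (faff rg).
- move=> h; rewrite mem_filter => /andP[/andP[/asboolP hh hne] _].
  apply: contrapT => n; move/eqP: hne; apply; apply/esym; apply: (wall_zeros rg) => // x fx.
  by apply/eqP; apply: contrapT => /negP fh; apply: n; exists x.
have hyt h : T h -> h <> t -> f h y != 0.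
  move=> hh hne; have [h0|h0] := eqVneq (f h y0) 0.
    apply: hg; rewrite mem_filter; apply/andP; split; first by apply/andP; split; [apply/asboolP|apply/eqP].
    by apply: hl => //; rewrite h0 oppr0 lexx.
  by have := he y hy h hh h0; apply: contraTneq => ->; rewrite mulr0 ltxx.
have [s s0 [h1 h2]] := near0_ex (near0_and (near_signs rg y (nrm t)) (near_signs rg y (- nrm t))).
pose z := y + s *: nrm t.
have ftz : f t z = s by rewrite /z (wall_formD rg) Py (ipZr rg) (nrm_unit rg ht); ring.
have tz : act t z = y + s *: (- nrm t).
  by rewrite (act_refl rg _ ht) ftz /z; apply: (ip_ext rg) => v; rewrite !ipE; ring.
have rz : reg z.
  move=> h hh; have [->|hne] := pselect (h = t); first by rewrite ftz gt_eqF.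
  by have := h1 h hh (hyt h hh hne); rewrite -/z; apply: contraTneq => ->; rewrite mulr0 ltxx.
have [r hr hc] := D_transitive rg (x0_reg rg) rz.
have ht' := T_conj rg r ht; pose t' := (r * t * r^-1)%g.
exists r^-1%g, t'; split; first exact: (D_inv rg).
  apply: simple_of_sep => // h hh hs.
  have c2 : cell T (act t' x0) (act r (act t z)).
    have -> : act r (act t z) = act t' (act r z) by rewrite /t' -!(rg_actM rg) mulgVK.
    exact: (cell_actT rg).
  have hs' : sep h (act r z) (act r (act t z)).
    have := cell_nsep hc hh; have := cell_nsep c2 hh; move=> n1 n2.
    have r1 : reg (act r z) by apply: (regular_act rg).
    have r2 : reg (act r (act t z)) by do 2 apply: (regular_act rg).
    have q1 := sep_trans hh (x0_reg rg) r1 (reg_act_x0 rg t').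
    have q2 := sep_trans hh r1 r2 (reg_act_x0 rg t').
    have q3 := sep_sym ip nrm off h (act t' x0) (act r (act t z)).
    tauto.
  move/(sep_conjV rg _ _ _ hh): hs'; set h' := (r^-1 * h * r)%g => hs'.
  have hh' : T h' by rewrite /h' -{2}[r]invgK; apply: (T_conj rg).
  have [e'|hne] := pselect (h' = t).
    by rewrite /t' -e' /h' !mulgA mulgV mul1g mulgK.
  have k1 := h1 h' hh' (hyt h' hh' hne); have k2 := h2 h' hh' (hyt h' hh' hne).
  move: hs'; rewrite /separates tz -/z in k1 k2 *.
  move: k1 k2; move: (f h' y) (f h' z) (f h' (y + s *: - nrm t)) => a b c k1 k2 k3.
  have := mulr_gt0 k1 k2; have -> : a * b * (a * c) = a ^+ 2 * (b * c) by ring.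
  by rewrite nmulr_lgt0 // ltNge sqr_ge0.
by rewrite /t' invgK !mulgA mulVg mul1g mulgVK.
Qed.

(** Every reflection is conjugate to a simple one, and simple reflections go to simple ones because
    lengths recognize them. *)
Lemma al_T alpha t : diagram_aut alpha -> T t -> T (alpha t).
Proof.
move=> al /reflection_conj_simple [r [s [Dr hs ->]]].
have Ds := rel_simple_D hs; have DV := D_inv rg Dr.
rewrite !(al_mul al) //; last exact: (D_mul rg).
rewrite (al_V al) //; apply: (T_conj rg); apply: simple_T.
by apply: (rel_simple_al al equivariant_id).
Qed.

(** When one chamber is that of [x0], separation is the length comparison of [sep_ell]; the general
    case follows after moving by [w^-1]. *)
Lemma al_sep alpha t w w' : diagram_aut alpha -> T t -> D w -> D w' ->
  sep (alpha t) (act (alpha w) x0) (act (alpha w') x0) <-> sep t (act w x0) (act w' x0).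
Proof.
move=> al.
have base u a : T u -> D a -> sep (alpha u) x0 (act (alpha a) x0) <-> sep u x0 (act a x0).
  move=> hu Da; have Du := T_sub_D rg hu; rewrite (sep_ell rg (alpha a) (al_T al hu)) (sep_ell rg a hu).
  by rewrite -(al_mul al) // !(al_ell al) //; apply: (D_mul rg).
move=> ht Dw Dw'; have DV := D_inv rg Dw; have Dt := T_sub_D rg ht.
have key a u b : T u -> sep u (act a x0) (act b x0) <-> sep (a^-1 * u * a)%g x0 (act (a^-1 * b)%g x0).
  move=> hu; rewrite -(sep_conjV rg a x0 _ hu) (rg_actM rg (a^-1)%g) .
  by rewrite (act_Kinv rg).
rewrite (key _ _ _ (al_T al ht)).
have ht' : T (w^-1 * t * w)%g by rewrite -{2}[w]invgK; apply: (T_conj rg).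
have := base _ _ ht' (D_mul rg DV Dw'); rewrite key // => <-.
by rewrite (al_mul al (D_mul rg DV Dt) Dw) (al_mul al DV Dt) (al_mul al DV Dw') (al_V al Dw).
Qed.
End DiagramAutomorphisms.

(** * Finite root systems and special vertices *)

Section Coroots.
Variables (R : realType) (V : lmodType R) (W : groupType).
Variables (ip : V -> V -> R) (act lin : W -> V -> V) (T D : set W).
Variables (nrm : W -> V) (off : W -> R) (x0 : V).
Hypothesis rg : reflection_group ip act lin T D nrm off x0.
Notation f := (wall_form ip nrm off).
Local Notation ipE := (ipE rg).

Lemma conj_normal w t : T t ->
  (nrm (w * t * w^-1)%g = lin w (nrm t) /\ forall x, f (w * t * w^-1)%g (act w x) = f t x) \/
  (nrm (w * t * w^-1)%g = - lin w (nrm t) /\ forall x, f (w * t * w^-1)%g (act w x) = - f t x).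
Proof.
move=> ht; have [s [s2 e h]] := wall_conj rg w ht.
have : (s == 1) || (s == -1) by rewrite -sqrf_eq1 s2.
case/orP=> /eqP es; rewrite es in e h.
  by left; split=> [|x]; rewrite ?e ?scale1r ?h ?mul1r.
by right; split=> [|x]; rewrite ?e ?scaleN1r ?h ?mulN1r.
Qed.

Lemma off_conj w t t' : T t -> T t' -> nrm t = nrm t' ->
  exists s : R, [/\ s = 1 \/ s = -1, nrm (w * t * w^-1)%g = nrm (w * t' * w^-1)%g,
    nrm (w * t * w^-1)%g = s *: lin w (nrm t) &
    off (w * t * w^-1)%g - off (w * t' * w^-1)%g = s * (off t - off t')].
Proof.
move=> ht ht' en.
have h1 := T_conj rg w ht; have h2 := T_conj rg w ht'.
have off_of u : off u = - f u 0 by rewrite /wall_form (ip0r rg); ring.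
have diff u u' x y : nrm u = nrm u' -> f u x - f u' x = f u y - f u' y.
  by rewrite /wall_form => ->; ring.
case: (conj_normal w ht) => -[n1 e1]; case: (conj_normal w ht') => -[n2 e2].
- exists 1; rewrite n1 n2 en scale1r; split; [by left|by []|by []|].
  have := diff _ _ 0 (act w 0) (etrans n1 (etrans (congr1 (lin w) en) (esym n2))).
  by rewrite e1 e2 !off_of; lra.
- by case: (nrm_opp rg h1 h2); rewrite n1 n2 en opprK.
- by case: (nrm_opp rg h1 h2); rewrite n1 n2 en.
exists (-1); rewrite n1 n2 en scaleN1r; split; [by right|by []|by []|].
have e : nrm (w * t * w^-1)%g = nrm (w * t' * w^-1)%g by rewrite n1 n2 en.
have := diff _ _ 0 (act w 0) e.
by rewrite e1 e2 !off_of; lra.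
Qed.

Lemma parallel_refl a b : T a -> T b -> nrm a = nrm b ->
  exists c, [/\ T c, nrm c = nrm a & off c = 2 * off a - off b].
Proof.
move=> ha hb e; exists (a * b * a^-1)%g; have hc := T_conj rg a hb.
have [s [s1 e1 e2 e3]] := off_conj a hb ha (esym e).
rewrite mulgK in e1 e3.
split=> //; move: e2; rewrite e1 -e (lin_refl rg _ ha) (nrm_unit rg ha) mulr1 => e2.
case: s1 => s1; subst s; last lra.
have : ip (nrm a) (nrm a) = -1.
  by rewrite {2}e2 !ipE (nrm_unit rg ha); ring.
by rewrite (nrm_unit rg ha); lra.
Qed.

Definition spacing t (d : R) := 0 < d /\
  forall c, (exists t', [/\ T t', nrm t' = nrm t & off t' = c]) <-> exists k : int, c = off t + k%:~R * d.

(** The offsets for one normal are discrete and stable under [2 * a - b], so the least gap [d] above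
    [off t] generates an arithmetic progression. Any further offset could be moved strictly between
    [off t] and [off t + d]. *)
Lemma spacing_ex t : T t -> exists d, spacing t d.
Proof.
move=> ht; pose O c := exists t', [/\ T t', nrm t' = nrm t & off t' = c].
have Orefl a b : O a -> O b -> O (2 * a - b).
  move=> [ta [h1 n1 <-]] [tb [h2 n2 <-]].
  have [|c [hc nc oc]] := parallel_refl h1 h2; first by rewrite n1 n2.
  by exists c; split=> //; rewrite nc n1.
have O0 : O (off t) by exists t.
have [t1 [ht1 n1 o1]] : exists t1, [/\ T t1, nrm t1 = nrm t & off t < off t1].
  have [t' [ht' n' o']] := off_infinite rg ht.
  case: (ltrgtP (off t') (off t)) => [lt|gt|e]; last by rewrite e eqxx in o'.
    have [|c [hc nc oc]] := parallel_refl ht ht'; first by [].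
    by exists c; split=> //; rewrite oc; lra.
  by exists t'.
have [l hl] := local_finite rg (off t *: nrm t) (off t1 - off t).
have fx t' : nrm t' = nrm t -> f t' (off t *: nrm t) = off t - off t'.
  by rewrite /wall_form => ->; rewrite !ipE (nrm_unit rg ht) mulr1.
pose l' := [seq t' <- l | `[< [/\ T t', nrm t' = nrm t & off t < off t'] >]].
have inl t' : T t' -> nrm t' = nrm t -> off t < off t' -> off t' <= off t1 -> t' \in l'.
  move=> h n a b; rewrite mem_filter; apply/andP; split; first by apply/asboolP.
  by apply: hl => //; rewrite fx //; apply/andP; split; lra.
have [t2 ht2 hmin] := min_in_seq off (inl t1 ht1 n1 o1 (lexx _)).
move: ht2; rewrite mem_filter => /andP[/asboolP [h2 n2 o2] _].
pose d := off t2 - off t.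
have d0 : 0 < d by rewrite subr_gt0.
have nob c : O c -> off t < c -> c < off t + d -> False.
  move=> [t' [h' n' <-]] a b; have [le|gt] := lerP (off t') (off t1).
    by have := hmin t' (inl _ h' n' a le); rewrite /d in b; lra.
  by have := hmin t1 (inl _ ht1 n1 o1 (lexx _)); rewrite /d in b; lra.
have O1 : O (off t + d) by exists t2; split=> //; rewrite /d; ring.
have Onat (k : nat) : O (off t + k%:R * d) /\ O (off t + k.+1%:R * d).
  elim: k => [|k [ih1 ih2]]; first by rewrite mul0r addr0 mul1r.
  split=> //; have := Orefl _ _ ih2 ih1.
  by rewrite -!natr1; congr O; ring.
have Oint (k : int) : O (off t + k%:~R * d).
  case: k => k; first by have [] := Onat k.
  have [_ h] := Onat k; have := Orefl _ _ O0 h.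
  by rewrite NegzE mulrNz -pmulrn; congr O; ring.
exists d; split=> // c; split; last by move=> [k ->]; apply: Oint.
move=> hc; pose k := Num.floor ((c - off t) / d); exists k.
have hk : k%:~R * d <= c - off t /\ c - off t < (k%:~R + 1) * d.
  have k1 : k%:~R <= (c - off t) / d := floor_le _.
  have k2 : (c - off t) / d < (k + 1)%:~R := floorD1_gt _.
  by rewrite -ler_pdivlMr // -ltr_pdivrMr // -[1](mulr1z 1) -intrD.
have tr (j : int) : O c -> O (c + 2 * j%:~R * d).
  move=> h; have := Orefl _ _ (Oint j) (Orefl _ _ O0 h).
  by congr O; ring.
pose r := c - off t - k%:~R * d.
have [r0|rpos] := eqVneq r 0; first by move: r0; rewrite /r; lra.
have r0 : 0 < r by rewrite lt_neqAle eq_sym rpos /=; case: hk => ? ?; rewrite /r; lra.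
have rd : r < d by case: hk => ? ?; rewrite /r; lra.
exfalso.
(* Two successive reflections shift by even multiples of [d] only, hence the parity split; an odd
   [k] takes one reflection instead. *)
have [j [hj|hj]] : exists j : int, k = 2 * j \/ k = 2 * j - 1.
  exists (((k + 1) %/ 2)%Z).
  have := divz_eq (k + 1) 2; have := modz_ge0 (k+1) (isT : (2 : int) != 0).
  have := ltz_pmod (k+1) (isT : 0 < (2 : int)).
  by move: ((k + 1) %/ 2)%Z ((k + 1) %% 2)%Z => a b; lia.
  have := tr (- j) hc; have ek : k%:~R = 2 * j%:~R :> R by rewrite hj intrM.
  move=> h; apply: (nob _ h); rewrite mulrNz; rewrite /r ek in r0 rd *; lra.
have ek : k%:~R = 2 * j%:~R - 1 :> R.
  by rewrite hj intrD mulrNz intrM.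
have := Orefl _ _ (Oint j) hc => h; apply: (nob _ h); rewrite /r ek in r0 rd *; lra.
Qed.
End Coroots.

Section CorootSystem.
Variables (R : realType) (V : lmodType R) (W : groupType).
Variables (ip : V -> V -> R) (act lin : W -> V -> V) (T D : set W).
Variables (nrm : W -> V) (off : W -> R) (x0 : V).
Hypothesis rg : reflection_group ip act lin T D nrm off x0.
Notation f := (wall_form ip nrm off).
Notation spacing := (spacing T nrm off).
Local Notation ipE := (ipE rg).

(** Up to the sign [s], the translation vector of the product of two neighbouring parallel
    reflections, so that coroots are translations in [D]. *)
Definition coroot (v : V) := exists t (d s : R),
  [/\ T t, spacing t d, s ^+ 2 = 1 & v = (s * (2 * d)) *: nrm t].

Lemma coroot_of t : T t -> exists2 d, spacing t d & coroot ((2 * d) *: nrm t).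
Proof.
move=> ht; have [d hd] := spacing_ex rg ht; exists d => //.
by exists t, d, 1; split=> //; rewrite ?expr1n ?mul1r.
Qed.

Lemma sgn_scale_neq0 (s d : R) : s ^+ 2 = 1 -> 0 < d -> s * (2 * d) != 0.
Proof.
move=> s2 d0; apply/eqP => e; have := congr1 (fun x => x ^+ 2) e.
rewrite exprMn s2 mul1r expr0n /= => /eqP; rewrite expf_eq0 mulf_eq0 pnatr_eq0 /=.
by rewrite gt_eqF.
Qed.

Lemma corootN v : coroot v -> coroot (- v).
Proof.
move=> [t [d [s [ht hd s2 ->]]]]; exists t, d, (- s); split=> //; first by rewrite sqrrN.
by rewrite mulNr scaleNr.
Qed.

Lemma coroot_ip t (d s : R) : T t -> s ^+ 2 = 1 ->
  ip ((s * (2 * d)) *: nrm t) ((s * (2 * d)) *: nrm t) = 4 * d ^+ 2.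
Proof.
move=> ht s2; rewrite !ipE (nrm_unit rg ht).
have -> : s * (2 * d) * (s * (2 * d) * 1) = s ^+ 2 * (4 * d ^+ 2) by ring.
by rewrite s2 mul1r.
Qed.

Lemma coroot_neq0 v : coroot v -> v != 0.
Proof.
move=> [t [d [s [ht [d0 _] s2 e]]]]; have := coroot_ip d ht s2; rewrite -e.
by have [->|//] := eqVneq v 0; rewrite (ip0l rg); nra.
Qed.

Lemma act_parallel a b x : T a -> T b -> nrm a = nrm b ->
  act (a * b)%g x = x + (2 * (off a - off b)) *: nrm a.
Proof.
move=> ha hb e; rewrite (rg_actM rg) (act_refl rg _ ha) (act_refl rg _ hb) -e.
rewrite (wall_formD rg) !ipE (nrm_unit rg ha) /wall_form -e.
by apply: (ip_ext rg) => z; rewrite !ipE; ring.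
Qed.

Lemma lin_translation w v : (forall x, act w x = x + v) -> forall x, lin w x = x.
Proof.
move=> h x; have := act_lin rg w x 0; rewrite !h subr0 => <-.
by rewrite add0r addrK.
Qed.

Lemma wall_translation w v t : (forall x, act w x = x + v) -> T t ->
  nrm (w * t * w^-1)%g = nrm t /\ off (w * t * w^-1)%g = off t + ip (nrm t) v.
Proof.
move=> hw ht; have lw := lin_translation hw.
have ht' := T_conj rg w ht.
case: (conj_normal rg w ht) => -[n e]; rewrite lw in n; last by case: (nrm_opp rg ht' ht).
split=> //; have := e 0; rewrite hw /wall_form n !ipE; lra.
Qed.

Lemma coroot_translation v : coroot v -> exists a b (c : R),
  [/\ T a, T b, nrm a = nrm b, (forall x, act (a * b)%g x = x + v) & c != 0 /\ v = c *: nrm a].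
Proof.
move=> [t [d [s [ht [d0 hd] s2 ->]]]].
have [t' [ht' n' o']] : exists t', [/\ T t', nrm t' = nrm t & off t' = off t + 1%:~R * d].
  by apply/hd; exists 1.
have : (s == 1) || (s == -1) by rewrite -sqrf_eq1 s2.
have d2 : 2 * d != 0 by rewrite mulf_neq0 ?pnatr_eq0 ?gt_eqF.
case/orP=> /eqP ->.
  exists t', t, (1 * (2 * d)); split=> // [x|]; last by rewrite n' mul1r.
  by rewrite act_parallel // n' o'; congr (_ + _ *: _); rewrite mul1r; ring.
exists t, t', (- 1 * (2 * d)); split=> // [x|]; last by rewrite mulN1r oppr_eq0.
by rewrite act_parallel // o'; congr (_ + _ *: _); rewrite mul1r; ring.
Qed.

(** Conjugation by the translation shifts the wall of [t] by [ip (nrm t) v], which must be a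
    multiple of the spacing. Applied to coroots, this is the integrality of Cartan numbers. *)
Lemma translation_spacing w v t (d : R) : (forall x, act w x = x + v) -> T t -> spacing t d ->
  exists k : int, ip (nrm t) v = k%:~R * d.
Proof.
move=> hw ht [d0 hd]; have [n o] := wall_translation hw ht.
have [k hk] : exists k : int, off (w * t * w^-1)%g = off t + k%:~R * d.
  by apply/hd; exists (w * t * w^-1)%g; split=> //; apply: (T_conj rg).
by exists k; lra.
Qed.

Lemma coroot_integral v g : coroot v -> coroot g -> exists k : int, 2 * ip v g = k%:~R * ip v v.
Proof.
move=> [t [d [s [ht hd s2 ev]]]] /coroot_translation [a [b [c [_ _ _ hab _]]]].
have [k hk] := translation_spacing hab ht hd.
have vv := coroot_ip d ht s2; rewrite -ev in vv.
have e : 2 * ip v g = (s * k%:~R) * ip v v by rewrite vv ev !ipE hk; ring.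
have : (s == 1) || (s == -1) by rewrite -sqrf_eq1 s2.
case/orP=> /eqP es; rewrite es in e; first by exists k; rewrite e mul1r.
by exists (- k); rewrite e mulN1r mulrNz.
Qed.

Lemma spacing_conj w t d : T t -> spacing t d -> spacing (w * t * w^-1)%g d.
Proof.
move=> ht [d0 hd]; split=> // c.
have ht1 := T_conj rg w ht.
have sgn (s : R) : s = 1 \/ s = -1 -> exists2 i : int, i%:~R = s & (i = 1 \/ i = -1).
  by case=> ->; [exists 1|exists (-1)]; auto.
split=> [[t' [ht' n' o']]|[k hk]].
  pose t2 := (w^-1 * t' * w)%g.
  have ht2 : T t2 by rewrite /t2 -{2}[w]invgK; apply: (T_conj rg).
  have et' : t' = (w * t2 * w^-1)%g by rewrite /t2 !mulgA mulgV mul1g mulgK.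
  have n2 : nrm t2 = nrm t.
    have [s [_ a _ _]] := off_conj rg w^-1%g ht' ht1 n'.
    by move: a; rewrite invgK -/t2 => ->; rewrite !mulgA mulVg mul1g mulgVK.
  have [s [/sgn[i ei _] _ _ o]] := off_conj rg w ht2 ht n2.
  have [k hk] : exists k : int, off t2 = off t + k%:~R * d by apply/hd; exists t2.
  exists (i * k); rewrite intrM ei -o' et'.
  by rewrite hk in o; rewrite -(subrK (off (w * t * w^-1)%g) (off (w * t2 * w^-1)%g)) o; ring.
have [s [/sgn[i ei hi] _ _ _]] := off_conj rg w ht ht erefl.
(* Conjugation may reverse the normal, in which case the offset for [- k] is the right one; both
   candidates are prepared. *)
have [t3 [ht3 n3 o3]] : exists t', [/\ T t', nrm t' = nrm t & off t' = off t + k%:~R * d].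
  by apply/hd; exists k.
have [t4 [ht4 n4 o4]] : exists t', [/\ T t', nrm t' = nrm t & off t' = off t + (- k)%:~R * d].
  by apply/hd; exists (- k).
have [s3 [h3 _ a3 b3]] := off_conj rg w ht3 ht n3.
have [s4 [h4 _ a4 b4]] := off_conj rg w ht4 ht n4.
case: h3 => e3.
  exists (w * t3 * w^-1)%g; split; first exact: (T_conj rg).
    by have [s' [_ -> _ _]] := off_conj rg w ht3 ht n3.
  by rewrite hk; move: b3; rewrite e3 o3; lra.
case: h4 => e4; last first.
  exists (w * t4 * w^-1)%g; split; first exact: (T_conj rg).
    by have [s' [_ -> _ _]] := off_conj rg w ht4 ht n4.
  by rewrite hk; move: b4; rewrite e4 o4 mulrNz; lra.
exfalso; apply: (nrm_opp rg (T_conj rg w ht3) (T_conj rg w ht4)).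
by rewrite a3 a4 e3 e4 n3 n4 scaleN1r scale1r.
Qed.

Lemma lin_id_refl t v c : T t -> c != 0 -> lin t v = v - (2 * ip (c *: nrm t) v / ip (c *: nrm t) (c *: nrm t)) *: (c *: nrm t).
Proof.
move=> ht c0; rewrite (lin_refl rg _ ht) scalerA; congr (_ - _ *: _).
by rewrite !ipE (nrm_unit rg ht); field.
Qed.

Lemma coroot_lin w v : coroot v -> coroot (lin w v).
Proof.
move=> [t [d [s [ht hd s2 ->]]]]; rewrite (linZ rg).
have hd' := spacing_conj w ht hd; have ht' := T_conj rg w ht.
case: (conj_normal rg w ht) => -[n _].
  by exists (w * t * w^-1)%g, d, s; split=> //; rewrite n.
exists (w * t * w^-1)%g, d, (- s); split=> //; first by rewrite sqrrN.
by rewrite n mulNr scaleNr scalerN opprK.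
Qed.

Lemma coroot_reflect v g : coroot v -> coroot g -> coroot (g - (2 * ip v g / ip v v) *: v).
Proof.
move=> hv hg; have [t [d [s [ht [d0 _] s2 e]]]] := hv.
have c0 : s * (2 * d) != 0.
  by rewrite sgn_scale_neq0.
by rewrite e -(lin_id_refl _ ht c0); apply: coroot_lin.
Qed.

Lemma spacing_unique t t' d d' : T t -> T t' -> nrm t = nrm t' -> spacing t d -> spacing t' d' -> d = d'.
Proof.
have le u u' e e' : T u -> T u' -> nrm u = nrm u' -> spacing u e -> spacing u' e' -> e <= e'.
  move=> hu hu' n [e0 he] [e0' he'].
  have [a ea] : exists k : int, off u = off u' + k%:~R * e' by apply/he'; exists u.
  have [u2 [hu2 n2 o2]] : exists t', [/\ T t', nrm t' = nrm u' & off t' = off u' + (a + 1)%:~R * e'].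
    by apply/he'; exists (a + 1).
  have [b eb] : exists k : int, off u2 = off u + k%:~R * e by apply/he; exists u2; rewrite n2 n.
  have e1 : e' = b%:~R * e by move: eb; rewrite o2 ea intrD; lra.
  have b0 : 0 < b by rewrite -(ltr0z R) -(pmulr_lgt0 _ e0) -e1.
  have b1 : 1 <= b%:~R :> R by rewrite ler1z -gtz0_ge1.
  by rewrite e1 ler_peMl // ltW.
by move=> ht ht' n h h'; apply/le_anti; rewrite (le t t' d d') // (le t' t d' d).
Qed.

Lemma coroot_finite : exists l : seq V, forall v, coroot v -> v \in l.
Proof.
have [L hL] := nrm_finite rg.
have one n : exists l : seq V, forall t (d s : R), T t -> nrm t = n -> spacing t d -> s ^+ 2 = 1 ->
    (s * (2 * d)) *: n \in l.
  have [[t [d [ht hn hd]]]|no] := pselect (exists t d, [/\ T t, nrm t = n & spacing t d]); last first.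
    by exists [::] => t d s ht hn hd; case: no; exists t, d.
  exists [:: (2 * d) *: n; (- (2 * d)) *: n] => t' d' s ht' hn' hd' s2.
  have -> : d' = d by apply: (spacing_unique ht' ht _ hd' hd); rewrite hn hn'.
  have : (s == 1) || (s == -1) by rewrite -sqrf_eq1 s2.
  by case/orP=> /eqP ->; rewrite !inE ?mul1r ?mulN1r eqxx ?orbT.
have [g hg] := boolp.choice one.
exists (flatten (map g L)) => v [t [d [s [ht hd s2 ->]]]]; apply/flatten_mapP.
by exists (nrm t); [apply: (hL t ht)|apply: (hg (nrm t) t d s)].
Qed.

(** Proportional coroots belong to parallel walls, and parallel walls have equal spacing. *)
Lemma coroot_reduced v g (c : R) : coroot v -> coroot g -> g = c *: v -> c ^+ 2 = 1.
Proof.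
move=> [t [d [s [ht hd s2 ev]]]] [t' [d' [s' [ht' hd' s2' eg]]]] e.
have vv := coroot_ip d ht s2; rewrite -ev in vv.
have gg := coroot_ip d' ht' s2'; rewrite -eg in gg.
have e2 : c ^+ 2 * (4 * d ^+ 2) = 4 * d' ^+ 2 by rewrite -vv -gg e !ipE; ring.
have [d0 _] := hd; have [d0' _] := hd'.
have p : 0 < 4 * d ^+ 2 by rewrite mulr_gt0 ?exprn_gt0.
have s0 : s' * (2 * d') != 0.
  by rewrite sgn_scale_neq0.
have en : nrm t' = (c * (s * (2 * d)) / (s' * (2 * d'))) *: nrm t.
  apply: (scalerI s0); rewrite -eg e ev !scalerA; congr (_ *: _).
  by rewrite [RHS]mulrC divfK.
set k := _ / _ in en.
have k2 : k ^+ 2 = 1.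
  by have := nrm_unit rg ht'; rewrite en !ipE (nrm_unit rg ht) mulr1 expr2.
have : (k == 1) || (k == -1) by rewrite -sqrf_eq1 k2.
case/orP=> /eqP ek; rewrite ek in en; last first.
  by move: en; rewrite scaleN1r => /(nrm_opp rg ht' ht).
rewrite scale1r in en; have ed := spacing_unique ht' ht en hd' hd.
by apply: (mulIf (lt0r_neq0 p)); rewrite e2 ed mul1r.
Qed.

End CorootSystem.

(** * Simple roots of a finite reduced root system *)

Section RootSystem.
Variables (R : realType) (V : lmodType R) (W : groupType).
Variables (ip : V -> V -> R) (act lin : W -> V -> V) (T D : set W).
Variables (nrm : W -> V) (off : W -> R) (x0 : V).
Hypothesis rg : reflection_group ip act lin T D nrm off x0.
Local Notation ipE := (ipE rg).

Lemma ip_suml (I : Type) (r : seq I) (P : pred I) (F : I -> V) y :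
  ip (\sum_(i <- r | P i) F i) y = \sum_(i <- r | P i) ip (F i) y.
Proof. by elim/big_rec2: _ => [|i a b _ <-]; rewrite !ipE. Qed.

Lemma ip_sumr (I : Type) (r : seq I) (P : pred I) (F : I -> V) y :
  ip y (\sum_(i <- r | P i) F i) = \sum_(i <- r | P i) ip y (F i).
Proof. by elim/big_rec2: _ => [|i a b _ <-]; rewrite !ipE. Qed.

Variables (Phi : set V) (rho : V).
Hypothesis Phi_finite : exists l : seq V, forall v, Phi v -> v \in l.
Hypothesis Phi_neq0 : forall v, Phi v -> v != 0.
Hypothesis PhiN : forall v, Phi v -> Phi (- v).
Hypothesis Phi_reflect : forall v g, Phi v -> Phi g -> Phi (g - (2 * ip v g / ip v v) *: v).
Hypothesis Phi_integral : forall v g, Phi v -> Phi g -> exists k : int, 2 * ip v g = k%:~R * ip v v.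
Hypothesis Phi_reduced : forall v g (c : R), Phi v -> Phi g -> g = c *: v -> c ^+ 2 = 1.
Hypothesis rho_regular : forall v, Phi v -> ip rho v != 0.

Definition pos_root v := Phi v /\ 0 < ip rho v.
Definition simple_root v := pos_root v /\
  forall a b, pos_root a -> pos_root b -> v <> a + b.

Lemma root_pos_or_neg v : Phi v -> pos_root v \/ pos_root (- v).
Proof.
move=> h; have := rho_regular h; case: (ltrgt0P (ip rho v)) => // p _; [left|right]; split=> //.
  exact: PhiN.
by rewrite (ipNr rg) oppr_gt0.
Qed.

Lemma simple_roots_ex : exists Del : seq V, uniq Del /\ forall v, v \in Del <-> simple_root v.
Proof.
have [l hl] := Phi_finite; exists (undup [seq v <- l | `[< simple_root v >]]).
split=> [|v]; first exact: undup_uniq.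
rewrite mem_undup mem_filter; split=> [/andP[/asboolP //]|h].
by apply/andP; split; [apply/asboolP|apply: hl; have [[]] := h].
Qed.

(* Induction on the height [ip rho v], which takes finitely many values on [Phi]. *)
Lemma pos_root_ind (P : V -> Prop) :
  (forall v, pos_root v -> (forall w, pos_root w -> ip rho w < ip rho v -> P w) -> P v) ->
  forall v, pos_root v -> P v.
Proof.
move=> h; have [l hl] := Phi_finite.
pose m v := count (fun w => ip rho w < ip rho v) l.
suff: forall k v, (m v < k)%N -> pos_root v -> P v by move=> H v; apply: (H (m v).+1).
elim=> // k ih v; rewrite ltnS => mk pv; apply: h => // w pw lt.
apply: ih => //; apply: leq_trans mk.
have lw : w \in l by apply: hl; case: pw.
rewrite /m; elim: l lw {hl m} => // a l ihl; rewrite in_cons => /orP[/eqP <-|/ihl {}ihl] /=.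
  rewrite lt ltxx add0n add1n ltnS; apply: sub_count => z /= hz; exact: lt_trans lt.
rewrite -addnS; apply: leq_add => //.
by case: (ltP (ip rho a) (ip rho w)) => // hz; rewrite (lt_trans hz lt).
Qed.

Variable Del : seq V.
Hypothesis Del_uniq : uniq Del.
Hypothesis DelP : forall v, v \in Del <-> simple_root v.

Lemma pos_root_sum v : pos_root v -> exists n : V -> nat, v = \sum_(a <- Del) (n a)%:R *: a.
Proof.
move: v; apply: pos_root_ind => v pv ih.
have [sv|nsv] := pselect (simple_root v).
  exists (fun a => (a == v : nat)); have vD := proj2 (DelP v) sv.
  rewrite (bigD1_seq v) //= eqxx scale1r big1 ?addr0 // => a /negPf ->.
  by rewrite scale0r.
have [a [b [pa pb e]]] : exists a b, [/\ pos_root a, pos_root b & v = a + b].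
  apply: contrapT => no; apply: nsv; split=> // a b pa pb e; apply: no.
  by exists a, b.
have [_ a0] := pa; have [_ b0] := pb.
have [n hn] := ih a pa ltac:(rewrite e (ipDr rg); lra).
have [n' hn'] := ih b pb ltac:(rewrite e (ipDr rg); lra).
exists (fun x => (n x + n' x)%N); rewrite e {1}hn {1}hn' -big_split /=.
by apply: eq_bigr => x _; rewrite natrD scalerDl.
Qed.

(** If the product were positive, both Cartan integers would be positive, and by strict
    Cauchy-Schwarz not both at least 2. One of them is 1, so a reflection makes the difference of
    [a] and [b] a root, and one of the two decomposes. *)
Lemma simple_obtuse a b : simple_root a -> simple_root b -> a <> b -> ip a b <= 0.
Proof.
move=> sa sb ne; rewrite leNgt; apply/negP => p.
have [[Pa ra] ia] := sa; have [[Pb rb] ib] := sb.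
have aa := ip_gt0 rg (Phi_neq0 Pa); have bb := ip_gt0 rg (Phi_neq0 Pb).
have [k hk] := Phi_integral Pa Pb; have [k' hk'] := Phi_integral Pb Pa.
rewrite (ipC rg b a) in hk'.
have kp : 0 < k by rewrite -(ltr0z R) -(pmulr_lgt0 _ aa) -hk mulr_gt0.
have kp' : 0 < k' by rewrite -(ltr0z R) -(pmulr_lgt0 _ bb) -hk' mulr_gt0.
have strict : ip a b ^+ 2 < ip a a * ip b b.
  have nz : b - (ip a b / ip a a) *: a != 0.
    rewrite subr_eq0; apply/eqP => e.
    have c2 := Phi_reduced Pa Pb e.
    have c0 : 0 < ip a b / ip a a by rewrite divr_gt0.
    have c1 : ip a b / ip a a = 1 by nra.
    by apply: ne; rewrite e c1 scale1r.
  have := ip_gt0 rg nz; rewrite !ipE (ipC rg b a) => h.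
  have : 0 < ip a a * (ip b b - ip a b / ip a a * ip a b).
    rewrite mulr_gt0 //; apply: lt_le_trans h _.
    have e : ip a b / ip a a * ip a a = ip a b by rewrite divfK // gt_eqF.
    by nra.
  have e : ip a a * (ip a b / ip a a * ip a b) = ip a b ^+ 2 by field; rewrite gt_eqF.
  by rewrite mulrBr e subr_gt0.
have key u w (j : int) : simple_root u -> simple_root w -> j = 1 -> 2 * ip u w = j%:~R * ip u u -> False.
  move=> [[Pu ru] iu] [[Pw rw] iw] -> e.
  have hP := Phi_reflect Pu Pw.
  have uu := ip_gt0 rg (Phi_neq0 Pu).
  rewrite e mul1r divff ?gt_eqF // scale1r in hP.
  case: (root_pos_or_neg hP) => hp.
    by apply: (iw u (w - u)) => //; rewrite addrC subrK.
  by apply: (iu w (- (w - u))) => //; rewrite opprB addrC subrK.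
have k1 : 1 <= k%:~R :> R by rewrite ler1z -gtz0_ge1.
have k1' : 1 <= k'%:~R :> R by rewrite ler1z -gtz0_ge1.
have [e|n1] := eqVneq k 1; first exact: (key a b k sa sb e hk).
have [e|n2] := eqVneq k' 1; first by apply: (key b a k' sb sa e); rewrite (ipC rg b a).
have k2 : 2 <= k%:~R :> R by rewrite (ler_int R 2); lia.
have k2' : 2 <= k'%:~R :> R by rewrite (ler_int R 2); lia.
have q1 : ip a a <= ip a b by nra.
have q2 : ip b b <= ip a b by nra.
by have := ler_pM (ltW aa) (ltW bb) q1 q2; rewrite -expr2 leNgt strict.
Qed.

(** Separate positive and negative coefficients. The two sums are equal, and their inner product is
    at most 0 by obtuseness, so both vanish; pairing with [rho] then kills each coefficient. *)
Lemma simple_independent (c : V -> R) :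
  \sum_(a <- Del) c a *: a = 0 -> forall a, a \in Del -> c a = 0.
Proof.
move=> h.
pose p a := Num.max (c a) 0; pose q a := Num.max (- c a) 0.
have p0 a : 0 <= p a by rewrite le_max lexx orbT.
have q0 a : 0 <= q a by rewrite le_max lexx orbT.
have pq a : c a = p a - q a by rewrite /p /q; case: (lerP (c a) 0); case: (lerP (- c a) 0); lra.
have pq0 a : p a * q a = 0 by rewrite /p /q; case: (lerP (c a) 0); case: (lerP (- c a) 0) => *; nra.
pose u := \sum_(a <- Del) p a *: a.
have uq : u = \sum_(a <- Del) q a *: a.
  have e : u - \sum_(a <- Del) q a *: a = \sum_(a <- Del) c a *: a.
    by rewrite /u -sumrB; apply: eq_bigr => a _; rewrite pq scalerBl.
  by apply/eqP; rewrite -subr_eq0 e h.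
have u0 : u = 0.
  apply: (ip_eq0 rg); apply/le_anti/andP; split; last exact: ip_ge0 rg _.
  rewrite {2}uq /u ip_suml big_seq sumr_le0 // => a ha.
  rewrite ip_sumr big_seq sumr_le0 // => b hb.
  rewrite (ipZl rg) (ipZr rg); have [->|ne] := pselect (a = b).
    by have -> : p b * (q b * ip b b) = (p b * q b) * ip b b by [ring]; rewrite pq0 mul0r.
  have := simple_obtuse (proj1 (DelP a) ha) (proj1 (DelP b) hb) ne.
  by have := p0 a; have := q0 b => ? ? ?; rewrite mulrA mulr_ge0_le0 // mulr_ge0.
have zero (g : V -> R) : (forall a, 0 <= g a) -> \sum_(a <- Del) g a *: a = 0 -> forall a, a \in Del -> g a = 0.
  move=> g0 e a ha; have := congr1 (ip rho) e; rewrite ip_sumr (ip0r rg) => s0.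
  have pos b : b \in Del -> 0 <= ip rho (g b *: b).
    by move=> /DelP[[_ hb] _]; rewrite (ipZr rg) mulr_ge0 // ltW.
  have : ip rho (g a *: a) = 0.
    apply/le_anti/andP; split; last exact: pos.
    rewrite -s0 (bigD1_seq a) //= lerDl big_seq_cond sumr_ge0 // => b /andP[hb _].
    exact: pos.
  have [[_ hr] _] := proj1 (DelP a) ha.
  by rewrite (ipZr rg) => /eqP; rewrite mulf_eq0 (gt_eqF hr) orbF => /eqP.
move=> a ha; rewrite pq (zero p p0 u0 a ha) (zero q q0 _ a ha) ?subrr //.
by rewrite -uq.
Qed.

(** A positive root that is not simple pairs positively with some simple [a]. Reflecting in [a]
    lowers its height and changes only the coefficient of [a]; another coefficient stays positive,
    so the result is again a positive root. *)
Lemma simple_reflection_ind (P : V -> Prop) : (forall a, a \in Del -> P a) ->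
  (forall a v, a \in Del -> pos_root v -> P (v - (2 * ip a v / ip a a) *: a) -> P v) ->
  forall v, pos_root v -> P v.
Proof.
move=> h1 h2; apply: pos_root_ind => v pv ih.
have [vD|vD] := boolP (v \in Del); first exact: h1.
have [n hn] := pos_root_sum pv; have [Pv rv] := pv.
have vv := ip_gt0 rg (Phi_neq0 Pv).
have [a aD av] : exists2 a, a \in Del & 0 < ip a v.
  apply: contrapT => no; move: vv; rewrite {1}hn ip_suml ltNge => /negP; apply.
  rewrite big_seq sumr_le0 // => a ha; rewrite (ipZl rg) mulr_ge0_le0 ?ler0n //.
  by rewrite leNgt; apply/negP => lt; apply: no; exists a.
have [[Pa ra] _] := proj1 (DelP a) aD.
have aa := ip_gt0 rg (Phi_neq0 Pa).
pose k := 2 * ip a v / ip a a.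
have k0 : 0 < k by rewrite divr_gt0 ?mulr_gt0.
have PP := Phi_reflect Pa Pv; rewrite -/k in PP.
apply: (h2 a v aD pv); rewrite -/k; apply: ih; last first.
  by rewrite !ipE ltrBlDr ltrDl mulr_gt0.
case: (root_pos_or_neg PP) => // neg; exfalso.
have [m hm] := pos_root_sum neg.
have [b bD [ba nb]] : exists2 b, b \in Del & b != a /\ n b != 0%N.
  apply: contrapT => no.
  have e : v = (n a)%:R *: a.
    rewrite hn (bigD1_seq a) //= big_seq_cond big1 ?addr0 // => b /andP[bD ba].
    have [->|nb] := eqVneq (n b) 0%N; first by rewrite scale0r.
    by case: no; exists b.
  have c2 := Phi_reduced Pa Pv e.
  have n0 : 0 <= (n a)%:R :> R by rewrite ler0n.
  have n1 : (n a)%:R = 1 :> R by nra.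
  by move/negP: vD; apply; rewrite e n1 scale1r.
have : (n b)%:R + (m b)%:R = 0 :> R.
  pose c x : R := (n x)%:R + (m x)%:R - k * (x == a)%:R.
  suff : c b = 0 by rewrite /c (negPf ba) mulr0 subr0.
  apply: simple_independent bD; rewrite /c.
  under eq_bigr do rewrite scalerBl scalerDl.
  rewrite sumrB big_split /= -hn -hm.
  have -> : \sum_(i <- Del) (k * (i == a)%:R) *: i = k *: a.
    rewrite (bigD1_seq a) //= eqxx mulr1 big1 ?addr0 // => i /negPf ->.
    by rewrite mulr0 scale0r.
  by apply: (ip_ext rg) => z; rewrite !ipE; ring.
have := ltr0n R (n b); rewrite lt0n nb => n0; have := ler0n R (m b); lra.
Qed.
End RootSystem.

(** * Special points and the root lattice *)

Section SpecialPoint.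
Variables (R : realType) (V : lmodType R) (W : groupType).
Variables (ip : V -> V -> R) (act lin : W -> V -> V) (T D : set W).
Variables (nrm : W -> V) (off : W -> R) (x0 : V).
Hypothesis rg : reflection_group ip act lin T D nrm off x0.
Notation f := (wall_form ip nrm off).
Notation coroot := (coroot T nrm off).
Local Notation ipE := (ipE rg).
Notation walls_at := (walls_at ip T nrm off).

(** Gram-Schmidt by induction: [o2] is the projection of [a] to the span of [l], so [e] is
    orthogonal to [l], and nonzero by independence. The span clause is what identifies [o2] as a
    projection. *)
Lemma solve_independent (l : seq V) (g : V -> R) : uniq l ->
  (forall c : V -> R, \sum_(a <- l) c a *: a = 0 -> forall a, a \in l -> c a = 0) ->
  exists2 o, (exists c : V -> R, o = \sum_(a <- l) c a *: a) & forall a, a \in l -> ip a o = g a.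
Proof.
elim: l g => [|a l ih] g /=.
  by exists 0 => //; exists (fun=> 0); rewrite big_nil.
move=> /andP[al ul] ind.
have ind' (c : V -> R) : \sum_(b <- l) c b *: b = 0 -> forall b, b \in l -> c b = 0.
  move=> h b bl; pose c' x := if x == a then 0 else c x.
  have ba : b != a by apply: contraNneq al => <-.
  have := ind c'; rewrite big_cons /c' eqxx scale0r add0r => H.
  have := H _ b; rewrite in_cons bl orbT (negPf ba); apply=> //.
  rewrite -[RHS]h big_seq [RHS]big_seq; apply: eq_bigr => x xl.
  by rewrite (_ : (x == a) = false) //; apply: contraNF al => /eqP <-.
have [o1 [c1 e1] h1] := ih g ul ind'.
have [o2 [c2 e2] h2] := ih (fun b => ip b a) ul ind'.
have [e edef] : exists e, e = a - o2 by exists (a - o2).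
have be b : b \in l -> ip b e = 0 by move=> bl; rewrite edef !ipE h2 // subrr.
have oe (c : V -> R) : ip (\sum_(b <- l) c b *: b) e = 0.
  by rewrite (ip_suml rg) big_seq big1 // => b bl; rewrite (ipZl rg) be // mulr0.
have e0 : e != 0.
  apply/eqP => e0; have := ind (fun x => if x == a then 1 else - c2 x).
  rewrite big_cons eqxx scale1r => /(_ _ a (mem_head _ _)); rewrite eqxx => H.
  have : 1 = 0 :> R; last by move/eqP; rewrite oner_eq0.
  apply: H; rewrite -[RHS]e0 edef e2 -sumrN; congr (_ + _); rewrite big_seq [RHS]big_seq.
  apply: eq_bigr => x xl; rewrite (_ : (x == a) = false) ?scaleNr //.
  by apply: contraNF al => /eqP <-.
have ae : ip a e = ip e e.
  have -> : ip a e = ip e e + ip o2 e by rewrite {2}edef !ipE; ring.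
  by rewrite e2 oe addr0.
have ee := ip_gt0 rg e0.
pose k := (g a - ip a o1) / ip e e.
exists (o1 + k *: e).
  exists (fun x => if x == a then k else c1 x - k * c2 x).
  rewrite big_cons eqxx e1 edef e2.
  have -> : \sum_(j <- l) (if j == a then k else c1 j - k * c2 j) *: j =
     \sum_(j <- l) c1 j *: j - k *: \sum_(j <- l) c2 j *: j.
    rewrite scaler_sumr -sumrB big_seq [RHS]big_seq; apply: eq_bigr => x xl.
    rewrite (_ : (x == a) = false) ?scalerBl ?scalerA //.
    by apply: contraNF al => /eqP <-.
  by apply: (ip_ext rg) => z; rewrite !ipE; ring.
move=> b; rewrite in_cons => /orP[/eqP->|bl].
  by rewrite !ipE ae /k divfK ?gt_eqF //; ring.
by rewrite !ipE be // h1 // mulr0 addr0.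
Qed.

(** A small generic perturbation of [nu] avoids all root hyperplanes and keeps every nonzero sign;
    it defines a positive system in which [nu] is dominant. *)
Lemma generic_near (nu : V) : exists rho, (forall v, coroot v -> ip rho v != 0) /\
  (forall v, coroot v -> 0 < ip nu v -> 0 < ip rho v).
Proof.
have [l hl] := coroot_finite rg.
pose l' := [seq v <- l | `[< coroot v >]].
have l'P v : v \in l' <-> coroot v.
  rewrite mem_filter; split=> [/andP[/asboolP //]|h].
  by apply/andP; split; [apply/asboolP|apply: hl].
have [| | |r0 [_ _ hr]] := generic_point rg (P := setT) (l := l') (g := fun v x => ip x v) (y0 := 0) (e := 1) _ _ ltr01 I _.
- by [].
- by move=> i y z s; rewrite !ipE; ring.
- move=> v /l'P /(coroot_neq0 rg) v0; exists v => //.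
  by rewrite gt_eqF // (ip_gt0 rg).
have [|s s0 hs] := near0_ex (near0_all (l := [seq v <- l' | ip nu v != 0])
   (P := fun v s => 0 < (ip nu v + s * ip r0 v) * ip nu v) _).
  by move=> v; rewrite mem_filter => /andP[h _]; apply: near0_affine.
have key v : coroot v -> ip nu v != 0 -> 0 < ip (nu + s *: r0) v * ip nu v.
  by move=> /l'P cv nv; rewrite !ipE; apply: hs; rewrite mem_filter nv.
exists (nu + s *: r0); split=> v cv.
  have [n0|nn] := eqVneq (ip nu v) 0.
    by rewrite !ipE n0 add0r mulf_neq0 ?(lt0r_neq0 s0) //; apply: hr; apply/l'P.
  by have := key v cv nn; apply: contraTneq => ->; rewrite mul0r ltxx.
by move=> p; have := key v cv (lt0r_neq0 p); rewrite pmulr_lgt0.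
Qed.

Variables (nu rho : V).
Hypothesis rho_reg : forall v, coroot v -> ip rho v != 0.
Hypothesis rho_nu : forall v, coroot v -> 0 < ip nu v -> 0 < ip rho v.
Variable Del : seq V.
Hypothesis Del_uniq : uniq Del.
Notation simple_root := (simple_root ip coroot rho).
Notation pos_root := (pos_root ip coroot rho).
Hypothesis DelP : forall v, v \in Del <-> simple_root v.

Lemma Del_coroot a : a \in Del -> coroot a.
Proof. by move=> /DelP[[]]. Qed.

Lemma coroot_sign v : coroot v -> pos_root v \/ pos_root (- v).
Proof. exact: (root_pos_or_neg rg (@corootN R V W T nrm off) rho_reg). Qed.

Lemma coroot_sum v : pos_root v -> exists n : V -> nat, v = \sum_(a <- Del) (n a)%:R *: a.
Proof. exact: (pos_root_sum rg (coroot_finite rg) Del_uniq DelP). Qed.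

Lemma Del_independent (c : V -> R) :
  \sum_(a <- Del) c a *: a = 0 -> forall a, a \in Del -> c a = 0.
Proof.
exact: (simple_independent rg (coroot_neq0 rg) (@corootN R V W T nrm off) (@coroot_reflect R V W ip act lin T D nrm off x0 rg)
  (@coroot_integral R V W ip act lin T D nrm off x0 rg) (@coroot_reduced R V W ip act lin T D nrm off x0 rg) rho_reg Del_uniq DelP).
Qed.

Lemma coroot_reflection_ind (P : V -> Prop) : (forall a, a \in Del -> P a) ->
  (forall a v, a \in Del -> pos_root v -> P (v - (2 * ip a v / ip a a) *: a) -> P v) ->
  forall v, pos_root v -> P v.
Proof.
exact: (simple_reflection_ind rg (coroot_finite rg) (coroot_neq0 rg) (@corootN R V W T nrm off) (@coroot_reflect R V W ip act lin T D nrm off x0 rg)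
  (@coroot_integral R V W ip act lin T D nrm off x0 rg) (@coroot_reduced R V W ip act lin T D nrm off x0 rg) rho_reg Del_uniq DelP).
Qed.

Lemma Del_nu_ge0 a : a \in Del -> 0 <= ip nu a.
Proof.
move=> /DelP[[ca pa] _]; rewrite leNgt; apply/negP => h.
have := rho_nu (corootN ca); rewrite !(ipNr rg) !oppr_gt0 => /(_ h).
by move=> /(lt_trans pa); rewrite ltxx.
Qed.

(** Choose a wall for each simple coroot and, by independence, a point [o] on all of them.
    Reflections in these walls fix [o] and reach every positive coroot from a simple one, so each
    direction has a wall through [o]. *)
Lemma special_point_ex : exists o, forall t, T t -> exists t', [/\ T t', nrm t' = nrm t & f t' o = 0].
Proof.
have wall a : exists t, a \in Del -> T t /\ exists2 c : R, c != 0 & a = c *: nrm t.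
  have [aD|aD] := boolP (a \in Del); last by exists 1%g.
  have [t [b [c [ht _ _ _ [c0 e]]]]] := coroot_translation rg (Del_coroot aD).
  by exists t => _; split=> //; exists c.
have [w hw] := boolp.choice wall.
have coef a : exists c : R, a \in Del -> c != 0 /\ a = c *: nrm (w a).
  have [aD|aD] := boolP (a \in Del); last by exists 1.
  by have [_ [c c0 e]] := hw a aD; exists c.
have [k hk] := boolp.choice coef.
have [o _ ho] := solve_independent (fun a => k a * off (w a)) Del_uniq Del_independent.
have f0 a : a \in Del -> f (w a) o = 0.
  move=> aD; have [c0 e] := hk a aD; have := ho a aD.
  by rewrite {1}e (ipZl rg) => /(mulfI c0) h; rewrite /wall_form h subrr.
exists o.
have posP v : pos_root v -> exists t (c : R), [/\ T t, c != 0, v = c *: nrm t & f t o = 0].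
  move: v; apply: coroot_reflection_ind => [a aD|a v aD pv [t [c [ht c0 e ft]]]].
    by have [ht _] := hw a aD; have [c0 e] := hk a aD; exists (w a), (k a); split=> //; apply: f0.
  have [hta _] := hw a aD; have [c0' e'] := hk a aD.
  have ev : v = lin (w a) (v - (2 * ip a v / ip a a) *: a).
    have := lin_id_refl rg (v - (2 * ip a v / ip a a) *: a) hta c0'; rewrite -e' => ->.
    have aa := ip_gt0 rg (coroot_neq0 rg (Del_coroot aD)).
    by apply: (ip_ext rg) => z; rewrite !ipE; field; rewrite gt_eqF.
  rewrite e (linZ rg) in ev.
  have ao : act (w a) o = o by apply: (act_fix rg hta); apply: f0.
  have ht' := T_conj rg (w a) ht.
  case: (conj_normal rg (w a) ht) => -[n fe]; have := fe o; rewrite ao ft.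
    by move=> f'; exists (w a * t * (w a)^-1)%g, c; split=> //; rewrite n.
  rewrite oppr0 => f'; exists (w a * t * (w a)^-1)%g, (- c); split=> //; first by rewrite oppr_eq0.
  by rewrite n scaleNr scalerN opprK.
move=> t ht; have [d [d0 _] ct] := coroot_of rg ht.
have [t' [c [ht' c0 e ft']]] : exists t' (c : R), [/\ T t', c != 0, (2 * d) *: nrm t = c *: nrm t' & f t' o = 0].
  case: (coroot_sign ct) => /posP[t' [c [h1 h2 h3 h4]]]; first by exists t', c.
  exists t', (- c); split=> //; first by rewrite oppr_eq0.
  by rewrite scaleNr -h3 opprK.
exists t'; split=> //.
have d2 : 2 * d != 0 by rewrite mulf_neq0 ?pnatr_eq0 ?gt_eqF.
have en : nrm t = (c / (2 * d)) *: nrm t'.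
  by apply: (scalerI d2); rewrite e scalerA; congr (_ *: _); field; rewrite gt_eqF.
set m := c / _ in en.
have k2 : m ^+ 2 = 1.
  by have := nrm_unit rg ht; rewrite en !ipE (nrm_unit rg ht') mulr1 expr2.
have : (m == 1) || (m == -1) by rewrite -sqrf_eq1 k2.
case/orP=> /eqP em; rewrite em in en; first by rewrite en scale1r.
by move: en; rewrite scaleN1r => /(nrm_opp rg ht ht').
Qed.

Definition root_lattice (mu : V) := exists z : V -> int, mu = \sum_(a <- Del) (z a)%:~R *: a.

Lemma root_lattice0 : root_lattice 0.
Proof. by exists (fun=> 0); rewrite big1 // => a _; rewrite scale0r. Qed.

Lemma root_latticeD mu mu' : root_lattice mu -> root_lattice mu' -> root_lattice (mu + mu').
Proof.
move=> [z ->] [z' ->]; exists (fun a => z a + z' a); rewrite -big_split.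
by apply: eq_bigr => a _; rewrite intrD scalerDl.
Qed.

Lemma root_latticeZ (k : int) mu : root_lattice mu -> root_lattice (k%:~R *: mu).
Proof.
move=> [z ->]; exists (fun a => k * z a); rewrite scaler_sumr.
by apply: eq_bigr => a _; rewrite intrM scalerA.
Qed.

Lemma root_lattice_coroot v : coroot v -> root_lattice v.
Proof.
have h w : pos_root w -> root_lattice w by move=> /coroot_sum[n ->]; exists (fun a => (n a : int)).
move=> /coroot_sign[/h //|/h /(root_latticeZ (-1))].
by rewrite mulrNz scaleN1r opprK.
Qed.

Lemma root_lattice_lin w mu : root_lattice mu -> root_lattice (lin w mu).
Proof.
move=> [z ->]; rewrite (big_morph (lin w) (linD rg w) (lin0 rg w)) big_seq.
elim/big_rec: _ => [|a v aD ih]; first exact: root_lattice0.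
apply: root_latticeD ih; rewrite (linZ rg); apply: root_latticeZ.
by apply: root_lattice_coroot; apply: (coroot_lin rg); apply: Del_coroot.
Qed.

Lemma translation_zmul p v (k : int) : D p -> (forall x, act p x = x + v) ->
  exists2 p', D p' & forall x, act p' x = x + k%:~R *: v.
Proof.
move=> Dp hp.
have nat_case (m : nat) : exists2 p', D p' & forall x, act p' x = x + m%:R *: v.
  elim: m => [|m [p' Dp' hp']].
    by exists 1%g => [|x]; [exact: (D_one rg)|rewrite (rg_act1 rg) scale0r addr0].
  exists (p' * p)%g => [|x]; first exact: (D_mul rg).
  by rewrite (rg_actM rg) hp hp' -natr1 scalerDl scale1r -addrA [v + _]addrC.
case: k => m; first exact: nat_case.
have [p' Dp' hp'] := nat_case m.+1; exists p'^-1%g => [|x]; first exact: (D_inv rg).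
rewrite -{1}[x](subrK ((m.+1)%:R *: v)) -hp' (act_invK rg).
by rewrite NegzE mulrNz scaleNr.
Qed.

Lemma root_lattice_translation mu : root_lattice mu -> exists2 p, D p & forall x, act p x = x + mu.
Proof.
move=> [z ->]; rewrite big_seq; elim/big_rec: _ => [|a v aD [p Dp hp]].
  by exists 1%g => [|x]; [exact: (D_one rg)|rewrite (rg_act1 rg) addr0].
have [t [t' [c [ht ht' _ htr _]]]] := coroot_translation rg (Del_coroot aD).
have Dt : D (t * t')%g by apply: (D_mul rg); apply: (T_sub_D rg).
have [p' Dp' hp'] := translation_zmul (z a) Dt htr.
exists (p * p')%g => [|x]; first exact: (D_mul rg).
by rewrite (rg_actM rg) hp hp' addrA.
Qed.

Variable o : V.
Hypothesis special : forall t, T t -> exists t', [/\ T t', nrm t' = nrm t & f t' o = 0].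

(** A reflection is its parallel through [o] followed by a translation along a multiple of the
    coroot. Collecting translations exhibits [D] as the root lattice extended by the stabilizer of
    [o]. *)
Lemma special_decomposition a : D a -> exists mu r,
  [/\ root_lattice mu, gen (walls_at o) r & forall x, act a x = act r x + mu].
Proof.
rewrite (D_gen rg); elim=> [|t w ht _ [mu [r [qm gr h]]]].
  by exists 0, 1%g; split=> [||x]; [exact: root_lattice0|exact: gen1|rewrite addr0].
have [t' [ht' n' f']] := special ht.
have [d hd ct] := coroot_of rg ht'.
have [k hk] : exists k : int, off t = off t' + k%:~R * d by apply/(proj2 hd); exists t.
exists (lin t' mu + k%:~R *: ((2 * d) *: nrm t')), (t' * r)%g; split=> [||x].
- apply: root_latticeD; first exact: root_lattice_lin.
  by apply: root_latticeZ; apply: root_lattice_coroot.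
- by apply: genM.
rewrite (rg_actM rg) h (rg_actM rg).
have -> : act t (act r x + mu) = act (t * t')%g (act t' (act r x + mu)).
  by rewrite (rg_actM rg) -(rg_actM rg t' t') (T_invol rg ht') (rg_act1 rg).
rewrite (act_parallel rg _ ht ht' (esym n')) (actD rg) -addrA; congr (_ + (_ + _)).
by rewrite -n' scalerA; congr (_ *: _); rewrite hk; ring.
Qed.

Definition nu_walls : set W := [set t | T t /\ ip (nrm t) nu = 0].

(** Chevalley's theorem on stabilizers. After a correction by reflections fixing [o] and [nu], the
    element preserves the side of [o + rho] for the walls through [o] parallel to [nu]; for the
    others the side is dictated by the fixed vector [nu]. Freeness at [o] concludes. *)
Lemma special_stabilizer r : gen (walls_at o) r -> lin r nu = nu -> gen nu_walls r.
Proof.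
move=> hr hnu.
pose T1 : set W := [set t | nu_walls t /\ walls_at o t].
have T1T : T1 `<=` T by move=> t [[]].
have T1o : T1 `<=` walls_at o by move=> t [].
have wT : walls_at o `<=` T by move=> t [].
have T1c : conj_closed T1.
  move=> a b [[ha na] oa] [[hb nb] ob]; split; last exact: (walls_at_conj_closed rg oa ob).
  split; first exact: (T_conj rg).
  have la : lin a nu = nu by rewrite (lin_refl rg _ ha) na mulr0 scale0r subr0.
  case: (conj_normal rg a hb) => -[-> _]; rewrite ?(ipNl rg) -{1}la (lin_ip rg) nb //.
  by rewrite oppr0.
pose y := o + rho.
have fy w t : act w o = o -> walls_at o t -> f t (act w y) = ip (nrm t) (lin w rho).
  by move=> wo [ht h0]; rewrite /y (actD rg) wo (wall_formD rg) h0 add0r.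
have nz w t : act w o = o -> walls_at o t -> f t (act w y) != 0.
  move=> wo ht; have [Tt _] := ht; rewrite fy // (ipC rg) (ip_linl rg).
  have [d [d0 _] ct] := coroot_of rg Tt.
  have := rho_reg (coroot_lin rg w^-1%g ct); rewrite (linZ rg) (ipZr rg).
  by rewrite mulf_eq0 negb_or => /andP[].
have r_o := walls_at_fix rg hr.
have [r1 hr1 hc] : exists2 r1, gen T1 r1 & cell ip nrm off T1 y (act r1 (act r y)).
  apply: (cell_transitive rg T1T T1c) => t /T1o ht; last exact: nz.
  by rewrite -[y](rg_act1 rg); apply: nz => //; rewrite (rg_act1 rg).
have r1_o := walls_at_fix rg (gen_sub T1o hr1).
have lr1 : lin r1 nu = nu.
  elim: hr1 => [|t w [[ht nt] _] _ ih]; first by rewrite (lin1 rg).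
  by rewrite (linM rg) ih (lin_refl rg _ ht) nt mulr0 scale0r subr0.
pose w := (r1 * r)%g.
have w_o : act w o = o by rewrite /w (rg_actM rg) r_o.
have lw : lin w nu = nu by rewrite /w (linM rg) hnu.
have lwV : lin w^-1%g nu = nu by rewrite -{1}lw (linVK rg).
have e : w = 1%g.
  apply: (walls_at_free rg (p := o) (y := y)).
    by rewrite /w; apply: gen_mul hr; apply: gen_sub hr1.
  move=> t ht; have [Tt _] := ht.
  have [n0|n0] := eqVneq (ip (nrm t) nu) 0.
    by rewrite /w (rg_actM rg); apply: hc.
  rewrite -{1}[y](rg_act1 rg) !fy // ?(rg_act1 rg) // (lin1 rg).
  have [d [d0 _] ct] := coroot_of rg Tt.
  have d2 : 0 < 2 * d by rewrite mulr_gt0.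
  have cw := coroot_lin rg w^-1%g ct.
  have enu : ip nu (lin w^-1%g ((2 * d) *: nrm t)) = 2 * d * ip (nrm t) nu.
    by rewrite (ipC rg) (ip_linl rg) invgK lw (ipZl rg).
  have erho : ip rho (lin w^-1%g ((2 * d) *: nrm t)) = 2 * d * ip (nrm t) (lin w rho).
    by rewrite (ipC rg) (ip_linl rg) invgK (ipZl rg).
  have enu1 : ip nu ((2 * d) *: nrm t) = 2 * d * ip (nrm t) nu by rewrite (ipC rg) (ipZl rg).
  have erho1 : ip rho ((2 * d) *: nrm t) = 2 * d * ip (nrm t) rho by rewrite (ipC rg) (ipZl rg).
  case: (ltrgt0P (ip (nrm t) nu)) n0 => // p _.
    have := rho_nu ct; rewrite enu1 erho1 !(pmulr_rgt0 _ d2) => h1.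
    have := rho_nu cw; rewrite enu erho !(pmulr_rgt0 _ d2) => h2.
    exact: mulr_gt0 (h1 p) (h2 p).
  have := rho_nu (corootN ct); rewrite !(ipNr rg) enu1 erho1 !oppr_gt0 !(pmulr_rlt0 _ d2) => h1.
  have := rho_nu (corootN cw); rewrite !(ipNr rg) enu erho !oppr_gt0 !(pmulr_rlt0 _ d2) => h2.
  by rewrite (nmulr_rgt0 _ (h1 p)); exact: h2 p.
have -> : r = (r1^-1)%g by apply: (mulgI r1); rewrite mulgV.
by apply: (gen_inv rg) => [t []//|]; apply: gen_sub hr1 => t [].
Qed.
End SpecialPoint.

(** * Reflections parallel to a translation *)

Section LeviLattice.
Variables (R : realType) (V : lmodType R) (W : groupType).
Variables (ip : V -> V -> R) (act lin : W -> V -> V) (T D : set W).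
Variables (nrm : W -> V) (off : W -> R) (x0 : V).
Hypothesis rg : reflection_group ip act lin T D nrm off x0.
Notation f := (wall_form ip nrm off).
Notation sep := (separates ip nrm off).
Notation reg := (regular ip T nrm off).
Notation cell := (cell ip nrm off).
Notation coroot := (coroot T nrm off).
Local Notation ipE := (ipE rg).
Notation walls_at := (walls_at ip T nrm off).

Variables (q : W) (nu : V).
Hypothesis Dq : D q.
Hypothesis hq : forall x, act q x = x + nu.
Notation T0 := (nu_walls ip T nrm nu).

(** Fixing [nu] becomes commutation with [q], a condition that every automorphism fixing [q]
    preserves. *)
Lemma comm_lin w : D w -> (w * q = q * w)%g <-> lin w nu = nu.
Proof.
move=> Dw; split=> h.
  have := congr1 (fun v => act v x0) h; rewrite /= !(rg_actM rg) !hq (actD rg).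
  exact: addrI.
apply: (D_faithful rg); try exact: (D_mul rg).
by rewrite !(rg_actM rg) !hq (actD rg) h.
Qed.

Lemma T0_lin t : T t -> T0 t <-> lin t nu = nu.
Proof.
move=> ht; rewrite (lin_refl rg _ ht); split=> [[_ ->]|/(congr1 (ip (nrm t)))].
  by rewrite mulr0 scale0r subr0.
by rewrite !ipE (nrm_unit rg ht) => h; split=> //; lra.
Qed.

Lemma T0_comm t : T t -> T0 t <-> (t * q = q * t)%g.
Proof. by move=> ht; rewrite T0_lin // -comm_lin //; apply: (T_sub_D rg). Qed.

Lemma T0_T : T0 `<=` T. Proof. by move=> t []. Qed.

Lemma T0_conj w t : lin w nu = nu -> T0 t -> T0 (w * t * w^-1)%g.
Proof.
move=> hw [ht h0]; split; first exact: (T_conj rg).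
case: (conj_normal rg w ht) => -[-> _]; rewrite ?(ipNl rg) -{1}hw (lin_ip rg) h0 //.
by rewrite oppr0.
Qed.

Lemma lin_nuV w : lin w nu = nu -> lin w^-1%g nu = nu.
Proof. by move=> h; rewrite -{1}h (linVK rg). Qed.

Lemma T0_conjV w t : lin w nu = nu -> T0 t -> T0 (w^-1 * t * w)%g.
Proof. by move=> /lin_nuV h ht; rewrite -{2}[w]invgK; apply: T0_conj. Qed.

Lemma T0_conj_closed : conj_closed T0.
Proof. by move=> a b ha hb; apply: T0_conj => //; apply/T0_lin => //; exact: T0_T. Qed.

Lemma gen_T0_lin r : gen T0 r -> lin r nu = nu.
Proof.
elim=> [|t w ht _ ih]; first exact: (lin1 rg).
by rewrite (linM rg) ih; apply/T0_lin => //; exact: T0_T.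
Qed.

Lemma gen_T0_D r : gen T0 r -> D r.
Proof. exact: (gen_D rg T0_T). Qed.

Lemma gen_T0_conj w r : lin w nu = nu -> gen T0 r -> gen T0 (w * r * w^-1)%g.
Proof.
move=> hw; elim=> [|t v ht _ ih]; first by rewrite mulg1 mulgV; apply: gen1.
have -> : (w * (t * v) * w^-1 = (w * t * w^-1) * (w * v * w^-1))%g by rewrite !mulgA mulgVK.
by apply: genM ih; apply: T0_conj.
Qed.

Lemma T0_displacement mu r x : (forall t, T0 t -> ip mu (nrm t) = 0) -> gen T0 r ->
  ip mu (act r x - x) = 0.
Proof.
move=> h; elim=> [|t w ht _ ih]; first by rewrite (rg_act1 rg) subrr (ip0r rg).
rewrite (rg_actM rg) (act_refl rg _ (T0_T ht)) addrAC (ipDr rg) ih !ipE h //.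
by rewrite mulr0 oppr0 addr0.
Qed.

Lemma cell_T0_act w x y : lin w nu = nu -> cell T0 x y -> cell T0 (act w x) (act w y).
Proof. by move=> hw; apply: (cell_act rg T0_T) => t; apply: T0_conjV. Qed.

Lemma act_expg r k x : act (r ^+ k)%g x = iter k (act r) x.
Proof. by elim: k => [|k ih]; rewrite ?expg0 ?(rg_act1 rg) // expgS (rg_actM rg) ih. Qed.

Lemma lin_expg r k x : lin (r ^+ k)%g x = iter k (lin r) x.
Proof. by elim: k => [|k ih]; rewrite ?expg0 ?(lin1 rg) // expgS (linM rg) ih. Qed.

Lemma act_lin0 w x : act w x = act w 0 + lin w x.
Proof. by rewrite -{1}[x]add0r (actD rg). Qed.

(* A power of r is a translation along a vector that is both orthogonal to T0 and displaced inside the span of T0,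
   so r has a fixed point in its cell, which can be moved along nu to a regular point. *)
Lemma T0_free r y : gen T0 r -> reg y -> cell T0 y (act r y) -> r = 1%g.
Proof.
move=> hr ry hc; have lr := gen_T0_lin hr; have Dr := gen_T0_D hr.
have [k k0 hk] := lin_finite rg r.
pose mu := act (r ^+ k)%g 0.
have trk x : act (r ^+ k)%g x = x + mu by rewrite act_lin0 lin_expg hk addrC.
have ci i : cell T0 y (act (r ^+ i)%g y).
  elim: i => [|i ih]; first by rewrite expg0 (rg_act1 rg); apply: cell_refl => t /T0_T; apply: ry.
  rewrite expgS (rg_actM rg); apply: (cell_trans hc); exact: cell_T0_act.
have trj j x : act (r ^+ (j * k))%g x = x + j%:R *: mu.
  elim: j => [|j ih]; first by rewrite mul0n expg0 (rg_act1 rg) scale0r addr0.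
  by rewrite mulSn expgnDr (rg_actM rg) ih trk -natr1 scalerDl scale1r addrA.
have orth t : T0 t -> ip mu (nrm t) = 0.
  move=> ht; apply/eqP; apply: contraT => c0; rewrite (ipC rg) in c0.
  have [i hi] : exists i : nat, f t y ^+ 2 < i%:R ^+ 2 * ip (nrm t) mu ^+ 2.
    have c2 : 0 < ip (nrm t) mu ^+ 2 by rewrite exprn_even_gt0.
    have := archi_boundP (divr_ge0 (sqr_ge0 (f t y)) (ltW c2)).
    set i := Num.Def.archi_bound _; rewrite ltr_pdivrMr // => h; exists i.+1.
    apply: lt_le_trans h _; rewrite ler_pM2r // -natrX ler_nat; nia.
  (* The wall of [t], carried along by [i%:R *: mu], separates [y] from [y] moved by twice that
     vector once [i] is large, although both lie in one cell. *)
  have [n o] := wall_translation rg (trj i) (T0_T ht).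
  have ht' := T0_conj (w := (r ^+ (i * k))%g) _ ht.
  have lri : lin (r ^+ (i * k))%g nu = nu by rewrite lin_expg; elim: (i * k)%N => //= m ->.
  have := ci (i.*2 * k)%N _ (ht' lri); rewrite trj.
  have e x : f (r ^+ (i * k) * t * (r ^+ (i * k))^-1)%g x = f t x - i%:R * ip (nrm t) mu.
    by rewrite /wall_form n o (ipZr rg); ring.
  rewrite !e (wall_formD rg) (ipZr rg) -muln2 natrM.
  move: (f t y) (ip _ _) (i%:R) hi => a b c hi.
  have -> : (a - c * b) * (a + c * 2 * b - c * b) = a ^+ 2 - c ^+ 2 * b ^+ 2 by ring.
  by rewrite subr_gt0 => /(lt_trans hi); rewrite ltxx.
have mu0 : mu = 0.
  have hrk : gen T0 (r ^+ k)%g.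
    by elim: (k) => [|m ih]; rewrite ?expg0; [exact: gen1|rewrite expgS; apply: gen_mul].
  apply: (ip_eq0 rg); have := T0_displacement y orth hrk.
  by rewrite trk addrAC subrr add0r.
have kR : k%:R != 0 :> R by rewrite pnatr_eq0 -lt0n.
(* The barycentre of the orbit of [y], closed after [k] steps as [mu] is 0; it stays in the cell
   because [f t] is affine. *)
pose p := k%:R^-1 *: \sum_(i < k) act (r ^+ i)%g y.
have fp : act r p = p.
  have e0 : k%:R^-1 *: \sum_(i < k) act r 0 = act r 0.
    by rewrite sumr_const card_ord -scaler_nat scalerA mulVf // scale1r.
  rewrite act_lin0 -{1}e0 /p (linZ rg) -scalerDr; congr (_ *: _).
  rewrite (big_morph (lin r) (linD rg r) (lin0 rg r)) -big_split /=.
  under eq_bigr do rewrite -act_lin0 -(rg_actM rg) -expgS.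
  case: (k) k0 trk => // m _ trm; rewrite big_ord_recr [RHS]big_ord_recl /= trm mu0 addr0.
  by rewrite expg0 (rg_act1 rg) addrC.
have cp t : T0 t -> f t p != 0.
  move=> ht; have : 0 < f t p * f t y.
    have -> : f t p = k%:R^-1 * \sum_(i < k) f t (act (r ^+ i)%g y).
      rewrite /wall_form /p (ipZr rg) (ip_sumr rg) sumrB sumr_const card_ord -mulr_natl.
      by field.
    rewrite -mulrA mulr_suml mulr_gt0 ?invr_gt0 ?ltr0n //.
    case: (k) k0 => // m _; rewrite big_ord_recl expg0 (rg_act1 rg) ltr_pwDl //.
      by rewrite -expr2 exprn_even_gt0 //; apply: ry; apply: T0_T.
    by rewrite sumr_ge0 // => i _; rewrite ltW // mulrC; apply: ci.
  by apply: contraTneq => ->; rewrite mul0r ltxx.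
pose P : set V := [set x | exists s : R, x = p + s *: nu].
have Paff : affine_set P.
  move=> y1 y2 s [s1 ->] [s2 ->]; exists (s1 + s * (s2 - s1)).
  by apply: (ip_ext rg) => z; rewrite !ipE; ring.
have Pp : P p by exists 0; rewrite scale0r addr0.
have [e e0 he] := ball_signs rg p.
have [l hl] := local_finite rg p 0.
pose l' := [seq h <- l | `[< walls_at p h >]].
have [| |y' [Py' hy hg]] := generic_point rg (P := P) (l := l') (g := fun h x => f h x) Paff _ e0 Pp _.
- by move=> h x z s; rewrite (faff rg).
- move=> h; rewrite mem_filter => /andP[/asboolP [hh h0] _].
  exists (p + nu); first by exists 1; rewrite scale1r.
  rewrite (wall_formD rg) h0 add0r; apply/eqP => hn.
  by have := cp h (conj hh hn); rewrite h0 eqxx.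
have ry' : reg y'.
  move=> t ht; have [h0|h0] := eqVneq (f t p) 0.
    apply: hg; rewrite mem_filter; apply/andP; split; first by apply/asboolP.
    by apply: hl => //; rewrite h0 oppr0 lexx.
  by have := he y' hy t ht h0; apply: contraTneq => ->; rewrite mulr0 ltxx.
apply: (D_fix_regular rg Dr ry'); have [s ->] := Py'.
by rewrite (actD rg) fp (linZ rg) lr.
Qed.

(** A complement to [gen T0] in the centralizer of [q]: [levi_proj] and [T0_free] give existence and
    uniqueness of representatives that preserve the [T0]-cell of [x0]. Its elements are translations
    only up to [gen T0]. *)
Definition levi_group (a : W) : Prop := [/\ D a, (a * q = q * a)%g & cell T0 x0 (act a x0)].

Lemma levi_lin a : levi_group a -> lin a nu = nu.
Proof. by move=> [Da h _]; apply/comm_lin. Qed.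

Lemma levi_mul a b : levi_group a -> levi_group b -> levi_group (a * b)%g.
Proof.
move=> ha hb; have la := levi_lin ha; have lb := levi_lin hb.
have [Da ca ea] := ha; have [Db cb eb] := hb; split; first exact: (D_mul rg).
  by apply/comm_lin; [exact: (D_mul rg)|rewrite (linM rg) lb].
by apply: (cell_trans ea); rewrite (rg_actM rg); apply: cell_T0_act.
Qed.

Lemma levi_one : levi_group 1%g.
Proof.
split; [exact: (D_one rg)|by rewrite mul1g mulg1|].
by rewrite (rg_act1 rg); apply: cell_refl => t /T0_T; apply: (x0_regular rg).
Qed.

Lemma levi_inv a : levi_group a -> levi_group (a^-1)%g.
Proof.
move=> ha; have la := lin_nuV (levi_lin ha); have [Da ca ea] := ha.
have DV := D_inv rg Da; split=> //; first by apply/comm_lin.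
by have := cell_T0_act la (cell_sym ea); rewrite (act_invK rg).
Qed.

Lemma levi_proj p : D p -> lin p nu = nu -> exists2 a, levi_group a & gen T0 (a * p^-1)%g.
Proof.
move=> Dp lp; have nz w t : T0 t -> f t (act w x0) != 0.
  by move=> /T0_T ht; apply: (reg_act_x0 rg w).
have nz0 t : T0 t -> f t x0 != 0 by move=> /T0_T; apply: (x0_regular rg).
have [r hr hc] := cell_transitive rg T0_T T0_conj_closed nz0 (nz p).
exists (r * p)%g; last by rewrite mulgK.
split; first by apply: (D_mul rg) => //; apply: gen_T0_D.
  apply/comm_lin; first by apply: (D_mul rg) => //; apply: gen_T0_D.
  by rewrite (linM rg) lp; apply: gen_T0_lin.
by rewrite (rg_actM rg).
Qed.

(** The chamber of [w] is on the side of [t] towards which [q] pushes, said without linear structure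
    so that automorphisms can transport it. *)
Definition pos_side (t w : W) : Prop := forall k : nat, ~ sep t (act w x0) (act (q ^+ k * w)%g x0).

Lemma pos_sideP t w : T t -> ~ T0 t -> pos_side t w <-> 0 < ip (nrm t) nu * f t (act w x0).
Proof.
move=> ht nt; have c0 : ip (nrm t) nu != 0 by apply/eqP => h; apply: nt.
have a0 : f t (act w x0) != 0 := reg_act_x0 rg w ht.
have e k : f t (act (q ^+ k * w)%g x0) = f t (act w x0) + k%:R * ip (nrm t) nu.
  rewrite (rg_actM rg) act_expg.
  have -> : iter k (act q) (act w x0) = act w x0 + k%:R *: nu.
    elim: k => [|k ih]; first by rewrite scale0r addr0.
    by rewrite iterS ih hq -natr1 scalerDl scale1r addrA.
  by rewrite (wall_formD rg) (ipZr rg).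
rewrite /pos_side /separates; split=> h.
  rewrite ltNge; apply/negP => le.
  have lt : ip (nrm t) nu * f t (act w x0) < 0 by rewrite lt_neqAle le mulf_neq0.
  have [k hk] : exists k : nat, f t (act w x0) ^+ 2 < k%:R * - (ip (nrm t) nu * f t (act w x0)).
    have p : 0 < - (ip (nrm t) nu * f t (act w x0)) by rewrite oppr_gt0.
    have := archi_boundP (divr_ge0 (sqr_ge0 (f t (act w x0))) (ltW p)).
    by rewrite ltr_pdivrMr // => ?; eexists; eassumption.
  apply: (h k); rewrite e; move: hk; lra.
move=> k; rewrite e; apply/negP; rewrite -leNgt.
have k0 : 0 <= k%:R :> R by rewrite ler0n.
have := mulr_ge0 k0 (ltW h); have := sqr_ge0 (f t (act w x0)); lra.
Qed.

(** The Levi representative of [t * t'] when the half-space of [t] in direction [nu] is contained in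
    that of [t']. Parallelism of the two walls is not imposed but follows in [pos_side_all]. *)
Definition levi_pos_gen (a : W) : Prop := levi_group a /\ exists t t',
  [/\ T t /\ ~ T0 t, T t' /\ ~ T0 t',
      forall w, D w -> pos_side t w -> pos_side t' w & gen T0 (a * (t * t')^-1)%g].

Lemma regular_on_ray x z (s0 s1 : R) : reg x -> s0 < s1 ->
  exists s, [/\ s0 < s, s < s1 & reg (x + s *: z)].
Proof.
move=> rx lt.
pose s2 := (s0 + s1) / 2; pose p := x + s2 *: z.
have [e e0 he] := ball_signs rg p.
have [l hl] := local_finite rg p 0.
(* The second bound is the squared half-length of the segment and keeps the parameter between [s0]
   and [s1]. *)
pose e' := Num.min e ((s1 - s0) ^+ 2 / 4 * ip z z).
have [z0|z0] := eqVneq z 0.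
  exists s2; rewrite z0 scaler0 addr0 /s2; split=> //; lra.
have zz := ip_gt0 rg z0.
have e'0 : 0 < e' by rewrite lt_min e0 mulr_gt0 // divr_gt0 // exprn_gt0 // subr_gt0.
pose P : set V := [set y | exists s : R, y = x + s *: z].
have Paff : affine_set P.
  move=> y1 y2 s [a ->] [b ->]; exists (a + s * (b - a)).
  by apply: (ip_ext rg) => v; rewrite !ipE; ring.
have Pp : P p by exists s2.
have [| |y [Py hy hg]] := generic_point rg (P := P) (l := [seq h <- l | `[< T h >]])
   (g := fun h x => f h x) Paff _ e'0 Pp _.
- by move=> h u v s; rewrite (faff rg).
- move=> h; rewrite mem_filter => /andP[/asboolP hh _].
  by exists x; [exists 0; rewrite scale0r addr0|apply: rx].
have [s es] := Py; exists s.
have : ip (y - p) (y - p) = (s - s2) ^+ 2 * ip z z.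
  by rewrite es /p !ipE; ring.
move=> ey; rewrite ey in hy.
have h1 : (s - s2) ^+ 2 * ip z z < e by apply: lt_le_trans hy _; rewrite ge_min lexx.
have h2 : (s - s2) ^+ 2 * ip z z < (s1 - s0) ^+ 2 / 4 * ip z z.
  by apply: lt_le_trans hy _; rewrite ge_min lexx orbT.
have h3 : (s - s2) ^+ 2 < (s1 - s0) ^+ 2 / 4 by rewrite -(ltr_pM2r zz).
have ds : 0 < s1 - s0 by lra.
split; [by rewrite ltNge; apply/negP; rewrite /s2 in h3 => ?; nra|by rewrite ltNge; apply/negP; rewrite /s2 in h3 => ?; nra|].
rewrite -es => t ht; have [h0|h0] := eqVneq (f t p) 0.
  apply: hg; rewrite mem_filter; apply/andP; split; first by apply/asboolP.
  by apply: hl => //; rewrite h0 oppr0 lexx.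
by have := he y _ t ht h0; rewrite ey => /(_ h1); apply: contraTneq => ->; rewrite mulr0 ltxx.
Qed.

(** Orient both normals along [nu]. If they differed, a point far along their difference would be in
    the first half-space and outside the second; once they agree, a regular point between the walls
    decides the order of the offsets. *)
Lemma pos_side_all t t' : T t -> ~ T0 t -> T t' -> ~ T0 t' ->
  (forall w, D w -> pos_side t w -> pos_side t' w) ->
  nrm t = nrm t' /\ 0 <= ip (nrm t) nu * (off t - off t').
Proof.
move=> ht nt ht' nt' h.
have c0 : ip (nrm t) nu != 0 by apply/eqP => e; apply: nt.
have c0' : ip (nrm t') nu != 0 by apply/eqP => e; apply: nt'.
have hy y : reg y -> 0 < ip (nrm t) nu * f t y -> 0 < ip (nrm t') nu * f t' y.
  move=> ry; have [r Dr hc] := D_transitive rg (x0_reg rg) ry.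
  have DV := D_inv rg Dr.
  have hc' : cell T (act r^-1%g x0) y by have := cell_actT rg r^-1%g hc; rewrite (act_invK rg).
  have sgn u : T u -> (0 < ip (nrm u) nu * f u y) = (0 < ip (nrm u) nu * f u (act r^-1%g x0)).
    move=> hu; have := hc' u hu.
    move: (f u y) (f u _) (ip _ nu) => a b c ba.
    case: (ltrgt0P b) ba => bs; [|rewrite nmulr_rgt0 //|by rewrite bs mul0r ltxx].
      by rewrite pmulr_rgt0 // => as_; rewrite !pmulr_lgt0.
    by move=> as_; rewrite !nmulr_lgt0.
  rewrite !sgn //; move=> p.
  by apply/(pos_sideP _ ht' nt')/(h _ DV)/(pos_sideP _ ht nt).
have hsg u : ip (nrm u) nu != 0 -> exists2 s : R, s ^+ 2 = 1 & 0 < s * ip (nrm u) nu.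
  move=> u0; case: (ltrgt0P (ip (nrm u) nu)) u0 => // p _; [exists 1|exists (-1)]; rewrite ?expr1n ?sqrrN ?expr1n ?mul1r //.
  by rewrite mulN1r oppr_gt0.
have [s s2 sp] := hsg t c0; have [s' s2' sp'] := hsg t' c0'.
have sgn (a b c : R) : a ^+ 2 = 1 -> 0 < a * b -> (0 < b * c) = (0 < a * c).
  move=> a2 ab; have -> : b * c = (a * b) * (a * c) by have -> : a * b * (a * c) = a ^+ 2 * (b * c) by [ring]; rewrite a2 mul1r.
  by rewrite pmulr_rgt0.
have hy' y : reg y -> 0 < s * f t y -> 0 < s' * f t' y.
  by move=> ry; rewrite -(sgn _ _ _ s2 sp) -(sgn _ _ _ s2' sp'); apply: hy.
have rx := x0_reg rg.
have nn := nrm_unit rg ht; have nn' := nrm_unit rg ht'.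
have en : s *: nrm t = s' *: nrm t'.
  apply: contrapT => ne.
  have lt1 : ip (s *: nrm t) (s' *: nrm t') < 1.
    apply: (unit_ip_lt rg) => //; rewrite !ipE ?nn ?nn' mulr1 -expr2 //.
  pose z := s *: nrm t - s' *: nrm t'.
  have ez1 : s * ip (nrm t) z = 1 - ip (s *: nrm t) (s' *: nrm t').
    by rewrite /z !ipE nn; move: s2 => /(congr1 (fun x => x * 1)) s2; rewrite mulrBr mulr1 -expr2; lra.
  have ez2 : s' * ip (nrm t') z = ip (s *: nrm t) (s' *: nrm t') - 1.
    by rewrite /z !ipE nn' (ipC rg (nrm t') (nrm t)) mulrBr mulr1 -expr2 s2'; ring.
  set g := ip _ _ in lt1 ez1 ez2.
  (* Large enough for the displacement to outweigh both values at [x0]; squares replace absolute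
     values. *)
  pose m := (1 + (s * f t x0) ^+ 2 + (s' * f t' x0) ^+ 2) / (1 - g).
  have g0 : 0 < 1 - g by lra.
  have [sg [m1 _ rs]] := regular_on_ray z (s0 := m) (s1 := m + 1) rx ltac:(lra).
  have m2 : 1 + (s * f t x0) ^+ 2 + (s' * f t' x0) ^+ 2 < sg * (1 - g).
    by rewrite -ltr_pdivrMr.
  have f1 : 0 < s * f t (x0 + sg *: z).
    have -> : s * f t (x0 + sg *: z) = s * f t x0 + sg * (1 - g).
      by rewrite (wall_formD rg) (ipZr rg) -ez1; ring.
    by move: m2 (sqr_ge0 (s' * f t' x0)); move: (s * f t x0) (sg * (1 - g)) => a b; nra.
  have := hy' _ rs f1.
  have -> : s' * f t' (x0 + sg *: z) = s' * f t' x0 - sg * (1 - g).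
    by rewrite (wall_formD rg) (ipZr rg); have -> : s' * (f t' x0 + sg * ip (nrm t') z) = s' * f t' x0 + sg * (s' * ip (nrm t') z) by [ring]; rewrite ez2; ring.
  by move: m2 (sqr_ge0 (s * f t x0)); move: (s' * f t' x0) (sg * (1 - g)) => a b; nra.
have sb : s = 1 \/ s = -1 by have : (s == 1) || (s == -1) by [rewrite -sqrf_eq1 s2]; case/orP => /eqP; auto.
have sb' : s' = 1 \/ s' = -1 by have : (s' == 1) || (s' == -1) by [rewrite -sqrf_eq1 s2']; case/orP => /eqP; auto.
have [en' ss] : nrm t = nrm t' /\ s = s'.
  case: sb sb' en => -> [] ->; rewrite ?scale1r ?scaleN1r => e; split=> //.
  - by case: (nrm_opp rg ht ht').
  - by case: (nrm_opp rg ht ht').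
  - by case: (nrm_opp rg ht ht'); rewrite -e opprK.
  - by case: (nrm_opp rg ht ht'); rewrite -e opprK.
  - exact: oppr_inj.
split=> //; rewrite leNgt; apply/negP => lt.
have so : s * off t < s * off t'.
  have : s * (off t - off t') < 0; last lra.
  have : (s * ip (nrm t) nu) * (s * (off t - off t')) < 0.
    by have -> : s * ip (nrm t) nu * (s * (off t - off t')) = s ^+ 2 * (ip (nrm t) nu * (off t - off t')) by [ring]; rewrite s2 mul1r.
  by rewrite pmulr_rlt0.
have [sg [m1 m2 rs]] := regular_on_ray (s *: nrm t) (s0 := s * off t - s * ip (nrm t) x0) (s1 := s * off t' - s * ip (nrm t) x0) rx ltac:(lra).
have ev u : nrm u = nrm t -> s * f u (x0 + sg *: (s *: nrm t)) = s * ip (nrm t) x0 + sg - s * off u.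
  move=> nu_; rewrite /wall_form nu_ !ipE nn.
  have -> : s * (ip (nrm t) x0 + sg * (s * 1) - off u) = s * ip (nrm t) x0 + s ^+ 2 * sg - s * off u by ring.
  by rewrite s2 mul1r.
have := hy' _ rs; rewrite -ss !ev // => hh.
have := hh ltac:(lra); lra.
Qed.
End LeviLattice.

(** * Coordinates on the Levi lattice *)

Section LeviCoordinates.
Variables (R : realType) (V : lmodType R) (W : groupType).
Variables (ip : V -> V -> R) (act lin : W -> V -> V) (T D : set W).
Variables (nrm : W -> V) (off : W -> R) (x0 : V).
Hypothesis rg : reflection_group ip act lin T D nrm off x0.
Notation f := (wall_form ip nrm off).
Notation cell := (cell ip nrm off).
Notation coroot := (coroot T nrm off).
Local Notation ipE := (ipE rg).
Notation walls_at := (walls_at ip T nrm off).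

Variables (q : W) (nu : V).
Hypothesis Dq : D q.
Hypothesis hq : forall x, act q x = x + nu.
Notation T0 := (nu_walls ip T nrm nu).
Notation levi_group := (levi_group ip act T D nrm off x0 q nu).
Notation levi_pos_gen := (levi_pos_gen ip act T D nrm off x0 q nu).

Section WithSimpleRoots.
Variable rho : V.
Hypothesis rho_reg : forall v, coroot v -> ip rho v != 0.
Hypothesis rho_nu : forall v, coroot v -> 0 < ip nu v -> 0 < ip rho v.
Variable Del : seq V.
Hypothesis Del_uniq : uniq Del.
Hypothesis DelP : forall v, v \in Del <-> simple_root ip coroot rho v.
Variable o : V.
Hypothesis special : forall t, T t -> exists t', [/\ T t', nrm t' = nrm t & f t' o = 0].
Variable om : V -> V.
Hypothesis omP : forall j a, a \in Del -> ip a (om j) = (a == j)%:R.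

(** The family [om] is the dual basis of [Del], its fundamental weights. As [nu] is dominant, [B]
    consists of the simple coroots that pair positively with it; coordinates along the others are
    absorbed by [gen T0]. *)
Let B := [seq a <- Del | ip nu a != 0].
Let n (a : W) (j : V) : R := ip (om j) (act a x0 - x0).

Lemma B_Del j : j \in B -> j \in Del /\ 0 < ip nu j.
Proof.
rewrite mem_filter => /andP[h jD]; split=> //.
rewrite lt_neqAle eq_sym h; exact: (Del_nu_ge0 rg rho_nu DelP).
Qed.

Lemma om_sum j (c : V -> R) : j \in Del -> ip (om j) (\sum_(a <- Del) c a *: a) = c j.
Proof.
move=> jD; rewrite (ip_sumr rg) (bigD1_seq j) //= (ipZr rg) (ipC rg) omP // eqxx mulr1.
rewrite big_seq_cond big1 ?addr0 // => a /andP[aD /negPf aj].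
by rewrite (ipZr rg) (ipC rg) omP // aj mulr0.
Qed.

(** A positive coroot orthogonal to [nu] is a nonnegative combination of simple ones; their
    contributions to the pairing with [nu] are nonnegative with sum 0, so members of [B] do not
    occur. *)
Lemma om_T0 j t : j \in B -> T0 t -> ip (om j) (nrm t) = 0.
Proof.
move=> /B_Del[jD jn] [ht h0].
have [d [d0 _] ct] := coroot_of rg ht.
have d2 : 2 * d != 0 by rewrite mulf_neq0 ?pnatr_eq0 ?gt_eqF.
have key v : pos_root ip coroot rho v -> ip nu v = 0 -> ip (om j) v = 0.
  move=> /(coroot_sum rg Del_uniq DelP)[m ->]; rewrite (ip_sumr rg) om_sum // => s0.
  have ge a : a \in Del -> 0 <= ip nu ((m a)%:R *: a).
    by move=> aD; rewrite (ipZr rg) mulr_ge0 ?ler0n //; apply: (Del_nu_ge0 rg rho_nu DelP).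
  have : ip nu ((m j)%:R *: j) = 0.
    apply/le_anti/andP; split; last exact: ge.
    by rewrite -s0 (bigD1_seq j) //= lerDl big_seq_cond sumr_ge0 // => a /andP[aD _]; apply: ge.
  by rewrite (ipZr rg) => /eqP; rewrite mulf_eq0 (gt_eqF jn) orbF => /eqP.
have e : ip (om j) ((2 * d) *: nrm t) = 0.
  have n0 : ip nu ((2 * d) *: nrm t) = 0 by rewrite (ipZr rg) (ipC rg) h0 mulr0.
  case: (coroot_sign rg rho_reg ct) => p; first exact: key.
  by have := key _ p; rewrite !(ipNr rg) n0 oppr0 => /(_ erefl)/eqP; rewrite oppr_eq0 => /eqP.
by move: e; rewrite (ipZr rg) => /eqP; rewrite mulf_eq0 (negPf d2) => /eqP.
Qed.

Lemma om_gen_T0 j r x : j \in B -> gen T0 r -> ip (om j) (act r x - x) = 0.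
Proof. by move=> jB; apply: (T0_displacement rg) => t; apply: om_T0. Qed.

(** Write the element as a root lattice translation after an element fixing [o]. The latter fixes
    [nu], so [special_stabilizer] puts it in [gen T0]. *)
Lemma levi_decomp a : levi_group a -> exists (z : V -> int) p,
  [/\ D p, (forall x, act p x = x + \sum_(b <- Del) (z b)%:~R *: b) & gen T0 (a * p^-1)%g].
Proof.
move=> ha; have la := levi_lin rg Dq hq ha; have [Da _ _] := ha.
have [mu [r [ql hr hx]]] := special_decomposition rg rho_reg Del_uniq DelP special Da.
have ll x : lin a x = lin r x.
  have := act_lin rg r x 0; have := act_lin rg a x 0; rewrite subr0 => <- <-.
  by rewrite !hx; apply: (ip_ext rg) => z; rewrite !ipE; ring.
have hr0 : gen T0 r.
  by apply: (special_stabilizer rg rho_reg rho_nu hr); rewrite -ll.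
have [p Dp hp] := root_lattice_translation rg DelP ql.
have [z ez] := ql; exists z, p; rewrite -ez; split=> //.
have -> : a = (p * r)%g.
  apply: (D_faithful rg Da); first by apply: (D_mul rg) => //; apply: (gen_T0_D rg hr0).
  by rewrite (rg_actM rg) hp hx.
apply: (gen_T0_conj rg) => //; exact: (lin_translation rg hp).
Qed.

(** Elements of [gen T0] do not change this coordinate, so it is independent of [x]; additivity of
    [n] rests on this. *)
Lemma n_decomp a p (z : V -> int) j x : j \in B ->
  (forall x, act p x = x + \sum_(b <- Del) (z b)%:~R *: b) -> gen T0 (a * p^-1)%g ->
  ip (om j) (act a x - x) = (z j)%:~R.
Proof.
move=> jB hp hr; have [jD _] := B_Del jB.
have -> : act a x - x = (act (a * p^-1)%g (act p x) - act p x) + (act p x - x).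
  by rewrite -(rg_actM rg) mulgVK addrA subrK.
rewrite (ipDr rg) om_gen_T0 // add0r hp addrAC subrr add0r.
by rewrite (om_sum (fun b => (z b)%:~R)).
Qed.

Lemma n_mul a b j : levi_group a -> levi_group b -> j \in B -> n (a * b)%g j = n a j + n b j.
Proof.
move=> ha hb jB; have [z [p [_ hp hr]]] := levi_decomp ha.
have e : n a j = ip (om j) (act a (act b x0) - act b x0).
  by rewrite /n !(n_decomp _ jB hp hr).
by rewrite e /n -(ipDr rg) (rg_actM rg) addrA subrK.
Qed.

Lemma n_int a j : levi_group a -> j \in B -> exists k : int, n a j = k%:~R.
Proof.
move=> ha jB; have [z [p [_ hp hr]]] := levi_decomp ha.
by exists (z j); rewrite /n (n_decomp _ jB hp hr).
Qed.

(** Without components along [B], the translation part is a combination of coroots orthogonal to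
    [nu] and lies in [gen T0]. So does [a], and [T0_free] makes it trivial. *)
Lemma n_inj a : levi_group a -> (forall j, j \in B -> n a j = 0) -> a = 1%g.
Proof.
move=> ha h0; have [z [p [Dp hp hr]]] := levi_decomp ha.
have [Da _ ca] := ha.
have z0 j : j \in B -> z j = 0.
  move=> jB; have := h0 j jB; rewrite /n (n_decomp _ jB hp hr) => /eqP.
  by rewrite intr_eq0 => /eqP.
have gp : gen T0 p.
  have [p' hp' ep'] : exists2 p', gen T0 p' & forall x, act p' x = x + \sum_(b <- Del) (z b)%:~R *: b.
    rewrite big_seq; elim/big_rec: _ => [|b v bD [p' hp' ep']].
      by exists 1%g => [|x]; [exact: gen1|rewrite (rg_act1 rg) addr0].
    have [b0|b0] := eqVneq (ip nu b) 0; last first.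
      by exists p' => // x; rewrite ep' z0 ?scale0r ?add0r // mem_filter b0.
    have [t [t' [c [ht ht' et htr [c0 ec]]]]] := coroot_translation rg (Del_coroot DelP bD).
    have t0 : ip (nrm t) nu = 0.
      by move: b0; rewrite ec (ipZr rg) (ipC rg) => /eqP; rewrite mulf_eq0 (negPf c0) => /eqP.
    have gt : gen T0 (t * t')%g.
      by apply: genM; [|apply: gen_incl]; split=> //; rewrite -et.
    have powk (k : nat) : exists2 p1, gen T0 p1 & forall x, act p1 x = x + k%:R *: b.
      elim: k => [|k [p1 g1 e1]].
        by exists 1%g => [|x]; [exact: gen1|rewrite (rg_act1 rg) scale0r addr0].
      exists (p1 * (t * t'))%g => [|x]; first exact: gen_mul.
      by rewrite (rg_actM rg) htr e1 -natr1 scalerDl scale1r -addrA [b + _]addrC.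
    have [p2 g2 e2] : exists2 p1, gen T0 p1 & forall x, act p1 x = x + (z b)%:~R *: b.
      case: (z b) => k; first exact: powk.
      have [p1 g1 e1] := powk k.+1; exists p1^-1%g => [|x]; first exact: (gen_inv rg (@T0_T R V W ip T nrm nu)).
      by rewrite -{1}[x](subrK ((k.+1)%:R *: b)) -e1 (act_invK rg) NegzE mulrNz scaleNr.
    exists (p' * p2)%g => [|x]; first exact: gen_mul.
    by rewrite (rg_actM rg) ep' e2 addrA.
  have -> // : p = p'.
  by apply: (D_faithful rg Dp (gen_T0_D rg hp')); rewrite hp ep'.
have ga : gen T0 a by rewrite -[a](mulgVK p); apply: gen_mul.
exact: (T0_free rg ga (x0_reg rg) ca).
Qed.

Lemma n_surj (z : V -> int) : exists a p, [/\ levi_group a, (forall j, j \in B -> n a j = (z j)%:~R),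
  D p, (forall x, act p x = x + \sum_(b <- Del) (z b)%:~R *: b) & gen T0 (a * p^-1)%g].
Proof.
have ql : root_lattice Del (\sum_(b <- Del) (z b)%:~R *: b) by exists z.
have [p Dp hp] := root_lattice_translation rg DelP ql.
have lp : lin p nu = nu by apply: (lin_translation rg hp).
have [a ha hr] := levi_proj rg Dq hq Dp lp.
by exists a, p; split=> // j jB; rewrite /n (n_decomp _ jB hp hr).
Qed.

Lemma n_pos_gen a j : levi_pos_gen a -> j \in B -> 0 <= n a j.
Proof.
move=> [ha [t [t' [[ht nt] [ht' nt'] hpos hr]]]] jB.
have [jD _] := B_Del jB.
have [en op] := pos_side_all rg hq ht nt ht' nt' hpos.
have c0 : ip (nrm t) nu != 0 by apply/eqP => e; apply: nt.
have -> : n a j = ip (om j) ((2 * (off t - off t')) *: nrm t).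
  have -> : n a j = ip (om j) (act (a * (t * t')^-1)%g (act (t * t')%g x0) - act (t * t')%g x0 + (act (t * t')%g x0 - x0)).
    by rewrite -(rg_actM rg) mulgVK addrA subrK.
  by rewrite (ipDr rg) om_gen_T0 // add0r (act_parallel rg _ ht ht' en) addrAC subrr add0r.
have [d [d0 _] ct] := coroot_of rg ht.
have key v (c : R) : pos_root ip coroot rho v -> 0 <= c -> 0 <= ip (om j) (c *: v).
  move=> /(coroot_sum rg Del_uniq DelP)[m ->] hc.
  by rewrite (ipZr rg) om_sum // mulr_ge0 ?ler0n.
have sgn v : coroot v -> pos_root ip coroot rho v -> 0 <= ip nu v.
  move=> cv [_ pv]; rewrite leNgt; apply/negP => lt.
  have := rho_nu (corootN cv); rewrite !(ipNr rg) !oppr_gt0 => /(_ lt).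
  by move=> /(lt_trans pv); rewrite ltxx.
pose c := (off t - off t') / d.
have ec : 2 * (off t - off t') = c * (2 * d) by rewrite /c; field; rewrite gt_eqF.
have dd : 0 < 2 * d by lra.
have dn : ip nu ((2 * d) *: nrm t) = 2 * d * ip (nrm t) nu by rewrite (ipZr rg) (ipC rg).
have oc : off t - off t' = c * d by rewrite /c divfK // gt_eqF.
rewrite ec -scalerA; case: (coroot_sign rg rho_reg ct) => p.
  apply: key => //; have := sgn _ ct p; rewrite dn pmulr_rge0 // le_eqVlt eq_sym (negPf c0) /= => nn.
  by move: op; rewrite pmulr_rge0 // oc pmulr_lge0.
have -> : c *: ((2 * d) *: nrm t) = (- c) *: (- ((2 * d) *: nrm t)) by rewrite scalerN scaleNr opprK.
apply: key => //; have := sgn _ (corootN ct) p; rewrite (ipNr rg) oppr_ge0 dn pmulr_rle0 // le_eqVlt (negPf c0) /= => nn.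
by move: op; rewrite nmulr_rge0 // oc pmulr_lle0 // oppr_ge0.
Qed.

Lemma gen_levi a : gen levi_pos_gen a -> levi_group a.
Proof.
elim=> [|t w [ht _] _ ih]; first exact: (levi_one rg q nu).
exact: (levi_mul rg Dq hq).
Qed.

Lemma n_one j : n 1%g j = 0.
Proof. by rewrite /n (rg_act1 rg) subrr (ip0r rg). Qed.

Lemma n_gen_ge0 a j : gen levi_pos_gen a -> j \in B -> 0 <= n a j.
Proof.
move=> h jB; elim: h => [|t w ht hw ih]; first by rewrite n_one.
by rewrite n_mul ?addr_ge0 ?(n_pos_gen ht) //; [case: ht|apply: gen_levi].
Qed.

Lemma n_basis j : j \in B -> exists2 a, levi_pos_gen a & forall i, i \in B -> n a i = (i == j)%:R.
Proof.
move=> jB; have [jD jn] := B_Del jB.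
have [a [p [ha hn Dp hp hr]]] := n_surj (fun i => (i == j : nat)).
exists a => [|i iB]; last by rewrite hn.
split=> //.
have sj : \sum_(b <- Del) (((b == j) : nat) : int)%:~R *: b = j :> V.
  rewrite (bigD1_seq j) //= eqxx scale1r big1 ?addr0 // => b /negPf ->.
  by rewrite scale0r.
rewrite sj in hp.
have [t [t' [c [ht ht' et htr [c0 ec]]]]] := coroot_translation rg (Del_coroot DelP jD).
have n0 : ip (nrm t) nu != 0.
  by move: jn; rewrite {1}ec (ipZr rg) (ipC rg); apply: contraTneq => ->; rewrite mulr0 ltxx.
have nt : ~ T0 t by move=> [_ e]; rewrite e eqxx in n0.
have nt' : ~ T0 t' by move=> [_ e]; rewrite et e eqxx in n0.
have oc : c = 2 * (off t - off t').
  have := htr x0; rewrite (act_parallel rg _ ht ht' et) => /addrI.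
  rewrite [X in _ = X -> _]ec => /(congr1 (ip (nrm t))); rewrite !(ipZr rg) (nrm_unit rg ht) !mulr1.
  by move=> ->.
exists t, t'; split=> //; last first.
  have -> // : (t * t')%g = p.
  apply: (D_faithful rg) => //; first by apply: (D_mul rg); apply: (T_sub_D rg).
  by rewrite htr hp.
move=> w Dw /(pos_sideP rg hq _ ht nt) h1; apply/(pos_sideP rg hq _ ht' nt').
have -> : f t' (act w x0) = f t (act w x0) + (off t - off t').
  by rewrite /wall_form et; ring.
rewrite -et mulrDr addr_gt0 //.
have : 0 < c * ip (nrm t) nu by rewrite -(ipZl rg) -ec (ipC rg).
by rewrite oc; lra.
Qed.

Lemma n_ge0_gen a : levi_group a -> (forall j, j \in B -> 0 <= n a j) -> gen levi_pos_gen a.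
Proof.
move=> ha h0.
have [z hz] : exists z : V -> nat, forall j, j \in B -> n a j = (z j)%:R.
  have ex j : exists m : nat, j \in B -> n a j = m%:R.
    have [jB|jB] := boolP (j \in B); last by exists 0%N.
    have [k hk] := n_int ha jB; have := h0 j jB; rewrite hk ler0z.
    by case: k hk => k hk // _; exists k.
  by have [z hz] := boolp.choice ex; exists z.
have uB : uniq B by rewrite filter_uniq.
have build (l : seq V) : uniq l -> {subset l <= B} -> exists2 b, gen levi_pos_gen b &
    forall j, j \in B -> n b j = (if j \in l then (z j)%:R else 0).
  elim: l => [_ _|i l ih /= /andP[il ul] sub].
    by exists 1%g => [|j jB]; [exact: gen1|rewrite n_one].
  have [b gb hb] := ih ul (fun j jl => sub j ltac:(by rewrite in_cons jl orbT)).
  have iB : i \in B by apply: sub; rewrite mem_head.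
  have [e he hne] := n_basis iB.
  have [b' gb' hb'] : exists2 b', gen levi_pos_gen b' & forall j, j \in B -> n b' j = (z i)%:R * (j == i)%:R.
    elim: (z i) => [|k [b' gb' hb']].
      by exists 1%g => [|j jB]; [exact: gen1|rewrite n_one mul0r].
    exists (e * b')%g => [|j jB]; first exact: genM.
    rewrite n_mul //; [|by case: he|exact: gen_levi].
    by rewrite hne // hb' // -natr1; ring.
  exists (b' * b)%g => [|j jB]; first exact: gen_mul.
  rewrite n_mul //; try exact: gen_levi.
  rewrite hb' // hb // in_cons; have [->|ji] := eqVneq j i.
    by rewrite (negPf il) mulr1 addr0.
  by rewrite mulr0 add0r.
have [b gb hb] := build B uB (fun _ h => h).
suff -> : a = b by [].
have lb := gen_levi gb.
have hbV := levi_inv rg Dq hq lb.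
have : (a * b^-1)%g = 1%g.
  apply: n_inj; first exact: (levi_mul rg Dq hq).
  move=> j jB; rewrite n_mul // hz //.
  have : n b j + n b^-1%g j = 0 by rewrite -n_mul // mulgV n_one.
  by rewrite hb // jB; lra.
by move/(congr1 (fun x => x * b)%g); rewrite mulgVK mul1g.
Qed.
End WithSimpleRoots.

(** The Levi group is an integral lattice whose coordinatewise cone is generated by [levi_pos_gen].
    The order is thus intrinsic: an automorphism preserving [levi_pos_gen] preserves it, whatever it
    does to the chosen simple coroots. *)
Lemma levi_lattice : exists (B : seq V) (n : W -> V -> R),
  [/\ forall a b j, levi_group a -> levi_group b -> j \in B -> n (a * b)%g j = n a j + n b j,
      forall a, levi_group a -> (forall j, j \in B -> n a j = 0) -> a = 1%g,
      forall z : V -> int, exists a, levi_group a /\ forall j, j \in B -> n a j = (z j)%:~R,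
      forall a j, levi_group a -> j \in B -> exists k : int, n a j = k%:~R &
      forall a, levi_group a -> (gen levi_pos_gen a <-> forall j, j \in B -> 0 <= n a j)].
Proof.
have [rho [r1 r2]] := generic_near rg nu.
have [Del [ud dp]] := simple_roots_ex ip rho (coroot_finite rg).
have [o ho] := special_point_ex rg r1 ud dp.
have ex j : exists w, forall a, a \in Del -> ip a w = (a == j)%:R.
  by have [w _ hw] := solve_independent rg (fun a => (a == j)%:R) ud (Del_independent rg r1 ud dp); exists w.
have [om hom] := boolp.choice ex.
exists [seq a <- Del | ip nu a != 0], (fun a j => ip (om j) (act a x0 - x0)); split.
- by move=> a b j ha hb hj; apply: (n_mul r1 r2 ud dp ho hom).
- by move=> a ha; apply: (n_inj r1 r2 ud dp ho hom).
- move=> z; have [a [p [ha hn _ _ _]]] := n_surj r1 r2 ud dp hom z.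
  by exists a.
- by move=> a j; apply: (n_int r1 r2 ud dp ho hom).
move=> a ha; split; first by move=> g j; apply: (n_gen_ge0 r1 r2 ud dp ho hom g).
by apply: (n_ge0_gen r1 r2 ud dp ho hom).
Qed.
End LeviCoordinates.

(** * Conjugation of straight elements *)

Section StraightConjugation.
Variables (R : realType) (V : lmodType R) (W : groupType).
Variables (ip : V -> V -> R) (act lin : W -> V -> V) (T D : set W).
Variables (nrm : W -> V) (off : W -> R) (x0 : V).
Hypothesis rg : reflection_group ip act lin T D nrm off x0.
Notation f := (wall_form ip nrm off).
Notation sep := (separates ip nrm off).
Notation cell := (cell ip nrm off).
Notation ell := (ell rg).
Local Notation ipE := (ipE rg).

Variable alpha : W -> W.
Hypothesis al : diagram_aut rg alpha.

Lemma twisted_powerD u n : D u -> D (twisted_power alpha u n).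
Proof.
move=> Du; elim: n => [|n ih]; first by rewrite /twisted_power big_ord0; apply: (D_one rg).
by rewrite twisted_powerS; apply: (D_mul rg) => //; apply: (al_iterD al).
Qed.

Lemma twisted_powerSl u n : D u -> twisted_power alpha u n.+1 = (u * alpha (twisted_power alpha u n))%g.
Proof.
move=> Du; elim: n => [|n ih].
  by rewrite twisted_powerS /twisted_power big_ord0 mul1g (al_1 al) mulg1.
rewrite twisted_powerS {1}ih [in RHS]twisted_powerS (al_mul al) ?mulgA //; first exact: twisted_powerD.
exact: (al_iterD al).
Qed.

Lemma twisted_power_add u n m : D u ->
  twisted_power alpha u (n + m) = (twisted_power alpha u n * iter n alpha (twisted_power alpha u m))%g.
Proof.
move=> Du; elim: m => [|m ih].
  rewrite addn0 {3}/twisted_power big_ord0.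
  have -> : iter n alpha 1%g = 1%g by elim: n => //= n ->; rewrite (al_1 al).
  by rewrite mulg1.
rewrite addnS twisted_powerS ih [in RHS]twisted_powerS (al_iter_mul al) ?mulgA.
- by rewrite -iterD.
- exact: twisted_powerD.
- exact: (al_iterD al).
Qed.

Lemma twisted_power_mul u N n : D u -> (forall w, D w -> iter N alpha w = w) ->
  twisted_power alpha u (n * N) = (twisted_power alpha u N ^+ n)%g.
Proof.
move=> Du hN; elim: n => [|n ih]; first by rewrite mul0n expg0 /twisted_power big_ord0.
by rewrite mulSn twisted_power_add // hN; [rewrite ih expgS|apply: twisted_powerD].
Qed.

Lemma twisted_power_conj u u' w n : D u -> D u' -> D w -> (u * alpha w = w * u')%g ->
  (twisted_power alpha u n * iter n alpha w = w * twisted_power alpha u' n)%g.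
Proof.
move=> Du Du' Dw e; elim: n => [|n ih].
  by rewrite /twisted_power !big_ord0 mul1g mulg1.
rewrite !twisted_powerS mulgA -ih -!mulgA; congr (_ * _)%g.
rewrite -(al_iter_mul al) // iterSr -(al_iter_mul al) ?e //.
exact: (al_D al).
Qed.

Definition straight_power u := forall n, ell (twisted_power alpha u n) = (n * ell u)%N.

(** Lengths of successive twisted powers add, so a wall once crossed is never crossed back. *)
Lemma straight_sep_mono u t n m : D u -> straight_power u -> T t ->
  sep t x0 (act (twisted_power alpha u n) x0) -> (n <= m)%N -> sep t x0 (act (twisted_power alpha u m) x0).
Proof.
move=> Du su ht h; elim: m => [|m ih]; first by rewrite leqn0 => /eqP <-.
rewrite leq_eqVlt => /orP[/eqP <- //|]; rewrite ltnS => /ih {}ih.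
have e : ell (twisted_power alpha u m.+1) = (ell (twisted_power alpha u m) + ell (iter m alpha u))%N.
  by rewrite !su (al_iter_ell al) // mulSn addnC.
rewrite twisted_powerS in e *.
have := proj1 (ellM_add rg _ _) e t ht ih => h2.
by apply/(sep_trans ht (x0_reg rg) (reg_act_x0 rg (twisted_power alpha u m)) (reg_act_x0 rg _)); left.
Qed.

(** By monotonicity the wall would still separate [x0] from its translate by [n%:R *: nu],
    impossible for a wall parallel to [nu]. *)
Lemma straight_parallel u N nu t n : D u -> straight_power u -> (0 < N)%N ->
  (forall w, D w -> iter N alpha w = w) ->
  (forall x, act (twisted_power alpha u N) x = x + nu) -> T t -> ip (nrm t) nu = 0 ->
  ~ sep t x0 (act (twisted_power alpha u n) x0).
Proof.
move=> Du su N0 hN hq ht h0 hs.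
have := straight_sep_mono Du su ht hs (leq_pmulr n N0).
rewrite twisted_power_mul // (act_expg rg).
have -> : iter n (act (twisted_power alpha u N)) x0 = x0 + n%:R *: nu.
  elim: n {hs} => [|n ih]; first by rewrite scale0r addr0.
  by rewrite iterS ih hq -natr1 scalerDl scale1r addrA.
by rewrite /separates (wall_formD rg) (ipZr rg) h0 mulr0 addr0 -expr2 ltNge sqr_ge0.
Qed.

Variables (sW : W -> W) (sA sC : V -> V).
Hypothesis sg : equivariant ip act T D x0 sW sA sC.
Hypothesis al_sW : forall w, D w -> alpha (sW w) = sW (alpha w).

Variables (u u' : W).
Hypothesis (Du : D u) (Du' : D u').
Hypothesis (su : sW u = u) (su' : sW u' = u').
Hypothesis (stu : straight_power u) (stu' : straight_power u').

(** The order of [alpha] makes twisted powers ordinary powers, and the order of the linear part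
    makes those translations. *)
Lemma translation_power_ex : exists N nu, [/\ (0 < N)%N, forall w, D w -> iter N alpha w = w &
  forall x, act (twisted_power alpha u N) x = x + nu].
Proof.
have [k k0 hk] := al_finite al.
have [m m0 hm] := lin_finite rg (twisted_power alpha u k).
exists (m * k)%N, (act (twisted_power alpha u (m * k)) 0); split; first by rewrite muln_gt0 m0.
  by move=> w Dw; elim: (m) => // j ih; rewrite mulSn iterD ih hk.
move=> x; rewrite (act_lin0 rg) twisted_power_mul // (lin_expg rg) hm addrC.
by congr (_ + _).
Qed.

Section Fixed.
Variables (N : nat) (nu : V).
Hypothesis N0 : (0 < N)%N.
Hypothesis hN : forall w, D w -> iter N alpha w = w.
Let q := twisted_power alpha u N.
Hypothesis hq : forall x, act q x = x + nu.
Notation T0 := (nu_walls ip T nrm nu).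
Notation levi_group := (levi_group ip act T D nrm off x0 q nu).
Notation levi_pos_gen := (levi_pos_gen ip act T D nrm off x0 q nu).

Let Dq : D q. Proof. exact: twisted_powerD. Qed.
(** An automorphism of [D] fixing [q]. The map [g] is its companion on chambers, with
    [g (x * y) = phi x * g y], and a conjugator is a solution of [g w = w * u']; left multiplication
    by a fixed point of [phi] preserves solutions. *)
Let phi x := (u * alpha x * u^-1)%g.
Let g x := (u * alpha x)%g.

Lemma phi_D x : D x -> D (phi x).
Proof. by move=> Dx; apply: (D_mul rg) (D_inv rg Du); apply: (D_mul rg) => //; apply: (al_D al). Qed.

Lemma phi_mul x y : D x -> D y -> phi (x * y)%g = (phi x * phi y)%g.
Proof. by move=> Dx Dy; rewrite /phi (al_mul al) // !mulgA mulgVK. Qed.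

Lemma phi_g x y : D x -> D y -> g (x * y)%g = (phi x * g y)%g.
Proof. by move=> Dx Dy; rewrite /phi /g (al_mul al) // !mulgA mulgVK. Qed.

Lemma phi_V x : D x -> phi (x^-1)%g = (phi x)^-1%g.
Proof. by move=> Dx; rewrite /phi (al_V al) // !invgM invgK mulgA. Qed.

Lemma phi_1 : phi 1%g = 1%g.
Proof. by rewrite /phi (al_1 al) mulg1 mulgV. Qed.

Lemma phi_q : phi q = q.
Proof. by rewrite /phi /q -twisted_powerSl // twisted_powerS hN // mulgK. Qed.

Lemma phi_iter i x : D x -> iter i phi x = (twisted_power alpha u i * iter i alpha x * (twisted_power alpha u i)^-1)%g.
Proof.
move=> Dx; elim: i => [|i ih]; first by rewrite /twisted_power big_ord0 mul1g invg1 mulg1.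
have Di := al_iterD al i Dx; have Dt := twisted_powerD i Du.
rewrite iterS ih twisted_powerSl // /phi !(al_mul al) ?(al_V al) ?invgM //; first by rewrite -iterS !mulgA.
all: by repeat first [exact: Di | exact: Dt | apply: (D_mul rg) | apply: (D_inv rg)].
Qed.

(** The [N]-th iterate of [phi] is conjugation by [q], so [phi] has finite order on the centralizer
    of [q]. *)
Lemma phi_N x : D x -> (x * q = q * x)%g -> iter N phi x = x.
Proof. by move=> Dx e; rewrite phi_iter // hN // -/q -e mulgK. Qed.

Lemma phi_T t : T t -> T (phi t).
Proof. by move=> ht; apply: (T_conj rg); apply: (al_T al). Qed.

Lemma phi_T0 t : T0 t -> T0 (phi t).
Proof.
move=> ht; have Tt := T0_T ht; have Dt := T_sub_D rg Tt.
apply/(T0_comm rg Dq hq (phi_T Tt)); rewrite -{1 2}phi_q -!phi_mul //; congr (phi _).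
exact/(T0_comm rg Dq hq).
Qed.

Lemma phi_T0_surj t : T0 t -> exists2 t0, T0 t0 & phi t0 = t.
Proof.
move=> ht; have Tt := T0_T ht; have Dt := T_sub_D rg Tt.
exists (iter N.-1 phi t); first by elim: (N.-1) => //= i; apply: phi_T0.
by rewrite -iterS (prednK N0) phi_N //; apply/(T0_comm rg Dq hq).
Qed.

Lemma phi_gen r : gen T0 r -> gen T0 (phi r).
Proof.
elim=> [|t w ht hw ih]; first by rewrite phi_1; apply: gen1.
rewrite phi_mul; [by apply: genM => //; apply: phi_T0|exact: (T_sub_D rg (T0_T ht))|exact: (gen_T0_D rg hw)].
Qed.

Lemma sep_g t x y : T t -> D x -> D y ->
  sep (phi t) (act (g x) x0) (act (g y) x0) <-> sep t (act x x0) (act y x0).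
Proof.
move=> ht Dx Dy; rewrite -(al_sep al ht Dx Dy) /g !(rg_actM rg).
by apply: (sep_conj rg); apply: (al_T al).
Qed.

Lemma cell_of_nsep x y : (forall t, T0 t -> ~ sep t (act x x0) (act y x0)) ->
  cell T0 (act x x0) (act y x0).
Proof. by apply: nsep_cell => t /T0_T ht; exact: (reg_act_x0 rg _ ht). Qed.

Lemma cell_g x y : D x -> D y -> cell T0 (act x x0) (act y x0) -> cell T0 (act (g x) x0) (act (g y) x0).
Proof.
move=> Dx Dy h; apply: cell_of_nsep => t /phi_T0_surj[t0 ht0 <-].
by move/(sep_g (T0_T ht0) Dx Dy); apply: (cell_nsep h).
Qed.

Lemma q_sW : sW q = q.
Proof.
have it i : sW (iter i alpha u) = iter i alpha u.
  by elim: i => //= i ih; rewrite -al_sW ?ih //; apply: (al_iterD al).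
rewrite /q; elim: (N) => [|i ih]; first by rewrite /twisted_power big_ord0 (sW_1 rg sg).
by rewrite twisted_powerS (sW_mul sg) ?ih ?it //; [apply: twisted_powerD|apply: (al_iterD al)].
Qed.

Lemma sW_T0 t : T0 t -> T0 (sW t).
Proof.
move=> ht; have Tt := T0_T ht; have Dt := T_sub_D rg Tt.
apply/(T0_comm rg Dq hq (sW_T sg Tt)); rewrite -{1 2}q_sW -!(sW_mul sg) //; congr (sW _).
exact/(T0_comm rg Dq hq).
Qed.

Lemma sW_surj (P : W -> Prop) x : (forall y, P y -> P (sW y)) -> P x -> D x -> exists2 y, P y & sW y = x.
Proof.
move=> hP px Dx; have [k k0 hk] := sW_finite sg.
exists (iter k.-1 sW x); first by elim: (k.-1) => //= i; apply: hP.
by rewrite -iterS (prednK k0) hk.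
Qed.

Lemma sep_sW t x y : T t -> D x -> D y ->
  sep (sW t) (act (sW x) x0) (act (sW y) x0) <-> sep t (act x x0) (act y x0).
Proof.
move=> ht Dx Dy; have [s s0 e] := wall_sigma rg sg ht.
have e2 z : act (sW z) x0 = sA (act z x0) by rewrite (sA_act sg) (sA_x0 sg).
have s2 : 0 < s * s by rewrite -expr2 exprn_even_gt0.
by rewrite /separates !e2 !e mulrACA (pmulr_rlt0 _ s2).
Qed.

Lemma cell_sW x y : D x -> D y -> cell T0 (act x x0) (act y x0) -> cell T0 (act (sW x) x0) (act (sW y) x0).
Proof.
move=> Dx Dy h; apply: cell_of_nsep => t ht.
have [t0 ht0 <-] := sW_surj sW_T0 ht (T_sub_D rg (T0_T ht)).
by move/(sep_sW (T0_T ht0) Dx Dy); apply: (cell_nsep h).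
Qed.

Lemma sW_gen_T0 r : gen T0 r -> gen T0 (sW r).
Proof. by apply: (sW_gen rg sg (@T0_T R V W ip T nrm nu)); apply: sW_T0. Qed.

Lemma cell_1u : cell T0 x0 (act u x0).
Proof.
have := @cell_of_nsep 1%g u; rewrite (rg_act1 rg); apply=> t [ht h0].
have := straight_parallel (n := 1) Du stu N0 hN hq ht h0.
by rewrite /twisted_power big_ord1.
Qed.

(* Walls parallel to nu separate the two chambers but neither line of chambers; removing them commutes with the
   twisted conjugation by the uniqueness of the reflecting element. *)
Lemma reduce_parallel w : D w -> (u * alpha w = w * u')%g ->
  exists w1, [/\ D w1, (u * alpha w1 = w1 * u')%g & cell T0 x0 (act w1 x0)].
Proof.
move=> Dw e.
have nz y t : T0 t -> f t (act y x0) != 0 by move=> /T0_T ht; exact: (reg_act_x0 rg y ht).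
have nz1 t : T0 t -> f t x0 != 0 by move=> /T0_T; apply: (x0_regular rg).
have [r hr hc] := cell_transitive rg (@T0_T R V W ip T nrm nu) (T0_conj_closed rg (nu := nu)) nz1 (nz w).
have Dr := gen_T0_D rg hr.
(* The [N]-th twisted power of [u'] translates by [lin w^-1 nu], so straightness of [u'] keeps it
   from crossing walls that [w] carries to walls parallel to [nu]. *)
have cw : cell T0 (act w x0) (act (w * u')%g x0).
  apply: cell_of_nsep => t [ht h0] hs.
  have ht' : T (w^-1 * t * w)%g by rewrite -{2}[w]invgK; apply: (T_conj rg).
  have hq' x : act (twisted_power alpha u' N) x = x + lin w^-1%g nu.
    have := twisted_power_conj N Du Du' Dw e; rewrite hN // => /(congr1 (fun y => w^-1 * y)%g).
    by rewrite mulKg => <-; rewrite !(rg_actM rg) hq (actD rg) (act_invK rg).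
  have h0' : ip (nrm (w^-1 * t * w)%g) (lin w^-1%g nu) = 0.
    by have := conj_normal rg w^-1%g ht; rewrite invgK => -[] [-> _]; rewrite ?(ipNl rg) (lin_ip rg) h0 ?oppr0.
  apply: (straight_parallel (n := 1) Du' stu' N0 hN hq' ht' h0').
  rewrite /twisted_power big_ord1; apply/(sep_conjV rg _ _ _ ht).
  by rewrite -(rg_actM rg).
have hr' := phi_gen hr.
have erw : g (r * w)%g = (phi r * w * u')%g by rewrite phi_g // /g e mulgA.
have c1 : cell T0 x0 (act (phi r * w)%g x0).
  apply: (cell_trans cell_1u).
  have h1 : cell T0 (act (g 1%g) x0) (act (g (r * w)%g) x0).
    apply: cell_g; [exact: (D_one rg)|exact: (D_mul rg)|].
    by rewrite (rg_act1 rg) (rg_actM rg).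
  rewrite erw /g (al_1 al) mulg1 in h1; apply: (cell_trans h1); apply: cell_sym.
  rewrite -(mulgA (phi r) w u') (rg_actM rg (phi r) w) (rg_actM rg (phi r) (w * u')%g).
  by apply: (cell_T0_act rg) => //; apply: (gen_T0_lin rg).
(* Both [phi r] and [r] carry [act w x0] into the [T0]-cell of [x0]. *)
have e1 : phi r = r.
  have h1 : gen T0 (phi r * r^-1)%g.
    by apply: gen_mul hr' _; apply: (gen_inv rg) hr; apply: T0_T.
  have := T0_free rg h1 (reg_act_x0 rg (r * w)%g).
  rewrite -(rg_actM rg) mulgA mulgVK => /(_ _)/(congr1 (fun y => y * r)%g).
  rewrite mulgVK mul1g; apply; apply: cell_trans c1; apply: cell_sym.
  by rewrite (rg_actM rg).
exists (r * w)%g; split; first exact: (D_mul rg).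
  by have := erw; rewrite /g e1 => ->.
by rewrite (rg_actM rg).
Qed.

Lemma phi_levi a : levi_group a -> levi_group (phi a).
Proof.
move=> [Da ca ea]; split; first exact: phi_D.
  by rewrite -{1 2}phi_q -!phi_mul // ca.
have h : cell T0 (act (g 1%g) x0) (act (g a) x0).
  by apply: cell_g => //; [exact: (D_one rg)|rewrite (rg_act1 rg)].
rewrite {1}/g (al_1 al) mulg1 in h; apply: (cell_trans cell_1u); apply: (cell_trans h).
have -> : g a = (phi a * u)%g by rewrite /g /phi mulgVK.
rewrite (rg_actM rg); apply: cell_sym; apply: (cell_T0_act rg); last exact: cell_1u.
by apply/(comm_lin rg Dq hq (phi_D Da)); rewrite -{1 2}phi_q -!phi_mul // ca.
Qed.

Lemma sW_levi a : levi_group a -> levi_group (sW a).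
Proof.
move=> [Da ca ea]; split; first exact: (sW_D rg sg).
  by rewrite -{1 2}q_sW -!(sW_mul sg) // ca.
have := @cell_sW 1%g a (D_one rg) Da; rewrite (sW_1 rg sg) (rg_act1 rg); exact.
Qed.

Lemma q_pow_D k : D (q ^+ k)%g.
Proof. by elim: k => [|k ih]; rewrite ?expg0 ?expgS; [exact: (D_one rg)|exact: (D_mul rg)]. Qed.

Lemma phi_qk k : phi (q ^+ k)%g = (q ^+ k)%g.
Proof.
elim: k => [|k ih]; first by rewrite expg0 phi_1.
by rewrite expgS phi_mul ?phi_q ?ih //; apply: q_pow_D.
Qed.

Lemma sW_qk k : sW (q ^+ k)%g = (q ^+ k)%g.
Proof.
elim: k => [|k ih]; first by rewrite expg0 (sW_1 rg sg).
by rewrite expgS (sW_mul sg) ?q_sW ?ih //; apply: q_pow_D.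
Qed.

Notation pos_side := (pos_side ip act nrm off x0 q).

Lemma phi_pos_side t w : T t -> D w -> pos_side (phi t) (g w) <-> pos_side t w.
Proof.
move=> ht Dw; have e k : (q ^+ k * g w)%g = g (q ^+ k * w)%g.
  by rewrite phi_g ?phi_qk //; apply: q_pow_D.
by split=> h k; move: (h k); rewrite e sep_g //; apply: (D_mul rg) => //; apply: q_pow_D.
Qed.

Lemma sW_pos_side t w : T t -> D w -> pos_side (sW t) (sW w) <-> pos_side t w.
Proof.
move=> ht Dw; have e k : (q ^+ k * sW w)%g = sW (q ^+ k * w)%g.
  by rewrite (sW_mul sg) ?sW_qk //; apply: q_pow_D.
by split=> h k; move: (h k); rewrite e sep_sW //; apply: (D_mul rg) => //; apply: q_pow_D.
Qed.

(** Each clause of [levi_pos_gen] is phrased through commutation with [q], cells and separation, all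
    respected by [phi] and [g]. *)
Lemma phi_pos_gen a : levi_pos_gen a -> levi_pos_gen (phi a).
Proof.
move=> [ha [t [t' [[ht nt] [ht' nt'] hpos hr]]]]; have [Da ca _] := ha.
split; first exact: phi_levi.
have Dt := T_sub_D rg ht; have Dt' := T_sub_D rg ht'.
have nT0 s : T s -> ~ T0 s -> ~ T0 (phi s).
  move=> hs ns; have Ds := T_sub_D rg hs => /(T0_comm rg Dq hq (phi_T hs)).
  rewrite -{1 2}phi_q -!phi_mul // => h; apply: ns; apply/(T0_comm rg Dq hq hs).
  move: h; rewrite /phi => /mulIg/mulgI h; apply: (al_inj al) h; exact: (D_mul rg).
exists (phi t), (phi t'); split; try by split; [apply: phi_T|apply: nT0].
  move=> w Dw; have [w0 Dw0 ew] : exists2 w0, D w0 & g w0 = w.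
    have [b Db eb] := al_surj al (D_mul rg (D_inv rg Du) Dw).
    by exists b => //; rewrite /g eb mulKVg.
  by rewrite -ew !phi_pos_side //; apply: hpos.
rewrite -phi_mul // -phi_V; last exact: (D_mul rg).
rewrite -phi_mul //; first exact: phi_gen.
by apply: (D_inv rg); apply: (D_mul rg).
Qed.

Lemma sW_pos_gen a : levi_pos_gen a -> levi_pos_gen (sW a).
Proof.
move=> [ha [t [t' [[ht nt] [ht' nt'] hpos hr]]]]; have [Da ca _] := ha.
split; first exact: sW_levi.
have Dt := T_sub_D rg ht; have Dt' := T_sub_D rg ht'.
have nT0 s : T s -> ~ T0 s -> ~ T0 (sW s).
  move=> hs ns; have Ds := T_sub_D rg hs => /(T0_comm rg Dq hq (sW_T sg hs)).
  rewrite -{1 2}q_sW -!(sW_mul sg) // => h; apply: ns; apply/(T0_comm rg Dq hq hs).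
  by apply: (sW_inj sg _ _ h); exact: (D_mul rg).
exists (sW t), (sW t'); split; try by split; [apply: (sW_T sg)|apply: nT0].
  move=> w Dw; have [w0 Dw0 <-] := sW_surj (@sW_D _ _ _ _ _ _ _ _ _ _ _ rg _ _ _ sg) Dw Dw.
  by rewrite !sW_pos_side //; apply: hpos.
rewrite -(sW_mul sg) // -(sW_V rg sg); last exact: (D_mul rg).
rewrite -(sW_mul sg) //; first exact: sW_gen_T0.
by apply: (D_inv rg); apply: (D_mul rg).
Qed.

Definition levi_le a b := gen levi_pos_gen (b * a^-1)%g.

Lemma phi_le a b : levi_group a -> levi_group b -> levi_le a b -> levi_le (phi a) (phi b).
Proof.
move=> [Da _ _] [Db _ _]; rewrite /levi_le -phi_V // -phi_mul //; last exact: (D_inv rg).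
elim=> [|t w ht hw ih]; first by rewrite phi_1; apply: gen1.
have [Dt _ _] := proj1 ht; have [Dw _ _] := gen_levi rg Dq hq hw.
by rewrite phi_mul //; apply: genM => //; apply: phi_pos_gen.
Qed.

Lemma sW_le a b : levi_group a -> levi_group b -> levi_le a b -> levi_le (sW a) (sW b).
Proof.
move=> [Da _ _] [Db _ _]; rewrite /levi_le -(sW_V rg sg) // -(sW_mul sg) //; last exact: (D_inv rg).
elim=> [|t w ht hw ih]; first by rewrite (sW_1 rg sg); apply: gen1.
have [Dt _ _] := proj1 ht; have [Dw _ _] := gen_levi rg Dq hq hw.
by rewrite (sW_mul sg) //; apply: genM => //; apply: sW_pos_gen.
Qed.

(* Least upper bounds exist in the lattice-ordered group [levi_group], so a finite orbit of an order automorphism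
   has a fixed least upper bound. *)
Lemma join_fixed (c : nat -> W) (K : nat) (Fs : (W -> W) -> Prop) : (0 < K)%N ->
  (forall i, levi_group (c i)) -> (forall i, exists2 j, (j < K)%N & c i = c j) ->
  (forall F, Fs F -> [/\ forall a, levi_group a -> levi_group (F a),
     forall a b, levi_group a -> levi_group b -> levi_le a b -> levi_le (F a) (F b),
     forall i, exists j, c i = F (c j) &
     exists2 k, (0 < k)%N & forall a, levi_group a -> iter k F a = a]) ->
  exists2 a, levi_group a & forall F, Fs F -> F a = a.
Proof.
move=> K0 hc hper hF.
have [B [n [n_mul n_inj n_surj n_int n_pos]]] := levi_lattice rg Dq hq.
have n1 j : j \in B -> n 1%g j = 0.
  by move=> jB; have := n_mul _ _ j (levi_one rg q nu) (levi_one rg q nu) jB; rewrite mulg1; lra.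
have nV a j : levi_group a -> j \in B -> n a^-1%g j = - n a j.
  move=> ha jB; have := n_mul _ _ j ha (levi_inv rg Dq hq ha) jB.
  by rewrite mulgV n1 //; lra.
have leP a b : levi_group a -> levi_group b -> levi_le a b <-> forall j, j \in B -> n a j <= n b j.
  move=> ha hb; rewrite /levi_le n_pos; last by apply: (levi_mul rg Dq hq) => //; apply: (levi_inv rg Dq hq).
  by split=> h j jB; have := h j jB; rewrite n_mul ?nV ?subr_ge0 //; apply: (levi_inv rg Dq hq).
(* The coordinatewise maximum over one period; that it is attained serves to compare it with its
   image under [F]. *)
have [z hz] : exists z : V -> int, forall j, j \in B ->
    (exists i, n (c i) j = (z j)%:~R) /\ forall i, n (c i) j <= (z j)%:~R.
  suff ex j : exists z : int, j \in B -> (exists i, n (c i) j = z%:~R) /\ forall i, n (c i) j <= z%:~R.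
    by have [z hz] := boolp.choice ex; exists z.
  have [jB|jB] := boolP (j \in B); last by exists 0.
  have i0 : 0%N \in iota 0 K by rewrite mem_iota.
  have [i hi hmin] := min_in_seq (fun i => - n (c i) j) i0.
  have [k hk] := n_int (c i) j (hc i) jB; exists k => _; split; first by exists i.
  move=> i'; have [j' j'K ->] := hper i'; rewrite -hk.
  by have := hmin j'; rewrite mem_iota add0n j'K => /(_ erefl); rewrite lerN2.
have [a [ha na]] := n_surj z; exists a => // F /hF[FA Fle Fc [k k0 Fk]].
have ub i : levi_le (c i) a by apply/leP => // j jB; rewrite na //; have [_] := hz j jB.
(* Each [c i] is the image of some [c i'], so [F a] is an upper bound as well, hence above the least
   one. *)
have le1 : levi_le a (F a).
  apply/leP => // [|j jB]; first exact: FA.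
  have [[i hi] _] := hz j jB; rewrite na // -hi; have [i' ->] := Fc i.
  by move/leP: (Fle _ _ (hc i') ha (ub i')) => h; apply: h => //; apply: FA.
have it m : levi_group (iter m F a) by elim: m => //= m; apply: FA.
(* Iterating [F] keeps climbing, until its finite order brings it back to [a]. *)
have le2 m : levi_le (F a) (iter m.+1 F a).
  elim: m => [|m ih]; first by apply/leP => //; apply: FA.
  have h1 : levi_le (F a) (F (F a)) by apply: Fle => //; apply: FA.
  have h2 : levi_le (iter m.+1 F a) (iter m.+2 F a).
    elim: (m.+1) => [|p ihp]; first exact: le1.
    by apply: Fle => //; [exact: it|exact: (it p.+1)].
  apply/leP => [||j jB]; [exact: FA|exact: (it m.+2)|].
  apply: le_trans (proj1 (leP _ _ (FA _ ha) (it m.+1)) ih j jB) _.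
  exact: (proj1 (leP _ _ (it m.+1) (it m.+2)) h2 j jB).
have le3 : levi_le (F a) a by have := le2 k.-1; rewrite (prednK k0) Fk.
have : (F a * a^-1)%g = 1%g.
  have hV := levi_inv rg Dq hq ha; have hFa := FA a ha.
  apply: n_inj; first exact: (levi_mul rg Dq hq).
  move=> j jB; rewrite n_mul // nV //.
  have := proj1 (leP _ _ ha hFa) le1 j jB; have := proj1 (leP _ _ hFa ha) le3 j jB; lra.
by move/(congr1 (fun x => x * a)%g); rewrite mulgVK mul1g.
Qed.

(** [Tm] is built so that [Tm c * w1 = sW (c * w1)]: a point fixed by [Tm] makes [c * w1] fixed by
    [sW], and one fixed by [phi] keeps it a conjugator. [Tm] need not be multiplicative but
    preserves the order, and [phi] fixes the [Tm]-orbit of 1 pointwise, so the join of this orbit is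
    fixed by both. *)
Lemma fixed_conjugator w : D w -> (u * alpha w = w * u')%g ->
  exists c, [/\ D c, sW c = c & (u * alpha c = c * u')%g].
Proof.
move=> Dw0 ew0; have [w1 [Dw ew cw]] := reduce_parallel Dw0 ew0.
have Dsw := sW_D rg sg Dw; have DwV := D_inv rg Dw.
pose e := (sW w1 * w1^-1)%g.
have De : D e by apply: (D_mul rg).
have esw : (u * alpha (sW w1) = sW w1 * u')%g.
  have := congr1 sW ew; rewrite (sW_mul sg) //; last exact: (al_D al).
  by rewrite (sW_mul sg) // su su' -al_sW.
have phie : phi e = e.
  rewrite /phi /e (al_mul al) // (al_V al) // mulgA esw.
  have -> : alpha w1 = (u^-1 * (w1 * u'))%g by rewrite -ew mulKg.
  by rewrite !invgM invgK !mulgA mulgK mulgK.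
have eq_ : (e * q = q * e)%g.
  have := phi_iter N De; rewrite -/q hN //.
  have -> : iter N phi e = e by elim: (N) => //= i ->.
  by move=> {1}->; rewrite mulgVK.
have le : lin e nu = nu by apply/(comm_lin rg Dq hq).
have levi_e : levi_group e.
  split=> //.
  have h1 : cell T0 x0 (act (sW w1) x0).
    have := @cell_sW 1%g w1 (D_one rg) Dw; rewrite (sW_1 rg sg) (rg_act1 rg); exact.
  have h2 : cell T0 (act e x0) (act (sW w1) x0).
    have -> : act (sW w1) x0 = act e (act w1 x0) by rewrite -(rg_actM rg) /e mulgVK.
    exact: (cell_T0_act rg).
  by apply: (cell_trans h1); apply: cell_sym.
pose Tm c := (sW c * e)%g.
have Tm_levi c : levi_group c -> levi_group (Tm c).
  by move=> hc; apply: (levi_mul rg Dq hq) => //; apply: sW_levi.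
have TmW c : D c -> (Tm c * w1)%g = sW (c * w1)%g.
  by move=> Dc; rewrite /Tm /e -mulgA mulgVK (sW_mul sg).
have Tm_iterD i c : levi_group c -> levi_group (iter i Tm c).
  by move=> hc; elim: i => //= i; apply: Tm_levi.
have Tm_iterW i c : levi_group c -> (iter i Tm c * w1)%g = iter i sW (c * w1)%g.
  by move=> hc; elim: i => //= i ih; rewrite TmW ?ih //; have [] := Tm_iterD i c hc.
have [K K0 hK] := sW_finite sg.
have TmK c : levi_group c -> iter K Tm c = c.
  move=> hc; apply: (mulIg w1); rewrite Tm_iterW // hK //.
  by have [Dc _ _] := hc; apply: (D_mul rg).
have l1 := levi_one rg q nu.
pose c i := iter i Tm 1%g.
have cK i : c (i + K)%N = c i by rewrite /c iterD TmK.
have phic i : phi (c i) = c i.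
  rewrite /c; elim: i => [|i ih]; first exact: phi_1.
  have [Di _ _] := Tm_iterD i _ l1.
  rewrite iterS /Tm phi_mul ?phie //; last exact: (sW_D rg sg).
  congr (_ * _)%g; rewrite -{2}ih /phi.
  have DuV := D_inv rg Du; have Da := al_D al Di.
  rewrite (sW_mul sg) // ?(sW_mul sg) // ?(sW_V rg sg) // ?su ?al_sW //.
  exact: (D_mul rg).
have [a ha hfix] : exists2 a, levi_group a & forall F, F = Tm \/ F = phi -> F a = a.
  apply: (join_fixed (c := c) (K := K)) => // [i|i|F hF].
  - exact: Tm_iterD.
  - exists (i %% K)%N; first by rewrite ltn_mod.
    rewrite {1}(divn_eq i K) addnC; elim: (i %/ K)%N => [|m ih]; first by rewrite mul0n addn0.
    by rewrite mulSn addnCA addnC cK.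
  case: hF => ->; split=> //.
  - move=> x y hx hy h; have [Dx _ _] := hx; have [Dy _ _] := hy.
    have Dsx := sW_D rg sg Dx.
    rewrite /levi_le /Tm invgM; have -> : (sW y * e * (e^-1 * (sW x)^-1) = sW y * (sW x)^-1)%g.
      by rewrite (mulgA (sW y * e)%g) mulgK.
    exact: sW_le.
  - by move=> i; exists (i + K.-1)%N; rewrite /c -iterS -addnS (prednK K0) -/(c (i + K)%N) cK.
  - by exists K.
  - exact: phi_levi.
  - exact: phi_le.
  - by move=> i; exists i; rewrite phic.
  - by exists N => // x [Dx cx _]; apply: phi_N.
have [Da _ _] := ha.
exists (a * w1)%g; split; first exact: (D_mul rg).
  by rewrite -TmW // hfix //; left.
have : phi a = a by apply: hfix; right.
rewrite /phi (al_mul al) // => h.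
have h2 : (u * alpha a = a * u)%g by rewrite -{2}h mulgVK.
by rewrite mulgA h2 -mulgA ew mulgA.
Qed.
End Fixed.

Theorem straight_conjugate_fixed w : D w -> (u * alpha w = w * u')%g ->
  exists c, [/\ D c, sW c = c & (u * alpha c = c * u')%g].
Proof.
have [N [nu [N0 hN hq]]] := translation_power_ex.
exact: (fixed_conjugator N0 hN hq).
Qed.
End StraightConjugation.

(** * Weights of a split torus *)

(** In characteristic 0 the number 2 has infinite order, so exponents of characters can be read off
    at points whose coordinates are powers of 2. *)
Lemma two_pow_inj (E : fieldType) (a : int) : (forall k : nat, (k.+1)%:R != 0 :> E) ->
  (2 : E) ^ a = 1 -> a = 0.
Proof.
move=> ch; have nat_case (k : nat) : (2 : E) ^+ k = 1 -> k = 0%N.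
  rewrite -natrX => h; case: k h => // k h.
  have : (2 ^ k.+1 - 1)%:R = 0 :> E by rewrite natrB ?expn_gt0 // h subrr.
  have : (0 < 2 ^ k.+1 - 1)%N by rewrite subn_gt0 -{1}(expn0 2) ltn_exp2l.
  by case: (2 ^ k.+1 - 1)%N => // j _ e; have := ch j; rewrite e eqxx.
case: a => k /=; first by move=> /nat_case ->.
rewrite NegzE -exprnN => /(congr1 (fun x => x^-1)); rewrite invrK invr1 => h.
by have := nat_case k.+1 h.
Qed.

Section Monomials.
Variable E : fieldType.

Lemma prodz_exp (I : finType) (F : I -> E) (z : int) : (forall i, F i != 0) ->
  (\prod_i F i) ^ z = \prod_i F i ^ z.
Proof.
move=> h; suff : \prod_i F i != 0 /\ (\prod_i F i) ^ z = \prod_i F i ^ z by case.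
elim/big_rec2: _ => [|i a b _ [a0 e]]; first by rewrite oner_neq0 exp1rz.
by rewrite mulf_neq0 // exprzMl ?unitfE // e.
Qed.

Lemma monomials_neq0 q r (A : 'M[int]_(q, r)) (t : 'cV[E]_r) :
  invertible_coords t -> invertible_coords (monomials A t).
Proof.
move=> ht i; rewrite mxE; apply/prodf_neq0 => j _; rewrite expfz_neq0 //; exact: ht.
Qed.

Lemma monomials_comp p q r (A : 'M[int]_(p, q)) (B : 'M[int]_(q, r)) (t : 'cV[E]_r) :
  invertible_coords t -> monomials A (monomials B t) = monomials (A *m B) t.
Proof.
move=> ht; apply/colP => i; rewrite !mxE.
transitivity (\prod_j \prod_l t l 0 ^ (A i j * B j l)).
  apply: eq_bigr => j _; rewrite mxE prodz_exp; last by move=> l; rewrite expfz_neq0 // ht.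
  by apply: eq_bigr => l _; rewrite exprz_exp mulrC.
rewrite exchange_big /=; apply: eq_bigr => l _; rewrite mxE.
apply/esym; apply: (big_morph (fun z => t l 0 ^ z)); last exact: expr0z.
by move=> x y; rewrite exprzDr // unitfE ht.
Qed.

Lemma monomials_row p q r (A : 'M[int]_(p, r)) (A' : 'M[int]_(q, r)) i j (t : 'cV[E]_r) :
  row i A = row j A' -> monomials A t i 0 = monomials A' t j 0.
Proof.
by move=> /rowP h; rewrite !mxE; apply: eq_bigr => l _; have := h l; rewrite !mxE => ->.
Qed.

Hypothesis ch : forall k : nat, (k.+1)%:R != 0 :> E.

Definition pow2 r (c : 'cV[int]_r) : 'cV[E]_r := \col_l (2 : E) ^ c l 0.

Lemma pow2_invertible r (c : 'cV[int]_r) : invertible_coords (pow2 c).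
Proof. by move=> l; rewrite mxE expfz_neq0 // (ch 1). Qed.

Lemma monomials_pow2 q r (A : 'M[int]_(q, r)) (c : 'cV[int]_r) i :
  monomials A (pow2 c) i 0 = 2 ^ (A *m c) i 0.
Proof.
rewrite !mxE; under eq_bigr => j _ do rewrite mxE exprz_exp mulrC.
apply/esym; apply: (big_morph (fun z => (2 : E) ^ z)); last exact: expr0z.
by move=> x y; rewrite exprzDr // unitfE (ch 1).
Qed.

Lemma two_exp_inj (a b : int) : (2 : E) ^ a = 2 ^ b -> a = b.
Proof.
move=> h; have u : (2 : E) \is a GRing.unit by rewrite unitfE (ch 1).
apply/eqP; rewrite -subr_eq0; apply/eqP/(two_pow_inj ch).
by rewrite exprzDr // -invr_expz h divff // expfz_neq0 // (ch 1).
Qed.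

Variables (n r : nat).
Definition torus_diag (m : 'M[int]_(n, r)) (t : 'cV[E]_r) : 'M[E]_n := diag_mx (monomials m t)^T.

Lemma diag_conj_entries (k : 'M[E]_n) (d d' : 'rV[E]_n) :
  k *m diag_mx d = diag_mx d' *m k <-> forall i j, k i j != 0 -> d 0 j = d' 0 i.
Proof.
split=> [/matrixP h i j k0|h].
  by have := h i j; rewrite mul_mx_diag mul_diag_mx !mxE mulrC => /(mulIf k0).
apply/matrixP => i j; rewrite mul_mx_diag mul_diag_mx !mxE mulrC.
by have [->|/h ->] := eqVneq (k i j) 0; rewrite ?mulr0.
Qed.

(** A nonzero entry forces two characters to agree, and evaluation at [pow2] of a basis vector
    recovers their exponents. *)
Lemma intertwine_rows (k : 'M[E]_n) (m m' : 'M[int]_(n, r)) :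
  (forall t, invertible_coords t -> k *m torus_diag m t = torus_diag m' t *m k) <->
  forall i j, k i j != 0 -> row j m = row i m'.
Proof.
split=> h.
  move=> i j k0; apply/rowP => l.
  pose c : 'cV[int]_r := delta_mx l 0.
  have /diag_conj_entries/(_ i j k0) := h _ (@pow2_invertible r c).
  rewrite !mxE => e; have {e} := e; rewrite -/(monomials m (pow2 c)).
  have e2 (A : 'M[int]_(n, r)) p : monomials A (pow2 c) p 0 = 2 ^ A p l.
    rewrite monomials_pow2 mxE (bigD1 l) //= mxE !eqxx mulr1 big1 ?addr0 // => j' /negPf nj.
    by rewrite mxE nj mulr0.
  have := e2 m j; have := e2 m' i; rewrite !mxE => -> -> /two_exp_inj.
  by [].
move=> t ht; apply/diag_conj_entries => i j /h e.
by rewrite ![(_)^T _ _]mxE; apply: monomials_row.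
Qed.

End Monomials.

(* k g0 normalizes the diagonal torus with weights m and acts on it through the matrix B. *)
Definition intertwines (E : fieldType) n r (m : 'M[int]_(n, r)) (k : 'M[E]_n) (B : 'M[int]_r) : Prop :=
  forall i j, k i j != 0 -> row j m = row i (m *m B).

Section Intertwiners.
Variables (n r : nat) (m : 'M[int]_(n, r)).

Lemma row_mulB (B : 'M[int]_r) i j (m1 m2 : 'M[int]_(n, r)) :
  row i m1 = row j m2 -> row i (m1 *m B) = row j (m2 *m B).
Proof. by rewrite !row_mul => ->. Qed.

Lemma intertwines_mul (E : fieldType) (k k' : 'M[E]_n) B B' :
  intertwines m k B -> intertwines m k' B' -> intertwines m (k *m k') (B *m B').
Proof.
move=> h h' i j; rewrite mxE => s0.
have [a /andP[ka ka']] : exists a, (k i a != 0) && (k' a j != 0).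
  apply/existsP; apply: contraR s0 => /existsPn no; apply/eqP; apply: big1 => a _.
  by have := no a; rewrite negb_and !negbK => /orP[]/eqP ->; rewrite ?mul0r ?mulr0.
by rewrite (h' a j ka') mulmxA; apply: row_mulB; apply: h.
Qed.

Lemma intertwines_map (E E' : fieldType) (phi : {rmorphism E -> E'}) (k : 'M[E]_n) B :
  intertwines m (map_mx phi k) B <-> intertwines m k B.
Proof. by split=> h i j k0; apply: h; move: k0; rewrite ?mxE ?fmorph_eq0. Qed.

Lemma intertwines_inv (E : fieldType) (k : 'M[E]_n) B B1 : (forall j : nat, (j.+1)%:R != 0 :> E) ->
  k \in unitmx -> B *m B1 = 1%:M -> intertwines m k B -> intertwines m (invmx k) B1.
Proof.
move=> ch uk BB h; have /(intertwine_rows ch) h' := h.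
apply/(intertwine_rows ch) => s hs.
have := h' _ (monomials_neq0 B1 hs).
rewrite /torus_diag !monomials_comp // -mulmxA BB mulmx1 => e.
have := congr1 (fun x => invmx k *m x *m invmx k) e.
by rewrite /= !mulmxA mulVmx // mul1mx -!mulmxA mulmxV // mulmx1 => ->.
Qed.

(** Some term of the Leibniz expansion of the determinant is nonzero. *)
Lemma unit_perm (E : fieldType) (k : 'M[E]_n) : k \in unitmx -> exists s : 'S_n, forall i, k i (s i) != 0.
Proof.
rewrite unitmxE unitfE => d0; apply: contrapT => no; move/negP: d0; apply; apply/eqP.
rewrite /determinant big1 // => s _.
have [i hi] : exists i, k i (s i) = 0.
  apply: contrapT => h; apply: no; exists s => i; apply/eqP => e; apply: h; by exists i.
by rewrite (bigD1 i) //= hi mul0r mulr0.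
Qed.

Lemma intertwines_perm (E : fieldType) (k : 'M[E]_n) B : k \in unitmx -> intertwines m k B ->
  exists s : 'S_n, m *m B = row_perm s m.
Proof.
move=> /unit_perm[s hs] h; exists s; apply/row_matrixP => i.
rewrite -(h i (s i) (hs i)); apply/rowP => l; by rewrite !mxE.
Qed.

Lemma intertwines_torus (E : fieldType) (g0 k : 'M[E]_n) B (t : 'cV[E]_r) : g0 \in unitmx -> k \in unitmx ->
  (forall j : nat, (j.+1)%:R != 0 :> E) ->
  intertwines m k B -> invertible_coords t ->
  (g0 *m k *m invmx g0) *m torus_param g0 m t *m invmx (g0 *m k *m invmx g0) = torus_param g0 m (monomials B t).
Proof.
move=> ug uk ch /(intertwine_rows ch) h ht; rewrite /torus_param.
have -> : invmx (g0 *m k *m invmx g0) = g0 *m invmx k *m invmx g0.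
  have ui : g0 *m k *m invmx g0 \in unitmx by rewrite !unitmx_mul ug uk unitmx_inv ug.
  apply: (can_inj (mulKmx ui)); rewrite mulmxV // !mulmxA mulmxKV // -(mulmxA g0) mulmxV // mulmx1.
  by rewrite mulmxV.
rewrite !mulmxA mulmxKV //.
rewrite mulmxKV // -(mulmxA g0 k) -/(torus_diag m t) (h t ht) /torus_diag monomials_comp // !mulmxA mulmxK //.
Qed.

Lemma torus_intertwines (E : fieldType) (g0 w : 'M[E]_n) B : g0 \in unitmx -> w \in unitmx ->
  (forall j : nat, (j.+1)%:R != 0 :> E) ->
  (forall t : 'cV[E]_r, invertible_coords t ->
     w *m torus_param g0 m t *m invmx w = torus_param g0 m (monomials B t)) ->
  intertwines m (invmx g0 *m w *m g0) B.
Proof.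
move=> ug uw ch h; apply/(intertwine_rows ch) => t ht.
have e1 : w *m torus_param g0 m t *m invmx w *m w *m g0 = w *m g0 *m torus_diag m t.
  by rewrite mulmxKV // /torus_param -!mulmxA (mulVmx ug) mulmx1.
have e2 : invmx g0 *m (torus_param g0 m (monomials B t) *m w *m g0) =
    torus_diag (m *m B) t *m (invmx g0 *m w *m g0).
  by rewrite /torus_param /torus_diag monomials_comp // !mulmxA mulVmx // mul1mx.
by rewrite -e2 -(h t ht) e1 !mulmxA.
Qed.
End Intertwiners.

Section WeightForm.
Variables (n r : nat) (m : 'M[int]_(n, r)).
Hypothesis m_inj : forall c : 'cV[int]_r, m *m c = 0 -> c = 0.

Lemma m_inj_mx p (c : 'M[int]_(r, p)) : m *m c = 0 -> c = 0.
Proof.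
move=> h; apply/matrixP => i j; have := m_inj (c := col j c).
by rewrite colE mulmxA h mul0mx => /(_ erefl)/matrixP/(_ i 0); rewrite -colE !mxE.
Qed.

(** Powers of [B] permute the weights by powers of [s], and injectivity of [m] lets the permuted
    weights determine the matrix. *)
Lemma perm_finite_order (B : 'M[int]_r) (s : 'S_n) : m *m B = row_perm s m ->
  exists2 N, (0 < N)%N & B ^+ N = 1%:M.
Proof.
move=> h; have hk k : m *m B ^+ k = row_perm (s ^+ k)%g m.
  elim: k => [|k ih]; first by rewrite expr0 expg0 row_perm1 mulmx1.
  by rewrite exprS -mulmxE mulmxA h [row_perm s m]row_permE -mulmxA ih -row_permE expgS row_permM.
exists #[s]%g; first exact: order_gt0.
have e : m *m (B ^+ #[s]%g - 1%:M) = 0.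
  by rewrite mulmxBr hk expg_order row_perm1 mulmx1 subrr.
by apply/eqP; rewrite -subr_eq0 (m_inj_mx e).
Qed.

Lemma inverse_of_order (B : 'M[int]_r) (s : 'S_n) : m *m B = row_perm s m ->
  exists B1, B *m B1 = 1%:M /\ B1 *m B = 1%:M.
Proof.
move=> /perm_finite_order[N N0 h]; exists (B ^+ N.-1).
by rewrite !mulmxE -exprS -exprSr (prednK N0).
Qed.

Variable R : realType.
Notation mR := (map_mx (fun z : int => z%:~R : R) m).

Lemma rational_kernel (x : 'cV[rat]_r) : map_mx (intr : int -> rat) m *m x = 0 -> x = 0.
Proof.
move=> h; pose d : int := \prod_i denq (x i 0).
have d0 : d != 0 by apply/prodf_neq0 => i _; rewrite denq_eq0.
have ex i : exists z : int, z%:~R = d%:~R * x i 0.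
  exists ((\prod_(j | j != i) denq (x j 0)) * numq (x i 0)).
  have dE : d = denq (x i 0) * \prod_(j | j != i) denq (x j 0) by rewrite /d (bigD1 i).
  rewrite dE; move: (\prod_(j | _) _) => P; rewrite !rmorphM /=.
  by rewrite numqE; ring.
have [z hz] := boolp.choice ex.
have : m *m (\col_i z i) = 0.
  apply/matrixP => i j; apply: (@intr_inj rat); rewrite !mxE.
  have /matrixP/(_ i 0) := h; rewrite !mxE => e.
  have : d%:~R * \sum_k map_mx intr m i k * x k 0 = 0 by rewrite e mulr0.
  rewrite mulr_sumr mulr0z => <-; rewrite (rmorph_sum (intmul (1:rat))); apply: eq_bigr => k _.
  by rewrite !mxE /= (rmorphM (intmul (1:rat))) /= hz; ring.
move=> /m_inj/matrixP c0; apply/matrixP => i j; rewrite (ord1 j) mxE.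
have := c0 i 0; rewrite !mxE => e; have := hz i; rewrite e => /esym/eqP.
by rewrite mulf_eq0 intr_eq0 (negPf d0) => /eqP.
Qed.

(** Injectivity passes from integers to rationals by clearing denominators, and rank is unchanged by
    extension to [R]. *)
Lemma real_kernel (x : 'cV[R]_r) : mR *m x = 0 -> x = 0.
Proof.
pose mQ := map_mx (intr : int -> rat) m.
have e : mR = map_mx (ratr : rat -> R) mQ.
  by apply/matrixP => i j; rewrite !mxE ratr_int.
have fQ : row_free mQ^T.
  apply: inj_row_free => v hv; apply: trmx_inj; rewrite trmx0; apply: rational_kernel.
  by apply: trmx_inj; rewrite trmx_mul trmxK hv trmx0.
have fR : row_free mR^T.
  by rewrite e map_trmx row_free_map.
move=> h; apply: trmx_inj; rewrite trmx0; apply: (row_free_inj fR).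
by rewrite -trmx_mul h trmx0 mul0mx.
Qed.

(** Weights are summed with multiplicity. Elements normalizing the torus permute them, which makes
    the form invariant; it is definite because the weights separate real cocharacters. *)
Definition weight_ip (x y : 'cV[R]_r) : R := \sum_i (mR *m x) i 0 * (mR *m y) i 0.

Lemma weight_ipC x y : weight_ip x y = weight_ip y x.
Proof. by apply: eq_bigr => i _; rewrite mulrC. Qed.

Lemma weight_ipD x y z : weight_ip (x + y) z = weight_ip x z + weight_ip y z.
Proof. by rewrite /weight_ip -big_split; apply: eq_bigr => i _; rewrite mulmxDr mxE mulrDl. Qed.

Lemma weight_ipZ (a : R) x y : weight_ip (a *: x) y = a * weight_ip x y.
Proof. by rewrite /weight_ip mulr_sumr; apply: eq_bigr => i _; rewrite -scalemxAr mxE mulrA. Qed.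

Lemma weight_ip_gt0 x : x != 0 -> 0 < weight_ip x x.
Proof.
move=> x0; rewrite lt_neqAle; apply/andP; split; last first.
  by rewrite sumr_ge0 // => i _; rewrite -expr2 sqr_ge0.
rewrite eq_sym; apply: contraNneq x0 => h; apply/eqP/real_kernel.
apply/matrixP => i j; rewrite (ord1 j) [RHS]mxE; apply/eqP.
have : (mR *m x) i 0 * (mR *m x) i 0 = 0.
  apply/eqP; move/eqP: h; rewrite psumr_eq0 => [/allP/(_ i)|k _]; last by rewrite -expr2 sqr_ge0.
  by rewrite mem_index_enum => /(_ isT).
by move/eqP; rewrite mulf_eq0 orbb.
Qed.

Lemma weight_ip_perm (B : 'M[int]_r) (s : 'S_n) x y : m *m B = row_perm s m ->
  weight_ip (map_mx intr B *m x) (map_mx intr B *m y) = weight_ip x y.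
Proof.
move=> h; rewrite /weight_ip [RHS](reindex_inj (@perm_inj _ s)) /=.
have e z i : (mR *m (map_mx intr B *m z)) i 0 = (mR *m z) (s i) 0.
  rewrite mulmxA -map_mxM h !mxE; apply: eq_bigr => k _; by rewrite !mxE.
by apply: eq_bigr => i _; rewrite !e.
Qed.

Lemma iter_mulmx (B : 'M[int]_r) k (x : 'cV[R]_r) :
  iter k (fun v => map_mx intr B *m v) x = map_mx intr (B ^+ k) *m x.
Proof.
elim: k => [|k ih]; first by rewrite expr0 map_mx1 mul1mx.
by rewrite iterS ih mulmxA -map_mxM exprS mulmxE.
Qed.

Lemma riesz (a : 'rV[R]_r) : exists v, forall x, weight_ip v x = (a *m x) 0 0.
Proof.
pose M := mR^T *m mR.
have ipE x y : weight_ip x y = (x^T *m M *m y) 0 0.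
  rewrite /weight_ip /M !mulmxA -trmx_mul -mulmxA mxE.
  by apply: eq_bigr => i _; rewrite [in RHS]mxE.
have uM : M \in unitmx.
  rewrite -row_free_unit; apply: inj_row_free => v hv.
  have : weight_ip v^T v^T = 0 by rewrite ipE trmxK hv mul0mx mxE.
  have [e _|nz e] := eqVneq v^T 0; first by apply: trmx_inj; rewrite e trmx0.
  by have := weight_ip_gt0 nz; rewrite e ltxx.
exists (a *m invmx M)^T => x; by rewrite ipE trmxK mulmxKV.
Qed.
End WeightForm.

Lemma conj_basis (E : fieldType) n (g0 g u : 'M[E]_n) : g0 \in unitmx -> g \in unitmx ->
  invmx g0 *m (g *m u *m invmx g) *m g0 =
  (invmx g0 *m g *m g0) *m (invmx g0 *m u *m g0) *m invmx (invmx g0 *m g *m g0).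
Proof.
move=> u0 ug.
have ui : invmx g0 \in unitmx by rewrite unitmx_inv.
have uk : invmx g0 *m g *m g0 \in unitmx by rewrite !unitmx_mul ui ug u0.
apply: (can_inj (mulmxK uk)); rewrite mulmxKV // !mulmxA (mulmxK u0) mulmxKV //.
by rewrite (mulmxK u0).
Qed.

(** * Root groups, rational points and the Frobenius *)

Section RootEntries.
Variables (n r : nat) (m : 'M[int]_(n, r)).

Definition root_entries (E : fieldType) (a : 'rV[int]_r) (U : 'M[E]_n) : Prop :=
  forall i j, U i j = (i == j)%:R \/
     exists p q : nat, [/\ (0 < p)%N, (0 < q)%N & (row i m - row j m) *+ q = a *+ p].

Lemma root_entries_map (E E' : fieldType) (phi : {rmorphism E -> E'}) a (U : 'M[E]_n) :
  root_entries a U -> root_entries a (map_mx phi U).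
Proof.
by move=> h i j; case: (h i j) => [e|e]; [left; rewrite mxE e rmorph_nat | right].
Qed.

(** Subtracting the identity leaves only entries between weights whose difference is a positive
    rational multiple of [a]; conjugation by [k] relabels these weights through [B1]. *)
Lemma root_entries_conj (E : fieldType) a (U k : 'M[E]_n) (B B1 : 'M[int]_r) :
  (forall j : nat, (j.+1)%:R != 0 :> E) ->
  B *m B1 = 1%:M -> B1 *m B = 1%:M -> k \in unitmx -> intertwines m k B ->
  root_entries a U -> root_entries (a *m B1) (k *m U *m invmx k).
Proof.
move=> ch BB1 B1B uk hk hU i j.
have hki := intertwines_inv ch uk BB1 hk.
have e1 : k *m U *m invmx k = 1%:M + k *m (U - 1%:M) *m invmx k.
  by rewrite mulmxBr mulmxBl mulmx1 mulmxV // addrC subrK.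
rewrite e1; set M := k *m _ *m _; rewrite [in LHS]mxE [X in X + _ = _]mxE.
have [z|nz] := eqVneq (M i j) 0; first by left; rewrite z addr0.
right; rewrite /M mxE in nz.
have [q] : exists q, (k *m (U - 1%:M)) i q * invmx k q j != 0.
  by apply: contrapT => no; move/negP: nz; apply; apply/eqP/big1 => q _; apply: contrapT => h; apply: no; exists q; apply/eqP.
rewrite mulf_eq0 negb_or mxE => /andP[nz1 kq].
have [p] : exists p, k i p * (U - 1%:M) p q != 0.
  by apply: contrapT => no; move/negP: nz1; apply; apply/eqP/big1 => p _; apply: contrapT => h; apply: no; exists p; apply/eqP.
rewrite mulf_eq0 negb_or => /andP[kp]; rewrite !mxE => Upq.
case: (hU p q) => [e|[x [y [x0 y0 e]]]]; first by rewrite e subrr eqxx in Upq.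
exists x, y; split=> //.
have ep := hk _ _ kp; have eq := hki _ _ kq.
have eq' : row q m = row j (m *m B).
  by rewrite row_mul eq row_mul -mulmxA B1B mulmx1.
have := congr1 (mulmxr B1) e; rewrite !raddfMn /= => <-; congr (_ *+ y).
by rewrite ep eq' !row_mul -mulmxBl -mulmxA BB1 mulmx1.
Qed.
End RootEntries.

Section GroupPoints.
Variables (F L : fieldType) (K : closedFieldType).
Variables (iF : {rmorphism F -> L}) (iL : {rmorphism L -> K}) (sigma : {rmorphism L -> L}).
Variables (n : nat) (G S : set 'M[K]_n).
Hypothesis sigma_iF : forall x, sigma (iF x) = iF x.
Hypothesis algG : alg_group (iL \o iF) G.

Lemma eval_mx_comp (k k' k'' : fieldType) (i : k -> k') (phi : {rmorphism k' -> k''})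
    (p : mpoly.mpoly (n * n) k) (g : 'M[k']_n) :
  eval_mx (phi \o i) p (map_mx phi g) = phi (eval_mx i p g).
Proof.
rewrite /eval_mx /mpoly.mmap rmorph_sum; apply: eq_bigr => x _ /=.
rewrite rmorphM /mpoly.mmap1 rmorph_prod; congr (_ * _); apply: eq_bigr => j _.
by rewrite rmorphXn /= -map_mxvec mxE.
Qed.

Lemma points_sigma g : points iL G g -> points iL G (map_mx sigma g).
Proof.
case: algG => -[P ->] _; rewrite /points /= => -[u h]; split.
  by rewrite map_unitmx map_unitmx -(map_unitmx iL).
move=> p hp; have := h p hp; rewrite !eval_mx_comp => /eqP; rewrite fmorph_eq0 => /eqP e.
have -> : eval_mx iF p (map_mx sigma g) = eval_mx (sigma \o iF) p (map_mx sigma g).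
  by rewrite /eval_mx /mpoly.mmap; apply: eq_bigr => x _ /=; rewrite sigma_iF.
by rewrite eval_mx_comp e !rmorph0.
Qed.

Lemma points_unit g : points iL G g -> g \in unitmx.
Proof. by case: algG => _ [h _ _ _] /h; rewrite map_unitmx. Qed.

Lemma points_mul g h : points iL G g -> points iL G h -> points iL G (g *m h).
Proof. by case: algG => _ [_ _ H _] hg hh; rewrite /points /= map_mxM; apply: H. Qed.

Lemma points_inv g : points iL G g -> points iL G (invmx g).
Proof. by case: algG => _ [_ _ _ H] hg; rewrite /points /= map_invmx; apply: H. Qed.

Lemma NS_points g : NS iL G S g -> points iL G g.
Proof. by case. Qed.

Lemma NS_unit g : NS iL G S g -> g \in unitmx.
Proof. by move/NS_points/points_unit. Qed.

Lemma NS_mul g h : NS iL G S g -> NS iL G S h -> NS iL G S (g *m h).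
Proof.
move=> Ng Nh; split; first exact: points_mul (NS_points Ng) (NS_points Nh).
have [ug uh] := (NS_unit Ng, NS_unit Nh).
rewrite -(map_unitmx iL) in ug; rewrite -(map_unitmx iL) in uh.
case: Ng Nh => _ hg [_ hh] s; rewrite hh hg map_mxM.
set X := _ *m _; set Y := (X in _ <-> S X); suff -> : X = Y by [].
rewrite /X /Y; apply: (can_inj (mulmxK (_ : map_mx iL g *m map_mx iL h \in unitmx))); first by rewrite unitmx_mul ug.
rewrite mulmxKV ?unitmx_mul ?ug //.
by rewrite !mulmxA (mulmxKV ug) (mulmxKV uh).
Qed.

Lemma NS_inv g : NS iL G S g -> NS iL G S (invmx g).
Proof.
move=> Ng; split; first exact: points_inv (NS_points Ng).
have ug := NS_unit Ng; rewrite -(map_unitmx iL) in ug.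
case: Ng => _ hg s; rewrite (hg (_ *m s *m _)) map_invmx invmxK !mulmxA mulmxV // mul1mx.
by rewrite mulmxK.
Qed.
End GroupPoints.

Lemma map_torus_param (E E' : fieldType) (phi : {rmorphism E -> E'}) n r (g : 'M[E]_n)
    (m : 'M[int]_(n, r)) (t : 'cV[E]_r) :
  map_mx phi (torus_param g m t) = torus_param (map_mx phi g) m (map_mx phi t).
Proof.
rewrite /torus_param !map_mxM map_invmx map_diag_mx; congr (_ *m diag_mx _ *m _).
apply/rowP => i; rewrite !mxE rmorph_prod; apply: eq_bigr => j _.
by rewrite !mxE fmorphXz.
Qed.

Section Roots.
Variables (F L : fieldType) (K : closedFieldType).
Variables (iF : {rmorphism F -> L}) (iL : {rmorphism L -> K}) (sigma : {rmorphism L -> L}).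
Variables (n r : nat) (G S : set 'M[K]_n) (g0 : 'M[L]_n) (m : 'M[int]_(n, r)).
Hypothesis chF : forall k : nat, (k.+1)%:R != 0 :> F.
Hypothesis sigma_bij : bijective sigma.
Hypothesis sigma_iF : forall x, sigma (iF x) = iF x.
Hypothesis algG : alg_group (iL \o iF) G.
Hypothesis hcoord : torus_coordinates iL g0 m S.
Notation NS := (NS iL G S).
Notation conj0 g := (invmx g0 *m g *m g0).

Lemma chL (k : nat) : (k.+1)%:R != 0 :> L.
Proof. by rewrite -(rmorph_nat iF) fmorph_eq0. Qed.

Lemma chK (k : nat) : (k.+1)%:R != 0 :> K.
Proof. by rewrite -(rmorph_nat iL) fmorph_eq0 chL. Qed.

Lemma g0_unit : g0 \in unitmx. Proof. by case: hcoord. Qed.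

(** The parametrization of the torus is injective, and [pow2] of a kernel vector has the same image
    as [pow2] of 0. *)
Lemma weights_inj (c : 'cV[int]_r) : m *m c = 0 -> c = 0.
Proof.
move=> h; case: hcoord => _ inj _.
have : pow2 K c = pow2 K 0.
  apply: inj; try exact: (pow2_invertible chK).
  rewrite /torus_param; congr (_ *m diag_mx _ *m _); apply/rowP => i.
  have e := fun c => monomials_pow2 chK m c i; rewrite [LHS]mxE [RHS]mxE !e h mulmx0.
  by [].
move=> /colP e; apply/colP => i; apply: (two_exp_inj chK).
by have := e i; rewrite !mxE.
Qed.

Lemma conj0_unit g : g \in unitmx -> conj0 g \in unitmx.
Proof. by move=> u; rewrite !unitmx_mul unitmx_inv g0_unit u. Qed.

Lemma conj0K g : g0 *m conj0 g *m invmx g0 = g.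
Proof. by rewrite !mulmxA mulmxV ?g0_unit // mul1mx mulmxK ?g0_unit. Qed.

Lemma conj0_inv g : g \in unitmx -> conj0 (invmx g) = invmx (conj0 g).
Proof.
move=> ug; have u0 := g0_unit; apply: (can_inj (mulmxK (conj0_unit ug))).
by rewrite mulVmx ?conj0_unit // !mulmxA (mulmxK u0) (mulmxKV ug) mulVmx.
Qed.

Lemma intertwines_invertible g (B : 'M[int]_r) : g \in unitmx -> intertwines m (conj0 g) B ->
  exists2 B1, B *m B1 = 1%:M /\ B1 *m B = 1%:M & intertwines m (conj0 (invmx g)) B1.
Proof.
move=> ug h; have uk := conj0_unit ug; have [s hs] := intertwines_perm uk h.
have [B1 [e1 e2]] := inverse_of_order weights_inj hs.
by exists B1 => //; rewrite conj0_inv //; apply: (intertwines_inv chL uk e1).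
Qed.

Lemma intertwines_normalizes g (B : 'M[int]_r) s : g \in unitmx -> intertwines m (conj0 g) B ->
  S s -> S (map_mx iL g *m s *m invmx (map_mx iL g)).
Proof.
move=> ug h; case: hcoord => _ _ ->; case=> t ht <-.
exists (monomials B t); first exact: monomials_neq0.
have u0 : map_mx iL g0 \in unitmx by rewrite map_unitmx g0_unit.
have uk : map_mx iL (conj0 g) \in unitmx by rewrite map_unitmx conj0_unit.
have h' : intertwines m (map_mx iL (conj0 g)) B by apply/intertwines_map.
have e : map_mx iL g = map_mx iL g0 *m map_mx iL (conj0 g) *m invmx (map_mx iL g0).
  by rewrite -map_invmx -!map_mxM conj0K.
by rewrite -(intertwines_torus u0 uk chK h' ht) -e.
Qed.

Lemma intertwines_NS g (B : 'M[int]_r) : points iL G g -> intertwines m (conj0 g) B -> NS g.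
Proof.
move=> pg h; split=> // s; have ug := points_unit algG pg.
have ug' : map_mx iL g \in unitmx by rewrite map_unitmx.
have [B1 _ h1] := intertwines_invertible ug h.
split; first exact: intertwines_normalizes h.
move/(intertwines_normalizes (_ : invmx g \in unitmx) h1); rewrite unitmx_inv => /(_ ug).
by rewrite map_invmx invmxK !mulmxA mulVmx // mul1mx mulmxKV.
Qed.

Lemma root_group_conj (g u : 'M[L]_n) (a : 'rV[int]_r) (B B1 : 'M[int]_r) :
  points iL G g -> intertwines m (conj0 g) B -> B *m B1 = 1%:M -> B1 *m B = 1%:M ->
  root_group iL G g0 m a u -> root_group iL G g0 m (a *m B1) (g *m u *m invmx g).
Proof.
move=> pg h e1 e2 [pu hu]; have ug := points_unit algG pg; split.
  exact (points_mul algG (points_mul algG pg pu) (points_inv algG pg)).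
rewrite (conj_basis u g0_unit ug); exact (root_entries_conj chL e1 e2 (conj0_unit ug) h hu).
Qed.

Lemma root_reflection_conj (g u w : 'M[L]_n) (a : 'rV[int]_r) (B : 'M[int]_r) :
  NS g -> intertwines m (conj0 g) B -> root_reflection iL G S g0 m a u w ->
  exists a', root_reflection iL G S g0 m a' (g *m u *m invmx g) (g *m w *m invmx g).
Proof.
move=> Ng h [a0 hu u1 Nw [u' [u'' [h' h'' e]]]]; have ug := NS_unit algG Ng.
have [B1 [e1 e2] _] := intertwines_invertible ug h; exists (a *m B1).
have pg := NS_points Ng; split.
- apply: contra a0 => /eqP z; apply/eqP; have := congr1 (mulmx^~ B) z.
  by rewrite -mulmxA e2 mulmx1 mul0mx.
- exact: root_group_conj e1 e2 hu.
- apply: contra u1 => /eqP z; apply/eqP.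
  have := congr1 (fun x => invmx g *m x *m g) z.
  by rewrite mulmx1 mulVmx // !mulmxA mulVmx // mul1mx mulmxKV.
- exact (NS_mul algG (NS_mul algG Ng Nw) (NS_inv algG Ng)).
- exists (g *m u' *m invmx g), (g *m u'' *m invmx g); rewrite -mulNmx; split; try exact: root_group_conj e1 e2 _.
  by rewrite e !mulmxA !(mulmxKV ug).
Qed.

Variables (C : 'M[int]_r).
Hypothesis sigma_torus : forall t : 'cV[L]_r, invertible_coords t ->
  map_mx sigma (torus_param g0 m t) = torus_param g0 m (monomials C (map_mx sigma t)).
Notation kappa := (invmx g0 *m map_mx sigma g0).

Lemma kappa_unit : kappa \in unitmx.
Proof. by rewrite unitmx_mul unitmx_inv g0_unit map_unitmx g0_unit. Qed.

(** [kappa] compares the eigenbasis [g0] with its image under [sigma]. Both diagonalize the same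
    torus, so it matches weight spaces, through [C]. *)
Lemma kappa_intertwines : intertwines m kappa C.
Proof.
have u0 := g0_unit; have u1 : map_mx sigma g0 \in unitmx by rewrite map_unitmx.
have uw : map_mx sigma g0 *m invmx g0 \in unitmx by rewrite unitmx_mul u1 unitmx_inv.
have := torus_intertwines (w := map_mx sigma g0 *m invmx g0) (B := C) (m := m) u0 uw chL.
rewrite mulmxA mulmxKV //; apply=> t ht.
(* Writing every torus point as an image under [sigma] makes the semilinear hypothesis a linear
   one. *)
have [tau tauK Ktau] := sigma_bij.
have e : map_mx sigma (map_mx tau t) = t by apply/matrixP => i j; rewrite !mxE Ktau.
have ht' : invertible_coords (map_mx tau t).
  move=> i; rewrite mxE -(fmorph_eq0 sigma) Ktau; exact: ht.
have := sigma_torus ht'; rewrite e => <-; rewrite map_torus_param e /torus_param.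
apply: (can_inj (mulmxK uw)); by rewrite mulmxKV // !mulmxA (mulmxKV u0) (mulmxKV u1).
Qed.

Lemma conj0_sigma g : conj0 (map_mx sigma g) = kappa *m map_mx sigma (conj0 g) *m invmx kappa.
Proof.
have u0 := g0_unit; have u1 : map_mx sigma g0 \in unitmx by rewrite map_unitmx.
apply: (can_inj (mulmxK kappa_unit)); rewrite mulmxKV ?kappa_unit // !map_mxM map_invmx.
by rewrite !mulmxA (mulmxK u0) (mulmxK u1).
Qed.

Lemma kappa_invertible : exists C1, C *m C1 = 1%:M /\ C1 *m C = 1%:M.
Proof.
have [s hs] := intertwines_perm kappa_unit kappa_intertwines.
exact (inverse_of_order weights_inj hs).
Qed.

Lemma NS_sigma g B : NS g -> intertwines m (conj0 g) B -> NS (map_mx sigma g).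
Proof.
move=> Ng h; have [C1 [e1 e2]] := kappa_invertible.
have pg := points_sigma sigma_iF algG (NS_points Ng).
apply: (intertwines_NS (B := C *m B *m C1) pg); rewrite conj0_sigma.
apply: intertwines_mul (intertwines_inv chL kappa_unit e1 kappa_intertwines).
by apply: intertwines_mul kappa_intertwines _; apply/intertwines_map.
Qed.

Lemma root_group_sigma u a C1 : C *m C1 = 1%:M -> C1 *m C = 1%:M ->
  root_group iL G g0 m a u -> root_group iL G g0 m (a *m C1) (map_mx sigma u).
Proof.
move=> e1 e2 [pu hu]; split; first exact (points_sigma sigma_iF algG pu).
rewrite conj0_sigma.
exact (root_entries_conj chL e1 e2 kappa_unit kappa_intertwines (root_entries_map sigma hu)).
Qed.

Lemma root_reflection_sigma u w a B : intertwines m (conj0 w) B ->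
  root_reflection iL G S g0 m a u w ->
  exists a', root_reflection iL G S g0 m a' (map_mx sigma u) (map_mx sigma w).
Proof.
move=> h [a0 hu u1 Nw [u' [u'' [h' h'' e]]]]; have [C1 [e1 e2]] := kappa_invertible.
exists (a *m C1); split.
- apply: contra a0 => /eqP z; apply/eqP; have := congr1 (mulmx^~ C) z.
  by rewrite -mulmxA e2 mulmx1 mul0mx.
- exact: root_group_sigma.
- apply: contra u1 => /eqP; rewrite -[RHS](map_mx1 sigma) => z; apply/eqP/matrixP => i j.
  by have /matrixP/(_ i j) := z; rewrite mxE [RHS]mxE => /fmorph_inj.
- exact: NS_sigma Nw h.
- exists (map_mx sigma u'), (map_mx sigma u''); rewrite -mulNmx; split; try exact: root_group_sigma.
  by rewrite e !map_mxM.
Qed.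
End Roots.

(** * Rational characters and translations *)

Lemma monomials1 (E : fieldType) r (t : 'cV[E]_r) : monomials 1%:M t = t.
Proof.
apply/colP => i; rewrite mxE (bigD1 i) //= big1 => [|j ij]; rewrite mxE.
  by rewrite eqxx expr1z mulr1.
by rewrite eq_sym (negPf ij) expr0z.
Qed.

Lemma monomialsMn (E : fieldType) q r (b : 'M[int]_(q, r)) (t : 'cV[E]_r) k i :
  monomials (b *+ k) t i 0 = monomials b t i 0 ^+ k.
Proof.
rewrite !mxE -prodrXl; apply: eq_bigr => j _.
by rewrite mulmxnE -mulr_natr natz -exprz_exp.
Qed.

Section Block.
Variables (E : fieldType) (n : nat) (J : pred 'I_n).

(** Padding by the identity keeps the size [n], while the determinant is that of the submatrix on
    [J]. *)
Definition block (k : 'M[E]_n) : 'M[E]_n :=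
  \matrix_(a, b) if J a && J b then k a b else (a == b)%:R.

Lemma block_mul (k k' : 'M[E]_n) : (forall a b, k a b != 0 -> J a = J b) ->
  block (k *m k') = block k *m block k'.
Proof.
move=> h; apply/matrixP => a b; rewrite !mxE; case: (boolP (J a)) => Ja /=; last first.
  rewrite (bigD1 a) //= big1 => [|c ca]; rewrite !mxE (negPf Ja) /=.
    by rewrite eqxx mul1r addr0.
  by rewrite eq_sym (negPf ca) mul0r.
case: (boolP (J b)) => Jb; last first.
  rewrite (bigD1 b) //= big1 => [|c cb]; rewrite !mxE Ja (negPf Jb) /= ?andbF.
    by rewrite eqxx mulr1 addr0.
  by rewrite (negPf cb) mulr0.
apply: eq_bigr => c _; rewrite !mxE Ja Jb andbT /=.
case: (boolP (J c)) => //= Jc.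
have -> : k a c = 0.
  by apply: contraNeq Jc => /h <-.
have -> : (a == c) = false by apply: contraNF Jc => /eqP <-.
by rewrite !mul0r.
Qed.

Lemma block_diag (d : 'rV[E]_n) (x : E) : (forall j, J j -> d 0 j = x) ->
  \det (block (diag_mx d)) = x ^+ #|J|.
Proof.
move=> h; have -> : block (diag_mx d) = diag_mx (\row_j if J j then x else 1).
  apply/matrixP => a b; rewrite !mxE; have [<-|ab] := eqVneq a b.
    by rewrite andbb !mulr1n; case: ifP => // /h ->.
  by rewrite !mulr0n if_same.
rewrite det_diag -prodr_const [RHS]big_mkcond; apply: eq_bigr => j _; by rewrite mxE.
Qed.
End Block.

Module BlockDeterminants.
Import mpoly.
Section Poly.
Variables (L K : fieldType) (iL : {rmorphism L -> K}) (n : nat).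

Lemma eval_mx_det q (P : 'M[{mpoly L[n * n]}]_q) (g : 'M[K]_n) :
  eval_mx iL (\det P) g = \det (map_mx (fun p => eval_mx iL p g) P).
Proof. exact (esym (det_map_mx (mmap iL (fun j => mxvec g 0 j)) P)). Qed.

Definition coord_poly (g0 : 'M[L]_n) (a b : 'I_n) : {mpoly L[n * n]} :=
  \sum_c \sum_d (invmx g0 a c * g0 d b) *: 'X_(mxvec_index c d).

Lemma eval_coord_poly g0 a b (g : 'M[K]_n) :
  eval_mx iL (coord_poly g0 a b) g = (invmx (map_mx iL g0) *m g *m map_mx iL g0) a b.
Proof.
rewrite /eval_mx /coord_poly raddf_sum /= -mulmxA mxE; apply: eq_bigr => c _.
rewrite raddf_sum /= mxE mulr_sumr; apply: eq_bigr => d _.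
rewrite mmapZ mmapX mmap1U mxvecE rmorphM -map_invmx !mxE; ring.
Qed.
End Poly.

Section BlockPoly.
Variables (L : fieldType) (n r : nat) (g0 : 'M[L]_n) (m : 'M[int]_(n, r)).
Notation same_weight i := (fun j => row j m == row i m).

(** The determinant on one weight space of [S], as a polynomial in the matrix entries. The
    centralizer of [S] preserves weight spaces, which makes this a character of it. *)
Definition block_poly (i : 'I_n) : {mpoly L[n * n]} :=
  \det (\matrix_(a, b) if same_weight i a && same_weight i b
        then coord_poly g0 a b else (a == b)%:R).

Lemma eval_block_poly (E : fieldType) (phi : {rmorphism L -> E}) i (g : 'M[E]_n) :
  eval_mx phi (block_poly i) g =
  \det (block (same_weight i) (invmx (map_mx phi g0) *m g *m map_mx phi g0)).
Proof.
rewrite eval_mx_det; congr (\det _); apply/matrixP => a b; rewrite !mxE.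
case: ifP => _; first by rewrite eval_coord_poly !mxE.
exact: (rmorph_nat (mmap phi (fun j => mxvec g 0 j)) (a == b)).
Qed.

End BlockPoly.
End BlockDeterminants.
Import BlockDeterminants.

Section Translations.
Variables (F L : fieldType) (K : closedFieldType).
Variables (iF : {rmorphism F -> L}) (iL : {rmorphism L -> K}) (v : L -> int).
Variables (n r : nat) (G S : set 'M[K]_n) (g0 : 'M[L]_n) (m : 'M[int]_(n, r)).
Hypothesis chF : forall k : nat, (k.+1)%:R != 0 :> F.
Hypothesis algG : alg_group (iL \o iF) G.
Hypothesis hcoord : torus_coordinates iL g0 m S.
Hypothesis SG : S `<=` G.
Notation same_weight i := (fun j => row j m == row i m).

Lemma intertwines1 (E : fieldType) i (k : 'M[E]_n) : intertwines m k 1%:M ->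
  forall a b, k a b != 0 -> same_weight i a = same_weight i b.
Proof. by move=> h a b /h; rewrite mulmx1 => ->. Qed.

Lemma diag_conj (E : fieldType) (g : 'M[E]_n) (d : 'rV[E]_n) : g \in unitmx ->
  invmx g *m (g *m diag_mx d *m invmx g) *m g = diag_mx d.
Proof. by move=> u; rewrite !mulmxA mulVmx // mul1mx mulmxKV. Qed.

Lemma rational_character_block i :
  rational_character iL G S g0 m (block_poly g0 m i) 0 (row i m *+ #|same_weight i|).
Proof.
have u0 : map_mx iL g0 \in unitmx by rewrite map_unitmx (g0_unit hcoord).
have cK := chK iF iL chF.
have ce (g : 'M[K]_n) : centralizer G S g ->
    intertwines m (invmx (map_mx iL g0) *m g *m map_mx iL g0) 1%:M.
  case=> Gg hg; have ug : g \in unitmx by case: algG => _ [H _ _ _]; exact: H.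
  apply: (torus_intertwines u0 ug cK) => t ht; rewrite monomials1 hg ?mulmxK //.
  by case: hcoord => _ _ ->; exists t.
split.
- rewrite expr0 divr1 eval_block_poly mulmx1 mulVmx //.
  have := block_diag (J := same_weight i) (d := const_mx (1 : K)) (x := 1).
  by rewrite diag_const_mx expr1n; apply=> j _; rewrite mxE.
- move=> g h /ce hg _; rewrite !expr0 !divr1 !eval_block_poly -det_mulmx -block_mul.
    by congr (\det (block _ _)); rewrite !mulmxA (mulmxK u0).
  exact: intertwines1.
- move=> t ht; rewrite expr0 divr1 eval_block_poly diag_conj //.
  rewrite (block_diag (x := monomials m t i 0)) => [|j /eqP e].
    by rewrite monomialsMn; congr (_ ^+ _); apply: monomials_row; rewrite row_id.
  by rewrite mxE; exact: monomials_row.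
Qed.

Hypothesis val_mul : forall x y, x != 0 -> y != 0 -> v (x * y) = v x + v y.
Variable varpi : L.
Hypotheses (varpi0 : varpi != 0) (val_varpi : v varpi = 1).

Lemma val1 : v 1 = 0.
Proof. by have := val_mul (oner_neq0 L) (oner_neq0 L); rewrite mulr1 => /esym/eqP; rewrite -subr_eq0 addrK => /eqP. Qed.

Lemma val_expn x k : x != 0 -> v (x ^+ k) = v x *+ k.
Proof.
move=> x0; elim: k => [|k ih]; first by rewrite val1.
by rewrite exprS val_mul ?expf_neq0 // ih mulrS.
Qed.

Lemma val_varpi_exp (z : int) : v (varpi ^ z) = z.
Proof.
case: z => k; first by rewrite -exprnP val_expn // val_varpi -[RHS]natz.
rewrite NegzE -exprnN; have e0 : varpi ^+ k.+1 != 0 by rewrite expf_neq0.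
have := val_mul e0 (invr_neq0 e0); rewrite divff // val1 val_expn // val_varpi natz.
by move/esym/eqP; rewrite addrC addr_eq0 => /eqP.
Qed.

(** The value at a uniformizer of the cocharacter [c]. *)
Definition varpi_torus (c : 'cV[int]_r) : 'M[L]_n := torus_param g0 m (\col_j varpi ^ c j 0).

Lemma varpi_invertible (c : 'cV[int]_r) : invertible_coords (\col_j varpi ^ c j 0).
Proof. by move=> j; rewrite mxE expfz_neq0. Qed.

Lemma monomials_varpi q (b : 'M[int]_(q, r)) (c : 'cV[int]_r) i :
  monomials b (\col_j varpi ^ c j 0) i 0 = varpi ^ (b *m c) i 0.
Proof.
rewrite !mxE; under eq_bigr => j _ do rewrite mxE exprz_exp mulrC.
apply/esym; apply: (big_morph (fun z => varpi ^ z)); last exact: expr0z.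
by move=> x y; rewrite expfzDr.
Qed.

Lemma varpi_torus_TS c : TS iL G S (varpi_torus c).
Proof.
have u0 := g0_unit hcoord; have u0' : map_mx iL g0 \in unitmx by rewrite map_unitmx.
have hc : invertible_coords (map_mx iL (\col_j varpi ^ c j 0)).
  by move=> j; rewrite mxE fmorph_eq0; exact: varpi_invertible.
rewrite /TS /points /= map_torus_param; case: hcoord => _ _ eS; split.
  by apply: SG; rewrite eS; exists (map_mx iL (\col_j varpi ^ c j 0)).
move=> s; rewrite eS => -[t ht <-]; rewrite /torus_param !mulmxA !(mulmxKV u0').
by rewrite -!(mulmxA (map_mx iL g0)) [diag_mx _ *m diag_mx _]diag_mxC.
Qed.

Variables (R : realType) (W : groupType) (pi : 'M[L]_n -> W).
Variable act : W -> 'cV[R]_r -> 'cV[R]_r.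
Hypothesis hact : is_apartment iL v G S g0 m pi act.
Notation mR := (map_mx (fun z : int => z%:~R : R) m).

Lemma pairing_row i k (y : 'cV[R]_r) : pairing (row i m *+ k) y = (mR *m y) i 0 *+ k.
Proof.
rewrite /pairing !mxE -sumrMnl; apply: eq_bigr => j _.
by rewrite !mxE mulmxnE mxE rmorphMn /= mulrnAl.
Qed.

Lemma same_weight_gt0 i : (0 < #|(fun j => row j m == row i m)|)%N.
Proof. by apply/card_gt0P; exists i; rewrite unfold_in eqxx. Qed.

(** The character at hand restricts to [k] times a weight, [k] being its multiplicity; this bounds
    the denominators of translations by [n]. *)
Lemma translation_integral t x i : TS iL G S t ->
  exists2 k, (0 < k <= n)%N & exists z : int, (mR *m (act (pi t) x - x)) i 0 *+ k = z%:~R.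
Proof.
move=> ht; exists #|(fun j => row j m == row i m)|.
  rewrite same_weight_gt0 /=; have := max_card (fun j => row j m == row i m).
  by rewrite card_ord.
have := act_translation hact ht (rational_character_block i) x.
by rewrite pairing_row -rmorphN => ->; eexists.
Qed.

(** Valuations of block determinants give both sides the same pairing with every weight, and weights
    separate real cocharacters. *)
Lemma varpi_translation c x :
  act (pi (varpi_torus c)) x = x - map_mx intr c.
Proof.
have u0 : g0 \in unitmx := g0_unit hcoord.
apply/eqP; rewrite -subr_eq0; apply/eqP; apply: (real_kernel (weights_inj iF chF hcoord)).
apply/colP => i; rewrite [RHS]mxE; apply: (@pmulrnI R _ (same_weight_gt0 i)).
have := act_translation hact (varpi_torus_TS c) (rational_character_block i) x.
have ev t : eval_mx id (block_poly g0 m i) t =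
    \det (block (fun j => row j m == row i m) (invmx g0 *m t *m g0)).
  have := eval_block_poly g0 m (idfun : {rmorphism L -> L}) i t.
  by rewrite (map_mx_id (f := idfun)).
rewrite expr0 divr1 ev /varpi_torus diag_conj //.
rewrite (block_diag (x := varpi ^ (m *m c) i 0)) => [|j /eqP e]; last first.
  by rewrite mxE -monomials_varpi; exact: monomials_row.
rewrite val_expn ?expfz_neq0 // val_varpi_exp pairing_row => e.
have -> : act (pi (torus_param g0 m (\col_j varpi ^ c j 0))) x - (x - map_mx intr c)
  = (act (pi (torus_param g0 m (\col_j varpi ^ c j 0))) x - x) + map_mx intr c by rewrite opprB addrA addrAC.
rewrite mulmxDr mxE mulrnDl e -map_mxM [map_mx _ _ i 0]mxE rmorphMn mul0rn.
by rewrite addNr.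
Qed.
End Translations.

(** * The apartment as a Euclidean space *)

Section OrthogonalReflection.
Variables (R : realType) (V : lmodType R) (ip : V -> V -> R).
Hypotheses (ipC : forall x y, ip x y = ip y x)
  (ipDl : forall x y z, ip (x + y) z = ip x z + ip y z)
  (ipZl : forall (a : R) x y, ip (a *: x) y = a * ip x y)
  (ip_gt0 : forall x, x != 0 -> 0 < ip x x).

(** The image of [e] is orthogonal to the fixed space, hence a multiple [mu *: e]; [mu] is a sign,
    and it is not 1 since [e] itself is not fixed. *)
Lemma reflection_formula (A : V -> V) (e : V) :
  (forall x y, A (x + y) = A x + A y) -> (forall (a : R) x, A (a *: x) = a *: A x) ->
  (forall x y, ip (A x) (A y) = ip x y) -> ip e e = 1 ->
  (forall y, A y = y <-> ip e y = 0) ->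
  forall y, A y = y - (2 * ip e y) *: e.
Proof.
move=> AD AZ Aip e1 hA y.
have ipDr x z z' : ip x (z + z') = ip x z + ip x z' by rewrite ipC ipDl !(ipC x).
have ipZr (a : R) x z : ip x (a *: z) = a * ip x z by rewrite ipC ipZl ipC.
have perp z : ip e (z - ip e z *: e) = 0.
  by rewrite -scaleN1r ipDr !ipZr e1 mulr1 mulN1r subrr.
pose mu := ip e (A e); pose w := A e - mu *: e.
have w0 : w = 0.
  apply: contrapT => /eqP/ip_gt0; suff -> : ip w w = 0 by rewrite ltxx.
  have ew : ip e w = 0 := perp (A e).
  have Aw : A w = w by apply/hA.
  have : ip (A e) w = 0 by rewrite -Aw Aip.
  by rewrite {2}/w -scaleN1r ipDl !ipZl ew !mulr0 addr0.
have Ae : A e = mu *: e by apply/eqP; rewrite -subr_eq0; apply/eqP.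
have mu2 : mu * mu = 1 by have := Aip e e; rewrite Ae ipZl ipZr e1 mulr1.
have mu1 : mu != 1.
  apply/eqP => m1; have := (hA e).1; rewrite Ae m1 scale1r e1 => /(_ erefl)/eqP.
  by rewrite oner_eq0.
have mN : mu = -1.
  have : (mu - 1) * (mu + 1) = 0 by ring: mu2.
  by move/eqP; rewrite mulf_eq0 subr_eq0 (negPf mu1) addr_eq0 => /eqP.
have h := (hA _).2 (perp y); rewrite -[y in LHS](subrK (ip e y *: e)) AD h AZ Ae mN.
by rewrite scaleN1r scalerN -addrA -opprD -scalerDl; congr (_ - _ *: _); ring.
Qed.
End OrthogonalReflection.

Section Apartment.
Variables (F L : fieldType) (K : closedFieldType).
Variables (iF : {rmorphism F -> L}) (iL : {rmorphism L -> K}) (v : L -> int) (sigma : {rmorphism L -> L}).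
Variables (n r : nat) (G S : set 'M[K]_n) (g0 : 'M[L]_n) (m : 'M[int]_(n, r)).
Hypothesis hF : padic_frobenius iF v sigma.
Hypothesis algG : alg_group (iL \o iF) G.
Hypothesis hcoord : torus_coordinates iL g0 m S.
Hypothesis SG : S `<=` G.
Variables (R : realType) (W : groupType) (pi : 'M[L]_n -> W).
Variable act : W -> 'cV[R]_r -> 'cV[R]_r.
Hypothesis hpi : is_quotient pi (NS iL G S) (T1 iL v G S).
Hypothesis hact : is_apartment iL v G S g0 m pi act.
Variable x0 : 'cV[R]_r.
Hypothesis hx0H : forall H, hyperplanes iL G S g0 m pi act H -> ~ H x0.
Hypothesis hW : affine_weyl_structure iL v G S g0 m pi act x0.

Notation NS := (NS iL G S).
Notation conj0 g := (invmx g0 *m g *m g0).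
Notation ip := (@weight_ip n r m R).
Notation chF := (padic_char0 hF).
Notation minj := (weights_inj iF chF hcoord).
Notation root_reflection := (root_reflection iL G S g0 m).

Definition root_reflections : set W := [set t | exists a u w, root_reflection a u w /\ t = pi w].
Notation T := root_reflections.
Definition linear_part (w : W) (x : 'cV[R]_r) : 'cV[R]_r := act w x - act w 0.
Notation lin := linear_part.

Lemma proj_mul x y : NS x -> NS y -> pi (x *m y) = (pi x * pi y)%g.
Proof. by case: hpi => h _ _; apply: h. Qed.

Lemma proj_onto w : exists2 x, NS x & pi x = w.
Proof. by case: hpi => _ h _; apply: h. Qed.

Lemma proj_1 : pi 1%:M = 1%g.
Proof.
have [x Nx _] := proj_onto 1%g; have N1 : NS 1%:M.
  by rewrite -(mulmxV (NS_unit algG Nx)); apply: (NS_mul algG Nx (NS_inv algG Nx)).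
by apply: (mulgI (pi 1%:M)); rewrite -proj_mul // mulmx1 mulg1.
Qed.

Lemma proj_inv x : NS x -> pi (invmx x) = (pi x)^-1%g.
Proof.
move=> Nx; apply: (mulgI (pi x)); rewrite -proj_mul //; last exact: (NS_inv algG).
by rewrite mulmxV ?proj_1 ?mulgV ?(NS_unit algG Nx).
Qed.

Lemma act_matrix x : NS x -> exists B s, [/\ m *m B = row_perm s m, intertwines m (conj0 x) B &
  forall y z, act (pi x) y - act (pi x) z = map_mx intr B *m (y - z)].
Proof.
move=> Nx; have [B [hB hact']] := act_linear hact Nx.
have ux := NS_unit algG Nx.
have hi : intertwines m (conj0 x) B.
  apply/(intertwines_map m iL); rewrite !map_mxM map_invmx.
  apply: (torus_intertwines _ _ (chK iF iL chF) hB); rewrite map_unitmx //.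
  exact: g0_unit hcoord.
have [s hs] := intertwines_perm (conj0_unit hcoord ux) hi.
by exists B, s.
Qed.

Lemma lin_matrix w : exists B s, m *m B = row_perm s m /\
  forall y, lin w y = map_mx intr B *m y.
Proof.
have [x Nx <-] := proj_onto w; have [B [s [hs _ h]]] := act_matrix Nx.
by exists B, s; split=> // y; rewrite /lin h subr0.
Qed.

Lemma act_sub w x y : act w x - act w y = lin w (x - y).
Proof.
have [z Nz <-] := proj_onto w; have [B [s [hs _ h]]] := act_matrix Nz.
by rewrite /lin !h subr0.
Qed.

Lemma linear_partD w x y : lin w (x + y) = lin w x + lin w y.
Proof. by have [B [s [_ h]]] := lin_matrix w; rewrite !h mulmxDr. Qed.

Lemma linear_partZ w (a : R) x : lin w (a *: x) = a *: lin w x.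
Proof. by have [B [s [_ h]]] := lin_matrix w; rewrite !h -scalemxAr. Qed.

Lemma linear_part_ip w x y : ip (lin w x) (lin w y) = ip x y.
Proof. by have [B [s [hs h]]] := lin_matrix w; rewrite !h; apply: (weight_ip_perm x y hs). Qed.

Lemma linear_part_finite w : exists2 k, (0 < k)%N & forall x, iter k (lin w) x = x.
Proof.
have [B [s [hs h]]] := lin_matrix w.
have [N N0 e] := perm_finite_order minj hs; exists N => // x.
by rewrite (eq_iter h) iter_mulmx e map_mx1 mul1mx.
Qed.

Lemma root_reflections_conj w t : T t -> T (w * t * w^-1)%g.
Proof.
have [g Ng <-] := proj_onto w; move=> [a [u [x [hx ->]]]].
have [B [s [_ hB _]]] := act_matrix Ng.
have Nx : NS x by case: hx.
have [a' h'] := root_reflection_conj chF algG hcoord Ng hB hx.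
exists a', (g *m u *m invmx g), (g *m x *m invmx g); split=> //.
rewrite proj_mul ?proj_mul ?proj_inv //; [exact: (NS_mul algG) | exact: (NS_inv algG)].
Qed.

Lemma pairingD b (x y : 'cV[R]_r) : pairing b (x + y) = pairing b x + pairing b y.
Proof. by rewrite /pairing mulmxDr mxE. Qed.

Lemma pairingZ b (a : R) (x : 'cV[R]_r) : pairing b (a *: x) = a * pairing b x.
Proof. by rewrite /pairing -scalemxAr mxE. Qed.

Lemma pairingMn b (x : 'cV[R]_r) k : pairing (b *+ k) x = pairing b x *+ k.
Proof.
rewrite /pairing !mxE -sumrMnl; apply: eq_bigr => j _.
by rewrite !mxE mulmxnE rmorphMn /= mulrnAl.
Qed.

Lemma pairing_tr_neq0 (b : 'rV[int]_r) : b != 0 -> pairing b (map_mx intr b^T : 'cV[R]_r) != 0.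
Proof.
move=> b0; rewrite /pairing mxE; apply: contra b0 => /eqP h; apply/eqP/rowP => j.
rewrite mxE; apply: (@intr_inj R); apply/eqP.
have : \sum_j (b 0 j)%:~R * (b 0 j)%:~R = 0 :> R.
  by rewrite -[RHS]h; apply: eq_bigr => k _; rewrite !mxE.
move/eqP; rewrite psumr_eq0 => [/allP/(_ j)|k _]; last by rewrite -expr2 sqr_ge0.
by rewrite mem_index_enum => /(_ isT); rewrite mulf_eq0 orbb.
Qed.

Definition unit_normal (b : 'rV[int]_r) : 'cV[R]_r :=
  let w := projT1 (cid (riesz minj (map_mx intr b : 'rV[R]_r))) in
  (Num.sqrt (ip w w))^-1 *: w.

Lemma unit_normalP b : b != 0 -> ip (unit_normal b) (unit_normal b) = 1 /\
  forall y, ip (unit_normal b) y = 0 <-> pairing b y = 0.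
Proof.
move=> b0; rewrite /unit_normal; case: cid => w hw /=.
have hw' y : ip w y = pairing b y := hw y.
have w0 : w != 0.
  apply: contra (pairing_tr_neq0 b0) => /eqP e; rewrite -hw' e.
  by rewrite -(scale0r 0) weight_ipZ mul0r.
have p0 := weight_ip_gt0 minj w0.
have s0 : Num.sqrt (ip w w) != 0 by rewrite gt_eqF // sqrtr_gt0.
split.
  rewrite weight_ipZ weight_ipC weight_ipZ -{3}(sqr_sqrtr (ltW p0)).
  by field.
move=> y; rewrite weight_ipZ; split=> [/eqP|z]; last by rewrite (hw' y) z mulr0.
by rewrite (hw' y) mulf_eq0 invr_eq0 (negPf s0) => /eqP.
Qed.

(** A nontrivial entry of [u] in the basis [g0] makes [a] proportional to a difference of two
    weights. There are finitely many differences, hence finitely many wall normals. *)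
Lemma reflection_hyperplane t : T t -> exists a i j c,
  [/\ a != 0, row i m - row j m != 0, forall x, act t x = x <-> pairing a x = c &
      forall y : 'cV[R]_r, pairing (row i m - row j m) y = 0 <-> pairing a y = 0].
Proof.
move=> [a [u [w [hx ->]]]].
have [c hc] := hyperplane_reflection hW hx.
have hfix x : act (pi w) x = x <-> pairing a x = c.
  by have := congr1 (fun X : set _ => X x) hc; rewrite /= => ->.
case: hx => a0 [pu hu] u1 Nw _.
have [i [j hij]] : exists i j, (conj0 u) i j != (i == j)%:R.
  apply: contrapT => no; move/eqP: u1; apply.
  have -> : u = g0 *m conj0 u *m invmx g0 by rewrite (conj0K hcoord).
  have -> : conj0 u = 1%:M.
    apply/matrixP => i j; rewrite [RHS]mxE; apply: contrapT => h; apply: no.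
    by exists i, j; apply/eqP.
  by rewrite mulmx1 mulmxV // (g0_unit hcoord).
case: (hu i j) => [e|[p [q [p0 q0 e]]]]; first by rewrite e eqxx in hij.
exists a, i, j, c; split=> //.
  apply: contra a0 => /eqP z; move: e; rewrite z mul0rn => /esym/eqP.
  apply: contraTT => a0; apply/eqP => /matrixP z'; move/negP: a0; apply; apply/eqP/rowP => k.
  have := z' 0 k; rewrite mulmxnE !mxE => /eqP; rewrite mulrn_eq0 => /orP[|/eqP //].
  by rewrite eqn0Ngt p0.
move=> y; have := congr1 (fun b => pairing b y) e; rewrite !pairingMn => e'.
split=> z; move: e'; rewrite z mul0rn.
  by move/esym/eqP; rewrite mulrn_eq0 eqn0Ngt p0 => /eqP.
by move/eqP; rewrite mulrn_eq0 eqn0Ngt q0 => /eqP.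
Qed.

Lemma reflection_fixed t : T t -> exists x, act t x = x.
Proof.
move=> /reflection_hyperplane[a [i [j [c [a0 _ hx _]]]]].
exists ((c / pairing a (map_mx intr a^T)) *: map_mx intr a^T); apply/hx.
by rewrite pairingZ divfK // pairing_tr_neq0.
Qed.

Lemma reflection_linear_fixed t : T t -> exists i j, row i m - row j m != 0 /\
  forall y, lin t y = y <-> pairing (row i m - row j m) y = 0.
Proof.
move=> ht; have [x hx] := reflection_fixed ht.
have [a [i [j [c [a0 b0 h hb]]]]] := reflection_hyperplane ht.
exists i, j; split=> // y; rewrite hb.
have e : act t (x + y) = x + lin t y.
  have hyx : x + y - x = y by rewrite addrAC subrr add0r.
  by have := act_sub t (x + y) x; rewrite hx hyx => <-; rewrite [RHS]addrC subrK.
have := h (x + y); rewrite e pairingD ((h x).1 hx) => h'; split=> z.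
  by have := h'.1; rewrite z => /(_ erefl)/eqP; rewrite -subr_eq0 addrAC subrr add0r => /eqP.
by apply: (addrI x); apply/h'; rewrite z addr0.
Qed.

Definition unit_normals : seq 'cV[R]_r :=
  [seq unit_normal (row ij.1 m - row ij.2 m) | ij : 'I_n * 'I_n].

Definition is_wall_normal (t : W) (e : 'cV[R]_r) : Prop :=
  ip e e = 1 /\ forall y, lin t y = y <-> ip e y = 0.

(* The first normal of a fixed list depends only on the linear part of t, so
   that parallel reflections get the same normal and not opposite ones. *)
Definition wall_normal (t : W) : 'cV[R]_r := head 0 [seq e <- unit_normals | `[< is_wall_normal t e >]].
(** By [offset_fixed] the chosen fixed point does not matter; a reflection has one, so the default 0
    is not reached. *)
Definition wall_offset (t : W) : R := ip (wall_normal t) (xget 0 [set x | act t x = x]).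

Lemma wall_normalP t : T t -> wall_normal t \in unit_normals /\ is_wall_normal t (wall_normal t).
Proof.
move=> ht; have [i [j [b0 hb]]] := reflection_linear_fixed ht.
have [e1 e2] := unit_normalP b0.
have : unit_normal (row i m - row j m) \in [seq e <- unit_normals | `[< is_wall_normal t e >]].
  rewrite mem_filter; apply/andP; split.
    by apply/asboolP; split=> // y; rewrite hb e2.
  exact: (codom_f (fun ij => unit_normal (row ij.1 m - row ij.2 m)) (i, j)).
rewrite /wall_normal; case E: [seq _ <- _ | _] => [//|e l] _ /=.
have : e \in [seq e <- unit_normals | `[< is_wall_normal t e >]] by rewrite E mem_head.
by rewrite mem_filter => /andP[/asboolP].
Qed.

Lemma wall_normal_eq t t' : (forall y, lin t y = y <-> lin t' y = y) -> wall_normal t = wall_normal t'.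
Proof.
move=> h; rewrite /wall_normal; congr head; apply: eq_filter => e.
by apply/asboolP/asboolP => -[e1 he]; split=> // y; rewrite ?h // -h.
Qed.

Lemma reflection_linear t y : T t -> lin t y = y - (2 * ip (wall_normal t) y) *: wall_normal t.
Proof.
move=> /wall_normalP[_ [e1 h]].
exact: (reflection_formula (@weight_ipC n r m R) (@weight_ipD n r m R) (@weight_ipZ n r m R)
  (@weight_ip_gt0 n r m minj R) (linear_partD t) (linear_partZ t) (linear_part_ip t) e1 h).
Qed.

Notation f := (wall_form ip wall_normal wall_offset).

Lemma reflection_affine t x : T t -> act t x = x - (2 * f t x) *: wall_normal t.
Proof.
move=> ht; rewrite /wall_form /wall_offset; case: xgetP => [p _ hp|no]; last first.
  by have [p hp] := reflection_fixed ht; case: (no p).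
have := act_sub t x p; rewrite [act t p]hp (reflection_linear _ ht) => /eqP.
rewrite subr_eq addrAC subrK => /eqP ->.
have -> : ip (wall_normal t) (x - p) = ip (wall_normal t) x - ip (wall_normal t) p.
  by rewrite weight_ipC weight_ipD -scaleN1r weight_ipZ mulN1r !(weight_ipC m (wall_normal t)).
by [].
Qed.

Lemma offset_fixed t x : T t -> act t x = x -> ip (wall_normal t) x = wall_offset t.
Proof.
move=> ht; rewrite (reflection_affine x ht) => /eqP.
rewrite -[X in _ == X]subr0 (inj_eq (addrI x)) eqr_opp scaler_eq0 => /orP[|/eqP z].
  by rewrite mulf_eq0 pnatr_eq0 /= /wall_form subr_eq0 => /eqP.
have [_ [+ _]] := wall_normalP ht; rewrite z -(scale0r 0) weight_ipZ mul0r => /esym/eqP.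
by rewrite oner_eq0.
Qed.

Lemma conj_linear_part t w y : lin (w * t * w^-1)%g (lin w y) = lin w (lin t y).
Proof.
have h u u' z : lin (u * u')%g z = lin u (lin u' z).
  by rewrite /lin !(act_mul hact) !act_sub /lin subr0 act_sub.
by rewrite -!h mulgKV.
Qed.

Lemma trivial_linear_TS g : NS g -> (forall y, lin (pi g) y = y) -> TS iL G S g.
Proof.
move=> Ng h; have [B [s [hs hB hl]]] := act_matrix Ng.
have B1 : B = 1%:M.
  apply/matrixP => i j; apply: (@intr_inj R).
  have := h (delta_mx j 0); rewrite /lin hl subr0 -colE => /colP/(_ i).
  by rewrite !mxE eqxx andbT => ->; case: eqP.
split; first exact: NS_points Ng.
have ug := NS_unit algG Ng; have u0 := g0_unit hcoord.
have u0' : map_mx iL g0 \in unitmx by rewrite map_unitmx.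
have uk : map_mx iL (conj0 g) \in unitmx by rewrite map_unitmx (conj0_unit hcoord).
have h' : intertwines m (map_mx iL (conj0 g)) 1%:M by apply/intertwines_map; rewrite -B1.
case: hcoord => _ _ -> x [t ht <-].
have := intertwines_torus u0' uk (chK iF iL chF) h' ht.
have -> : map_mx iL g0 *m map_mx iL (conj0 g) *m invmx (map_mx iL g0) = map_mx iL g.
  by rewrite -map_invmx -!map_mxM (conj0K hcoord).
rewrite monomials1 => {2}<-; rewrite mulmxKV // map_unitmx //.
Qed.

(** [t' * t] comes from the centralizer of [S] and translates by a vector of length [2 * d]. Some
    weight is nonzero on it, and at most [n] times its value is a nonzero integer; that value is
    bounded by the length. Using [n.+1] avoids a zero denominator. *)
Lemma offset_spacing t t' : T t -> T t' -> wall_normal t = wall_normal t' ->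
  wall_offset t < wall_offset t' -> (2 * n.+1%:R)^-1 <= wall_offset t' - wall_offset t.
Proof.
move=> ht ht' en lt0.
have e1 : ip (wall_normal t) (wall_normal t) = 1 by case: (wall_normalP ht) => _ [].
have tau x : act (t' * t)%g x = x + (2 * (wall_offset t' - wall_offset t)) *: wall_normal t.
  have ipB (a : R) y : ip (wall_normal t) (y - a *: wall_normal t) = ip (wall_normal t) y - a.
    by rewrite weight_ipC -scaleNr weight_ipD weight_ipZ e1 mulr1 weight_ipC.
  rewrite (act_mul hact) (reflection_affine x ht) (reflection_affine _ ht') /wall_form -en ipB.
  by rewrite -addrA -opprD -scalerDl -scaleNr; congr (_ + _ *: _); ring.
have [g Ng eg] := proj_onto (t' * t)%g.
have hT : TS iL G S g.
  by apply: trivial_linear_TS Ng _ => y; rewrite eg /lin !tau add0r addrK.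
set d := wall_offset t' - wall_offset t in tau *; have d0 : 0 < d by rewrite subr_gt0.
pose y := (2 * d) *: wall_normal t; pose mR := map_mx (fun z : int => z%:~R : R) m.
have ipyy : ip y y = 4 * d ^+ 2.
  by rewrite /y weight_ipZ weight_ipC weight_ipZ e1; ring.
have [i hi] : exists i, (mR *m y) i 0 != 0.
  apply: contrapT => no; have : ip y y = 0.
    apply: big1 => i _; suff -> : (map_mx (fun z : int => z%:~R) m *m y) i 0 = 0 by rewrite mul0r.
    by apply: contrapT => h; apply: no; exists i; apply/eqP.
  by rewrite ipyy => /eqP; rewrite mulf_eq0 pnatr_eq0 /= sqrf_eq0 gt_eqF.
have [k /andP[k0 kn] [z hz]] := translation_integral chF algG hcoord hact 0 i hT.
rewrite eg tau addrC addKr -/y -/mR -mulr_natr in hz.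
set c := (mR *m y) i 0 in hi hz.
have c2 : c ^+ 2 <= 4 * d ^+ 2.
  rewrite -ipyy /weight_ip (bigD1 i) //= -/mR -/c -expr2 lerDl; apply: sumr_ge0 => j _.
  by rewrite -expr2 sqr_ge0.
have z0 : z != 0.
  apply: contraNneq hi => z0; move/eqP: hz; rewrite z0 mulf_eq0 pnatr_eq0 => /orP[//|].
  by rewrite eqn0Ngt k0.
have z1 : (1 : R) <= (z ^+ 2)%:~R.
  by rewrite -[1]/(1%:~R) ler_int; have : (0 < z ^+ 2)%R by rewrite exprn_even_gt0.
have k1 : (k%:R : R) <= n.+1%:R by rewrite ler_nat leqW.
have kp : (0 : R) < k%:R by rewrite ltr0n.
have np : (0 : R) < n.+1%:R by rewrite ltr0n.
rewrite rmorphXn /= -hz exprMn in z1.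
have h1 : (1 : R) <= (2 * n.+1%:R * d) ^+ 2.
  apply: le_trans z1 _; have -> : (2 * n.+1%:R * d) ^+ 2 = (4 * d ^+ 2) * n.+1%:R ^+ 2 by ring.
  apply: ler_pM; rewrite ?sqr_ge0 //; by rewrite ler_pXn2r // nnegrE ltW.
have q0 : (0 : R) < 2 * n.+1%:R by rewrite mulr_gt0.
rewrite -[leLHS]mul1r ler_pdivrMr // mulrC.
have qd : (0 : R) <= 2 * n.+1%:R * d by rewrite mulr_ge0 // ltW.
by rewrite -(ler_pXn2r (n := 2)) ?nnegrE ?ler01 // expr1n.
Qed.

(** Conjugation by a uniformizer translation along the transpose of [b] keeps the normal and moves
    the wall, since [b] does not vanish on its transpose. *)
Lemma offset_translate t : T t -> exists t', [/\ T t', wall_normal t' = wall_normal t & wall_offset t' != wall_offset t].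
Proof.
move=> ht; have [i [j [b0 hb]]] := reflection_linear_fixed ht.
have [varpi [varpi0 vv]] := val_base_onto hF.
have p0 : iF varpi != 0 by rewrite fmorph_eq0.
pose b := row i m - row j m; pose q := pi (varpi_torus g0 m (iF varpi) b^T).
have hq x : act q x = x - map_mx intr b^T :=
  varpi_translation chF algG hcoord SG (val_mul hF) p0 vv hact b^T x.
have Tt' := root_reflections_conj q ht; exists (q * t * q^-1)%g.
have linq y : lin q y = y by rewrite /lin !hq sub0r opprK subrK.
have en : wall_normal (q * t * q^-1)%g = wall_normal t.
  by apply: wall_normal_eq => y; rewrite -{1}(linq y) conj_linear_part linq.
split=> //; have [x hx] := reflection_fixed ht.
have hx' : act (q * t * q^-1)%g (act q x) = act q x.
  by rewrite -(act_mul hact) mulgKV (act_mul hact) hx.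
rewrite -(offset_fixed Tt' hx') en -(offset_fixed ht hx) hq.
rewrite weight_ipC -scaleN1r weight_ipD weight_ipZ weight_ipC -subr_eq0 addrAC subrr add0r.
rewrite mulN1r oppr_eq0; apply/eqP => z.
rewrite weight_ipC in z; have [_ [_ hn]] := wall_normalP ht.
have /hb/eqP := (hn _).2 z; apply/negP; exact: pairing_tr_neq0.
Qed.
End Apartment.

Section ApartmentReflectionGroup.
Variables (F L : fieldType) (K : closedFieldType).
Variables (iF : {rmorphism F -> L}) (iL : {rmorphism L -> K}) (v : L -> int) (sigma : {rmorphism L -> L}).
Variables (n r : nat) (G S : set 'M[K]_n) (g0 : 'M[L]_n) (m : 'M[int]_(n, r)).
Hypothesis hF : padic_frobenius iF v sigma.
Hypothesis algG : alg_group (iL \o iF) G.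
Hypothesis hcoord : torus_coordinates iL g0 m S.
Hypothesis SG : S `<=` G.
Variables (R : realType) (W : groupType) (pi : 'M[L]_n -> W).
Variable act : W -> 'cV[R]_r -> 'cV[R]_r.
Hypothesis hpi : is_quotient pi (NS iL G S) (T1 iL v G S).
Hypothesis hact : is_apartment iL v G S g0 m pi act.
Variable x0 : 'cV[R]_r.
Hypothesis hx0H : forall H, hyperplanes iL G S g0 m pi act H -> ~ H x0.
Hypothesis hW : affine_weyl_structure iL v G S g0 m pi act x0.

Notation NS := (NS iL G S).
Notation conj0 g := (invmx g0 *m g *m g0).
Notation ip := (@weight_ip n r m R).
Notation chF := (padic_char0 hF).
Notation minj := (weights_inj iF chF hcoord).
Notation root_reflection := (root_reflection iL G S g0 m).

Notation T := (root_reflections iL G S g0 m pi).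
Notation lin := (linear_part act).
Notation nrm := (wall_normal hF hcoord act).
Notation off := (wall_offset hF hcoord act).
Notation f := (wall_form ip nrm off).
Notation Wabr := (Wa iL v G S g0 m pi act).
Notation Hbr := (hyperplanes iL G S g0 m pi act).

Lemma wall_fixed t x : T t -> act t x = x <-> f t x = 0.
Proof.
move=> ht; split=> [hx|z].
  by rewrite /wall_form (offset_fixed hF algG hcoord hpi hact hW ht hx) subrr.
by rewrite (reflection_affine hF algG hcoord hpi hact hW x ht) z mulr0 scale0r subr0.
Qed.

Lemma hyperplanesP H : Hbr H <-> exists2 t, T t & H = [set x | act t x = x].
Proof.
split=> [[a [u [w [h ->]]]]|[t [a [u [w [h ->]]]] ->]]; last by exists a, u, w.
by exists (pi w) => //; exists a, u, w.
Qed.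

Lemma base_regular t : T t -> f t x0 != 0.
Proof.
move=> ht; apply/eqP => z; apply: (hx0H (H := [set x | act t x = x])).
  by apply/hyperplanesP; exists t.
by apply/wall_fixed.
Qed.

Lemma wall_form_line t y (s : R) : f t (x0 + s *: (y - x0)) = f t x0 + s * (f t y - f t x0).
Proof.
rewrite /wall_form weight_ipC weight_ipD weight_ipZ -scaleN1r weight_ipD weight_ipZ.
by rewrite !(weight_ipC m _ (nrm t)); ring.
Qed.

Lemma alcoveP y : alcove Hbr x0 y <-> forall t, T t -> 0 < f t x0 * f t y.
Proof.
split=> [h t ht|h H /hyperplanesP[t ht ->] s /= /andP[s0 s1]].
  have r0 := base_regular ht; rewrite ltNge; apply/negP => neg.
  have d0 : f t x0 - f t y != 0.
    apply: contraL neg; rewrite subr_eq0 => /eqP <-; rewrite -ltNge.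
    by rewrite -expr2 lt_neqAle sqr_ge0 eq_sym sqrf_eq0 r0.
  pose s := f t x0 / (f t x0 - f t y).
  have hd : s * (f t x0 - f t y) = f t x0 by rewrite /s divfK.
  have d2 : 0 < (f t x0 - f t y) ^+ 2 by rewrite lt_neqAle sqr_ge0 eq_sym sqrf_eq0 d0.
  apply: (h [set x | act t x = x] _ s) => /=; first by apply/hyperplanesP; exists t.
    apply/andP; split.
      rewrite -(pmulr_rge0 _ d2) expr2 -mulrA [_ * s]mulrC hd; move: neg.
      move: (f t x0) (f t y) => a b neg; have : 0 <= a * a by rewrite -expr2 sqr_ge0.
      move=> aa; have -> : (a - b) * a = a * a - a * b by ring.
      by rewrite subr_ge0 (le_trans neg).
    rewrite -subr_ge0 -(pmulr_rge0 _ d2) expr2 -mulrA mulrBr mulr1 [_ * s]mulrC hd; move: neg.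
    move: (f t x0) (f t y) => a b neg; have bb : 0 <= b * b by rewrite -expr2 sqr_ge0.
    have -> : (a - b) * (a - b - a) = b * b - a * b by ring.
    by rewrite subr_ge0 (le_trans neg).
  apply/wall_fixed => //; rewrite wall_form_line -opprB mulrN hd subrr //.
move/(wall_fixed _ ht); rewrite wall_form_line => z.
have := h t ht; have r0 := base_regular ht.
have a2 : 0 < f t x0 * f t x0 by rewrite -expr2 lt_neqAle sqr_ge0 eq_sym sqrf_eq0 r0.
move=> pos; have : f t x0 * (f t x0 + s * (f t y - f t x0)) = 0 by rewrite z mulr0.
have -> : f t x0 * (f t x0 + s * (f t y - f t x0)) =
  (1 - s) * (f t x0 * f t x0) + s * (f t x0 * f t y) by ring.
have [->|sn] := eqVneq s 0; first by rewrite subr0 mul1r mul0r addr0 => e; rewrite e ltxx in a2.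
move=> e; have : 0 < (1 - s) * (f t x0 * f t x0) + s * (f t x0 * f t y).
  apply: ltr_wpDl; first by rewrite mulr_ge0 ?subr_ge0 // ltW.
  by rewrite mulr_gt0 // lt_neqAle eq_sym sn.
by rewrite e ltxx.
Qed.

(** The computation of [wall_conj], at a stage where the axioms of a reflection group are still
    being verified. *)
Lemma wall_form_act t w : T t -> T (w^-1 * t * w)%g -> exists2 e : R, e * e = 1 &
  forall y, f t (act w y) = e * f (w^-1 * t * w)%g y.
Proof.
move=> ht ht'; set t' := (w^-1 * t * w)%g in ht' *.
have e1 : ip (nrm t) (nrm t) = 1 by case: (wall_normalP hF algG hcoord hpi hact hW ht) => _ [].
have e1' : ip (nrm t') (nrm t') = 1 by case: (wall_normalP hF algG hcoord hpi hact hW ht') => _ [].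
have key y : f t' y *: lin w (nrm t') = f t (act w y) *: nrm t.
  have : act w (act t' y) = act t (act w y) by rewrite -!(act_mul hact) /t' !mulgA mulgV mul1g.
  rewrite (reflection_affine hF algG hcoord hpi hact hW y ht') (reflection_affine hF algG hcoord hpi hact hW _ ht).
  have -> : act w (y - (2 * f t' y) *: nrm t') = act w y - (2 * f t' y) *: lin w (nrm t').
    apply/eqP; rewrite -subr_eq0 opprB addrA addrAC.
    rewrite (act_sub hF algG hcoord hpi hact) [y - _ - y]addrAC subrr add0r -scaleNr.
    by rewrite (linear_partZ hF algG hcoord hpi hact) scaleNr addNr.
  move=> /addrI/oppr_inj; rewrite -!scalerA.
  by move/(scalerI (_ : (2 : R) != 0)); apply; rewrite pnatr_eq0.
pose e := ip (nrm t) (lin w (nrm t')).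
have lin1 y : f t (act w y) = e * f t' y.
  have := congr1 (ip (nrm t)) (key y); rewrite weight_ipC weight_ipZ weight_ipC -/e.
  by rewrite [RHS]weight_ipC weight_ipZ e1 mulr1 => <-; rewrite mulrC.
exists e => //; have sq : f t' x0 * f t' x0 = f t (act w x0) * f t (act w x0).
  have : ip (f t' x0 *: lin w (nrm t')) (f t' x0 *: lin w (nrm t')) =
         ip (f t (act w x0) *: nrm t) (f t (act w x0) *: nrm t) by rewrite key.
  rewrite !weight_ipZ !(weight_ipC m _ (_ *: _)) !weight_ipZ.
  by rewrite (linear_part_ip hF algG hcoord hpi hact) e1 e1' !mulr1.
have r0 := base_regular ht'.
apply: (mulIf (_ : f t' x0 * f t' x0 != 0)); first by rewrite mulf_eq0 negb_or r0.
by rewrite mul1r [RHS]sq lin1; ring.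
Qed.

Lemma root_reflections_conjV w t : T t -> T (w^-1 * t * w)%g.
Proof.
by move=> /(root_reflections_conj hF algG hcoord hpi hact w^-1%g); rewrite invgK.
Qed.

Lemma not_separates_pos w : (forall t, T t -> ~ separates ip nrm off t x0 (act w x0)) ->
  forall y, alcove Hbr x0 y -> alcove Hbr x0 (act w y).
Proof.
move=> h y /alcoveP hy; apply/alcoveP => t ht.
have ht' := root_reflections_conjV w ht.
have [e e2 he] := wall_form_act ht ht'.
have := h t ht; rewrite /separates !he => /negP; rewrite -leNgt => nn.
have py := hy _ ht'; move: (base_regular ht) (base_regular ht') py nn.
move: (f t x0) (f (w^-1 * t * w)%g x0) (f _ y) => a b c a0 b0 bc nn.
have e0 : e != 0 by apply/eqP => z; move: e2; rewrite z mulr0 => /esym/eqP; rewrite oner_eq0.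
have b2 : 0 < b * b by rewrite -expr2 lt_neqAle sqr_ge0 eq_sym sqrf_eq0 b0.
have pp : 0 < a * (e * b) by rewrite lt_neqAle eq_sym nn !mulf_eq0 !negb_or a0 e0 b0.
rewrite -(pmulr_rgt0 _ b2); have -> : b * b * (a * (e * c)) = (a * (e * b)) * (b * c) by ring.
exact: mulr_gt0.
Qed.

Lemma not_separates_inv w : (forall t, T t -> ~ separates ip nrm off t x0 (act w x0)) ->
  forall t, T t -> ~ separates ip nrm off t x0 (act w^-1%g x0).
Proof.
move=> h t ht.
have ht' := root_reflections_conj hF algG hcoord hpi hact w ht.
have ht'' : T (w^-1 * (w * t * w^-1) * w)%g by rewrite !mulgA mulVg mul1g mulgKV.
have [e e2 he] := wall_form_act ht' ht''.
have ew : (w^-1 * (w * t * w^-1) * w)%g = t by rewrite !mulgA mulVg mul1g mulgKV.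
rewrite ew in he; have := h _ ht'; rewrite /separates he.
have -> : f t (act w^-1%g x0) = e * f (w * t * w^-1)%g x0.
  by rewrite -[X in _ * f _ X](act_one hact) -(mulgV w) (act_mul hact) he mulrA e2 mul1r.
by move=> h1 h2; apply: h1; apply: le_lt_trans h2; rewrite le_eqVlt; apply/orP; left; apply/eqP; ring.
Qed.

(** Supplies [D_free]: an element crossing no wall stabilizes the alcove, and [Wa] meets [Omega]
    trivially. *)
Lemma alcove_stabilizer w : (forall t, T t -> ~ separates ip nrm off t x0 (act w x0)) ->
  Omega iL G S g0 m pi act x0 w.
Proof.
move=> h; apply/seteqP; split=> [_ [y hy <-]|y hy]; first exact: not_separates_pos.
exists (act w^-1%g y); first exact: (not_separates_pos (not_separates_inv h)).
by rewrite -(act_mul hact) mulgV (act_one hact).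
Qed.

Lemma Wa_gen w : Wabr w <-> gen T w.
Proof.
rewrite (Wa_generated hW); split=> [[l [hl ->]]|].
  elim: l hl => [|t l ih] hl; first by rewrite big_nil; apply: gen1.
  rewrite big_cons; apply: genM; last by apply: ih => i hi; apply: (hl i.+1).
  by have [a [u [x [hx e]]]] := hl 0%N isT; exists a, u, x.
elim=> [|t u [a [x [y [hx ->]]]] _ [l [hl ->]]]; first by exists [::]; rewrite big_nil; split.
exists (pi y :: l); rewrite big_cons; split=> // -[|i] hi; last exact: hl.
by exists a, x, y.
Qed.

Lemma apartment_reflection_group : reflection_group ip act lin T Wabr nrm off x0.
Proof.
split.
- exact: weight_ipC.
- exact: weight_ipD.
- exact: weight_ipZ.
- exact: (@weight_ip_gt0 n r m minj R).
- exact: (act_one hact).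
- exact: (act_mul hact).
- exact: (act_sub hF algG hcoord hpi hact).
- exact: (linear_partZ hF algG hcoord hpi hact).
- exact: (linear_part_ip hF algG hcoord hpi hact).
- exact: (linear_part_finite hF algG hcoord hpi hact).
- by move=> t /(wall_normalP hF algG hcoord hpi hact hW)[_ []].
- by move=> t x ht; apply: (reflection_affine hF algG hcoord hpi hact hW).
- by move=> w t; apply: (root_reflections_conj hF algG hcoord hpi hact).
- exists (unit_normals hF hcoord R) => t; by case/(wall_normalP hF algG hcoord hpi hact hW).
- move=> t t' ht ht' e.
  have [_ [e1 h]] := wall_normalP hF algG hcoord hpi hact hW ht.
  have [_ [e1' h']] := wall_normalP hF algG hcoord hpi hact hW ht'.
  have e2 : nrm t = nrm t'.
    apply: wall_normal_eq => y; rewrite h h' e -scaleN1r weight_ipZ mulN1r.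
    by split=> /eqP; rewrite ?oppr_eq0 => /eqP // ->; rewrite oppr0.
  have : ip (nrm t') (nrm t) = - ip (nrm t') (nrm t').
    by rewrite e weight_ipC -scaleN1r weight_ipZ mulN1r.
  rewrite e2 e1' => /eqP; rewrite -addr_eq0; apply/negP; exact: (lt0r_neq0 (addr_gt0 ltr01 ltr01)).
- exists (2 * n.+1%:R)^-1; first by rewrite invr_gt0 mulr_gt0 // ltr0n.
  by move=> t t' ht ht'; apply: (offset_spacing algG hpi hact hW).
- by move=> t ht; apply: (offset_translate hF algG hcoord SG hpi hact hW).
- exact: Wa_gen.
- exact: base_regular.
- by move=> w hw h; apply: (Wa_Omega_disjoint hW hw); apply: alcove_stabilizer.
Qed.
End ApartmentReflectionGroup.

(** * The Frobenius on the apartment *)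

Section SigmaAction.
Variables (F L : fieldType) (K : closedFieldType).
Variables (iF : {rmorphism F -> L}) (iL : {rmorphism L -> K}) (v : L -> int) (sigma : {rmorphism L -> L}).
Variables (n r : nat) (G S : set 'M[K]_n) (g0 : 'M[L]_n) (m : 'M[int]_(n, r)).
Hypothesis hF : padic_frobenius iF v sigma.
Hypothesis algG : alg_group (iL \o iF) G.
Hypothesis hcoord : torus_coordinates iL g0 m S.
Hypothesis SG : S `<=` G.
Variables (R : realType) (W : groupType) (pi : 'M[L]_n -> W).
Variable act : W -> 'cV[R]_r -> 'cV[R]_r.
Hypothesis hpi : is_quotient pi (NS iL G S) (T1 iL v G S).
Hypothesis hact : is_apartment iL v G S g0 m pi act.
Variable x0 : 'cV[R]_r.
Hypothesis hx0H : forall H, hyperplanes iL G S g0 m pi act H -> ~ H x0.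
Hypothesis hW : affine_weyl_structure iL v G S g0 m pi act x0.

Notation NS := (NS iL G S).
Notation conj0 g := (invmx g0 *m g *m g0).
Notation ip := (@weight_ip n r m R).
Notation chF := (padic_char0 hF).
Notation minj := (weights_inj iF chF hcoord).
Notation root_reflection := (root_reflection iL G S g0 m).

Notation T := (root_reflections iL G S g0 m pi).
Notation lin := (linear_part act).
Notation nrm := (wall_normal hF hcoord act).
Notation off := (wall_offset hF hcoord act).
Notation f := (wall_form ip nrm off).
Notation Wabr := (Wa iL v G S g0 m pi act).
Notation Hbr := (hyperplanes iL G S g0 m pi act).

Notation rg := (apartment_reflection_group hF algG hcoord SG hpi hact hx0H hW).
Variables (sW : W -> W) (sA : 'cV[R]_r -> 'cV[R]_r).
Hypothesis hsigma : is_sigma_action iL sigma G S g0 m pi act sW sA.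
Hypothesis hx0 : sA x0 = x0.

Lemma sigma_W_mul w w' : sW (w * w')%g = (sW w * sW w')%g.
Proof.
have [C [hC _]] := sigma_linear hsigma.
have [x Nx <-] := proj_onto hpi w; have [y Ny <-] := proj_onto hpi w'.
have Ns z : NS z -> NS (map_mx sigma z).
  move=> Nz; have [B [s [_ hB _]]] := act_matrix hF algG hcoord hact Nz.
  exact: (NS_sigma chF (sigma_bij hF) (sigma_base hF) algG hcoord hC Nz hB).
rewrite -(proj_mul hpi) // !(sigma_W hsigma) //; last exact: (NS_mul algG).
by rewrite map_mxM (proj_mul hpi) //; apply: Ns.
Qed.

Lemma sigma_W_reflection t : T t -> T (sW t).
Proof.
have [C [hC _]] := sigma_linear hsigma; move=> [a [u [w [hw ->]]]].
have Nw : NS w by case: hw.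
have [B [s [_ hB _]]] := act_matrix hF algG hcoord hact Nw.
have [a' h'] := root_reflection_sigma chF (sigma_bij hF) (sigma_base hF) algG hcoord hC hB hw.
by exists a', (map_mx sigma u), (map_mx sigma w); rewrite (sigma_W hsigma).
Qed.

Lemma sigma_W_Wa w : Wabr w -> Wabr (sW w).
Proof.
rewrite !(Wa_gen hW); elim=> [|t u ht _ ih].
  have -> : sW 1%g = 1%g; last exact: gen1.
  by apply: (mulgI (sW 1%g)); rewrite -sigma_W_mul !mulg1.
by rewrite sigma_W_mul; apply: genM => //; apply: sigma_W_reflection.
Qed.

(** [C] permutes the weights, so it is an isometry of finite order. As [x0] is fixed, [sA] has
    finite order too, and an element of the affine Weyl group is determined by its image of [x0],
    which passes this on to [sW]. *)
Lemma sigma_equivariant_action : exists sC, equivariant ip act T Wabr x0 sW sA sC.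
Proof.
have [C [hC hA]] := sigma_linear hsigma.
have [s hs] := intertwines_perm (kappa_unit sigma hcoord)
  (kappa_intertwines iF chF (sigma_bij hF) hcoord hC).
exists (fun x => map_mx intr C *m x); split=> //.
- by move=> a x; rewrite -scalemxAr.
- by move=> x y; apply: (weight_ip_perm x y hs).
- exact: (sigma_equivariant hsigma).
- by move=> w w' _ _; apply: sigma_W_mul.
- exact: sigma_W_reflection.
have [N N0 hN] := perm_finite_order minj hs; exists N => // w Dw.
have iA x : iter N sA x = x.
  have h k : iter k sA x - x0 = iter k (fun y => map_mx intr C *m y) (x - x0).
    by elim: k => //= k <-; rewrite -hA hx0.
  by apply: (addIr (- x0)); rewrite h iter_mulmx hN map_mx1 mul1mx.
have h k x : iter k sA (act w x) = act (iter k sW w) (iter k sA x).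
  by elim: k => //= k ->; rewrite (sigma_equivariant hsigma).
have Di : Wabr (iter N sW w) by elim: (N) => //= k; apply: sigma_W_Wa.
by apply: (D_faithful rg Di Dw); rewrite -[x0 in LHS](iA x0) -h iA.
Qed.
End SigmaAction.

Section RelativeWalls.
Variables (F L : fieldType) (K : closedFieldType).
Variables (iF : {rmorphism F -> L}) (iL : {rmorphism L -> K}) (v : L -> int) (sigma : {rmorphism L -> L}).
Variables (n r : nat) (G S : set 'M[K]_n) (g0 : 'M[L]_n) (m : 'M[int]_(n, r)).
Hypothesis hF : padic_frobenius iF v sigma.
Hypothesis algG : alg_group (iL \o iF) G.
Hypothesis hcoord : torus_coordinates iL g0 m S.
Hypothesis SG : S `<=` G.
Variables (R : realType) (W : groupType) (pi : 'M[L]_n -> W).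
Variable act : W -> 'cV[R]_r -> 'cV[R]_r.
Hypothesis hpi : is_quotient pi (NS iL G S) (T1 iL v G S).
Hypothesis hact : is_apartment iL v G S g0 m pi act.
Variable x0 : 'cV[R]_r.
Hypothesis hx0H : forall H, hyperplanes iL G S g0 m pi act H -> ~ H x0.
Hypothesis hW : affine_weyl_structure iL v G S g0 m pi act x0.

Notation NS := (NS iL G S).
Notation conj0 g := (invmx g0 *m g *m g0).
Notation ip := (@weight_ip n r m R).
Notation chF := (padic_char0 hF).
Notation minj := (weights_inj iF chF hcoord).
Notation root_reflection := (root_reflection iL G S g0 m).

Notation T := (root_reflections iL G S g0 m pi).
Notation lin := (linear_part act).
Notation nrm := (wall_normal hF hcoord act).
Notation off := (wall_offset hF hcoord act).
Notation f := (wall_form ip nrm off).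
Notation Wabr := (Wa iL v G S g0 m pi act).
Notation Hbr := (hyperplanes iL G S g0 m pi act).

Notation rg := (apartment_reflection_group hF algG hcoord SG hpi hact hx0H hW).
Variables (sW : W -> W) (sA sC : 'cV[R]_r -> 'cV[R]_r).
Hypothesis sg : equivariant ip act T Wabr x0 sW sA sC.

(** For hyperplanes cut down to the fixed space, uniqueness of the one through the wall point says
    that all absolute walls through that point have the same trace. *)
Lemma wall_reflections_rel_simple s :
  wall_reflections act [set H `&` [set x | sA x = x] | H in Hbr] x0 (Wabr `&` [set w | sW w = w]) s
  <-> rel_simple ip act T Wabr nrm off x0 sW sA s.
Proof.
have wf t x : T t -> act t x = x <-> f t x = 0 := fun ht => wall_fixed hF algG hcoord hpi hact hW x ht.
split.
  move=> [[Ds ss] s1 [H [[_ /hyperplanesP[t ht ->] <-] [y [[/= hy sy] huniq hseg]]]] hfix].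
  exists t, y; split=> //; split=> //.
  - by apply/wf.
  - move=> t' ht' z' p Pp.
    have e := huniq ([set x | act t' x = x] `&` [set x | sA x = x]).
    have {}e : [set x | act t' x = x] `&` [set x | sA x = x] =
               [set x | act t x = x] `&` [set x | sA x = x].
      apply: e; last by split=> //=; apply/wf.
      by exists [set x | act t' x = x] => //; apply/hyperplanesP; exists t'.
    have := congr1 (fun X : set _ => X p) e; rewrite /setI /= => e'.
    rewrite -!wf //; split=> h.
      by have [] : act t p = p /\ sA p = p by rewrite -e'; exact (conj h Pp).
    by have [] : act t' p = p /\ sA p = p by rewrite e'; exact (conj h Pp).
  - move=> c c0 c1 t' ht'; apply/eqP => z'.
    apply: (hseg ([set x | act t' x = x] `&` [set x | sA x = x]) _ c) => /=.
    - by exists [set x | act t' x = x] => //; apply/hyperplanesP; exists t'.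
    - by rewrite c0.
    - split=> /=; first exact/wf.
      by apply: (fixA_affine sg) => //; apply: (fixA_x0 sg).
  - by move=> p Pp fp; apply: hfix; split=> //=; apply/wf.
move=> [t [y [Ds ss s1 ht [sy fy tr hreg hfix]]]].
split=> //; exists ([set x | act t x = x] `&` [set x | sA x = x]); last first.
  by move=> x [/= hx sx]; apply: hfix => //; apply/wf.
split; first by exists [set x | act t x = x] => //; apply/hyperplanesP; exists t.
exists y; split; first by split=> //=; apply/wf.
  move=> _ [_ /hyperplanesP[t' ht' ->] <-] [/= hy' _].
  have {}tr := tr t' ht' ((wf _ _ ht').1 hy').
  apply/seteqP; split=> x [/= hx sx]; split=> //=; apply/wf => //; apply/(tr x sx); exact/wf.
move=> _ [_ /hyperplanesP[t' ht' ->] <-] c /= /andP[c0 c1] [/= hc _].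
by have := hreg c c0 c1 t' ht'; rewrite ((wf t' _ ht').1 hc) eqxx.
Qed.
End RelativeWalls.

(** * Straight orbits *)

Section StraightOrbits.
Variables (R : realType) (V : lmodType R) (W : groupType).
Variables (ip : V -> V -> R) (act lin : W -> V -> V) (T D : set W).
Variables (nrm : W -> V) (off : W -> R) (x0 : V).
Hypothesis rg : reflection_group ip act lin T D nrm off x0.
Variables (sW : W -> W) (sA sC : V -> V).
Hypothesis sg : equivariant ip act T D x0 sW sA sC.
Hypothesis sW_M : forall w w', sW (w * w')%g = (sW w * sW w')%g.
Notation f := (wall_form ip nrm off).
Notation sep := (separates ip nrm off).
Notation ell := (ell rg).
Variables (Om Sr SrF : set W).
Hypotheses (Om1 : Om 1%g) (OmM : forall a b, Om a -> Om b -> Om (a * b)%g)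
  (OmV : forall a, Om a -> Om (a^-1)%g).
Hypothesis Om_cell : forall a t, Om a -> T t -> 0 < f t x0 * f t (act a x0).
Hypothesis D_Om : forall w, D w -> Om w -> w = 1%g.
Hypothesis D_normal : forall w u, D u -> D (w * u * w^-1)%g.
Hypothesis SrP : forall s, Sr s <-> rel_simple ip act T D nrm off x0 id id s.
Hypothesis SrFP : forall s, SrF s <-> rel_simple ip act T D nrm off x0 sW sA s.
Let WF : set W := [set w | sW w = w].
Notation len := (has_length D Om Sr).
Notation lenF := (has_length (D `&` WF) (Om `&` WF) SrF).
Variable th : W -> W.
Hypothesis thM : forall w w', th (w * w')%g = (th w * th w')%g.
Hypothesis th_len : forall w k, len w k -> len (th w) k.
Hypothesis thD : th @` D = D.
Hypothesis th_finite : exists d : nat, (0 < d)%N /\ forall w, iter d th w = w.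
Hypothesis th_sW : forall w, th (sW w) = sW (th w).

Lemma DOm_unique u u' a a' : D u -> D u' -> Om a -> Om a' -> (u * a = u' * a')%g -> u = u' /\ a = a'.
Proof.
move=> Du Du' Oa Oa' e; have e' : (u'^-1 * u = a' * a^-1)%g.
  by apply: (mulgI u'); apply: (mulIg a); rewrite mulKVg e mulgA mulgKV.
have h : (u'^-1 * u = 1)%g.
  apply: D_Om; first by apply: (D_mul rg) => //; apply: (D_inv rg).
  by rewrite e'; apply: OmM => //; apply: OmV.
have eu : u = u' by apply: (mulgI u'^-1%g); rewrite h mulVg.
by split=> //; apply: (mulgI u); rewrite e eu.
Qed.

Lemma th1 : th 1%g = 1%g.
Proof. by apply: (mulgI (th 1%g)); rewrite -thM !mulg1. Qed.

Lemma thV w : th (w^-1)%g = (th w)^-1%g.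
Proof. by apply: (mulgI (th w)); rewrite -thM !mulgV th1. Qed.

Lemma thD_in w : D w -> D (th w).
Proof. by move=> Dw; rewrite -thD; exists w. Qed.

(** The [D]-part is unique, and on [D] shortest words in simple reflections have size [ell]. *)
Lemma len_ell u a k : D u -> Om a -> len (u * a)%g k <-> k = ell u.
Proof.
move=> Du Oa.
have nthE (l : seq W) j : size l = j -> (forall i, (i < j)%N -> Sr (nth 1%g l i)) <->
    (forall s, s \in l -> rel_simple ip act T D nrm off x0 id id s).
  move=> <-; split=> [h s /(nthP 1%g)[i hi <-]|h i hi]; first exact/SrP/h.
  by apply/SrP/h/mem_nth.
have [l0 [hl0 sl0 pl0]] := simple_word rg Du.
split=> [[u' [a' [Du' Oa' e [l [sl hl pl]] hmin]]]|->].
  have [eu _] := DOm_unique Du Du' Oa Oa' e; rewrite -eu in pl hmin.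
  apply/eqP; rewrite eqn_leq; apply/andP; split.
    by apply: hmin; exists l0; split=> //; exact: (proj2 (nthE _ _ sl0) hl0).
  by rewrite pl -sl; apply: (word_ell_le rg); exact: (proj1 (nthE _ _ sl) hl).
exists u, a; split=> //; first by exists l0; split=> //; exact: (proj2 (nthE _ _ sl0) hl0).
by move=> j [l [sl hl ->]]; rewrite -sl; apply: (word_ell_le rg); exact: (proj1 (nthE _ _ sl) hl).
Qed.

Lemma th_ell u : D u -> ell (th u) = ell u.
Proof.
move=> Du; have := th_len (proj2 (len_ell (ell u) Du Om1) erefl).
by rewrite mulg1 => h; apply/esym/(len_ell _ (thD_in Du) Om1); rewrite mulg1.
Qed.

(** Elements of [Om] have length 0, which [th] preserves, and length 0 forces a trivial [D]-part. *)
Lemma th_Om a : Om a -> Om (th a).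
Proof.
move=> Oa; have h : len a 0.
  by rewrite -[a]mul1g; apply/(len_ell _ (D_one rg) Oa); rewrite ell1.
have := th_len h; case=> u [a' [Du Oa' e _ _]].
have := th_len h; rewrite e => /(len_ell _ Du Oa')/esym/(ell0 Du) u1.
by rewrite u1 mul1g.
Qed.

Lemma Om_ell a : Om a -> ell a = 0%N.
Proof.
move=> Oa; change (size (separators rg x0 (act a x0)) = 0%N); case E: (separators rg x0 (act a x0)) => [|t l] //.
have : t \in separators rg x0 (act a x0) by rewrite E mem_head.
move=> /mem_separators[ht h]; have := lt_trans h (Om_cell Oa ht); by rewrite ltxx.
Qed.

Lemma Om_conj_ell a u : Om a -> ell (a * u * a^-1)%g = ell u.
Proof.
have le b w : Om b -> (ell (b * w * b^-1)%g <= ell w)%N.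
  move=> Ob; apply: leq_trans (ellM_le rg _ _) _; rewrite (Om_ell (OmV Ob)) addn0.
  by apply: leq_trans (ellM_le rg _ _) _; rewrite (Om_ell Ob).
move=> Oa; apply/eqP; rewrite eqn_leq le //=.
by have := le _ (a * u * a^-1)%g (OmV Oa); rewrite invgK !mulgA mulVg mul1g mulgKV.
Qed.

Lemma Om_exp a k : Om a -> Om (a ^+ k)%g.
Proof. by move=> Oa; elim: k => [|k ih]; rewrite ?expg0 // expgS; apply: OmM. Qed.

(** Powers of [b] and their inverses keep [x0] in its alcove, so [f t] has constant sign along an
    arithmetic progression in both directions, which forces slope 0. *)
Lemma Om_translation_perp b nu t : Om b -> (forall x, act b x = x + nu) -> T t ->
  ip (nrm t) nu = 0.
Proof.
move=> Ob hb ht; have r0 := x0_regular rg ht.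
have hk k : act (b ^+ k)%g x0 = x0 + k%:R *: nu.
  rewrite (act_expg rg); elim: k => [|k ih]; first by rewrite scale0r addr0.
  by rewrite iterS ih hb -natr1 scalerDl scale1r addrA.
have hkV k : act (b ^+ k)^-1%g x0 = x0 - k%:R *: nu.
  apply: (can_inj (act_invK rg (b ^+ k)%g)); rewrite (act_Kinv rg).
  rewrite (act_expg rg); elim: k => [|k ih]; first by rewrite scale0r subr0.
  rewrite iterSr hb -natr1 scalerDl scale1r opprD addrA subrK; exact: ih.
pose d := f t x0 * ip (nrm t) nu.
have h1 k : 0 < f t x0 * f t x0 + k%:R * d.
  have := Om_cell (Om_exp k Ob) ht; rewrite hk (wall_formD rg) (ipZr rg) mulrDr /d.
  by rewrite mulrCA.
have h2 k : 0 < f t x0 * f t x0 - k%:R * d.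
  have := Om_cell (OmV (Om_exp k Ob)) ht; rewrite hkV (wall_formD rg) (ipNr rg) (ipZr rg) mulrDr mulrN /d.
  by rewrite [_ * (k%:R * _)]mulrCA.
have p0 : 0 <= f t x0 * f t x0 by rewrite -expr2 sqr_ge0.
suff : d = 0 by move/eqP; rewrite mulf_eq0 (negPf r0) => /eqP.
have bound (c : R) : 0 < c -> exists k : nat, f t x0 * f t x0 < k%:R * c.
  move=> c0; exists (Num.bound (f t x0 * f t x0 / c)).
  by rewrite -ltr_pdivrMr // archi_boundP // divr_ge0 // ltW.
apply/eqP; apply: contrapT => /negP d0; case/orP: (lt_total d0) => c.
  have [|k hkk] := bound (- d); first by rewrite oppr_gt0.
  by have := lt_trans hkk; have := h1 k; rewrite -[X in _ < _ + X]opprK -mulrN subr_gt0 => u /(_ _ u); rewrite ltxx.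
have [k hkk] := bound d c.
by have := h2 k; rewrite subr_gt0 => u; have := lt_trans hkk u; rewrite ltxx.
Qed.

(** A translation parallel to every wall commutes with every reflection. *)
Lemma Om_translation_central b nu w : Om b -> (forall x, act b x = x + nu) -> D w ->
  (b * w * b^-1)%g = w.
Proof.
move=> Ob hb; rewrite (D_gen rg); elim=> [|t u ht _ ih]; first by rewrite mulg1 mulgV.
have e : (b * t * b^-1)%g = t.
  apply: (D_faithful rg); try exact: (T_sub_D rg).
    by apply: D_normal; apply: (T_sub_D rg).
  have hbV : act b^-1%g x0 = x0 - nu.
    by apply: (can_inj (act_invK rg b)); rewrite (act_Kinv rg) hb subrK.
  rewrite !(rg_actM rg) hbV (actD rg) (linN rg) (lin_refl rg) // (Om_translation_perp Ob hb ht).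
  by rewrite mulr0 scale0r subr0 hb subrK.
by rewrite -{2}ih -{2}e !mulgA mulgKV.
Qed.

Lemma th_iterM n x y : iter n th (x * y)%g = (iter n th x * iter n th y)%g.
Proof. by elim: n => //= n ->; rewrite thM. Qed.

Lemma th_iterV n x : iter n th (x^-1)%g = (iter n th x)^-1%g.
Proof. by elim: n => //= n ->; rewrite thV. Qed.

Definition twisted_conj (a w : W) : W := (a * th w * a^-1)%g.

Lemma twisted_conj_iter a n w : iter n (twisted_conj a) w =
  (twisted_power th a n * iter n th w * (twisted_power th a n)^-1)%g.
Proof.
elim: n w => [|n ih] w; first by rewrite /twisted_power big_ord0 mul1g invg1 mulg1.
rewrite iterSr ih twisted_powerS !th_iterM th_iterV -iterSr invMg !mulgA.
by [].
Qed.

(** Moving all factors [a] to the right absorbs them into the automorphism, leaving a twisted power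
    inside [D]. *)
Lemma twisted_powerM u a n : twisted_power th (u * a)%g n =
  (twisted_power (twisted_conj a) u n * twisted_power th a n)%g.
Proof.
elim: n => [|n ih]; first by rewrite /twisted_power !big_ord0 mulg1.
by rewrite !twisted_powerS ih twisted_conj_iter th_iterM !mulgA mulgKV.
Qed.

Lemma Om_twisted_power a n : Om a -> Om (twisted_power th a n).
Proof.
move=> Oa; elim: n => [|n ih]; first by rewrite /twisted_power big_ord0.
by rewrite twisted_powerS; apply: OmM => //; elim: n {ih} => //= n; apply: th_Om.
Qed.

Lemma D_twisted_conj a w : D w -> D (twisted_conj a w).
Proof. by move=> Dw; apply: D_normal; apply: thD_in. Qed.

Lemma D_twisted_power a u n : D u -> D (twisted_power (twisted_conj a) u n).
Proof.
move=> Du; elim: n => [|n ih]; first by rewrite /twisted_power big_ord0; apply: (D_one rg).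
by rewrite twisted_powerS; apply: (D_mul rg) => //; elim: n {ih} => //= n; apply: D_twisted_conj.
Qed.

(** Finite order is the delicate clause, as [Om] may be infinite. After [d] steps the iterate is
    conjugation by [b]; some power of [b] is a translation, and translations in [Om] centralize
    [D]. *)
Lemma twisted_conj_aut a : Om a -> diagram_aut rg (twisted_conj a).
Proof.
move=> Oa; split.
- exact: D_twisted_conj.
- by move=> w w' _ _; rewrite /twisted_conj thM !mulgA mulgKV.
- by move=> w Dw; rewrite Om_conj_ell // th_ell.
have [d [d0 hd]] := th_finite; pose b := twisted_power th a d.
have Ob : Om b := Om_twisted_power d Oa.
have [k k0 hk] := lin_finite rg b; exists (k * d)%N; first by rewrite muln_gt0 k0.
have e j w : iter (j * d) (twisted_conj a) w = (b ^+ j * w * (b ^+ j)^-1)%g.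
  elim: j => [|j ih]; first by rewrite expg0 mul1g invg1 mulg1.
  by rewrite mulSn iterD ih twisted_conj_iter -/b hd expgS invMg !mulgA.
move=> w Dw; rewrite e; apply: (Om_translation_central (nu := act (b ^+ k)%g 0)) => //.
  exact: Om_exp.
by move=> x; rewrite (act_lin0 rg) (lin_expg rg) hk addrC; congr (_ + _).
Qed.

Lemma sW_twisted_conj a w : sW a = a -> twisted_conj a (sW w) = sW (twisted_conj a w).
Proof.
move=> sa; have sW1 : sW 1%g = 1%g by apply: (mulgI (sW 1%g)); rewrite -sW_M !mulg1.
have sV : sW (a^-1)%g = (a^-1)%g by apply: (mulgI a); rewrite -{1}sa -sW_M !mulgV.
by rewrite /twisted_conj !sW_M sa sV th_sW.
Qed.

Notation min_word := (min_word ip act T D nrm off x0 sW sA).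

Lemma lenF_min u a k : D u -> Om a -> lenF (u * a)%g k -> min_word u k.
Proof.
move=> Du Oa [u' [a' [[Du' _] [Oa' _] e hw hmin]]].
have [eu _] := DOm_unique Du Du' Oa Oa' e; rewrite -eu in hw hmin.
have nthE (l : seq W) j : size l = j -> (forall i, (i < j)%N -> SrF (nth 1%g l i)) <->
    words ip act T D nrm off x0 sW sA l.
  move=> <-; split=> [h s /(nthP 1%g)[i hi <-]|h i hi]; first exact/SrFP/h.
  by apply/SrFP/h/mem_nth.
split; first by case: hw => l [sl hl ->]; exists l; split=> //; exact: (proj1 (nthE _ _ sl) hl).
by move=> l hl pl; apply: hmin; exists l; split=> //; exact: (proj2 (nthE l _ erefl) hl).
Qed.

Lemma straightF_decomposition x : straight th lenF x -> exists u a,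
  [/\ D u /\ sW u = u, Om a /\ sW a = a, x = (u * a)%g &
      straight_power rg (twisted_conj a) u].
Proof.
move=> [k hk hj]; have [u [a [[Du su] [Oa sa] e _ _]]] := hk; exists u, a; split=> //.
have hu : min_word u k by apply: (lenF_min Du Oa); rewrite -e.
apply: (min_word_power (twisted_conj_aut Oa) sg _ hu); first by move=> w _; apply: sW_twisted_conj.
move=> j; apply: (lenF_min (D_twisted_power a j Du) (Om_twisted_power j Oa)).
by rewrite -twisted_powerM -e; apply: hj.
Qed.

Lemma straight_of_power u a : D u -> Om a -> straight_power rg (twisted_conj a) u ->
  straight th len (u * a)%g.
Proof.
move=> Du Oa h; exists (ell u); first exact/(len_ell _ Du Oa).
move=> j; change (len (twisted_power th (u * a)%g j) (j * ell u)).
rewrite twisted_powerM; apply/(len_ell _ (D_twisted_power a j Du) (Om_twisted_power j Oa)).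
by rewrite h.
Qed.

Lemma straight_power_conj g u a : Om g -> D u -> straight_power rg (twisted_conj a) u ->
  straight_power rg (twisted_conj (g * a * (th g)^-1)%g) (g * u * g^-1)%g.
Proof.
move=> Og Du h n; have it i w : iter i (twisted_conj (g * a * (th g)^-1)%g) (g * w * g^-1)%g =
    (g * iter i (twisted_conj a) w * g^-1)%g.
  elim: i => //= i ->; rewrite /twisted_conj !thM thV !invMg invgK !mulgA.
  by rewrite !mulgKV.
have e : twisted_power (twisted_conj (g * a * (th g)^-1)%g) (g * u * g^-1)%g n =
    (g * twisted_power (twisted_conj a) u n * g^-1)%g.
  elim: n => [|n ih]; first by rewrite /twisted_power !big_ord0 mulg1 mulgV.
  by rewrite !twisted_powerS ih it !mulgA mulgKV.
by rewrite e !Om_conj_ell // h.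
Qed.

Variable Gamma : set W.
Hypotheses (hGamma : is_subgroup Gamma) (GammaOm : Gamma `<=` Om `&` WF).

Lemma set_prod_group (E : set W) : is_subgroup E ->
  (forall g w, Gamma g -> E w -> E (g * w * g^-1)%g) -> is_subgroup (set_prod E Gamma).
Proof.
move=> [E1 EM EV] hn; have [G1 GM GV] := hGamma; split.
- by exists 1%g, 1%g; split=> //; rewrite mulg1.
- move=> _ _ [x [g [Ex Gg ->]]] [y [h [Ey Gh ->]]]; exists (x * (g * y * g^-1))%g, (g * h)%g.
  by split; [apply: EM => //; apply: hn|exact: GM|rewrite !mulgA mulgKV].
move=> _ [x [g [Ex Gg ->]]]; exists (g^-1 * x^-1 * g^-1^-1)%g, (g^-1)%g; split; last 1 first.
- by rewrite invMg mulgKV.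
- by apply: hn; [apply: GV|apply: EV].
- exact: GV.
Qed.

Lemma orbit_eq (E : set W) x y : is_subgroup E -> twisted_orbit th E y x ->
  twisted_orbit th E y = twisted_orbit th E x.
Proof.
move=> [_ EM EV] [w Ew <-]; apply/seteqP; split=> _ [v Ev <-].
  exists (v * w^-1)%g; first by apply: EM => //; apply: EV.
  by rewrite thM thV invMg invgK !mulgA !mulgKV.
by exists (v * w)%g; [apply: EM|rewrite thM invMg !mulgA].
Qed.

Lemma orbit_self (E : set W) x : is_subgroup E -> twisted_orbit th E x x.
Proof. by move=> [E1 _ _]; exists 1%g => //; rewrite th1 invg1 mul1g mulg1. Qed.

Notation DG := (set_prod D Gamma).
Notation DFG := (set_prod (D `&` WF) Gamma).

Lemma sWV w : sW (w^-1)%g = (sW w)^-1%g.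
Proof.
have sW1 : sW 1%g = 1%g by apply: (mulgI (sW 1%g)); rewrite -sW_M !mulg1.
by apply: (mulgI (sW w)); rewrite -sW_M !mulgV.
Qed.

Lemma DG_group : is_subgroup DG.
Proof.
apply: set_prod_group => [|g w _]; last exact: D_normal.
by split; [exact: (D_one rg)|by move=> x y; apply: (D_mul rg)|by move=> x; apply: (D_inv rg)].
Qed.

Lemma DFG_group : is_subgroup DFG.
Proof.
apply: set_prod_group => [|g w Gg [Dw sw]]; last first.
  have [_ sg'] := GammaOm Gg; split; first exact: D_normal.
  by rewrite /WF /= !sW_M sWV sw sg'.
split; first by split; [exact: (D_one rg)|exact: (sW_1 rg sg)].
  by move=> x y [Dx sx] [Dy sy]; split; [exact: (D_mul rg)|rewrite /WF /= sW_M sx sy].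
by move=> x [Dx sx]; split; [exact: (D_inv rg)|rewrite /WF /= sWV sx].
Qed.

(** The factor [g] only replaces [u1] and [a1] by conjugates. Comparing [Om]-parts then leaves a
    twisted conjugation of [D]-parts, where the conjugator can be replaced by one fixed by [sW]. *)
Lemma straight_orbit_injective x1 x2 : straight th lenF x1 -> straight th lenF x2 ->
  twisted_orbit th DG x1 x2 -> twisted_orbit th DFG x1 x2.
Proof.
move=> /straightF_decomposition[u1 [a1 [[Du1 su1] [Oa1 sa1] e1 st1]]].
move=> /straightF_decomposition[u2 [a2 [[Du2 su2] [Oa2 sa2] e2 st2]]].
move=> [_ [w [g [Dw Gg ->]]] ex]; have [Og sgg] := GammaOm Gg.
pose u := (g * u1 * g^-1)%g; pose a := (g * a1 * (th g)^-1)%g.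
have Du : D u by apply: D_normal.
have Oa : Om a by apply: OmM; [apply: OmM|apply/OmV/th_Om].
have [] := @DOm_unique u2 (w * u * (twisted_conj a w)^-1)%g a2 a Du2 _ Oa2 Oa.
- apply: (D_mul rg); first exact: (D_mul rg).
  by apply: (D_inv rg); apply: D_twisted_conj.
- rewrite -e2 -ex e1 /u /a /twisted_conj thM !invMg !invgK !mulgA.
  by rewrite !(mulgKV, mulgK).
move=> eu ea.
have su : sW u = u by rewrite /u !sW_M sWV sgg su1.
have st : straight_power rg (twisted_conj a2) u by rewrite ea; apply: straight_power_conj.
have key : (u * twisted_conj a2 w^-1 = w^-1 * u2)%g.
  rewrite eu ea /twisted_conj thV !invMg !invgK !mulgA mulVg mul1g.
  by [].
have [c [Dc sc ec]] := straight_conjugate_fixed (twisted_conj_aut Oa2) sg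
  (fun w _ => sW_twisted_conj w sa2) Du Du2 su su2 st st2 (D_inv rg Dw) key.
exists (c^-1 * g)%g.
  by exists (c^-1)%g, g; split=> //; split; [exact: (D_inv rg)|rewrite /WF /= sWV sc].
rewrite e2; have -> : u2 = (c^-1 * (u * twisted_conj a2 c))%g by rewrite ec mulKg.
rewrite ea /u /a /twisted_conj e1 thM thV !invMg !invgK !mulgA.
by rewrite !(mulgKV, mulgK).
Qed.

Theorem straight_orbits_injection :
  induces_injection (straight_orbits th WF DFG lenF) (straight_orbits th [set: W] DG len).
Proof.
have [G1 _ _] := hGamma.
have sub : DFG `<=` DG by move=> _ [x [g [[Dx _] Gg ->]]]; exists x, g.
(* The saturation of [O] under the larger group; on an orbit it is a single orbit, by [imE]. *)
exists (fun O => [set z | exists2 x, O x & twisted_orbit th DG x z]).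
have imE O y : O = twisted_orbit th DFG y ->
    [set z | exists2 x, O x & twisted_orbit th DG x z] = twisted_orbit th DG y.
  move=> ->; apply/seteqP; split=> z.
    move=> [x [w /sub hw <-]]; rewrite (orbit_eq (x := (w * y * (th w)^-1)%g) (y := y) DG_group) //; by exists w.
  by move=> hz; exists y => //; apply: orbit_self; apply: DFG_group.
split.
  move=> O [[y _ eO] [x Ox sx]]; have [u [a [[Du _] [Oa _] e st]]] := straightF_decomposition sx.
  have subO : O `<=` twisted_orbit th DG y by rewrite eO => _ [w /sub hw <-]; exists w.
  rewrite (imE O y eO); split=> //.
    split; first by exists y.
    by exists x; [exact: subO|rewrite e; apply: straight_of_power].
  move=> O' [[y' _ ->] _] sO; apply: (orbit_eq DG_group); apply: sO.
  by rewrite eO; apply: orbit_self; apply: DFG_group.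
move=> O1 O2 [[y1 _ e1] [x1 O1x s1]] [[y2 _ e2] [x2 O2x s2]].
rewrite (imE _ _ e1) (imE _ _ e2).
have b1 : twisted_orbit th DG y1 x1 by move: O1x; rewrite e1 => -[w /sub hw <-]; exists w.
have b2 : twisted_orbit th DG y2 x2 by move: O2x; rewrite e2 => -[w /sub hw <-]; exists w.
rewrite (orbit_eq DG_group b1) (orbit_eq DG_group b2) => e.
have h : twisted_orbit th DG x1 x2 by rewrite e; apply: orbit_self; apply: DG_group.
have := straight_orbit_injective s1 s2 h; rewrite e1 in O1x *; rewrite e2 in O2x *.
rewrite (orbit_eq DFG_group O1x) (orbit_eq DFG_group O2x).
by move/(orbit_eq DFG_group).
Qed.
End StraightOrbits.

Section AlcoveStabilizer.
Variables (L : fieldType) (K : closedFieldType) (iL : {rmorphism L -> K}).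
Variables (n r : nat) (G S : set 'M[K]_n) (g0 : 'M[L]_n) (m : 'M[int]_(n, r)).
Variables (R : realType) (W : groupType) (pi : 'M[L]_n -> W) (act : W -> 'cV[R]_r -> 'cV[R]_r).
Hypotheses (act1 : forall x, act 1%g x = x)
  (actM : forall w w' x, act (w * w')%g x = act w (act w' x)).
Variable x0 : 'cV[R]_r.
Notation Om := (Omega iL G S g0 m pi act x0).

Lemma Omega_one : Om 1%g.
Proof.
by apply/seteqP; split=> [_ [x hx <-]|x hx]; rewrite ?act1 //; exists x; rewrite ?act1.
Qed.

Lemma Omega_mul a b : Om a -> Om b -> Om (a * b)%g.
Proof.
move=> ha hb; apply/seteqP; split=> [_ [x hx <-]|x].
  by rewrite actM -ha; exists (act b x) => //; rewrite -hb; exists x.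
by rewrite -{1}ha => -[y + <-]; rewrite -{1}hb => -[z hz <-]; exists z; rewrite ?actM.
Qed.

Lemma Omega_inv a : Om a -> Om (a^-1)%g.
Proof.
move=> ha; apply/seteqP; split=> [_ [x + <-]|x hx].
  by rewrite -{1}ha => -[y hy <-]; rewrite -actM mulVg act1.
exists (act a x); first by rewrite -ha; exists x.
by rewrite -actM mulVg act1.
Qed.
End AlcoveStabilizer.

Theorem theorem4p1
  (R : realType)
  (F L : fieldType) (K : closedFieldType)
  (iF : {rmorphism F -> L}) (iL : {rmorphism L -> K})
  (v : L -> int) (sigma : {rmorphism L -> L})
  (hF : padic_frobenius iF v sigma) (hK : algebraic_closure iL)
  (n : nat) (G : set 'M[K]_n) (hG : connected_reductive (iL \o iF) G)
  (A S : set 'M[K]_n)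
  (hA : maximal_split_torus (iL \o iF) G A)
  (hS : maximal_split_torus iL G S)
  (hSF : closed_over (iL \o iF) S) (hAS : A `<=` S)
  (r : nat) (g0 : 'M[L]_n) (m : 'M[int]_(n, r))
  (hcoord : torus_coordinates iL g0 m S)
  (W : groupType) (pi : 'M[L]_n -> W)
  (hpi : is_quotient pi (NS iL G S) (T1 iL v G S))
  (act : W -> 'cV[R]_r -> 'cV[R]_r)
  (hact : is_apartment iL v G S g0 m pi act)
  (sW : W -> W) (sA : 'cV[R]_r -> 'cV[R]_r)
  (hsigma : is_sigma_action iL sigma G S g0 m pi act sW sA)
  (x0 : 'cV[R]_r) (hx0 : sA x0 = x0)
  (hx0H : forall H, hyperplanes iL G S g0 m pi act H -> ~ H x0)
  (hW : affine_weyl_structure iL v G S g0 m pi act x0) :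
  let Hbr := hyperplanes iL G S g0 m pi act in
  let Wabr := Wa iL v G S g0 m pi act in
  let Ombr := Omega iL G S g0 m pi act x0 in
  let lenbr := has_length Wabr Ombr (wall_reflections act Hbr x0 Wabr) in
  let WF := [set w | sW w = w] in
  let HF := [set H `&` [set x | sA x = x] | H in Hbr] in
  let WaF := Wabr `&` WF in
  let OmF := Ombr `&` WF in
  let lenF := has_length WaF OmF (wall_reflections act HF x0 WaF) in
  let I := parahoric_at iL v G S g0 m pi act x0 in
  forall (theta : 'M[L]_n -> 'M[L]_n)
    (htheta : is_automorphism iL G theta \/
              is_frobenius_morphism iF iL sigma G theta)
    (hthetaI : theta @` I = I)
    (thW : W -> W)
    (hthW : is_induced_automorphism thW (NS iL G S) I pi theta Wabr lenbr)
    (hfin : exists d : nat, (0 < d)%N /\ forall w, iter d thW w = w)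
    (hcomm : forall w, thW (sW w) = sW (thW w))
    (Gamma : set W) (hGamma : is_subgroup Gamma) (hGammaOm : Gamma `<=` OmF)
    (hGammatheta : thW @` Gamma = Gamma),
  induces_injection
    (straight_orbits thW WF (set_prod WaF Gamma) lenF)
    (straight_orbits thW [set: W] (set_prod Wabr Gamma) lenbr).
Proof.
move=> Hbr Wabr Ombr lenbr WF HF WaF OmF lenF I theta _ _ thW hthW hfin hcomm Gamma hGamma hGammaOm hGammatheta.
have algG : alg_group (iL \o iF) G by case: hG.
have SG : S `<=` G by case: hS.
have [sC sg] := sigma_equivariant_action hF algG hcoord SG hpi hact hx0H hW hsigma hx0.
pose rg := apartment_reflection_group hF algG hcoord SG hpi hact hx0H hW.
have SrP s : wall_reflections act Hbr x0 Wabr s <->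
    rel_simple (@weight_ip n r m R) act (root_reflections iL G S g0 m pi) Wabr
      (wall_normal hF hcoord act) (wall_offset hF hcoord act) x0 id id s.
  (* With the identity as sigma, the traces on the fixed space are the hyperplanes themselves. *)
  have := wall_reflections_rel_simple hF algG hcoord hpi hact hW (equivariant_id _ _ _ _ x0) s.
  have -> : [set H `&` [set x | id x = x] | H in Hbr] = Hbr.
    apply/seteqP; split=> [_ [H hH <-]|H hH].
      by rewrite (_ : [set x | id x = x] = setT) ?setIT //; apply/seteqP.
    by exists H => //; rewrite (_ : [set x | id x = x] = setT) ?setIT //; apply/seteqP.
  by rewrite (_ : [set w | id w = w] = setT) ?setIT //; apply/seteqP.
have SrFP := wall_reflections_rel_simple hF algG hcoord hpi hact hW sg.
apply: (straight_orbits_injection rg sg (sigma_W_mul hF algG hcoord hpi hact hsigma) _ _ _ _ _ _ SrP SrFP).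
- by move: (Omega_one iL G S g0 m pi (act_one hact) x0).
- by move: (@Omega_mul _ _ iL _ _ G S g0 m _ _ pi _ (act_mul hact) x0).
- by move: (@Omega_inv _ _ iL _ _ G S g0 m _ _ pi _ (act_one hact) (act_mul hact) x0).
- move=> a t Oa ht; apply: (proj1 (alcoveP hF algG hcoord hpi hact hx0H hW _)) => //.
  rewrite -Oa; exists x0 => //; apply/(alcoveP hF algG hcoord hpi hact hx0H hW) => t' ht'.
  by rewrite -expr2 exprn_even_gt0 // (base_regular hF algG hcoord hpi hact hx0H hW ht').
- exact: (Wa_Omega_disjoint hW).
- exact: (Wa_normal hW).
- exact: (induced_mul hthW).
- exact: (induced_length hthW).
- exact: (induced_Wa hthW).
- exact: hfin.
- exact: hcomm.
- exact: hGamma.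
- exact: hGammaOm.
Qed.
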